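(* Let $e\in\mathcal N_2$ and $X=\overline{Ge}$. The $B$-orbits on $X$ are parametrized by $\mathrm{Ort}(X)$: the map $$\mathrm{Ort}(X)\longrightarrow B\backslash X,\qquad S\longmapsto Be_S,$$ is a bijection.
   Context: $G$ is an almost simple algebraic group over an algebraically closed field of characteristic zero, with Borel subgroup $B$ and maximal torus $T\subset B$; $\mathfrak g,\mathfrak t$ are the Lie algebras of $G,T$. $\Phi$ is the root system of $(G,T)$, with simple roots $\Delta$ defined by $B$, and Weyl group $W$. For every $\alpha\in\Phi$ fix a nonzero $e_\alpha$ in the root space $\mathfrak g_\alpha$; for $S\subset\Phi$ put $e_S=\sum_{\alpha\in S}e_\alpha$. For a nilpotent $e$, $\mathrm{ht}(e)=\max\{n\in\mathbb N : \mathrm{ad}(e)^n\neq0\}$, and $\mathcal N_2$ is the set of nilpotent elements of $\mathfrak g$ of height at most $2$. For $e\in\mathcal N_2$ let $h\in\mathfrak t$ be the dominant characteristic of $Ge$: the unique $h\in\mathfrak t$ with $\alpha(h)\geq0$ for all $\alpha\in\Delta$ which is the semisimple element of an $\mathfrak{sl}_2$-triple whose nilpositive element lies in $Ge$. Put $\Psi=\{\alpha\in\Phi : \alpha(h)=2\}$, let $\mathrm{Ort}(\Psi)$ be the set of subsets of $\Psi$ consisting of pairwise orthogonal roots, and $$\mathrm{Ort}(X)=\{w(S) : w\in W,\ S\in\mathrm{Ort}(\Psi)\}.$$ *)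

(* Defs.v *)
From mathcomp Require Import all_boot all_order all_algebra.
From mathcomp Require Import boolp classical_sets functions cardinality fsbigop.
From mathcomp Require Import mpoly.

Set Implicit Arguments.
Unset Strict Implicit.
Unset Printing Implicit Defensive.

Import Order.TTheory GRing.Theory Num.Theory.
Local Open Scope classical_set_scope.
Local Open Scope ring_scope.

(* Algebraic groups in characteristic zero over an algebraically closed field *)
(* are treated as varieties: a (linear) algebraic group is a Zariski closed   *)
(* subgroup of GL_n, given by its set of K-points in 'M[K]_n.                 *)

(** ** Polynomial functions on matrices, Zariski topology *)

Section Polynomials.
Variables (K : closedFieldType) (m n : nat).

Definition mxeval (p : {mpoly K[m * n]}) (A : 'M[K]_(m, n)) : K :=
  p.@[fun i => mxvec A 0 i].

(* the derivative of p at A in the direction X *)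
Definition mxderiv (p : {mpoly K[m * n]}) (A X : 'M[K]_(m, n)) : K :=
  \sum_(i < m * n) (p^`M(i)).@[fun j => mxvec A 0 j] * mxvec X 0 i.

Definition vanishing_ideal (A : set 'M[K]_(m, n)) : set {mpoly K[m * n]} :=
  [set p | forall x, A x -> mxeval p x = 0].

Definition zeros (F : set {mpoly K[m * n]}) : set 'M[K]_(m, n) :=
  [set x | forall p, F p -> mxeval p x = 0].

Definition zclosed (A : set 'M[K]_(m, n)) : Prop := exists F, A = zeros F.

Definition zclosure (A : set 'M[K]_(m, n)) : set 'M[K]_(m, n) :=
  zeros (vanishing_ideal A).

Definition zconnected (A : set 'M[K]_(m, n)) : Prop :=
  forall C D : set 'M[K]_(m, n), zclosed C -> zclosed D ->
    A `<=` C `|` D -> A `&` C `&` D = set0 ->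
    A `&` C = set0 \/ A `&` D = set0.

End Polynomials.

(** ** Algebraic groups *)

Section Groups.
Variables (K : closedFieldType) (n : nat).
Implicit Types G H N B T : set 'M[K]_n.

Definition subgroup_GL H : Prop :=
  [/\ H `<=` [set g | g \in unitmx],
      H 1%:M,
      forall g g', H g -> H g' -> H (g *m g') &
      forall g, H g -> H (invmx g)].

Definition algebraic_group G : Prop :=
  subgroup_GL G /\
  exists C : set 'M[K]_n, zclosed C /\ G = C `&` [set g | g \in unitmx].

Definition normal_in G N : Prop :=
  N `<=` G /\ forall g x, G g -> N x -> N (g *m x *m invmx g).

Definition derived_group H : set 'M[K]_n :=
  [set g | forall L, subgroup_GL L ->
     (forall x y, H x -> H y -> L (x *m y *m invmx x *m invmx y)) -> L g].

Definition solvable_group H : Prop :=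
  exists k, iter k derived_group H = [set 1%:M].

Definition almost_simple G : Prop :=
  [/\ algebraic_group G,
      zconnected G,
      (exists x y, [/\ G x, G y & x *m y <> y *m x]) &
      forall N, algebraic_group N -> zconnected N -> normal_in G N ->
        N = [set 1%:M] \/ N = G].

Definition connected_solvable_subgroup G B : Prop :=
  [/\ algebraic_group B, B `<=` G, zconnected B & solvable_group B].

Definition borel_subgroup G B : Prop :=
  connected_solvable_subgroup G B /\
  forall B', connected_solvable_subgroup G B' -> B `<=` B' -> B' = B.

(* Regular functions on a closed subset A of GL_n: K[GL_n] is generated by    *)
(* the entries of g and of g^-1.                                              *)
Definition regular_repr (A : set 'M[K]_n) (f : 'M[K]_n -> K)
    (p : {mpoly K[n * (n + n)]}) : Prop :=
  forall g, A g -> f g = mxeval p (row_mx g (invmx g)).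

Definition regular_on (A : set 'M[K]_n) (f : 'M[K]_n -> K) : Prop :=
  exists p, regular_repr A f p.

End Groups.

Section Tori.
Variables (K : closedFieldType) (n : nat).
Implicit Types G T : set 'M[K]_n.

Definition diagonal_torus r : set 'M[K]_r :=
  [set d | is_diag_mx d /\ d \in unitmx].
Arguments diagonal_torus r : clear implicits.

(* a torus is an algebraic group isomorphic to some group of all invertible   *)
(* diagonal matrices                                                          *)
Definition torus T : Prop :=
  algebraic_group T /\
  exists r (f : 'M[K]_r -> 'M[K]_n) (f' : 'M[K]_n -> 'M[K]_r),
    [/\ set_bij (diagonal_torus r) T f,
        (forall d, diagonal_torus r d -> f' (f d) = d),
        (forall d d', diagonal_torus r d -> diagonal_torus r d' ->
           f (d *m d') = f d *m f d'),
        (forall i j, regular_on (diagonal_torus r) (fun d => f d i j)) &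
        (forall i j, regular_on T (fun t => f' t i j))].

Definition maximal_torus G T : Prop :=
  [/\ torus T, T `<=` G & forall T', torus T' -> T' `<=` G -> T `<=` T' -> T' = T].

End Tori.

(** ** Lie algebra, nilpotent elements *)

Section Lie.
Variables (K : closedFieldType) (n : nat).
Implicit Types (G : set 'M[K]_n) (e h x y : 'M[K]_n).

(* the tangent space of G at 1, a Lie subalgebra of gl_n *)
Definition lie_algebra G : set 'M[K]_n :=
  [set x | forall p, vanishing_ideal G p -> mxderiv p 1%:M x = 0].

Definition bracket x y : 'M[K]_n := x *m y - y *m x.

Definition Ad (g x : 'M[K]_n) : 'M[K]_n := g *m x *m invmx g.

Definition orbit_Ad G x : set 'M[K]_n := [set Ad g x | g in G].

(* B\X, the set of B-orbits on the B-stable subset X *)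
Definition orbits_on (B X : set 'M[K]_n) : set (set 'M[K]_n) :=
  [set orbit_Ad B x | x in X].

Definition nilpotent_element G e : Prop :=
  lie_algebra G e /\ exists k, e ^+ k = 0.

Definition ad_power_neq0 G e k : Prop :=
  exists2 x, lie_algebra G x & iter k (bracket e) x <> 0.

Definition height G e k : Prop :=
  ad_power_neq0 G e k /\ forall l, ad_power_neq0 G e l -> (l <= k)%N.

Definition height_le2_nilpotents G : set 'M[K]_n :=
  [set e | nilpotent_element G e /\ exists2 k, (k <= 2)%N & height G e k].

(* (e, h, f) is an sl_2-triple; the trivial triple (0, 0, 0) is allowed *)
Definition sl2_triple e h f : Prop :=
  [/\ bracket h e = 2%:R *: e, bracket h f = - (2%:R *: f) & bracket e f = h].

End Lie.

(** ** Characters and roots *)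

Section Roots.
Variables (K : closedFieldType) (n : nat).
Implicit Types (G B T : set 'M[K]_n) (w h : 'M[K]_n).

Definition chr : Type := 'M[K]_n -> K.
Implicit Types (a b c : chr) (S : set chr).

(* A character of T is a function on all matrices which is 0 outside T, so    *)
(* that Leibniz equality is equality of characters.                           *)
Definition character T a : Prop :=
  [/\ forall x, ~ T x -> a x = 0,
      forall t, T t -> a t != 0,
      forall s t, T s -> T t -> a (s *m t) = a s * a t &
      regular_on T a].

Definition trivial_chr T : chr := fun x => if `[< T x >] then 1 else 0.

(* the group law of the character group, written additively for roots *)
Definition chr_add a b : chr := fun x => a x * b x.

(* a(h) for h in the Lie algebra of T, i.e. the differential of a at 1,       *)
(* applied to h: the differential at 1 of g |-> (g, g^-1) is h |-> (h, -h).   *)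
(* The value does not depend on the chosen representative p.                  *)
Definition chr_diff T a h : K :=
  xget 0 [set d | exists2 p, regular_repr T a p &
            d = mxderiv p (row_mx 1%:M 1%:M) (row_mx h (- h))].

Definition root_space G T a : set 'M[K]_n :=
  [set x | lie_algebra G x /\ forall t, T t -> Ad t x = a t *: x].

Definition roots G T : set chr :=
  [set a | [/\ character T a, a <> trivial_chr T &
               exists2 x, root_space G T a x & x <> 0]].

Definition positive_roots G B T : set chr :=
  [set a | roots G T a /\ root_space G T a `<=` lie_algebra B].

Definition simple_roots G B T : set chr :=
  [set a | positive_roots G B T a /\
     forall b c, positive_roots G B T b -> positive_roots G B T c ->
       a <> chr_add b c].

(* elements of the Weyl group N_G(T)/T are given by representatives *)
Definition normalizer G T : set 'M[K]_n :=
  [set w | G w /\ [set Ad w t | t in T] = T].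

Definition weyl_act w a : chr := fun x => a (Ad (invmx w) x).

(* a W-invariant inner product on the space X(T) (x) Q, given by its values   *)
(* on X(T)                                                                    *)
Definition weyl_inner_product G T (ip : chr -> chr -> rat) : Prop :=
  [/\ forall a b, character T a -> character T b -> ip a b = ip b a,
      forall a b c, character T a -> character T b -> character T c ->
        ip (chr_add a b) c = ip a c + ip b c,
      forall a, character T a -> a <> trivial_chr T -> 0 < ip a a &
      forall w a b, normalizer G T w -> character T a -> character T b ->
        ip (weyl_act w a) (weyl_act w b) = ip a b].

Definition root_vectors G T (ev : chr -> 'M[K]_n) : Prop :=
  forall a, roots G T a -> root_space G T a (ev a) /\ ev a <> 0.

Definition root_vector_sum (ev : chr -> 'M[K]_n) S : 'M[K]_n :=
  \sum_(a \in S) ev a.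

(* x >= 0 for an element x of the prime field Q of K *)
Definition nonneg_rational (x : K) : Prop := exists2 q : rat, 0 <= q & x = ratr q.

Definition dominant_characteristic G B T e h : Prop :=
  [/\ lie_algebra T h,
      forall a, simple_roots G B T a -> nonneg_rational (chr_diff T a h) &
      exists e' f, [/\ orbit_Ad G e e', lie_algebra G f & sl2_triple e' h f]].

Definition Psi G T h : set chr :=
  [set a | roots G T a /\ chr_diff T a h = 2%:R].

Definition orthogonal_subsets (ip : chr -> chr -> rat) (P : set chr) :
    set (set chr) :=
  [set S | S `<=` P /\ forall a b, S a -> S b -> a <> b -> ip a b = 0].

Definition OrtX G T (ip : chr -> chr -> rat) h : set (set chr) :=
  [set S | exists w S', [/\ normalizer G T w,
             orthogonal_subsets ip (Psi G T h) S' & S = weyl_act w @` S']].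

End Roots.

(* Main.v *)
Require Import Defs.
From HB Require Import structures.
From mathcomp Require Import all_boot all_order all_algebra.
From mathcomp Require Import boolp classical_sets functions cardinality fsbigop.
From mathcomp Require Import mpoly.
From mathcomp Require Import ring lra zify.
Set Implicit Arguments.
Unset Strict Implicit.
Unset Printing Implicit Defensive.
Import Order.TTheory GRing.Theory Num.Theory.
Local Open Scope classical_set_scope.
Local Open Scope ring_scope.

(** The trace form is nondegenerate on the Lie algebra (its radical would give a
    commutative normal subgroup), so roots can be treated as elements of the
    torus algebra, on which the Weyl group acts by conjugation. Let h be the
    characteristic and g(2) its eigenspace of weight 2.

    The sums e_S lie in X because the centralizer of h has a dense orbit in g(2)
    (deg2_dense). Conversely, for h' in the Weyl orbit of h, each element of degree
    2 for h' is conjugate, under the unipotent radical U of B, to a sum of root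
    vectors over orthogonal roots: one clears the support starting from its lowest
    root (degree2_orth). Let A be the union of the U-orbits so obtained. It is
    stable under the simple reflections by the Bruhat decomposition in rank one
    (ort_set_n), hence under the minimal parabolic subgroups. As T rescales
    orthogonal root vectors independently (orth_scale), A has finitely many
    B-orbits. Saturation of a closed B-stable set under a minimal parabolic
    subgroup is closed, by elimination over the projective line (par_sat_closed);
    so a largest closed B-stable subset of A containing g(2) is stable under G,
    and contains X (orbit_closure_ort). Thus every B-orbit of X contains some e_S.

    For injectivity, let b in B move e_S to e_S'. Kostant's argument makes b carry
    one sl2-triple to the other, so the products of the reflections in S and in S'
    agree up to positive root vectors, hence agree (osum_inj); this product
    determines S among the orthogonal sets of degree 2 (orefl_inj). *)

(** * Polynomial functions on matrices *)

Lemma mpoly_ringind (n : nat) (R : comNzRingType) (P : {mpoly R[n]} -> Prop) :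
  (forall c, P c%:MP) -> (forall i, P 'X_i) ->
  (forall p q, P p -> P q -> P (p + q)) ->
  (forall p q, P p -> P q -> P (p * q)) -> forall p, P p.
Proof.
move=> PC PX PD PM; elim/mpolyind => [|c m p _ _ Pp]; first by rewrite -mpolyC0.
apply: (PD) => //; rewrite -mul_mpolyC; apply: (PM) => //.
rewrite mpolyXE_id; apply: (big_ind P) => [|//|i _]; first by rewrite -mpolyC1.
by elim: (m i) => [|k IH]; rewrite ?expr0 ?exprS -?mpolyC1 //; apply: PM.
Qed.

Section PolyFun.
Variable (K : closedFieldType).
Hypothesis charK : [pchar K] =i pred0.

Lemma natr_neq0 k : (k.+1%:R != 0 :> K).
Proof. by rewrite (pcharf0P K).1. Qed.

Lemma natr_inj : injective (fun k : nat => k%:R : K).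
Proof.
move=> i j /= /eqP; wlog le_ij : i j / (i <= j)%N.
  by move=> H; case/orP: (leq_total i j) => l; [|rewrite eq_sym => e]; [|apply/esym; move: e]; apply: H.
rewrite eq_sym -subr_eq0 -natrB // (pcharf0P K).1 // subn_eq0 => le_ji.
by apply/eqP; rewrite eqn_leq le_ij.
Qed.

Lemma poly_eval0 (q : {poly K}) : (forall i : nat, q.[i%:R] = 0) -> q = 0.
Proof.
move=> q0; apply/eqP; case: eqP => // /eqP nz.
have := max_poly_roots nz (rs := [seq i%:R | i <- iota 0 (size q)]).
rewrite size_map size_iota ltnn => H; rewrite H //.
  by apply/allP => _ /mapP [i _ ->]; rewrite rootE q0.
by rewrite map_inj_uniq ?iota_uniq //; apply: natr_inj.
Qed.

Lemma poly_evalP (q r : {poly K}) : (forall t, q.[t] = r.[t]) -> q = r.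
Proof.
by move=> e; apply: subr0_eq; apply/poly_eval0 => i; rewrite !hornerE e subrr.
Qed.

Lemma poly_deriv_eq0 (q : {poly K}) t : (forall k, q^`(k).[t] = 0) -> q = 0.
Proof.
move=> q0; have [d le_d] := ubnP (size q).
have : forall d (q : {poly K}), (size q < d)%N -> (forall k, q^`(k).[t] = 0) -> q = 0.
  elim=> // {le_d q0 q}d' IH q le_q q0.
  have q'0 : q^`() = 0.
    have [->|nz] := eqVneq q 0; first by rewrite deriv0.
    apply: IH => [|k]; first exact: leq_trans (lt_size_deriv nz) le_q.
    by rewrite -derivSn; apply: q0.
  have sq : (size q <= 1)%N.
    apply/leq_sizeP => j; case: j => // j _.
    have := congr1 (fun p : {poly K} => p`_j) q'0; rewrite coef_deriv coef0 /= => /eqP.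
    by rewrite -mulr_natr mulf_eq0 (negPf (natr_neq0 _)) orbF => /eqP.
  have := q0 0%N; rewrite derivn0 (size1_polyC sq) hornerC => ->; by rewrite polyC0.
by move=> H; apply: (H d).
Qed.

Section Curves.
Variables (m n : nat).
Implicit Types (p : {mpoly K[m * n]}) (A X : 'M[K]_(m, n)) (c : 'M[{poly K}]_(m, n)).

Definition ceval c (t : K) : 'M[K]_(m, n) := map_mx (fun q => q.[t]) c.
Definition cderiv c : 'M[{poly K}]_(m, n) := map_mx (fun q => q^`()) c.

Definition pcomp p c : {poly K} := mmap polyC (fun i => mxvec c 0 i) p.

Lemma mxvec_map (R S : Type) (f : R -> S) a b (M : 'M[R]_(a, b)) i :
  mxvec (map_mx f M) 0 i = f (mxvec M 0 i).
Proof. by rewrite -map_mxvec mxE. Qed.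

Lemma pcompE p c t : (pcomp p c).[t] = mxeval p (ceval c t).
Proof.
rewrite /pcomp /mxeval; elim/mpoly_ringind: p => [a|i|p q IHp IHq|p q IHp IHq].
- by rewrite mmapC mevalC hornerC.
- by rewrite mmapX mmap1U mevalXU mxvec_map.
- by rewrite mmapD mevalD hornerD IHp IHq.
by rewrite rmorphM /= mevalM hornerM IHp IHq.
Qed.

Lemma deriv_pcomp p c :
  (pcomp p c)^`() = \sum_(i < m * n) pcomp p^`M(i) c * (mxvec c 0 i)^`().
Proof.
rewrite /pcomp; elim/mpoly_ringind: p => [a|i|p q IHp IHq|p q IHp IHq].
- by rewrite mmapC derivC big1 // => i _; rewrite mderivC mmap0 mul0r.
- rewrite mmapX mmap1U (bigD1 i) //= big1 ?addr0.
    rewrite mderivX mnmE eqxx; have -> : (U_(i) - U_(i))%MM = 0%MM :> 'X_{1..m*n}.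
      by apply/mnmP => j; rewrite mnmBE subnn mnm0E.
    by rewrite mpolyX0 scale1r rmorph1 mul1r.
  by move=> j ji; rewrite mderivX mnmE eq_sym (negPf ji) scale0r mmap0 mul0r.
- rewrite mmapD derivD IHp IHq -big_split; apply: eq_bigr => i _.
  by rewrite mderivD mmapD mulrDl.
rewrite rmorphM /= derivM IHp IHq mulr_suml mulr_sumr -big_split; apply: eq_bigr => i _.
by rewrite mderivM mmapD !rmorphM /=; ring.
Qed.

Lemma deriv_pcompE p c t :
  (pcomp p c)^`().[t] = mxderiv p (ceval c t) (ceval (cderiv c) t).
Proof.
rewrite deriv_pcomp horner_sum /mxderiv; apply: eq_bigr => i _.
rewrite hornerM pcompE /mxeval; congr (_ * _).
by rewrite /ceval /cderiv -map_mx_comp mxvec_map.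
Qed.

Lemma mxderiv_linear p A : linear (mxderiv p A : 'M[K]_(m, n) -> K^o).
Proof.
move=> a X Y; rewrite /mxderiv scaler_sumr -big_split; apply: eq_bigr => i _.
by rewrite linearP !mxE mulrDr /=; congr (_ + _); rewrite mulrCA.
Qed.

Definition polyfun (F : 'M[K]_(m, n) -> K) := exists p, forall A, F A = mxeval p A.

Lemma polyfun_mxeval p : polyfun (mxeval p). Proof. by exists p. Qed.

Lemma polyfun_cst a : polyfun (fun=> a).
Proof. by exists a%:MP => A; rewrite /mxeval mevalC. Qed.

Lemma polyfun_entry i j : polyfun (fun A => A i j).
Proof. by exists 'X_(mxvec_index i j) => A; rewrite /mxeval mevalXU mxvecE. Qed.

Lemma polyfunD F G : polyfun F -> polyfun G -> polyfun (fun A => F A + G A).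
Proof. by move=> [p Fp] [q Gq]; exists (p + q) => A; rewrite /mxeval mevalD Fp Gq. Qed.

Lemma polyfunM F G : polyfun F -> polyfun G -> polyfun (fun A => F A * G A).
Proof. by move=> [p Fp] [q Gq]; exists (p * q) => A; rewrite /mxeval mevalM Fp Gq. Qed.

Lemma eq_polyfun F G : F =1 G -> polyfun F -> polyfun G.
Proof. by move=> e [p Fp]; exists p => A; rewrite -e Fp. Qed.

Lemma polyfunN F : polyfun F -> polyfun (fun A => - F A).
Proof.
move=> pF; apply: (eq_polyfun _ (polyfunM (polyfun_cst (-1)) pF)) => A.
by rewrite mulN1r.
Qed.

Lemma polyfunB F G : polyfun F -> polyfun G -> polyfun (fun A => F A - G A).
Proof. by move=> pF pG; apply: polyfunD => //; apply: polyfunN. Qed.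

Lemma polyfun_sum (I : Type) (r : seq I) (P : pred I) (F : I -> 'M[K]_(m, n) -> K) :
  (forall i, P i -> polyfun (F i)) -> polyfun (fun A => \sum_(i <- r | P i) F i A).
Proof.
move=> pF; elim: r => [|i r IH].
  by apply: (eq_polyfun _ (polyfun_cst 0)) => A; rewrite big_nil.
case Pi: (P i); last by apply: (eq_polyfun _ IH) => A; rewrite big_cons Pi.
by apply: (eq_polyfun _ (polyfunD (pF i Pi) IH)) => A; rewrite big_cons Pi.
Qed.

Lemma polyfun_prod (I : Type) (r : seq I) (P : pred I) (F : I -> 'M[K]_(m, n) -> K) :
  (forall i, P i -> polyfun (F i)) -> polyfun (fun A => \prod_(i <- r | P i) F i A).
Proof.
move=> pF; elim: r => [|i r IH].
  by apply: (eq_polyfun _ (polyfun_cst 1)) => A; rewrite big_nil.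
case Pi: (P i); last by apply: (eq_polyfun _ IH) => A; rewrite big_cons Pi.
by apply: (eq_polyfun _ (polyfunM (pF i Pi) IH)) => A; rewrite big_cons Pi.
Qed.

Lemma polyfunX F k : polyfun F -> polyfun (fun A => F A ^+ k).
Proof.
move=> pF; elim: k => [|k IH]; first exact: (polyfun_cst 1).
by apply: (eq_polyfun _ (polyfunM pF IH)) => A; rewrite exprS.
Qed.

Lemma zclosureE (S : set 'M[K]_(m, n)) A :
  zclosure S A <-> (forall F, polyfun F -> (forall s, S s -> F s = 0) -> F A = 0).
Proof.
split=> [clA F [p Fp] F0|clA p Ip].
  by rewrite Fp; apply: clA => s Ss; rewrite -Fp F0.
exact: clA (polyfun_mxeval p) Ip.
Qed.

Lemma sub_zclosure (S : set 'M[K]_(m, n)) : S `<=` zclosure S.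
Proof. by move=> A SA; apply/zclosureE => F _; apply. Qed.

Lemma zclosureS (S S' : set 'M[K]_(m, n)) : S `<=` S' -> zclosure S `<=` zclosure S'.
Proof. by move=> sub A /zclosureE clA; apply/zclosureE => F pF F0; apply: clA => // s /sub; apply: F0. Qed.

Lemma zclosed_zclosure (S : set 'M[K]_(m, n)) : zclosed (zclosure S).
Proof. by exists (vanishing_ideal S). Qed.

Lemma zclosedE (C : set 'M[K]_(m, n)) : zclosed C -> zclosure C = C.
Proof.
move=> [F ->]; apply/seteqP; split; last exact: sub_zclosure.
by move=> A clA p Fp; apply: clA => B; apply.
Qed.

Lemma zclosure_min (S C : set 'M[K]_(m, n)) : zclosed C -> S `<=` C -> zclosure S `<=` C.
Proof. by move=> cC sub; rewrite -[X in _ `<=` X]zclosedE //; apply: zclosureS. Qed.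

Lemma zclosed_by (C : set 'M[K]_(m, n)) :
  (forall A, ~ C A -> exists F, [/\ polyfun F, forall B, C B -> F B = 0 & F A <> 0]) ->
  zclosed C.
Proof.
move=> sep; exists (vanishing_ideal C); apply/seteqP; split; first exact: sub_zclosure.
move=> A clA; apply: contrapT => /sep [F [pF F0 FA]]; apply: FA.
by move/zclosureE: clA; apply.
Qed.

Lemma zclosed_zeros (I : Type) (P : I -> Prop) (F : I -> 'M[K]_(m, n) -> K) :
  (forall i, P i -> polyfun (F i)) -> zclosed [set A | forall i, P i -> F i A = 0].
Proof.
move=> pF; apply: zclosed_by => A nA; apply: contrapT => nex; apply: nA => i Pi.
apply: contrapT => Fi; apply: nex; exists (F i); split => //; first exact: pF.
by move=> B; apply.
Qed.

End Curves.

Section Comp.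
Variables (m n m' n' : nat).

Definition polymap (f : 'M[K]_(m, n) -> 'M[K]_(m', n')) :=
  forall i j, polyfun (fun A => f A i j).

Lemma polyfun_comp f F : polymap f -> polyfun F -> polyfun (fun A => F (f A)).
Proof.
move=> pf [p Fp]; apply: (eq_polyfun (F := fun A => mxeval p (f A))); first by move=> A; rewrite Fp.
rewrite /mxeval; elim/mpoly_ringind: p {Fp} => [a|i|p q IHp IHq|p q IHp IHq].
- by apply: (eq_polyfun _ (polyfun_cst _ _ a)) => A; rewrite mevalC.
- case/mxvec_indexP: i => i j.
  by apply: (eq_polyfun _ (pf i j)) => A; rewrite mevalXU mxvecE.
- by apply: (eq_polyfun _ (polyfunD IHp IHq)) => A; rewrite mevalD.
by apply: (eq_polyfun _ (polyfunM IHp IHq)) => A; rewrite mevalM.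
Qed.
End Comp.

Lemma polymap_id m n : polymap (@id 'M[K]_(m, n)).
Proof. by move=> i j; apply: polyfun_entry. Qed.

Lemma polymap_cst m n p q (A : 'M[K]_(p, q)) : polymap (fun _ : 'M[K]_(m, n) => A).
Proof. by move=> i j; apply: polyfun_cst. Qed.

Lemma polymap_mul m n p q r (f : 'M[K]_(m, n) -> 'M[K]_(p, q)) (g : 'M[K]_(m, n) -> 'M[K]_(q, r)) :
  polymap f -> polymap g -> polymap (fun A => f A *m g A).
Proof.
move=> pf pg i j; apply: (eq_polyfun (F := fun A => \sum_k f A i k * g A k j)).
  by move=> A; rewrite mxE.
by apply: polyfun_sum => k _; apply: polyfunM.
Qed.

Lemma polymap_conj m n p q (A : 'M[K]_(p, m)) (B : 'M[K]_(n, q)) :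
  polymap (fun X => A *m X *m B).
Proof. by do 2?apply: polymap_mul; solve [exact: polymap_cst|exact: polymap_id]. Qed.

Lemma polyfun_det m n r (f : 'M[K]_(m, n) -> 'M[K]_r) :
  polymap f -> polyfun (fun A => \det (f A)).
Proof.
move=> pf; rewrite /determinant; apply: polyfun_sum => s _; apply: polyfunM; first exact: polyfun_cst.
by apply: polyfun_prod => i _; apply: pf.
Qed.

End PolyFun.

(** * Left invariant derivations and the Lie algebra *)

Notation Lie := lie_algebra (only parsing).

Section LieAlgebra.
Variable (K : closedFieldType).
Hypothesis charK : [pchar K] =i pred0.

Section Lines.
Variables (m n : nat).
Implicit Types (p q : {mpoly K[m * n]}) (A X : 'M[K]_(m, n)).

Definition line A X : 'M[{poly K}]_(m, n) := map_mx polyC A + 'X *: map_mx polyC X.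

Lemma line_eval A X t : ceval (line A X) t = A + t *: X.
Proof. by apply/matrixP => i j; rewrite !mxE !hornerE mulrC. Qed.

Lemma line_deriv A X t : ceval (cderiv (line A X)) t = X.
Proof. by apply/matrixP => i j; rewrite !mxE !derivE !hornerE. Qed.

Lemma mxderiv_line p A X : mxderiv p A X = (pcomp p (line A X))^`().[0].
Proof. by rewrite deriv_pcompE line_eval line_deriv scale0r addr0. Qed.

Lemma mxderivD p q A X : mxderiv (p + q) A X = mxderiv p A X + mxderiv q A X.
Proof.
rewrite /mxderiv -big_split /=; apply: eq_bigr => i _.
by rewrite mderivD mevalD mulrDl.
Qed.

Lemma mxderivM p q A X :
  mxderiv (p * q) A X = mxderiv p A X * mxeval q A + mxeval p A * mxderiv q A X.
Proof.
rewrite /mxderiv mulr_suml mulr_sumr -big_split /=; apply: eq_bigr => i _.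
rewrite mderivM mevalD !mevalM /mxeval. ring.
Qed.

Lemma mxderivC a A X : mxderiv a%:MP A X = 0.
Proof. by rewrite /mxderiv big1 // => i _; rewrite mderivC meval0 mul0r. Qed.

Lemma mxderivX i j A X : mxderiv 'X_(mxvec_index i j) A X = X i j.
Proof.
rewrite mxderiv_line.
have -> : pcomp 'X_(mxvec_index i j) (line A X) = line A X i j.
  by apply: (poly_evalP charK) => t; rewrite pcompE /mxeval mevalXU mxvecE !mxE.
by rewrite !mxE !derivE !hornerE.
Qed.

End Lines.

Lemma mxderiv_mulmx m n m' n' (a : 'M[K]_(m', m)) (b : 'M[K]_(n, n'))
  (p : {mpoly K[m' * n']}) (q : {mpoly K[m * n]}) A X :
  (forall A, mxeval q A = mxeval p (a *m A *m b)) ->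
  mxderiv q A X = mxderiv p (a *m A *m b) (a *m X *m b).
Proof.
move=> e; rewrite !mxderiv_line; congr ((_)^`().[_]); apply: (poly_evalP charK) => t.
rewrite !pcompE e !line_eval; congr mxeval.
by rewrite mulmxDr mulmxDl -scalemxAr -scalemxAl.
Qed.

Variable (n : nat).
Implicit Types (p q : {mpoly K[n * n]}) (g x y : 'M[K]_n) (H : set 'M[K]_n).

Local Notation cmx := (map_mx (@mpolyC (n * n) K)).
Definition gmx : 'M[{mpoly K[n * n]}]_n := \matrix_(i, j) 'X_(mxvec_index i j).

(** The left invariant derivation of the coordinate ring of matrices attached
    to x; it differentiates along the flow g |-> g (1 + t x). *)
Definition ldiff x p : {mpoly K[n * n]} :=
  \sum_i p^`M(i) * mxvec (gmx *m cmx x) 0 i.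

Lemma ldiff_is_linear x : linear (ldiff x).
Proof.
move=> a p q; rewrite /ldiff scaler_sumr -big_split /=; apply: eq_bigr => i _.
by rewrite mderivD mderivZ mulrDl scalerAl.
Qed.
HB.instance Definition _ x := GRing.isLinear.Build K {mpoly K[n * n]} {mpoly K[n * n]} _ (ldiff x) (ldiff_is_linear x).

Lemma ldiffM x p q : ldiff x (p * q) = ldiff x p * q + p * ldiff x q.
Proof.
rewrite /ldiff mulr_suml mulr_sumr -big_split /=; apply: eq_bigr => i _.
by rewrite mderivM; ring.
Qed.

Lemma ldiffC x a : ldiff x a%:MP = 0.
Proof. by rewrite /ldiff big1 // => i _; rewrite mderivC mul0r. Qed.

Lemma ldiffX x i j :
  ldiff x 'X_(mxvec_index i j) = (gmx *m cmx x) i j.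
Proof.
rewrite /ldiff (bigD1 (mxvec_index i j)) //= big1 ?addr0.
  rewrite mderivX mnmE eqxx; have -> : (U_(mxvec_index i j) - U_(mxvec_index i j))%MM = 0%MM :> 'X_{1..n*n}.
    by apply/mnmP => k; rewrite mnmBE subnn mnm0E.
  by rewrite mpolyX0 scale1r mul1r mxvecE.
by move=> k ki; rewrite mderivX mnmE eq_sym (negPf ki) scale0r mul0r.
Qed.

Lemma ldiff_linear_l a x y p : ldiff (a *: x + y) p = a *: ldiff x p + ldiff y p.
Proof.
rewrite /ldiff scaler_sumr -big_split /=; apply: eq_bigr => i _ /=.
have -> : cmx (a *: x + y) =
   a%:MP *: cmx x + cmx y.
  by apply/matrixP => u v; rewrite !mxE mpolyCD mpolyCM.
rewrite mulmxDr -scalemxAr linearD linearZ mxE [X in X + _]mxE.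
by rewrite mulrDr -mul_mpolyC mulrCA.
Qed.

Lemma ldiff_gmx x (M : 'M[K]_n) :
  map_mx (ldiff x) (gmx *m cmx M)
  = gmx *m cmx (x *m M).
Proof.
apply/matrixP => i j; rewrite mxE [LHS]/= mxE linear_sum /=.
under eq_bigr => k _ do rewrite !mxE ldiffM ldiffC mulr0 addr0 ldiffX.
rewrite map_mxM mulmxA [RHS]mxE; apply: eq_bigr => k _.
by rewrite [in RHS](mxE _ _ k j).
Qed.

Lemma ldiff_comm x y p :
  ldiff x (ldiff y p) - ldiff y (ldiff x p) = ldiff (bracket x y) p.
Proof.
elim/mpoly_ringind: p => [a|i|p q IHp IHq|p q IHp IHq].
- by rewrite !ldiffC subrr.
- case/mxvec_indexP: i => i j; rewrite !ldiffX.
  have E u v : ldiff u ((gmx *m cmx v) i j)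
      = (gmx *m cmx (u *m v)) i j.
    by rewrite -ldiff_gmx [RHS]mxE.
  rewrite !E /bracket map_mxB mulmxBr; by rewrite !mxE.
- by rewrite !linearD /= -IHp -IHq addrACA.
rewrite !ldiffM !linearD /= !ldiffM -IHp -IHq. move: (ldiff x (ldiff y p)) (ldiff x (ldiff y q)) (ldiff y (ldiff x p)) (ldiff y (ldiff x q)) => u1 u2 u3 u4; move: (ldiff x p) (ldiff y p) (ldiff x q) (ldiff y q) => v1 v2 v3 v4; ring.
Qed.

Lemma meval_gmx g : map_mx (meval (fun i => mxvec g 0 i)) gmx = g.
Proof. by apply/matrixP => i j; rewrite !mxE mevalXU mxvecE. Qed.

Lemma mxeval_ldiff x p g : mxeval (ldiff x p) g = mxderiv p g (g *m x).
Proof.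
rewrite /mxeval /ldiff /mxderiv (big_morph (meval _) (mevalD _) (meval0 _)); apply: eq_bigr => i _.
rewrite mevalM -(mxvec_map (meval _)) map_mxM meval_gmx; congr (_ * mxvec (_ *m _) 0 _).
by rewrite -map_mx_comp; apply/matrixP => u v; rewrite mxE /= mevalC.
Qed.

Lemma mxeval_trans g p : exists q, forall A, mxeval q A = mxeval p (g *m A *m 1%:M).
Proof.
have : polyfun (fun A => mxeval p (g *m A *m 1%:M)).
  apply: polyfun_comp (polyfun_mxeval p).
  exact: polymap_conj.
by move=> [q E]; exists q => A; rewrite -E.
Qed.

Definition monoid_mx H := H 1%:M /\ forall g g', H g -> H g' -> H (g *m g').

Lemma subgroup_monoid H : subgroup_GL H -> monoid_mx H.
Proof. by case. Qed.

Lemma lieP H x : monoid_mx H ->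
  Lie H x <-> (forall p, vanishing_ideal H p -> vanishing_ideal H (ldiff x p)).
Proof.
move=> [H1 HM]; split=> [Lx p Ip g Hg|inv p Ip].
  have [q qE] := mxeval_trans g p.
  have : mxderiv q 1%:M x = 0.
    by apply: Lx => A HA; rewrite qE mulmx1; apply: Ip; apply: HM.
  by rewrite (mxderiv_mulmx 1%:M x qE) !mulmx1 mxeval_ldiff.
by rewrite -[x]mul1mx -mxeval_ldiff; apply: inv Ip _ H1.
Qed.

Lemma lie_linear H a x y :
  Lie H x -> Lie H y -> Lie H (a *: x + y).
Proof. by move=> Lx Ly p Ip; rewrite mxderiv_linear Lx // Ly // scaler0 addr0. Qed.

Lemma lie0 H : Lie H 0.
Proof.
move=> p _; have := mxderiv_linear p 1%:M (-1) 0 0.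
by rewrite scaleN1r addNr => ->; rewrite scaleN1r addNr.
Qed.

Lemma lieZ H a x : Lie H x -> Lie H (a *: x).
Proof. by move=> Lx; have := lie_linear a Lx (@lie0 H); rewrite addr0. Qed.

Lemma lieD H x y : Lie H x -> Lie H y -> Lie H (x + y).
Proof. by move=> Lx Ly; have := lie_linear 1 Lx Ly; rewrite scale1r. Qed.

Lemma lie_sub H x y : Lie H x -> Lie H y -> Lie H (x - y).
Proof. by move=> Lx Ly; apply: lieD; rewrite // -scaleN1r; apply: lieZ. Qed.

Lemma lie_sum H (I : Type) (r : seq I) (P : pred I) (F : I -> 'M[K]_n) :
  (forall i, P i -> Lie H (F i)) -> Lie H (\sum_(i <- r | P i) F i).
Proof. by apply: big_ind; [exact: lie0|exact: lieD]. Qed.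

Lemma lie_bracket H x y : monoid_mx H ->
  Lie H x -> Lie H y -> Lie H (bracket x y).
Proof.
move=> mH /(lieP _ mH) Lx /(lieP _ mH) Ly; apply/(lieP _ mH) => p Ip g Hg.
have EB (a b : {mpoly K[n * n]}) : mxeval (a - b) g = mxeval a g - mxeval b g by exact: mevalB.
have A1 := Lx _ (Ly _ Ip) _ Hg; have A2 := Ly _ (Lx _ Ip) _ Hg.
move: A1 A2 (ldiff_comm x y p).
by move: (ldiff x (ldiff y p)) (ldiff y (ldiff x p)) => a b A1 A2 <-; rewrite EB A1 A2 subrr.
Qed.

Lemma lie_mono H H' : H `<=` H' -> Lie H `<=` Lie H'.
Proof. by move=> sub x Lx p Ip; apply: Lx => g /sub; apply: Ip. Qed.

Lemma lie_conj H g : subgroup_GL H ->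
  forall x, H g -> Lie H x -> Lie H (Ad g x).
Proof.
move=> [subH H1 HM HV] x Hg Lx p Ip.
have : polyfun (fun A => mxeval p (g *m A *m invmx g)).
  apply: polyfun_comp (polyfun_mxeval p).
  exact: polymap_conj.
move=> [q qE]; have := mxderiv_mulmx 1%:M x (fun A => esym (qE A)).
rewrite mulmx1 mulmxV; last exact: subH.
by move=> <-; apply: Lx => h Hh; rewrite -qE; apply: Ip; apply: (HM); [apply: HM|apply: HV].
Qed.

(** An equation of H vanishes along the curve; it is differentiated at 0. *)
Lemma lie_curve H (c : 'M[{poly K}]_n) :
  (forall t, zclosure H (ceval c t)) -> ceval c 0 = 1%:M ->
  Lie H (ceval (cderiv c) 0).
Proof.
move=> Hc c0 p Ip; rewrite -c0 -deriv_pcompE.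
suff -> : pcomp p c = 0 by rewrite derivC hornerC.
by apply: (poly_evalP charK) => t; rewrite pcompE horner0; apply: Hc.
Qed.

(** ** Regular functions on GL_n *)

Section RegularDerivative.
Let gv g := row_mx g (invmx g).

Let tau x := mxderiv (\det gmx) 1%:M x.

Lemma mxeval_det g : mxeval (\det gmx) g = \det g.
Proof. by rewrite /mxeval -det_map_mx meval_gmx. Qed.

Lemma mxeval_adj i j g : mxeval ((\adj gmx) i j) g = (\adj g) i j.
Proof. by rewrite /mxeval -[in RHS](meval_gmx g) -map_mx_adj [RHS]mxE. Qed.

Lemma mxderiv_adj i j x : mxderiv ((\adj gmx) i j) 1%:M x = tau x *+ (i == j) - x i j.
Proof.
have E := congr1 (fun M : 'M__ => mxderiv (M i j) 1%:M x) (mul_mx_adj gmx).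
move: E => /=; rewrite [in RHS]mxE.
have -> : mxderiv (\det gmx *+ (i == j)) 1%:M x = tau x *+ (i == j).
  by case: (i == j); rewrite ?mulr1n ?mulr0n // -mpolyC0 mxderivC.
move=> <-; rewrite [X in mxderiv X _ _ - _]mxE.
have -> : mxderiv (\sum_k gmx i k * (\adj gmx) k j) 1%:M x =
   \sum_k mxderiv (gmx i k * (\adj gmx) k j) 1%:M x.
  apply: (big_morph (fun p => mxderiv p 1%:M x)) => [p q|]; first exact: mxderivD.
  by rewrite -mpolyC0 mxderivC.
under eq_bigr => k _ do rewrite mxderivM mxeval_adj adj1 !mxE mxderivX
  /mxeval mevalXU mxvecE !mxE.
rewrite big_split /= (bigD1 j) //= eqxx mulr1 big1 ?addr0; last first.
  by move=> k /negPf->; rewrite mulr0.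
rewrite (bigD1 i) //= eqxx mul1r big1 ?addr0; last first.
  by move=> k; rewrite eq_sym => /negPf->; rewrite mul0r.
by rewrite addrAC subrr add0r mxE.
Qed.

(** A polynomial in g and its inverse becomes, after multiplication by a power
    of the determinant, a polynomial in g; the derivative at 1 follows. *)
Lemma clear_det (P : {mpoly K[n * (n + n)]}) : exists N q,
  (forall g, g \in unitmx -> mxeval q g = \det g ^+ N * mxeval P (gv g)) /\
  (forall x, mxderiv q 1%:M x = N%:R * tau x * mxeval P (row_mx 1%:M 1%:M)
       + mxderiv P (row_mx 1%:M 1%:M) (row_mx x (- x))).
Proof.
have ev1 p N (P' : {mpoly K[n * (n + n)]}) :
   (forall g, g \in unitmx -> mxeval p g = \det g ^+ N * mxeval P' (gv g)) ->
   mxeval p 1%:M = mxeval P' (row_mx 1%:M 1%:M).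
  by move=> ->; rewrite ?unitmx1 // det1 expr1n mul1r /gv invmx1.
elim/mpoly_ringind: P => [a|i|P Q [N [p [pE pD]]] [M [q [qE qD]]]|P Q [N [p [pE pD]]] [M [q [qE qD]]]].
- exists 0%N, a%:MP; split=> [g _|x]; rewrite ?expr0 /mxeval ?mevalC ?mul1r //.
  by rewrite !mxderivC !mul0r addr0.
- case/mxvec_indexP: i => i j; case: (splitP j) => k jk.
    have -> : j = lshift n k by apply: val_inj.
    exists 0%N, 'X_(mxvec_index i k); split=> [g _|x].
      by rewrite expr0 mul1r /mxeval !mevalXU !mxvecE row_mxEl.
    by rewrite !mxderivX row_mxEl !mul0r add0r.
  have -> : j = rshift n k by apply: val_inj.
  exists 1%N, ((\adj gmx) i k); split=> [g ug|x].
    rewrite mxeval_adj expr1 /mxeval mevalXU mxvecE row_mxEr /invmx ug [in RHS]mxE mulrA.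
    by rewrite mulfV ?mul1r // -unitfE.
  rewrite mxderiv_adj mxderivX row_mxEr /mxeval mevalXU mxvecE row_mxEr !mxE mul1r.
  by rewrite mulr_natr.
- exists (N + M)%N, (p * (\det gmx) ^+ M + q * (\det gmx) ^+ N).
  have dX k g : mxeval (\det gmx ^+ k) g = \det g ^+ k.
    by rewrite -(mxeval_det g) /mxeval rmorphXn.
  have DX k x : mxderiv (\det gmx ^+ k) 1%:M x = k%:R * tau x.
    elim: k => [|k IH]; first by rewrite expr0 -mpolyC1 mxderivC mul0r.
    rewrite exprS mxderivM IH dX det1 expr1n mxeval_det det1 mulr1 mul1r.
    by rewrite -add1n natrD mulrDl mul1r.
  split=> [g ug|x].
    rewrite /mxeval !mevalD !mevalM -!/(mxeval _ _) !dX pE // qE // exprD.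
    by ring.
  rewrite !mxderivD !mxderivM !dX !DX det1 !expr1n pD qD (ev1 _ _ _ pE) (ev1 _ _ _ qE).
  by rewrite /mxeval mevalD -!/(mxeval _ _) natrD; ring.
exists (N + M)%N, (p * q); split=> [g ug|x].
  by rewrite /mxeval !mevalM -!/(mxeval _ _) pE // qE // exprD; ring.
rewrite !mxderivM pD qD (ev1 _ _ _ pE) (ev1 _ _ _ qE).
by rewrite /mxeval mevalM -!/(mxeval _ _) natrD; ring.
Qed.

(** An identity between g and its inverse valid on H can be differentiated
    along the Lie algebra, the inverse contributing with the opposite sign. *)
Lemma regular_deriv0 H x (P : {mpoly K[n * (n + n)]}) :
  H `<=` [set g | g \in unitmx] -> H 1%:M ->
  (forall g, H g -> mxeval P (row_mx g (invmx g)) = 0) -> Lie H x ->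
  mxderiv P (row_mx 1%:M 1%:M) (row_mx x (- x)) = 0.
Proof.
move=> sub H1 P0 Lx; have [N [q [qE qD]]] := clear_det P.
have : mxderiv q 1%:M x = 0 by apply: Lx => g Hg; rewrite qE ?P0 ?mulr0 //; apply: sub.
rewrite qD; have := P0 _ H1; rewrite invmx1 => ->; by rewrite mulr0 add0r.
Qed.

Lemma regular_zclosure H (F : 'M[K]_(n, n + n) -> K) : polyfun F ->
  H `<=` [set g | g \in unitmx] -> (forall g, H g -> F (row_mx g (invmx g)) = 0) ->
  forall g, zclosure H g -> g \in unitmx -> F (row_mx g (invmx g)) = 0.
Proof.
move=> [P FP] sub P0 g clg ug; have [N [q [qE qD]]] := clear_det P.
have : mxeval q g = 0 by apply: clg => h Hh; rewrite qE -?FP ?P0 ?mulr0 //; apply: sub.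
rewrite qE // FP => /eqP; rewrite mulf_eq0 expf_eq0; have := ug; rewrite unitmxE unitfE => /negPf->.
by rewrite andbF => /eqP.
Qed.

End RegularDerivative.

Lemma polymap_lsub m n1 n2 : polymap (lsubmx : 'M[K]_(m, n1 + n2) -> 'M_(m, n1)).
Proof.
move=> i j; apply: (eq_polyfun _ (polyfun_entry _ i (lshift n2 j))) => A.
by rewrite mxE.
Qed.

Lemma polymap_rsub m n1 n2 : polymap (rsubmx : 'M[K]_(m, n1 + n2) -> 'M_(m, n2)).
Proof.
move=> i j; apply: (eq_polyfun _ (polyfun_entry _ i (rshift n1 j))) => A.
by rewrite mxE.
Qed.

Definition alg_closure H := zclosure H `&` [set g | g \in unitmx].

Lemma alg_closure_group H : subgroup_GL H -> algebraic_group (alg_closure H).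
Proof.
move=> [sub H1 HM HV]; split; last by exists (zclosure H); split => //; apply: zclosed_zclosure.
split.
- by move=> g [].
- by split; [apply: sub_zclosure|apply: unitmx1].
- move=> g g' [clg ug] [clg' ug']; split; last by rewrite /= unitmx_mul; apply/andP.
  have Hl h a : H h -> zclosure H a -> zclosure H (h *m a).
    move=> Hh /zclosureE cla; apply/zclosureE => F pF F0.
    apply: (cla (fun a => F (h *m a))) => [|b Hb]; last by apply: F0; apply: HM.
    by apply: polyfun_comp pF; apply: polymap_mul; [exact: polymap_cst|exact: polymap_id].
  move/zclosureE: clg => clg; apply/zclosureE => F pF F0.
  apply: (clg (fun a => F (a *m g'))) => [|b Hb].
    by apply: polyfun_comp pF; apply: polymap_mul; [exact: polymap_id|exact: polymap_cst].
  by move/zclosureE: (Hl _ _ Hb clg'); apply.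
move=> g [clg ug]; split; last by rewrite /= unitmx_inv.
apply/zclosureE => F pF F0.
have := @regular_zclosure H (fun A => F (rsubmx A)) _ sub _ g clg ug.
rewrite row_mxKr; apply; first exact: polyfun_comp (@polymap_rsub _ _ _) pF.
by move=> h Hh; rewrite row_mxKr; apply: F0; apply: HV.
Qed.

Lemma sub_alg_closure H : H `<=` [set g | g \in unitmx] -> H `<=` alg_closure H.
Proof. by move=> sub g Hg; split; [apply: sub_zclosure|apply: sub]. Qed.

Lemma algebraic_groupP H : algebraic_group H -> alg_closure H = H.
Proof.
move=> [[sub _ _ _] [C [cC eH]]]; apply/seteqP; split; last exact: sub_alg_closure.
move=> g [clg ug]; rewrite eH; split=> //; rewrite -(zclosedE cC).
by apply: zclosureS clg; rewrite eH => h [].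
Qed.

Lemma alg_closure_min H G : algebraic_group G -> H `<=` G -> alg_closure H `<=` G.
Proof.
by move=> aG sub; rewrite -(algebraic_groupP aG) => g [clg ug]; split=> //; apply: zclosureS clg.
Qed.

End LieAlgebra.

(** * Exponential and logarithm *)

Section Exponential.
Variable (K : closedFieldType).
Hypothesis charK : [pchar K] =i pred0.

Definition pc m n (A : 'M[K]_(m, n)) : 'M[{poly K}]_(m, n) := map_mx polyC A.

Lemma ceval_pc m n (A : 'M[K]_(m, n)) t : ceval (pc A) t = A.
Proof. by apply/matrixP => i j; rewrite !mxE hornerC. Qed.

Lemma cevalM m n p (A : 'M[{poly K}]_(m, n)) (B : 'M_(n, p)) t :
  ceval (A *m B) t = ceval A t *m ceval B t.
Proof. exact: (map_mxM (horner_eval t)). Qed.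

Lemma cevalD m n (A B : 'M[{poly K}]_(m, n)) t : ceval (A + B) t = ceval A t + ceval B t.
Proof. exact: (map_mxD (horner_eval t)). Qed.

Lemma cevalB m n (A B : 'M[{poly K}]_(m, n)) t : ceval (A - B) t = ceval A t - ceval B t.
Proof. exact: (map_mxB (horner_eval t)). Qed.

Lemma cevalZ m n q (A : 'M[{poly K}]_(m, n)) t : ceval (q *: A) t = q.[t] *: ceval A t.
Proof. by apply/matrixP => i j; rewrite !mxE hornerM. Qed.

Lemma ceval_sum m n I (r : seq I) (P : pred I) (F : I -> 'M[{poly K}]_(m, n)) t :
  ceval (\sum_(i <- r | P i) F i) t = \sum_(i <- r | P i) ceval (F i) t.
Proof. exact: (raddf_sum (map_mx (horner_eval t))). Qed.

Lemma cderivM m n p (A : 'M[{poly K}]_(m, n)) (B : 'M_(n, p)) :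
  cderiv (A *m B) = cderiv A *m B + A *m cderiv B.
Proof.
apply/matrixP => i j; rewrite !mxE -big_split /= (big_morph _ (@derivD K) (deriv0 K)); apply: eq_bigr => k _.
by rewrite !mxE derivM.
Qed.

Lemma cderivD m n (A B : 'M[{poly K}]_(m, n)) : cderiv (A + B) = cderiv A + cderiv B.
Proof. by apply/matrixP => i j; rewrite !mxE derivD. Qed.

Lemma cderivB m n (A B : 'M[{poly K}]_(m, n)) : cderiv (A - B) = cderiv A - cderiv B.
Proof. by apply/matrixP => i j; rewrite !mxE derivB. Qed.

Lemma cderiv_sum m n I (r : seq I) (P : pred I) (F : I -> 'M[{poly K}]_(m, n)) :
  cderiv (\sum_(i <- r | P i) F i) = \sum_(i <- r | P i) cderiv (F i).
Proof. exact: (raddf_sum (map_mx (@deriv K))). Qed.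

Lemma cderivZ m n q (A : 'M[K]_(m, n)) : cderiv (q *: pc A) = q^`() *: pc A.
Proof. by apply/matrixP => i j; rewrite !mxE derivM derivC mulr0 addr0. Qed.

Lemma cderiv_pc m n (A : 'M[K]_(m, n)) : cderiv (pc A) = 0.
Proof. by apply/matrixP => i j; rewrite !mxE derivC. Qed.

Lemma pcM m n p (A : 'M[K]_(m, n)) (B : 'M_(n, p)) : pc (A *m B) = pc A *m pc B.
Proof. exact: map_mxM. Qed.

Lemma curve_eq m n (A B : 'M[{poly K}]_(m, n)) :
  (forall j : nat, ceval A j%:R = ceval B j%:R) -> A = B.
Proof.
move=> e; apply/matrixP => i j; apply: subr0_eq.
apply: (poly_eval0 charK) => k; have /matrixP/(_ i j) := e k.
by rewrite !mxE !hornerE => ->; rewrite subrr.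
Qed.

(** Uniqueness for linear differential equations with constant coefficients. *)
Lemma ode_uniq m n (a : 'M[K]_m) (b : 'M[K]_n) (D : 'M[{poly K}]_(m, n)) :
  cderiv D = pc a *m D + D *m pc b -> ceval D 0 = 0 -> D = 0.
Proof.
move=> eD D0; apply/matrixP => i j; rewrite mxE.
apply: (poly_deriv_eq0 charK (t := 0)) => k.
have : forall k (D : 'M[{poly K}]_(m, n)), cderiv D = pc a *m D + D *m pc b ->
   ceval D 0 = 0 -> (D i j)^`(k).[0] = 0.
  elim=> {k eD D0}[|k IH] D' eD D0; first by move/matrixP/(_ i j): D0; rewrite !mxE derivn0.
  have e' : cderiv (cderiv D') = pc a *m cderiv D' + cderiv D' *m pc b.
    by rewrite [in LHS]eD cderivD !cderivM !cderiv_pc mul0mx mulmx0 add0r addr0.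
  have := IH _ e'; rewrite [ceval (cderiv _) _](_ : _ = 0).
    by rewrite mxE -derivSn; apply.
  by rewrite eD cevalD !cevalM D0 mulmx0 mul0mx addr0.
by apply.
Qed.

Variable (n : nat).
Implicit Types (g x y : 'M[K]_n) (H : set 'M[K]_n).

Definition nilp x := exists k, x ^+ k = 0.

Lemma nilp0 : nilp 0. Proof. by exists 1%N; rewrite expr1. Qed.

Lemma expr_leq0 x k l : (k <= l)%N -> x ^+ k = 0 -> x ^+ l = 0.
Proof. by move=> /subnK <- x0; rewrite exprD x0 mulr0. Qed.

Lemma mx_exprZ a x k : (a *: x) ^+ k = a ^+ k *: x ^+ k.
Proof.
elim: k => [|k IH]; first by rewrite !expr0 scale1r.
by rewrite !exprS IH -!mulmxE -scalemxAl -scalemxAr scalerA.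
Qed.

Lemma nilpZ a x : nilp x -> nilp (a *: x).
Proof. by move=> [k xk]; exists k; rewrite mx_exprZ xk scaler0. Qed.

Lemma nilpN x : nilp x -> nilp (- x).
Proof. by rewrite -scaleN1r; apply: nilpZ. Qed.

Lemma nilpD x y : x *m y = y *m x -> nilp x -> nilp y -> nilp (x + y).
Proof.
move=> cxy [k xk] [l yl]; exists (k + l)%N; have cc : GRing.comm x y by [].
rewrite exprDn_comm //.
apply: big1 => i _; have [lei|lti] := leqP l i.
  by rewrite (expr_leq0 lei yl) mulr0 mul0rn.
by rewrite (expr_leq0 (l := (k + l - i)%N) _ xk) ?mul0r ?mul0rn //; lia.
Qed.

Lemma nilpM x y : x *m y = y *m x -> nilp x -> nilp (x *m y).
Proof. by move=> cxy [k xk]; exists k; rewrite mulmxE exprMn_comm ?xk ?mul0r. Qed.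

Lemma nilp_conj g x : g \in unitmx -> nilp x -> nilp (Ad g x).
Proof.
move=> ug [k xk]; exists k; suff -> : (Ad g x) ^+ k = Ad g (x ^+ k).
  by rewrite xk /Ad mulmx0 mul0mx.
elim: k {xk} => [|k IH]; first by rewrite !expr0 /Ad mulmx1 mulmxV.
by rewrite !exprS IH /Ad -!mulmxE !mulmxA mulmxKV.
Qed.

Definition expN N x := \sum_(k < N) (k`!%:R)^-1 *: x ^+ k.
Definition expm x := expN (xget 0%N [set k | x ^+ k = 0]) x.

Definition ecurveN N x : 'M[{poly K}]_n := \sum_(k < N) ((k`!%:R)^-1 *: 'X^k) *: pc (x ^+ k).
Definition ecurve x := ecurveN (xget 0%N [set k | x ^+ k = 0]) x.

Lemma fact_neq0 k : k`!%:R != 0 :> K.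
Proof. by have := fact_gt0 k; case: (k`!) => // m _; apply: natr_neq0. Qed.

Lemma expNE N x : x ^+ N = 0 -> expm x = expN N x.
Proof.
move=> xN; rewrite /expm; set M := xget _ _.
have xM : x ^+ M = 0.
  by rewrite /M; case: xgetP => [y -> //|/(_ N)]; case.
have aux : forall A B, (A <= B)%N -> x ^+ A = 0 -> expN A x = expN B x.
  move=> A B leAB xA; rewrite /expN -(big_mkord xpredT (fun k => (k`!%:R)^-1 *: x ^+ k)).
  rewrite -(big_mkord xpredT (fun k => (k`!%:R)^-1 *: x ^+ k)) (big_cat_nat (n := A) (p := B)) //=.
  rewrite [X in _ = _ + X]big_nat_cond [X in _ = _ + X]big1 ?addr0 // => i /andP [/andP [lei _] _].
  by rewrite (expr_leq0 lei xA) scaler0.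
by case/orP: (leq_total M N) => l; [|apply: esym]; apply: aux.
Qed.

Lemma ecurve_eval x t : nilp x -> ceval (ecurve x) t = expm (t *: x).
Proof.
move=> [N xN]; rewrite /ecurve; set M := xget _ _.
have xM : x ^+ M = 0 by rewrite /M; case: xgetP => [y -> //|/(_ N)]; case.
rewrite (@expNE M); last by rewrite mx_exprZ xM scaler0.
rewrite ceval_sum; apply: eq_bigr => k _.
by rewrite cevalZ ceval_pc mx_exprZ scalerA hornerZ hornerXn.
Qed.

Lemma pcMXr x k : pc (x ^+ k) *m pc x = pc (x ^+ k.+1).
Proof. by rewrite -pcM mulmxE -exprSr. Qed.

Lemma pcMXl x k : pc x *m pc (x ^+ k) = pc (x ^+ k.+1).
Proof. by rewrite -pcM mulmxE -exprS. Qed.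

Lemma ecurve_deriv x : nilp x -> cderiv (ecurve x) = ecurve x *m pc x.
Proof.
move=> [N xN]; rewrite /ecurve; set M := xget _ _.
have xM : x ^+ M = 0 by rewrite /M; case: xgetP => [y -> //|/(_ N)]; case.
case: M xM => [|M] xM; rewrite /ecurveN ?big_ord0; first by apply/matrixP => i j; rewrite !mxE ?big1 ?deriv0 // => k _; rewrite !mxE mul0r.
rewrite cderiv_sum mulmx_suml [LHS]big_ord_recl [RHS]big_ord_recr /=.
rewrite expr0 fact0 invr1 scale1r cderivZ derivC scale0r add0r.
rewrite -[X in _ = _ + X]scalemxAl pcMXr xM.
rewrite [X in _ + X](_ : _ = 0) ?addr0; last by apply/matrixP => i j; rewrite !mxE mulr0.
apply: eq_bigr => k _; rewrite cderivZ derivZ derivXn /= /bump /= add1n.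
rewrite -scalemxAl pcMXr; congr (_ *: _).
rewrite -scaler_nat scalerA; congr (_ *: _).
rewrite factS natrM invfM -mulrA [X in _ * X]mulrC mulrA mulVf ?mul1r //.
exact: natr_neq0.
Qed.

Lemma ecurve_pcC x : nilp x -> pc x *m ecurve x = ecurve x *m pc x.
Proof.
move=> _; rewrite /ecurve /ecurveN mulmx_sumr mulmx_suml; apply: eq_bigr => k _.
by rewrite -scalemxAl -scalemxAr pcMXl pcMXr.
Qed.

Lemma expm0 : expm 0 = 1%:M.
Proof. by rewrite (@expNE 1) ?expr1 // /expN big_ord1 expr0 fact0 invr1 scale1r. Qed.

Lemma ecurve0 x : nilp x -> ceval (ecurve x) 0 = 1%:M.
Proof. by move=> nx; rewrite ecurve_eval // scale0r expm0. Qed.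

Lemma ecurve_uniq x (C : 'M[{poly K}]_n) :
  nilp x -> cderiv C = C *m pc x -> ceval C 0 = 1%:M -> C = ecurve x.
Proof.
move=> nx dC C0; apply: subr0_eq.
apply: (@ode_uniq n n 0 x); last by rewrite cevalB C0 ecurve0 // subrr.
rewrite cderivB dC ecurve_deriv // mulmxBl; have -> : pc 0 = 0 :> 'M[{poly K}]_n by apply/matrixP => i j; rewrite !mxE.
by rewrite mul0mx add0r.
Qed.

Lemma expmD x y : x *m y = y *m x -> nilp x -> nilp y -> expm (x + y) = expm x *m expm y.
Proof.
move=> cxy nx ny; have nxy := nilpD cxy nx ny.
rewrite -[x + y]scale1r -ecurve_eval // -[x in RHS]scale1r -[y in RHS]scale1r.
rewrite -!ecurve_eval // -cevalM; congr ceval; apply/esym/ecurve_uniq => //.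
  rewrite cderivM !ecurve_deriv // -!mulmxA.
  have -> : pc x *m ecurve y = ecurve y *m pc x.
    rewrite /ecurve /ecurveN mulmx_sumr mulmx_suml; apply: eq_bigr => k _.
    rewrite -scalemxAl -scalemxAr -!pcM !mulmxE; congr (_ *: pc _); exact/commrX.
  rewrite -!mulmxDr; congr (_ *m (_ *m _)); by apply/matrixP => i j; rewrite !mxE polyCD.
by rewrite cevalM !ecurve0 // mulmx1.
Qed.

Lemma expmNK x : nilp x -> expm x *m expm (- x) = 1%:M.
Proof.
move=> nx; rewrite -expmD ?subrr ?expm0 //; last exact: nilpN.
by rewrite mulmxN mulNmx.
Qed.

Lemma expm_unit x : nilp x -> expm x \in unitmx.
Proof. by move=> nx; have := mulmx1_unit (expmNK nx); case. Qed.

Lemma invmx_expm x : nilp x -> invmx (expm x) = expm (- x).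
Proof.
move=> nx; rewrite -[RHS]mul1mx -(mulVmx (expm_unit nx)) -mulmxA expmNK //.
by rewrite mulmx1.
Qed.

Lemma invmx_mul g h : g \in unitmx -> h \in unitmx ->
  invmx (g *m h) = invmx h *m invmx g.
Proof.
move=> ug uh; have ugh : g *m h \in unitmx by rewrite unitmx_mul ug.
by rewrite -[RHS]mulmx1 -(mulmxV ugh) !mulmxA mulmxKV // mulVmx // mul1mx.
Qed.

Lemma AdM g h x : g \in unitmx -> h \in unitmx -> Ad (g *m h) x = Ad g (Ad h x).
Proof. by move=> ug uh; rewrite /Ad invmx_mul // !mulmxA. Qed.

Lemma Ad1 x : Ad 1%:M x = x.
Proof. by rewrite /Ad invmx1 mulmx1 mul1mx. Qed.

Lemma AdK g : g \in unitmx -> cancel (Ad g) (Ad (invmx g)).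
Proof. by move=> ug x; rewrite -AdM ?unitmx_inv // mulVmx // Ad1. Qed.

Lemma AdVK g : g \in unitmx -> cancel (Ad (invmx g)) (Ad g).
Proof. by move=> ug x; rewrite -AdM ?unitmx_inv // mulmxV // Ad1. Qed.

Lemma Ad_is_linear g : linear (Ad g).
Proof. by move=> a x y; rewrite /Ad mulmxDr mulmxDl -scalemxAr -scalemxAl. Qed.
HB.instance Definition _ g := GRing.isLinear.Build K 'M[K]_n 'M[K]_n _ (Ad g) (Ad_is_linear g).

Lemma Ad_mul g x y : g \in unitmx -> Ad g (x *m y) = Ad g x *m Ad g y.
Proof. by move=> ug; rewrite /Ad !mulmxA mulmxKV. Qed.

Lemma Ad_bracket g x y : g \in unitmx -> Ad g (bracket x y) = bracket (Ad g x) (Ad g y).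
Proof. by move=> ug; rewrite /bracket linearB /= !Ad_mul. Qed.

Lemma Ad_expm g x : g \in unitmx -> nilp x -> Ad g (expm x) = expm (Ad g x).
Proof.
move=> ug [N xN]; have E k : (Ad g x) ^+ k = Ad g (x ^+ k).
  elim: k => [|k IH]; first by rewrite !expr0 /Ad mulmx1 mulmxV.
  by rewrite !exprS IH -!mulmxE -Ad_mul.
rewrite (expNE xN) (@expNE N); last by rewrite E xN linear0.
by rewrite /expN linear_sum; apply: eq_bigr => k _; rewrite linearZ E.
Qed.

Lemma bracket_linear_r x : linear (bracket x).
Proof. by move=> a y z; rewrite /bracket mulmxDr mulmxDl -scalemxAr -scalemxAl scalerBr opprD addrACA. Qed.
HB.instance Definition _ x := GRing.isLinear.Build K 'M[K]_n 'M[K]_n _ (bracket x) (bracket_linear_r x).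

Lemma bracketC x y : bracket x y = - bracket y x.
Proof. by rewrite /bracket opprB. Qed.

Lemma bracketxx x : bracket x x = 0.
Proof. by rewrite /bracket subrr. Qed.

Lemma bracketDl x y z : bracket (x + y) z = bracket x z + bracket y z.
Proof. by rewrite /bracket mulmxDl mulmxDr opprD addrACA. Qed.

Lemma bracketZl a x y : bracket (a *: x) y = a *: bracket x y.
Proof. by rewrite /bracket -scalemxAl -scalemxAr scalerBr. Qed.

Lemma bracketNl x y : bracket (- x) y = - bracket x y.
Proof. by rewrite -!scaleN1r bracketZl. Qed.

Lemma bracketDr x y z : bracket x (y + z) = bracket x y + bracket x z.
Proof. by rewrite linearD. Qed.

Lemma bracketZr a x y : bracket x (a *: y) = a *: bracket x y.
Proof. by rewrite linearZ. Qed.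

Lemma bracketNr x y : bracket x (- y) = - bracket x y.
Proof. by rewrite linearN. Qed.

Lemma bracket0r x : bracket x 0 = 0.
Proof. by rewrite linear0. Qed.

Lemma bracket0l x : bracket 0 x = 0.
Proof. by rewrite bracketC bracket0r oppr0. Qed.

Lemma bracketBl x y z : bracket (x - y) z = bracket x z - bracket y z.
Proof. by rewrite bracketDl bracketNl. Qed.

Lemma bracketBr x y z : bracket x (y - z) = bracket x y - bracket x z.
Proof. by rewrite bracketDr bracketNr. Qed.

Lemma bracket_suml I (r : seq I) (P : pred I) (F : I -> 'M[K]_n) y :
  bracket (\sum_(i <- r | P i) F i) y = \sum_(i <- r | P i) bracket (F i) y.
Proof. by elim/big_rec2: _ => [|i a b _ <-]; rewrite ?bracket0l ?bracketDl. Qed.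

Lemma bracket_sumr I (r : seq I) (P : pred I) (F : I -> 'M[K]_n) y :
  bracket y (\sum_(i <- r | P i) F i) = \sum_(i <- r | P i) bracket y (F i).
Proof. by elim/big_rec2: _ => [|i a b _ <-]; rewrite ?bracket0r ?bracketDr. Qed.

Lemma jacobi x y z : bracket x (bracket y z) = bracket (bracket x y) z + bracket y (bracket x z).
Proof.
rewrite /bracket !mulmxBr !mulmxBl !mulmxA.
move: (x *m y *m z) (x *m z *m y) (y *m z *m x) (z *m y *m x) (y *m x *m z) (z *m x *m y) => a b c d e f.
by rewrite !opprB; apply/matrixP => i j; rewrite !mxE; ring.
Qed.

(** exp (ad x) = Ad (exp x), for any bound on the order of nilpotency of ad x
    at y. *)
Lemma Ad_expm_ad x y N : nilp x -> iter N (bracket x) y = 0 ->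
  Ad (expm x) y = \sum_(k < N) (k`!%:R)^-1 *: iter k (bracket x) y.
Proof.
move=> nx yN; pose F := ecurve x *m pc y *m ecurve (- x).
pose S : 'M[{poly K}]_n := \sum_(k < N) ((k`!%:R)^-1 *: 'X^k) *: pc (iter k (bracket x) y).
have nxN := nilpN nx.
suff e : F = S.
  have := congr1 (fun C => ceval C 1) e; rewrite /F !cevalM !ecurve_eval // !scale1r ceval_pc.
  rewrite /Ad invmx_expm // => ->; rewrite ceval_sum; apply: eq_bigr => k _.
  by rewrite cevalZ ceval_pc hornerZ hornerXn expr1n mulr1.
apply: subr0_eq; apply: (@ode_uniq n n x (- x)); last first.
  rewrite cevalB /F !cevalM !ecurve0 // ceval_pc mul1mx mulmx1.
  rewrite /S ceval_sum; case: N yN @S => [|N] yN S.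
    by rewrite big_ord0 subr0; exact: yN.
  rewrite big_ord_recl big1 => [|k _]; rewrite cevalZ hornerZ hornerXn ?fact0 ?invr1 ?expr0 ?mulr1 ?ceval_pc ?scale1r.
    by rewrite addr0 subrr.
  by rewrite expr0n mulr0 scale0r.
have dF : cderiv F = pc x *m F + F *m pc (- x).
  rewrite /F !cderivM !ecurve_deriv // cderiv_pc mulmx0 addr0 -(ecurve_pcC nx).
  by rewrite -!mulmxA.
have dS : cderiv S = pc x *m S + S *m pc (- x).
  rewrite /S cderiv_sum mulmx_sumr mulmx_suml -big_split /=.
  under [RHS]eq_bigr => k _.
    rewrite -scalemxAl -scalemxAr -scalerDr -!pcM.
    rewrite (_ : pc _ + pc _ = pc (iter k.+1 (bracket x) y)); last first.
      by rewrite /= /bracket mulmxN /pc map_mxB map_mxN.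
    over.
  case: N yN @S => [|N] yN S; first by rewrite !big_ord0.
  rewrite [LHS]big_ord_recl [RHS]big_ord_recr /= fact0 invr1 scale1r cderivZ derivC scale0r add0r.
  have -> : bracket x (iter N (bracket x) y) = 0 by rewrite -iterS.
  rewrite [X in _ + X](_ : _ = 0) ?addr0; last by apply/matrixP => i j; rewrite !mxE mulr0.
  apply: eq_bigr => k _; rewrite cderivZ derivZ derivXn /= /bump /= add1n.
  congr (_ *: _); rewrite -scaler_nat scalerA; congr (_ *: _).
  rewrite factS natrM invfM -mulrA [X in _ * X]mulrC mulrA mulVf ?mul1r //.
  exact: natr_neq0.
by rewrite cderivB dF dS mulmxBr mulmxBl opprD addrACA.
Qed.

Lemma Ad_expm_fix x y : nilp x -> bracket x y = 0 -> Ad (expm x) y = y.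
Proof.
move=> nx xy; rewrite (@Ad_expm_ad x y 1) // big_ord1 /= fact0 invr1.
by rewrite scale1r.
Qed.

(** An integral curve of a left invariant vector field of the Lie algebra stays
    in the closure of the group. *)
Lemma integral_curve H (c : 'M[{poly K}]_n) x t : monoid_mx H ->
  zclosure H (ceval c 0) -> cderiv c = c *m pc x -> Lie H x ->
  zclosure H (ceval c t).
Proof.
move=> mH c0 dc /(lieP charK _ mH) Lx p Ip.
have dp q : (pcomp q c)^`() = pcomp (ldiff x q) c.
  apply: (poly_evalP charK) => s; rewrite deriv_pcompE pcompE mxeval_ldiff.
  by rewrite dc cevalM ceval_pc.
have Ik k : vanishing_ideal H (iter k (ldiff x) p).
  by elim: k => //= k; apply: Lx.
rewrite -pcompE; suff -> : pcomp p c = 0 by rewrite horner0.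
apply: (poly_deriv_eq0 charK (t := 0)) => k.
suff -> : (pcomp p c)^`(k) = pcomp (iter k (ldiff x) p) c by rewrite pcompE; apply: c0 (Ik k).
elim: k => [|k IH]; first by rewrite derivn0.
by rewrite derivnS IH dp.
Qed.

Lemma lie_expm H x : algebraic_group H -> Lie H x -> nilp x -> H (expm x).
Proof.
move=> aH Lx nx; rewrite -(algebraic_groupP aH); split; last exact: expm_unit.
rewrite -[x]scale1r -ecurve_eval //.
have sH := (aH.1); apply: (@integral_curve _ _ x) => //.
- exact: subgroup_monoid.
- by rewrite ecurve0 //; apply: sub_zclosure; case: sH.
exact: ecurve_deriv.
Qed.

Lemma lie_of_expm H x : algebraic_group H -> nilp x ->
  (forall t, H (expm (t *: x))) -> Lie H x.
Proof.
move=> aH nx Hx; have := lie_curve charK (H := H) (c := ecurve x).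
rewrite ecurve_deriv // cevalM ecurve0 // mul1mx ceval_pc; apply => // t.
by rewrite ecurve_eval //; apply: sub_zclosure.
Qed.

(** The curve t |-> u ^ t, given by the binomial series, passes through the
    powers of u at the natural numbers. *)
Lemma logarithm u : nilp (u - 1%:M) -> exists y, [/\ nilp y, u = expm y,
  (exists N (a : nat -> K), y = \sum_(k < N) a k *: (u - 1%:M) ^+ k.+1) &
  forall H, monoid_mx H -> H u -> Lie H y].
Proof.
set v := u - 1%:M; move=> [N vN].
pose binp k : {poly K} := (k`!%:R)^-1 *: \prod_(i < k) ('X - i%:R%:P).
pose c : 'M[{poly K}]_n := \sum_(k < N.+1) binp k *: pc (v ^+ k).
have binE k j : (binp k).[j%:R] = 'C(j, k)%:R.
  rewrite /binp hornerZ horner_prod; apply: (mulfI (fact_neq0 k)).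
  rewrite mulrA mulfV ?fact_neq0 // mul1r -natrM mulnC bin_ffact ffact_prod natr_prod.
  have [lekj|ltjk] := leqP k j.
    apply: eq_bigr => i _; rewrite !hornerE natrB //; have := ltn_ord i; lia.
  rewrite (bigD1 (Ordinal ltjk)) //= !hornerE subrr mul0r.
  by rewrite (bigD1 (Ordinal ltjk)) //= subnn mul0r.
have cE (j : nat) : ceval c j%:R = u ^+ j.
  have -> : u = v + 1 by rewrite /v subrK.
  rewrite exprDn_comm; last exact: commr1.
  rewrite /c ceval_sum.
  have FE M : \sum_(k < M) ceval (binp k *: pc (v ^+ k)) j%:R = \sum_(0 <= k < M) v ^+ k *+ 'C(j, k).
    rewrite big_mkord; apply: eq_bigr => k _.
    by rewrite cevalZ ceval_pc binE scaler_nat.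
  have tr M : \sum_(0 <= k < N.+1 + M) v ^+ k *+ 'C(j, k) = \sum_(0 <= k < N.+1) v ^+ k *+ 'C(j, k).
    rewrite (big_cat_nat (n := N.+1)) //= ?leq_addr // [X in _ + X]big_nat_cond.
    rewrite [X in _ + X]big1 ?addr0 // => i /andP[/andP[lei _] _].
    by rewrite (expr_leq0 (ltnW lei) vN) mul0rn.
  rewrite FE -(tr j.+1) addnC (big_cat_nat (n := j.+1)) //= ?leq_addr //.
  rewrite [X in _ + X]big_nat_cond [X in _ + X]big1 ?addr0; last first.
    by move=> i /andP[/andP[lei _] _]; rewrite bin_small.
  rewrite big_mkord (reindex_inj rev_ord_inj) /=; apply: eq_bigr => i _.
  rewrite expr1n mulr1 !subSS bin_sub //; have := ltn_ord i; lia.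
have cu : (forall j : nat, pc (u ^+ j) *m c = map_mx (fun q => q \Po ('X + j%:R%:P)) c).
  move=> j; apply: curve_eq => i; rewrite cevalM ceval_pc cE.
  have -> : ceval (map_mx (fun q => q \Po ('X + j%:R%:P)) c) i%:R = ceval c (i + j)%:R.
    by apply/matrixP => a b; rewrite !mxE horner_comp !hornerE natrD.
  by rewrite cE addnC exprD.
pose y := ceval (cderiv c) 0.
have dc : cderiv c = c *m pc y.
  apply: curve_eq => j; rewrite cevalM cE ceval_pc.
  have := congr1 (fun C => ceval (cderiv C) 0) (cu j).
  rewrite /= cderivM cderiv_pc mul0mx add0r cevalM ceval_pc -/y => ->.
  apply/matrixP => a b; rewrite !mxE deriv_comp derivD derivX derivC addr0 mulr1.
  by rewrite horner_comp !hornerE.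
have yE : y = \sum_(k < N) (binp k.+1)^`().[0] *: v ^+ k.+1.
  rewrite /y /c cderiv_sum ceval_sum big_ord_recl /= cderivZ cevalZ /binp big_ord0.
  rewrite derivZ derivC scaler0 horner0 scale0r add0r; apply: eq_bigr => k _.
  by rewrite cderivZ cevalZ ceval_pc.
have c0 : ceval c 0 = 1%:M by have := cE 0%N; rewrite expr0.
have ny : nilp y.
  have -> : y = v *m \sum_(k < N) (binp k.+1)^`().[0] *: v ^+ k.
    by rewrite mulmx_sumr yE; apply: eq_bigr => k _; rewrite -scalemxAr mulmxE -exprS.
  apply: nilpM; last by exists N.
  rewrite mulmx_sumr mulmx_suml; apply: eq_bigr => i _.
  by rewrite -scalemxAr -scalemxAl !mulmxE -exprS -exprSr.
exists y; split=> //.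
- rewrite -[y]scale1r -ecurve_eval // -(ecurve_uniq ny dc c0).
  by have := cE 1%N; rewrite expr1.
- by exists N, (fun k => (binp k.+1)^`().[0]).
move=> H [H1 HM] Hu; apply: (lie_curve charK) => // t p Ip.
rewrite -pcompE (poly_eval0 charK (q := pcomp p c)) ?horner0 // => j.
rewrite pcompE cE; apply: Ip; elim: j => [|j IH]; first by rewrite expr0.
by rewrite exprS; apply: HM.
Qed.

End Exponential.

(** * Weights of polynomials and algebraicity of the Lie algebra *)

Section Weights.
Variable (K : closedFieldType).
Hypothesis charK : [pchar K] =i pred0.

Section ComponentLemma.
Variables (W : lmodType K) (D : {linear W -> W}) (I : W -> Prop).
Hypotheses (I0 : I 0) (IL : forall a u v, I u -> I v -> I (a *: u + v)).
Hypothesis (ID : forall u, I u -> I (D u)).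

Let Dw w u := D u - w *: u.

Let IB u v : I u -> I v -> I (v - u).
Proof. by move=> Iu Iv; rewrite addrC -scaleN1r; apply: IL. Qed.

Let IZ a u : I u -> I (a *: u).
Proof. by move=> Iu; rewrite -[_ *: _]addr0; apply: IL. Qed.

Let IDw w u : I u -> I (Dw w u).
Proof. by move=> Iu; apply: IB; [apply: IZ|apply: ID]. Qed.

Let DwC w w' u : Dw w (Dw w' u) = Dw w' (Dw w u).
Proof.
have E a b : Dw a (Dw b u) = D (D u) - b *: D u - a *: D u + (a * b) *: u.
  by rewrite /Dw linearB linearZ /= scalerBr scalerA opprB !addrA addrAC.
by rewrite !E [w * w']mulrC; congr (_ + _); rewrite addrAC.
Qed.

Let iterDw k w w' u : iter k (Dw w) (Dw w' u) = Dw w' (iter k (Dw w) u).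
Proof. by elim: k => //= k ->; rewrite DwC. Qed.

Let iterDwC k l w w' u : iter k (Dw w) (iter l (Dw w') u) = iter l (Dw w') (iter k (Dw w) u).
Proof. by elim: l => //= l <-; rewrite iterDw. Qed.

Let Dw0 w : Dw w 0 = 0. Proof. by rewrite /Dw linear0 scaler0 subr0. Qed.
Let iterDw0 k w : iter k (Dw w) 0 = 0.
Proof. by elim: k => //= k ->. Qed.

Let cancel1 M w w0 g : w != w0 -> iter M (Dw w) g = 0 -> I (Dw w0 g) -> I g.
Proof.
move=> ne; elim: M g => [|M IH] g; first by move=> /= -> _.
rewrite iterSr => gM Ig; have Ig' : I (Dw w g).
  by apply: IH => //; rewrite DwC; apply: IDw.
have : I (Dw w0 g - Dw w g) by apply: IB.
have -> : Dw w0 g - Dw w g = (w - w0) *: g.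
  by rewrite /Dw scalerBl opprB addrC addrA subrK.
by move=> /(IZ (w - w0)^-1); rewrite scalerA mulVf ?scale1r // subr_eq0.
Qed.

Let cancelN N M w w0 g : w != w0 -> iter M (Dw w) g = 0 -> I (iter N (Dw w0) g) -> I g.
Proof.
move=> ne; elim: N g => [//|N IH] g gM /= Ig.
have e : iter M (Dw w) (iter N (Dw w0) g) = 0 by rewrite iterDwC gM iterDw0.
exact: IH gM (cancel1 ne e Ig).
Qed.

(** A D-stable subspace containing a sum of generalized eigenvectors for
    distinct eigenvalues contains each of them. *)
Lemma gen_eigen_component (ws : seq K) (f : K -> W) :
  uniq ws -> (forall w, w \in ws -> exists N, iter N (fun u => D u - w *: u) (f w) = 0) ->
  I (\sum_(w <- ws) f w) -> forall w, w \in ws -> I (f w).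
Proof.
elim: ws f => [//|w0 ws IH] f /= /andP[nw0 uws] fN; rewrite big_cons => Isum.
have [N fN0] := fN w0 (mem_head _ _).
have TI w : w \in ws -> I (f w).
  move=> wws; have wne : w != w0 by apply: contraNneq nw0 => <-.
  have [M fM] := fN w (mem_behead (s := w0 :: ws) wws); apply: (cancelN (N := N) wne fM).
  apply: (IH (fun w => iter N (Dw w0) (f w))) => // [v vws|].
    have [L fL] := fN v (mem_behead (s := w0 :: ws) vws); exists L.
    by rewrite -/(Dw v) iterDwC fL iterDw0.
  have -> : \sum_(v <- ws) iter N (Dw w0) (f v) = iter N (Dw w0) (\sum_(v <- ws) f v).
    rewrite (big_morph (iter N (Dw w0)) (op1 := +%R) (id1 := 0)) //.
    elim: (N) => [//|k IHk] u v /=; rewrite IHk /Dw linearD /= scalerDr opprD.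
    by rewrite addrACA.
  have : I (iter N (Dw w0) (f w0 + \sum_(v <- ws) f v)).
    by elim: (N) => //= k; apply: IDw.
  suff -> : iter N (Dw w0) (f w0 + \sum_(v <- ws) f v) = iter N (Dw w0) (\sum_(v <- ws) f v) by [].
  have itD k u v : iter k (Dw w0) (u + v) = iter k (Dw w0) u + iter k (Dw w0) v.
    elim: k => [//|k IHk] /=; rewrite IHk /Dw linearD /= scalerDr opprD.
    by rewrite addrACA.
  by rewrite itD -/(Dw w0) in fN0 *; rewrite fN0 add0r.
move=> w; rewrite inE => /orP[/eqP->|/TI //].
rewrite -(addrK (\sum_(v <- ws) f v) (f w0)); apply: IB => //.
rewrite big_seq; apply: big_ind => //; first by move=> u v Iu Iv; rewrite -[u]scale1r; apply: IL.
Qed.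

End ComponentLemma.

Section ZMonomials.
Variables (n : nat) (P : 'M[K]_n).
Hypothesis uP : P \in unitmx.
Implicit Types (p q : {mpoly K[n * n]}) (H : set 'M[K]_n) (d c : 'rV[K]_n) (ds : seq 'rV[K]_n) (m : 'X_{1..n*n}).

Definition dg d : 'M[K]_n := invmx P *m diag_mx d *m P.

Local Notation cmx := (map_mx (@mpolyC (n * n) K)).
Local Notation column i := (enum_val (cast_ord (esym (mxvec_cast n n)) i)).2.
Let Zm := gmx K n *m cmx (invmx P).

Definition zmon m : {mpoly K[n * n]} := \prod_i (mxvec Zm 0 i) ^+ m i.

Definition colsum m (j : 'I_n) : nat := \sum_(i < n) m (mxvec_index i j).

Definition wt d m : K := \sum_j (colsum m j)%:R * d 0 j.

Definition zspan (s : seq (K * 'X_{1..n*n})) := \sum_(u <- s) u.1 *: zmon u.2.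

Lemma zmonD m m' : zmon (m + m') = zmon m * zmon m'.
Proof. by rewrite /zmon -big_split /=; apply: eq_bigr => i _; rewrite mnmDE exprD. Qed.

Lemma zmonU i j : zmon U_(mxvec_index i j) = Zm i j.
Proof.
rewrite /zmon (bigD1 (mxvec_index i j)) //= mnmE eqxx expr1 mxvecE big1 ?mulr1 //.
by move=> k ne; rewrite mnmE eq_sym (negPf ne) expr0.
Qed.

Lemma zspanP p : exists s, p = zspan s.
Proof.
elim/mpoly_ringind: p => [a|i|p q [s ->] [t ->]|p q [s ->] [t ->]].
- exists [:: (a, 0%MM)]; rewrite /zspan big_seq1 /= /zmon big1 ?alg_mpolyC //.
  by move=> i _; rewrite mnm0E expr0.
- case/mxvec_indexP: i => i j.
  exists [seq (P k j, U_(mxvec_index i k)%MM) | k <- enum 'I_n].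
  rewrite /zspan big_map big_enum /=.
  transitivity ((Zm *m cmx P) i j).
    by rewrite /Zm -mulmxA -map_mxM mulVmx // map_mx1 mulmx1 mxE.
  rewrite mxE; apply: eq_bigr => k _.
  by rewrite zmonU -mul_mpolyC mulrC [in LHS](mxE _ _ k j).
- by exists (s ++ t); rewrite /zspan big_cat.
exists [seq (u.1 * v.1, (u.2 + v.2)%MM) | u <- s, v <- t].
rewrite /zspan big_allpairs_dep /= mulr_suml; apply: eq_bigr => u _.
rewrite mulr_sumr; apply: eq_bigr => v _.
by rewrite zmonD -scalerAl -scalerAr scalerA.
Qed.

Lemma Zm_ldiff d : map_mx (ldiff (dg d)) Zm = Zm *m cmx (diag_mx d).
Proof.
rewrite /Zm ldiff_gmx -mulmxA -map_mxM; congr (_ *m map_mx _ _).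
by rewrite /dg mulmxK.
Qed.

Lemma sum_colsum (R : nmodType) (F : 'I_n -> nat -> R) m :
  (forall j, F j 0%N = 0) -> (forall j a b, F j (a + b)%N = F j a + F j b) ->
  \sum_(i < n * n) F (column i) (m i)
  = \sum_j F j (colsum m j).
Proof.
move=> F0 FD; have -> : \sum_j F j (colsum m j) = \sum_j \sum_i F j (m (mxvec_index i j)).
  by apply: eq_bigr => j _; rewrite /colsum (big_morph (F j) (FD j) (F0 j)).
rewrite exchange_big pair_bigA /= (reindex (uncurry (@mxvec_index n n))) /=.
  apply: eq_bigr => -[i j] _ /=; by rewrite /mxvec_index cast_ordK enum_rankK.
exact: curry_mxvec_bij.
Qed.

Lemma ldiff_zmon d m : ldiff (dg d) (zmon m) = wt d m *: zmon m.
Proof.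
have Z1 i j : ldiff (dg d) (Zm i j) = d 0 j *: Zm i j.
  have := Zm_ldiff d => /matrixP/(_ i j); rewrite mxE => ->.
  rewrite mxE (bigD1 j) //= big1 ?addr0.
    by rewrite !(mxE _ _ j j) eqxx mulr1n -mul_mpolyC mulrC.
  by move=> k /negPf ne; rewrite !(mxE _ _ k j) ne mulr0n mulr0.
have Zi (i : 'I_(n * n)) : ldiff (dg d) (mxvec Zm 0 i)
   = d 0 (column i) *: mxvec Zm 0 i.
  by case/mxvec_indexP: i => i j; rewrite mxvecE Z1 /mxvec_index cast_ordK enum_rankK.
have Zk i k : ldiff (dg d) (mxvec Zm 0 i ^+ k) =
   (k%:R * d 0 (column i)) *: mxvec Zm 0 i ^+ k.
  elim: k => [|k IH]; first by rewrite expr0 -mpolyC1 ldiffC mul0r scale0r.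
  rewrite exprS ldiffM IH Zi -scalerAl -scalerAr -scalerDl; congr (_ *: _).
  by rewrite mulrS mulrDl mul1r.
rewrite /wt -(@sum_colsum _ (fun j a => a%:R * d 0 j)); last 2 first.
- by move=> j; rewrite mul0r.
- by move=> j a b; rewrite natrD mulrDl.
rewrite /zmon; elim: (index_enum _) => [|i r IH].
  by rewrite !big_nil -mpolyC1 ldiffC scale0r.
rewrite !big_cons ldiffM IH Zk -scalerAl -scalerAr -scalerDl.
by [].
Qed.

Lemma mxeval_zmon_dg d m g :
  mxeval (zmon m) (g *m dg d) = (\prod_j d 0 j ^+ colsum m j) * mxeval (zmon m) g.
Proof.
have evZ h (i : 'I_(n * n)) : mxeval (mxvec Zm 0 i) h = mxvec (h *m invmx P) 0 i.
  rewrite /mxeval -(mxvec_map (meval _)) map_mxM meval_gmx; congr (mxvec (_ *m _) 0 i).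
  by rewrite -map_mx_comp; apply/matrixP => u v; rewrite mxE /= mevalC.
have Zi (i : 'I_(n * n)) : mxeval (mxvec Zm 0 i) (g *m dg d)
   = d 0 (column i) * mxeval (mxvec Zm 0 i) g.
  rewrite !evZ; case/mxvec_indexP: i => i j; rewrite !mxvecE /mxvec_index cast_ordK enum_rankK /=.
  rewrite /dg -!mulmxA mulmxV // mulmx1 mulmxA mul_mx_diag mxE mulrC; congr (_ * _).
have -> : \prod_j d 0 j ^+ colsum m j =
   \prod_(i < n * n) d 0 (column i) ^+ m i.
  have -> : \prod_j d 0 j ^+ colsum m j = \prod_j \prod_i d 0 j ^+ (m (mxvec_index i j)).
    by apply: eq_bigr => j _; rewrite /colsum expr_sum.
  rewrite exchange_big pair_bigA /= [RHS](reindex (uncurry (@mxvec_index n n))) /=.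
    apply: eq_bigr => -[i j] _ /=; by rewrite /mxvec_index cast_ordK enum_rankK.
  exact: curry_mxvec_bij.
rewrite /zmon /mxeval !rmorph_prod -big_split /=; apply: eq_bigr => i _.
by rewrite !rmorphXn /= -!/(mxeval _ _) Zi exprMn.
Qed.

(** phi is selecting for an ideal when multiplying each monomial coefficient
    by the value of phi preserves the ideal. *)
Definition selecting H (phi : 'X_{1..n*n} -> K) :=
  forall s, vanishing_ideal H (zspan s) ->
    vanishing_ideal H (zspan [seq (phi u.2 * u.1, u.2) | u <- s]).

Let viL H a p q : vanishing_ideal H p -> vanishing_ideal H q -> vanishing_ideal H (a *: p + q).
Proof. by move=> Ip Iq g Hg; rewrite /mxeval mevalD mevalZ -!/(mxeval _ _) Ip // Iq // mulr0 addr0. Qed.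

Let vi0 H : vanishing_ideal H 0.
Proof. by move=> g Hg; rewrite /mxeval meval0. Qed.

Lemma eq_selecting H phi psi : phi =1 psi -> selecting H phi -> selecting H psi.
Proof.
move=> e sel s Is; have := sel s Is; rewrite (eq_map (g := fun u => (psi u.2 * u.1, u.2))) //.
by move=> u; rewrite e.
Qed.

Lemma selectingM H phi psi : selecting H phi -> selecting H psi ->
  selecting H (fun m => phi m * psi m).
Proof.
move=> sphi spsi s /spsi /sphi; rewrite -map_comp /=.
by rewrite (eq_map (g := fun u => (phi u.2 * psi u.2 * u.1, u.2))) // => u; rewrite /= mulrA.
Qed.

Lemma selecting_sum H I (r : seq I) (F : I -> 'X_{1..n*n} -> K) (a : I -> K) :
  (forall i, selecting H (F i)) -> selecting H (fun m => \sum_(i <- r) a i * F i m).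
Proof.
move=> sF s Is; elim: r => [|i r IH].
  rewrite /zspan big_map big1 // => u _; by rewrite big_nil mul0r scale0r.
rewrite [zspan _](_ : _ = a i *: zspan [seq (F i u.2 * u.1, u.2) | u <- s] +
  zspan [seq ((\sum_(j <- r) a j * F j u.2) * u.1, u.2) | u <- s]); last first.
  rewrite /zspan !big_map scaler_sumr -big_split /=; apply: eq_bigr => u _.
  by rewrite big_cons mulrDl scalerDl scalerA mulrA.
exact: viL (sF i s Is) IH.
Qed.

Lemma selecting_agree H phi :
  (forall s : seq (K * 'X_{1..n*n}), exists2 psi, selecting H psi & forall u, u \in s -> phi u.2 = psi u.2) ->
  selecting H phi.
Proof.
move=> agr s Is; have [psi spsi e] := agr s; have := spsi s Is.
rewrite /zspan !big_map big_seq [in X in _ -> X]big_seq.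
by rewrite (eq_bigr (fun u => (phi u.2 * u.1) *: zmon u.2)) // => u us; rewrite e.
Qed.

Lemma derivation_nilp D (D1 : forall p q, D (p * q) = D p * q + p * D q)
  (D2 : linear D) (m0 : nat) (DC : forall a, D a%:MP = 0)
  (DX : forall i : 'I_(n * n), exists k, iter k D 'X_i = 0) p : exists k, iter k D p = 0.
Proof.
have itD k (u v : {mpoly K[n * n]}) : iter k D (u + v) = iter k D u + iter k D v.
  by elim: k => //= k ->; rewrite -[iter k D u in LHS]scale1r D2 scale1r.
have it0 k : iter k D 0 = 0 by elim: k => //= k ->; rewrite -mpolyC0 DC.
have mono k l u : (k <= l)%N -> iter k D u = 0 -> iter l D u = 0.
  by move=> /subnK <- e; rewrite iterD e it0.
elim/mpoly_ringind: p => [a|i|p q [k pk] [l ql]|p q [k pk] [l ql]].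
- by exists 1%N; apply: DC.
- exact: DX.
- exists (maxn k l); rewrite itD (mono k) ?leq_maxl // (mono l) ?leq_maxr ?addr0 //.
exists (k + l)%N; have [d] := ubnP (k + l).
elim: d k l p q pk ql => // d IH [|k] l p q pk ql.
  by move: pk => /= -> _; rewrite mul0r it0.
case: l ql => [|l] ql; first by move=> _; have -> : q = 0 := ql; rewrite mulr0 it0.
move=> le_d; rewrite addSn iterSr D1 itD.
have -> : iter (k + l.+1) D (D p * q) = 0.
  by apply: IH => //; rewrite -iterSr.
rewrite add0r addnS -addSn; apply: IH => //; first by rewrite -iterSr.
by move: le_d; clear; lia.
Qed.

(** If the Lie algebra contains x = s + m, where s is diagonal and m is a
    commuting nilpotent matrix, the vanishing ideal is graded by the weights of
    s. *)
Lemma selecting_wt H d x (m : 'M[K]_n) psi : monoid_mx H -> Lie H x -> x = dg d + m ->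
  bracket (dg d) m = 0 -> nilp m -> selecting H (fun u => psi (wt d u)).
Proof.
move=> mH /(lieP charK _ mH) Lx xE cm nm s Is.
pose ws := undup [seq wt d u.2 | u <- s].
pose f w := \sum_(u <- s | wt d u.2 == w) u.1 *: zmon u.2.
have part (a : K -> K) : \sum_(u <- s) (a (wt d u.2) * u.1) *: zmon u.2 = \sum_(w <- ws) a w *: f w.
  under [RHS]eq_bigr => w _ do rewrite /f scaler_sumr big_mkcond /=.
  rewrite exchange_big /= big_seq [RHS]big_seq; apply: eq_bigr => u us.
  have uw : wt d u.2 \in ws by rewrite mem_undup; apply: (map_f (fun u => wt d u.2)).
  rewrite (bigD1_seq (wt d u.2)) ?undup_uniq //= eqxx scalerA.
  by rewrite big1 ?addr0 // => w /negPf ne; rewrite eq_sym ne.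
rewrite [zspan _](_ : _ = \sum_(w <- ws) psi w *: f w); last first.
  by rewrite -part /zspan big_map.
have If : forall w, w \in ws -> vanishing_ideal H (f w).
  apply: (gen_eigen_component (D := ldiff x)) => //; last 1 first.
  - have -> : \sum_(w <- ws) f w = zspan s.
      transitivity (\sum_(w <- ws) (fun=> 1) w *: f w); first by apply: eq_bigr => w _; rewrite scale1r.
      by rewrite -part; apply: eq_bigr => u _; rewrite mul1r.
    exact: Is.
  - exact: viL.
  - exact: undup_uniq.
  move=> w _; have Ds : ldiff (dg d) (f w) = w *: f w.
    rewrite /f linear_sum scaler_sumr; apply: eq_bigr => u /eqP wu.
    by rewrite linearZ /= ldiff_zmon wu !scalerA mulrC.
  have DsM k : ldiff (dg d) (iter k (ldiff m) (f w)) = w *: iter k (ldiff m) (f w).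
    elim: k => [//|k IH] /=; have := ldiff_comm (dg d) m (iter k (ldiff m) (f w)).
    rewrite cm IH linearZ /= => e.
    have l0 q : ldiff 0 q = 0.
      have := ldiff_linear_l (-1) 0 0 q; rewrite scaleN1r addNr => ->.
      by rewrite scaleN1r addNr.
    by apply/eqP; rewrite -subr_eq0 e l0.
  have it k : iter k (fun u => ldiff x u - w *: u) (f w) = iter k (ldiff m) (f w).
    elim: k => [//|k /= ->]; rewrite xE -[dg d]scale1r ldiff_linear_l scale1r DsM.
    by rewrite addrAC subrr add0r.
  have : exists k, iter k (ldiff m) (f w) = 0.
    apply: (derivation_nilp (D := ldiff m)) => //; [exact: ldiffM|exact: ldiff_is_linear|exact: ldiffC|].
    case/mxvec_indexP => i j; have [N mN] := nm; exists N.
    have gk k : map_mx (iter k (ldiff m)) (gmx K n) = gmx K n *m cmx (m ^+ k).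
      elim: k => [|k IH]; first by rewrite expr0 map_mx1 mulmx1; apply/matrixP => a b; rewrite mxE.
      rewrite exprS -[_ * _]/(_ *m _) -ldiff_gmx -IH.
      by apply/matrixP => a b; rewrite !mxE.
    have /matrixP/(_ i j) := gk N; rewrite mN !mxE => ->.
    by apply: big1 => k _; rewrite !mxE mpolyC0 mulr0.
  by move=> [k fk]; exists k; rewrite it.
rewrite big_seq; apply: big_ind => //.
  by move=> p q Ip Iq; rewrite -[p]scale1r; apply: viL.
by move=> w /If Iw; rewrite -[_ *: _]addr0; apply: viL.
Qed.

Lemma lie_dg_selecting H d y : monoid_mx H -> selecting H (wt d) -> y = dg d -> Lie H y.
Proof.
move=> mH sel ->; apply/(lieP charK _ mH) => p Ip.
have [s ps] := zspanP p; rewrite ps in Ip *; have := sel s Ip.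
rewrite /zspan big_map linear_sum /=.
rewrite (eq_bigr (fun u => ldiff (dg d) (u.1 *: zmon u.2))) // => u _.
by rewrite linearZ /= ldiff_zmon scalerA mulrC.
Qed.

Lemma dg_add d d' : dg (d + d') = dg d + dg d'.
Proof. by rewrite /dg linearD mulmxDr mulmxDl. Qed.

Lemma dg_mul d d' : dg d *m dg d' = dg (\row_j (d 0 j * d' 0 j)).
Proof.
rewrite /dg -!mulmxA (mulmxA P) mulmxV // mul1mx (mulmxA (diag_mx d)); congr (_ *m (_ *m _)).
rewrite mul_diag_mx; apply/matrixP => i j; rewrite !mxE.
by rewrite mulrnAr.
Qed.

Lemma dg1 : dg (const_mx 1) = 1%:M.
Proof. by rewrite /dg diag_const_mx mulmx1 mulVmx. Qed.

Lemma dg_unit d : (forall j, d 0 j != 0) -> dg d \in unitmx.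
Proof.
move=> nz; have e : dg d *m dg (\row_j (d 0 j)^-1) = 1%:M.
  rewrite dg_mul -dg1; congr dg; apply/rowP => j; rewrite !mxE mulfV //.
by have := mulmx1_unit e; case.
Qed.

Lemma dg_inj d d' : dg d = dg d' -> d = d'.
Proof.
move=> /(congr1 (fun M => P *m M *m invmx P)); rewrite /dg !mulmxA mulmxV // !mul1mx.
rewrite !mulmxK //; move/matrixP => e; apply/rowP => j; have := e j j.
by rewrite !mxE eqxx !mulr1n.
Qed.

Lemma lie_semisimple_part H d (m : 'M[K]_n) : monoid_mx H -> Lie H (dg d + m) ->
  bracket (dg d) m = 0 -> nilp m -> Lie H (dg d).
Proof.
by move=> mH Lx cm nm; apply: (@lie_dg_selecting _ d) => //; exact: (selecting_wt id mH Lx erefl cm nm).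
Qed.

Lemma selecting_wts H (ds : seq 'rV[K]_n) (psi : seq K -> K) : monoid_mx H ->
  (forall d, d \in ds -> Lie H (dg d)) ->
  selecting H (fun m => psi [seq wt d m | d <- ds]).
Proof.
move=> mH; elim: ds psi => [|d ds IH] psi Ld.
  apply: (eq_selecting _ (@selecting_sum H _ [:: tt] (fun _ _ => 1) (fun=> psi [::]) _)) => [m|i s Is].
    by rewrite big_seq1 mulr1.
  rewrite (eq_map (g := id)) ?map_id // => -[a m] /=; by rewrite mul1r.
apply: selecting_agree => s; pose ws := undup [seq wt d u.2 | u <- s].
exists (fun m => \sum_(w <- ws) 1 * ((wt d m == w)%:R * psi (w :: [seq wt d m | d <- ds]))).
  apply: selecting_sum => w; apply: selectingM; last first.
    apply: (IH (fun v => psi (w :: v))) => d' d'ds; apply: Ld.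
    by rewrite inE d'ds orbT.
  apply: (@selecting_wt H d (dg d) 0 (fun v => (v == w)%:R)) => //.
  - by apply: Ld; rewrite mem_head.
  - by rewrite addr0.
  - by rewrite /bracket mulmx0 mul0mx subrr.
  - exact: nilp0.
move=> u us; have uw : wt d u.2 \in ws by rewrite mem_undup; apply: (map_f (fun u => wt d u.2)).
rewrite (bigD1_seq (wt d u.2)) ?undup_uniq //= eqxx !mul1r.
by rewrite big1 ?addr0 // => w /negPf ne; rewrite eq_sym ne mul0r mulr0.
Qed.

(** Linear relations with natural coefficients between the entries of ds, written
    multiplicatively for c. *)
Definition mul_compat (ds : seq 'rV[K]_n) (c : 'rV[K]_n) :=
  forall a b : 'I_n -> nat,
  (forall d, d \in ds -> \sum_j (a j)%:R * d 0 j = \sum_j (b j)%:R * d 0 j) ->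
  \prod_j c 0 j ^+ a j = \prod_j c 0 j ^+ b j.

Definition add_compat (ds : seq 'rV[K]_n) (c : 'rV[K]_n) :=
  forall a b : 'I_n -> nat,
  (forall d, d \in ds -> \sum_j (a j)%:R * d 0 j = \sum_j (b j)%:R * d 0 j) ->
  \sum_j (a j)%:R * c 0 j = \sum_j (b j)%:R * c 0 j.

Let factor_wts (ds : seq 'rV[K]_n) (F : ('I_n -> nat) -> K) :
  (forall a b : 'I_n -> nat,
    (forall d, d \in ds -> \sum_j (a j)%:R * d 0 j = \sum_j (b j)%:R * d 0 j) -> F a = F b) ->
  exists psi, forall m, F (colsum m) = psi [seq wt d m | d <- ds].
Proof.
move=> compat; exists (fun v => F (colsum (xget 0%MM [set m | [seq wt d m | d <- ds] = v]))).
move=> m; case: xgetP => [m' _ /= e|/(_ m)]; last by case.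
apply: compat => d dds; have := congr1 (fun s => nth 0 s (index d ds)) e.
by rewrite !(nth_map d) ?index_mem // nth_index // /wt.
Qed.

(** An algebraic group whose Lie algebra contains the diagonal matrices ds
    contains all invertible diagonal matrices subject to the integral relations
    between the entries of ds. *)
Lemma algebraic_diag H ds c : algebraic_group H ->
  (forall d, d \in ds -> Lie H (dg d)) -> (forall j, c 0 j != 0) ->
  mul_compat ds c -> H (dg c).
Proof.
move=> aH Ld nz compat; rewrite -(algebraic_groupP aH); split; last exact: dg_unit.
have mH := subgroup_monoid aH.1; move=> p Ip; have [s ps] := zspanP p.
have [psi psiE] := factor_wts compat.
rewrite ps in Ip *; have := selecting_wts psi mH Ld Ip mH.1.
rewrite -[dg c]mul1mx /zspan big_map /mxeval !raddf_sum /= => E; rewrite -[RHS]E.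
apply: eq_bigr => u _; rewrite !mevalZ -!/(mxeval _ _) mxeval_zmon_dg psiE.
by rewrite mulrA [u.1 * _]mulrC.
Qed.

Lemma algebraic_replica H ds c : monoid_mx H ->
  (forall d, d \in ds -> Lie H (dg d)) -> add_compat ds c -> Lie H (dg c).
Proof.
move=> mH Ld compat; apply: (@lie_dg_selecting _ c) => //.
have [psi psiE] := factor_wts compat.
by apply: eq_selecting (selecting_wts psi mH Ld) => m; rewrite -psiE.
Qed.

Lemma lie_one_param H (k : 'I_n -> int) : monoid_mx H ->
  (forall z, z != 0 -> H (dg (\row_j (z ^ k j)))) -> Lie H (dg (\row_j (k j)%:~R)).
Proof.
move=> mH Hz; apply/(lieP charK _ mH) => p Ip g Hg; have [s ps] := zspanP p.
rewrite ps in Ip *; rewrite /zspan linear_sum /mxeval raddf_sum /=.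
pose iw m : int := \sum_j (colsum m j)%:Z * k j.
have wtE m : wt (\row_j (k j)%:~R) m = (iw m)%:~R.
  rewrite /wt /iw rmorph_sum; apply: eq_bigr => j _.
  by rewrite mxE rmorphM.
pose N := (\sum_(u <- s) `|iw u.2|)%N.
have leN u : u \in s -> (0 <= iw u.2 + N%:Z)%R.
  move=> us; have : (`|iw u.2| <= N)%N by rewrite /N (big_rem u) //= leq_addr.
  by lia.
pose q : {poly K} := \sum_(u <- s) (u.1 * mxeval (zmon u.2) g) *: 'X^(absz (iw u.2 + N%:Z)).
have q0 : q = 0.
  suff : 'X * q = 0 by move/eqP; rewrite mulf_eq0 polyX_eq0 => /eqP.
  apply: (poly_eval0 charK) => -[|i]; rewrite hornerM hornerX ?mul0r //.
  apply/eqP; rewrite mulf_eq0; apply/orP; right.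
  set z : K := i.+1%:R; have nz : z != 0 by apply: natr_neq0.
  have := Ip (g *m dg (\row_j (z ^ k j))) (mH.2 _ _ Hg (Hz z nz)).
  rewrite /zspan /mxeval raddf_sum /= => /(congr1 (fun t => z ^+ N * t)); rewrite mulr0 => E.
  apply/eqP; rewrite -E /q horner_sum mulr_sumr big_seq [RHS]big_seq; apply: eq_bigr => u us.
  rewrite mevalZ -!/(mxeval _ _) mxeval_zmon_dg hornerZ hornerXn.
  have -> : z ^+ absz (iw u.2 + N%:Z) = z ^+ N * \prod_j (\row_j0 (z ^ k j0)) 0 j ^+ colsum u.2 j.
    have -> : z ^+ absz (iw u.2 + N%:Z) = z ^ (iw u.2 + N%:Z).
      by rewrite -[in RHS](gez0_abs (leN u us)).
    rewrite expfzDr // mulrC; congr (_ * _).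
    rewrite /iw; elim/big_rec2: _ => [|j a b _ <-]; first by rewrite expr0z.
    by rewrite expfzDr // mxE; congr (_ * _); rewrite exprnP exprz_exp mulrC.
  move: (\prod_j _) (mxeval (zmon _) g) (z ^+ N) => a b e; ring.
have qd : q^`().[1] = \sum_(u <- s) (u.1 * mxeval (zmon u.2) g) * (iw u.2 + N%:Z)%:~R.
  rewrite /q (big_morph _ (@derivD K) (deriv0 K)) horner_sum big_seq [RHS]big_seq.
  apply: eq_bigr => u us; rewrite derivZ derivXn hornerZ hornerMn hornerXn expr1n.
  by rewrite -[in RHS](gez0_abs (leN u us)).
have q1 : q.[1] = \sum_(u <- s) (u.1 * mxeval (zmon u.2) g).
  by rewrite /q horner_sum; apply: eq_bigr => u us; rewrite hornerZ hornerXn expr1n mulr1.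
move: qd q1; rewrite q0 deriv0 !horner0 => /esym qd /esym q1.
transitivity (\sum_(u <- s) (u.1 * mxeval (zmon u.2) g) * (iw u.2)%:~R).
  apply: eq_bigr => u _; rewrite linearZ /= mevalZ ldiff_zmon mevalZ wtE -/(mxeval _ _).
  by rewrite -mulrA; congr (_ * _); apply: mulrC.
move: qd; rewrite (eq_bigr (fun u => (u.1 * mxeval (zmon u.2) g) * (iw u.2)%:~R +
  (u.1 * mxeval (zmon u.2) g) * N%:R)).
  by rewrite big_split /= -mulr_suml q1 mul0r addr0.
by move=> u _; rewrite intrD mulrDr.
Qed.

End ZMonomials.
End Weights.

(** * Jordan decomposition, rational replicas, nilpotent matrices *)

Section LinearAlgebra.

Lemma vspace_of_pred (F : fieldType) (vT : vectType F) (P : vT -> Prop) :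
  P 0 -> (forall a u v, P u -> P v -> P (a *: u + v)) ->
  exists U : {vspace vT}, forall v, v \in U <-> P v.
Proof.
move=> P0 PL; pose Q k := `[< exists U : {vspace vT}, \dim U = k /\ (forall v, v \in U -> P v) >].
have exQ : exists k, Q k.
  by exists 0%N; apply/asboolP; exists 0%VS; rewrite dimv0; split=> // v; rewrite memv0 => /eqP->.
have bQ k : Q k -> (k <= \dim {: vT})%N by move/asboolP => [U [<- _]]; apply: dimvS; apply: subvf.
case: (ex_maxnP exQ bQ) => k /asboolP [U [dU UP]] maxk; exists U => v; split; first exact: UP.
move=> Pv; have /maxk : Q (\dim (U + <[v]>)%VS).
  apply/asboolP; exists (U + <[v]>)%VS; split=> // w /memv_addP [u uU [_ /vlineP[a ->] ->]].
  by rewrite addrC; apply: PL => //; apply: UP.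
rewrite -dU => le; have /eqP e : (U == U + <[v]>)%VS by rewrite eqEdim addvSl.
by rewrite e; apply: (subvP (addvSr _ _)); apply: memv_line.
Qed.

Lemma mx_of_pred (F : fieldType) n (P : 'rV[F]_n -> Prop) :
  P 0 -> (forall a u v, P u -> P v -> P (a *: u + v)) ->
  exists R : 'M[F]_n, forall v, (v <= R)%MS <-> P v.
Proof.
move=> P0 PL; pose Q k := `[< exists R : 'M[F]_n, \rank R = k /\ (forall v, (v <= R)%MS -> P v) >].
have exQ : exists k, Q k.
  exists 0%N; apply/asboolP; exists 0; rewrite mxrank0; split=> // v.
  by rewrite submx0 => /eqP->.
have bQ k : Q k -> (k <= n)%N by move/asboolP => [U [<- _]]; apply: rank_leq_row.
case: (ex_maxnP exQ bQ) => k /asboolP [U [dU UP]] maxk; exists U => v; split; first exact: UP.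
move=> Pv; have /maxk : Q (\rank (U + v)%MS).
  apply/asboolP; exists (U + v)%MS; split=> // w /sub_addsmxP [[u1 u2] /= ->].
  have -> : u2 *m v = u2 0 0 *: v by rewrite [u2]mx11_scalar mul_scalar_mx mxE eqxx mulr1n.
  by rewrite addrC; apply: PL => //; apply: UP; rewrite submxMl.
rewrite -dU => le; have : (U + v <= U)%MS.
  by rewrite -(geq_leqif (mxrank_leqif_sup (addsmxSl U v))).
by apply: submx_trans; apply: addsmxSr.
Qed.

Variable (K : closedFieldType).
Hypothesis charK : [pchar K] =i pred0.

Lemma intr_eq0K (k : int) : (k%:~R == 0 :> K) = (k == 0).
Proof.
case: k => k; first by rewrite /= -pmulrn (pcharf0P K).1.
by rewrite NegzE mulrNz oppr_eq0 -pmulrn (negPf (natr_neq0 charK _)) oppr_eq0.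
Qed.

Lemma intr_injK : injective (fun k : int => k%:~R : K).
Proof.
move=> a b /= /eqP; rewrite -subr_eq0 -rmorphB intr_eq0K subr_eq0.
by move/eqP.
Qed.

Lemma ratrE (x : rat) a b : b != 0 -> x * b%:~R = a%:~R -> ratr x * b%:~R = a%:~R :> K.
Proof.
move=> b0 e; have nd : (denq x)%:~R != 0 :> K by rewrite intr_eq0K denq_eq0.
rewrite /ratr mulrAC; apply: (canLR (mulfK nd)); rewrite -!rmorphM; congr (_%:~R).
apply: (intr_inj (R := rat)); rewrite !rmorphM /= -e.
by rewrite -{2}[x]divq_num_den mulrAC divfK // intr_eq0 denq_eq0.
Qed.

Lemma ratrK_add (x y : rat) : ratr (x + y) = ratr x + ratr y :> K.
Proof.
have dK z : (denq z)%:~R != 0 :> K by rewrite intr_eq0K denq_eq0.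
have dQ (z : rat) : z * (denq z)%:~R = (numq z)%:~R.
  by rewrite -{1}[z]divq_num_den divfK // intr_eq0 denq_eq0.
have d0 z : denq z != 0 by rewrite denq_eq0.
have := @ratrE (x + y) (numq x * denq y + numq y * denq x) (denq x * denq y) _ _.
rewrite mulf_neq0 // => /(_ isT) H; apply: (mulIf (mulf_neq0 (dK x) (dK y))).
rewrite -[in LHS]rmorphM H.
  have rx z : ratr z * (denq z)%:~R = (numq z)%:~R :> K by rewrite /ratr divfK.
  by rewrite rmorphD !rmorphM /= -!rx; ring.
by rewrite rmorphD !rmorphM /= -!dQ; ring.
Qed.

Lemma ratrK_mul (x y : rat) : ratr (x * y) = ratr x * ratr y :> K.
Proof.
have dK z : (denq z)%:~R != 0 :> K by rewrite intr_eq0K denq_eq0.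
have dQ (z : rat) : z * (denq z)%:~R = (numq z)%:~R.
  by rewrite -{1}[z]divq_num_den divfK // intr_eq0 denq_eq0.
have d0 z : denq z != 0 by rewrite denq_eq0.
have := @ratrE (x * y) (numq x * numq y) (denq x * denq y) _ _.
rewrite mulf_neq0 // => /(_ isT) H; apply: (mulIf (mulf_neq0 (dK x) (dK y))).
rewrite -[in LHS]rmorphM H; last by rewrite !rmorphM /= -!dQ; ring.
by rewrite /ratr rmorphM /= mulrACA !divfK.
Qed.

Lemma ratrK_int (k : int) : ratr k%:~R = k%:~R :> K.
Proof. by have := @ratrE k%:~R k 1 isT; rewrite !mulr1; apply. Qed.

Section RationalReplicas.
Variable n : nat.
Implicit Types d : 'rV[K]_n.

(** A row of scalars orthogonal to all its rational replicas vanishes: the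
    rational relations between the entries form a subspace of Q^n containing its
    own orthogonal, hence everything. *)
Lemma replica_orthogonal_eq0 d :
  (forall phi : 'rV[rat]_n, add_compat [:: d] (map_mx ratr phi) ->
     \sum_j d 0 j * ratr (phi 0 j) = 0) -> d = 0.
Proof.
move=> orth; pose rel (v : 'rV[rat]_n) := \sum_j d 0 j * ratr (v 0 j) = 0.
have r0 : ratr 0 = 0 :> K by rewrite -[0 in LHS]/(0%:~R) ratrK_int.
have [|a u v|R RP] := @mx_of_pred rat n rel.
- by apply: big1 => j _; rewrite mxE r0 mulr0.
- rewrite /rel => u0 v0; under eq_bigr => j _ do rewrite !mxE ratrK_add ratrK_mul mulrDr mulrCA.
  by rewrite big_split /= -mulr_sumr u0 v0 mulr0 addr0.
have dotE (u v : 'rV[rat]_n) : (u *m v^T) 0 0 = \sum_j u 0 j * v 0 j.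
  by rewrite mxE; apply: eq_bigr => j _; rewrite mxE.
have kerR (phi : 'rV[rat]_n) : phi *m R^T = 0 -> phi = 0.
  move=> phiR; have Rphi : R *m phi^T = 0 by rewrite -[LHS]trmxK trmx_mul trmxK phiR trmx0.
  have : rel phi.
    apply: orth => a b ab.
    have : rel (\row_j ((a j)%:R - (b j)%:R)).
      rewrite /rel; under eq_bigr => j _.
        rewrite mxE -[_ - _](_ : ((a j)%:Z - (b j)%:Z)%:~R = _); last by rewrite rmorphB.
        rewrite ratrK_int rmorphB /= mulrBr ![d 0 j * _]mulrC; over.
      by rewrite sumrB (ab d) ?mem_head // subrr.
    move/RP/submxP => [c cE]; have : (\row_j ((a j)%:R - (b j)%:R) *m phi^T) 0 0 = 0.
      by rewrite cE -mulmxA Rphi mulmx0 mxE.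
    rewrite dotE => /(congr1 (ratr : rat -> K)).
    have -> : ratr (\sum_j (\row_j0 ((a j0)%:R - (b j0)%:R)) 0 j * phi 0 j) =
       \sum_j ((a j)%:R - (b j)%:R) * ratr (phi 0 j) :> K.
      rewrite (big_morph _ ratrK_add r0); apply: eq_bigr => j _.
      rewrite mxE ratrK_mul -[_ - _ in LHS](_ : ((a j)%:Z - (b j)%:Z)%:~R = _); last by rewrite rmorphB.
      by rewrite ratrK_int rmorphB.
    rewrite r0 => /eqP; under eq_bigr => j _ do rewrite mulrBl.
    rewrite sumrB subr_eq0 => /eqP e.
    transitivity (\sum_j (a j)%:R * ratr (phi 0 j) : K); first by apply: eq_bigr => j _; rewrite mxE.
    by rewrite e; apply: eq_bigr => j _; rewrite mxE.
  move/RP/submxP => [c cE].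
  have : (phi *m phi^T) 0 0 = 0 by rewrite {1}cE -mulmxA Rphi mulmx0 mxE.
  rewrite dotE => /eqP; rewrite psumr_eq0 => [/allP z|j _]; last by rewrite -expr2 sqr_ge0.
  apply/rowP => j; rewrite mxE; have := z j (mem_index_enum j).
  by rewrite /= mulf_eq0 orbb => /eqP.
have fullR : row_full R.
  rewrite /row_full -mxrank_tr -/(row_free _) -kermx_eq0; apply/eqP/row_matrixP => i.
  by rewrite row0; apply: kerR; apply/sub_kermxP; apply: row_sub.
apply/rowP => j; rewrite mxE; have : rel (delta_mx 0 j) by apply/RP; apply: submx_full.
rewrite /rel (bigD1 j) //= big1 ?addr0.
  by rewrite mxE !eqxx -[true%:R]/(1%:~R) ratrK_int mulr1.
by move=> i /negPf ne; rewrite mxE ne andbF r0 mulr0.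
Qed.

End RationalReplicas.

Lemma nilp_trace n (x : 'M[K]_n) : nilp x -> \tr x = 0.
Proof.
case: n x => [|n] x [k xk]; first by rewrite /mxtrace big_ord0.
have [rs rsE] := closed_field_poly_normal (char_poly x).
rewrite (monicP (char_poly_monic x)) scale1r in rsE.
have z0 z : z \in rs -> z = 0.
  move=> zrs; have : root (char_poly x) z by rewrite rsE root_prod_XsubC.
  rewrite -eigenvalue_root_char => /eigenvalueP [v vx nv].
  have vX j : v *m x ^+ j = z ^+ j *: v.
    elim: j => [|j IH]; first by rewrite !expr0 mulmx1 scale1r.
    by rewrite !exprS [_ * x ^+ j]/(x *m x ^+ j) mulmxA vx -scalemxAl IH scalerA.
  have := vX k; rewrite xk mulmx0 => /esym/eqP.
  by rewrite scaler_eq0 (negPf nv) orbF expf_eq0 => /andP[_ /eqP].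
have : char_poly x = 'X^(size rs).
  rewrite rsE; elim: rs z0 {rsE} => [|z rs IH] z0; first by rewrite big_nil expr0.
  rewrite big_cons IH => [|w wrs]; last by apply: z0; rewrite inE wrs orbT.
  by rewrite (z0 z) ?mem_head // subr0 -exprS.
move=> e; have s : size rs = n.+1 by have := size_char_poly x; rewrite e size_polyXn => -[].
have := char_poly_trace x (ltn0Sn n); rewrite e s coefXn /= ltn_eqF // => /esym/eqP.
by rewrite oppr_eq0 => /eqP.
Qed.

Lemma crt_poly N (rs : seq K) : uniq rs ->
  exists q : {poly K}, forall r, r \in rs -> ('X - r%:P) ^+ N %| q - r%:P.
Proof.
elim: rs => [|r rs IH] /=; first by exists 0.
move=> /andP[nr /IH [q qP]]; pose M := \prod_(s <- rs) ('X - s%:P) ^+ N.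
have cop : coprimep M (('X - r%:P) ^+ N).
  rewrite /M big_seq; apply: (big_ind (fun p => coprimep p (('X - r%:P) ^+ N))) => [|p1 p2 c1 c2|s srs].
    exact: coprime1p.
    by rewrite coprimepMl c1.
  apply: coprimep_expl; apply: coprimep_expr; rewrite coprimep_XsubC root_XsubC.
  by apply: contraNneq nr => ->.
have /Bezout_eq1_coprimepP [[u1 u2] /= e] := cop.
exists (q + M * u1 * (r%:P - q)) => s; rewrite inE => /orP[/eqP->|srs].
  have -> : q + M * u1 * (r%:P - q) - r%:P = (q - r%:P) * u2 * ('X - r%:P) ^+ N.
    have -> : M * u1 = 1 - u2 * ('X - r%:P) ^+ N by rewrite -e; ring.
    by ring.
  exact: dvdp_mulIr.
have -> : q + M * u1 * (r%:P - q) - s%:P = (q - s%:P) + M * (u1 * (r%:P - q)) by ring.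
rewrite dvdp_addr ?qP //; apply: dvdp_mulr; rewrite /M (big_rem s) //=.
exact: dvdp_mulIl.
Qed.

Lemma jordan_decomposition n (x : 'M[K]_n) : exists (P m : 'M[K]_n) (d : 'rV[K]_n),
  [/\ P \in unitmx, x = dg P d + m, bracket (dg P d) m = 0, nilp m &
      forall y, bracket y x = 0 -> bracket y (dg P d) = 0].
Proof.
case: n x => [|n] x.
  exists 1%:M, 0, 0; split; rewrite ?unitmx1 //; try by apply/matrixP => -[].
    exact: nilp0.
  by move=> y _; apply/matrixP => -[].
have [rs rsE] := closed_field_poly_normal (char_poly x).
rewrite (monicP (char_poly_monic x)) scale1r in rsE.
have srs : size rs = n.+1 by have := size_char_poly x; rewrite rsE size_prod_XsubC => -[].
have [q qP] := crt_poly n.+1 (undup_uniq rs).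
pose s := horner_mx x q.
have CH p : char_poly x %| p -> horner_mx x p = 0.
  by move=> /dvdpP [p' ->]; rewrite rmorphM /= Cayley_Hamilton mulr0.
have comm_s y : bracket y x = 0 -> bracket y s = 0.
  move=> /eqP; rewrite subr_eq0 => /eqP yx; apply/eqP; rewrite subr_eq0; apply/eqP.
  exact/comm_mx_horner.
have [P uP] : exists2 P : 'M_n.+1, P \in unitmx & similar_diag P s.
  apply/diagonalizableP; exists (undup rs); first exact: undup_uniq.
  apply: mxminpoly_min; have -> : horner_mx s (\prod_(w <- undup rs) ('X - w%:P)) =
      horner_mx x (\prod_(w <- undup rs) (q - w%:P)).
    rewrite !rmorph_prod; apply: eq_bigr => w _.
    by rewrite !rmorphB /= horner_mx_X !horner_mx_C.
  apply: CH; rewrite rsE -prodr_undup_exp_count /=.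
  rewrite big_seq [X in _ %| X]big_seq; elim/big_rec2: _ => [|w p1 p2 wrs]; first exact: dvdpp.
  apply: dvdp_mul; apply: dvdp_trans (qP w wrs); apply: dvdp_exp2l.
  by rewrite -srs count_size.
move=> /(similar_diagLR uP) [d sE].
have {}sE : s = dg P d.
  by rewrite sE conjumx ?unitmx_inv // invmxK.
exists P, (x - s), d; rewrite -sE; split=> //.
- by rewrite addrC subrK.
- rewrite linearB /= bracketxx subr0 bracketC comm_s ?oppr0 //.
  by rewrite bracketxx.
exists n.+1; have -> : x - s = horner_mx x ('X - q) by rewrite rmorphB /= horner_mx_X.
rewrite -rmorphXn; apply: CH; rewrite rsE -[in X in _ %| X]srs.
have XqP z : z \in rs -> 'X - z%:P %| 'X - q.
  move=> zrs; have -> : 'X - q = ('X - z%:P) - (q - z%:P) by ring.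
  rewrite dvdp_subr ?dvdpp //; apply: dvdp_trans (qP z _); last by rewrite mem_undup.
  by rewrite exprS dvdp_mulr.
elim: rs XqP {rsE srs qP} => [|z rs IH] XqP /=; first by rewrite big_nil expr0 dvdpp.
rewrite big_cons exprS; apply: dvdp_mul; first by apply: XqP; rewrite mem_head.
by apply: IH => w wrs; apply: XqP; rewrite inE wrs orbT.
Qed.

Lemma dg_comm n (P m : 'M[K]_n) (d c : 'rV[K]_n) : P \in unitmx ->
  (forall i j, d 0 i = d 0 j -> c 0 i = c 0 j) ->
  bracket (dg P d) m = 0 -> bracket (dg P c) m = 0.
Proof.
move=> uP dc; pose M := P *m m *m invmx P.
have mE : m = invmx P *m M *m P by rewrite /M !mulmxA mulVmx // mul1mx mulmxKV.
have E e : bracket (dg P e) m = invmx P *m (diag_mx e *m M - M *m diag_mx e) *m P.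
  rewrite /bracket {1 2}mE /dg mulmxBr mulmxBl !mulmxA; congr (_ - _).
    by rewrite mulmxK.
  by rewrite mulmxK.
rewrite !E; clearbody M => /(congr1 (fun A => P *m A *m invmx P)).
rewrite !mulmxA mulmxV // mul1mx mulmxK // mulmx0 mul0mx => e0.
rewrite [_ - _](_ : _ = 0) ?mulmx0 ?mul0mx //; apply/matrixP => i j.
have /matrixP/(_ i j) := e0; rewrite !mul_diag_mx !mul_mx_diag !mxE.
have [/dc->|ne] := eqVneq (d 0 i) (d 0 j); first by move=> _; rewrite mulrC subrr.
rewrite [M i j * _]mulrC -mulrBl => /eqP; rewrite mulf_eq0 subr_eq0 (negPf ne) /= => /eqP->.
by rewrite mulr0 mul0r subrr.
Qed.

Lemma trace_dg n (P : 'M[K]_n) d : P \in unitmx -> \tr (dg P d) = \sum_j d 0 j.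
Proof.
by move=> uP; rewrite /dg -mulmxA mxtrace_mulC mulmxK // mxtrace_diag.
Qed.

Lemma ad_nilp n (x : 'M[K]_n) : nilp x -> exists N, forall v, iter N (bracket x) v = 0.
Proof.
move=> [k xk]; exists (k + k)%N => v.
have H j a b : (k + k <= a + b + j)%N -> x ^+ a *m iter j (bracket x) v *m x ^+ b = 0.
  elim: j a b => [|j IH] a b le.
    have [la|lb] := leqP k a; first by rewrite (expr_leq0 la xk) !mul0mx.
    by rewrite (expr_leq0 (k := k) (l := b) _ xk) ?mulmx0 //; move: le lb; clear; lia.
  rewrite /= /bracket mulmxBr mulmxBl.
  rewrite mulmxA [x ^+ a *m x](_ : _ = x ^+ a.+1); last by rewrite mulmxE exprSr.
  rewrite [X in _ - X](_ : _ = x ^+ a *m iter j (bracket x) v *m x ^+ b.+1); last first.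
    by rewrite -!mulmxA; congr (_ *m (_ *m _)); rewrite mulmxE exprS.
  by rewrite !IH ?subrr //; move: le; clear; lia.
by have := H (k + k)%N 0%N 0%N; rewrite !expr0 mulmx1 mul1mx; apply; rewrite !add0n.
Qed.

(** Engel's theorem for a Lie algebra of nilpotent matrices acting on a
    subquotient Q/P of the adjoint module. *)
Lemma engel n (L P Q : {vspace 'M[K]_n}) :
  (forall x y, x \in L -> y \in L -> bracket x y \in L) ->
  (forall x, x \in L -> nilp x) ->
  (forall x v, x \in L -> v \in P -> bracket x v \in P) ->
  (forall x v, x \in L -> v \in Q -> bracket x v \in Q) ->
  ~~ (Q <= P)%VS -> exists q, [/\ q \in Q, q \notin P & forall x, x \in L -> bracket x q \in P].
Proof.
have [d] := ubnP (\dim L); elim: d L P Q => // d IH L P Q; rewrite ltnS => dL Lb Ln LP LQ nQP.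
have [/eqP|dL0] := posnP (\dim L).
  rewrite dimv_eq0 => /eqP L0; have [q qQ qP] := subvPn nQP; exists q; split=> // x.
  by rewrite L0 memv0 => /eqP->; rewrite /bracket mul0mx mulmx0 subrr mem0v.
pose R k := `[< exists M : {vspace 'M[K]_n}, [/\ \dim M = k, (M <= L)%VS, (k < \dim L)%N &
   forall x y, x \in M -> y \in M -> bracket x y \in M] >].
have exR : exists k, R k.
  exists 0%N; apply/asboolP; exists 0%VS; split; rewrite ?dimv0 ?sub0v // => x y.
  by rewrite !memv0 => /eqP-> _; rewrite /bracket mul0mx mulmx0 subrr.
have bR k : R k -> (k <= \dim L)%N by move/asboolP => [M [_ _ lt _]]; apply: ltnW.
case: (ex_maxnP exR bR) => k /asboolP [M [dM ML ltM Mb]] maxk.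
have MinL x : x \in M -> x \in L by apply/subvP.
have ltMd : (\dim M < d)%N by rewrite dM (leq_trans ltM).
have [y [yL yM My]] : exists y, [/\ y \in L, y \notin M & forall x, x \in M -> bracket x y \in M].
  apply: (IH M M L) => //; first by move=> x /MinL; apply: Ln.
  - by move=> x v /MinL xL; apply: Lb.
  by apply: contraL ltM => /dimvS; rewrite dM -leqNgt.
have LE : L = (M + <[y]>)%VS.
  have sub : (M + <[y]> <= L)%VS by rewrite subv_add ML -memvE.
  apply/esym/eqP; rewrite eqEdim sub /= leqNgt; apply/negP => lt.
  have : R (\dim (M + <[y]>)%VS).
    apply/asboolP; exists (M + <[y]>)%VS; split=> // u v.
    move=> /memv_addP [a aM [_ /vlineP[s ->] ->]] /memv_addP [b bM [_ /vlineP[t ->] ->]].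
    apply: (subvP (addvSl _ _)).
    have -> : bracket (a + s *: y) (b + t *: y) = bracket a b + t *: bracket a y - s *: bracket b y.
      rewrite bracketDl bracketZl !bracketDr !bracketZr bracketxx scaler0 addr0.
      by rewrite (bracketC y b) scalerN.
    by apply: rpredB; [apply: rpredD; [apply: Mb|apply: rpredZ; apply: My]|apply: rpredZ; apply: My].
  move/maxk; rewrite leqNgt => /negP; apply; rewrite -dM.
  rewrite ltnNge; apply/negP => le.
  have /eqP e : (M == M + <[y]>)%VS by rewrite eqEdim addvSl.
  by move/negP: yM; apply; rewrite e; apply: (subvP (addvSr _ _)); apply: memv_line.
have [|a u v|Q' Q'P] := @vspace_of_pred K 'M[K]_n (fun q => q \in Q /\ forall x, x \in M -> bracket x q \in P).
- by split=> [|x _]; rewrite ?mem0v ?linear0 ?mem0v.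
- move=> [uQ uP] [vQ vP]; split=> [|x xM]; first by rewrite rpredD ?rpredZ.
  by rewrite linearP rpredD ?rpredZ ?uP ?vP.
have [q0 [q0Q q0P Mq0]] : exists q, [/\ q \in Q, q \notin P & forall x, x \in M -> bracket x q \in P].
  by apply: (IH M P Q) => // [x /MinL|x v /MinL|x v /MinL]; [apply: Ln|apply: LP|apply: LQ].
have yQ' q : q \in Q' -> bracket y q \in Q'.
  move=> /Q'P [qQ qM]; apply/Q'P; split=> [|x xM]; first exact: LQ.
  rewrite jacobi rpredD //; first exact: qM (My x xM).
  by apply: LP => //; apply: qM.
have itQ' j : iter j (bracket y) q0 \in Q'.
  by elim: j => [|j IHj] /=; [apply/Q'P | apply: yQ'].
have exj : exists j, iter j (bracket y) q0 \in P.
  by have [N yN] := ad_nilp (Ln y yL); exists N; rewrite yN mem0v.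
case: (ex_minnP exj) => -[|j] jP minj; first by rewrite /= (negPf q0P) in jP.
exists (iter j (bracket y) q0); have /Q'P [jQ jM] := itQ' j; split=> //.
  by apply/negP => /minj; rewrite ltnn.
move=> x; rewrite LE => /memv_addP [a aM [_ /vlineP[t ->] ->]].
by rewrite bracketDl bracketZl rpredD ?rpredZ // jM.
Qed.

End LinearAlgebra.

(** * Connected groups generated by unipotents; nondegeneracy of the trace form *)

Section AlmostSimple.
Variable (K : closedFieldType).
Hypothesis charK : [pchar K] =i pred0.
Variable n : nat.
Implicit Types (g x y z : 'M[K]_n) (S H G : set 'M[K]_n).

(** A group all of whose elements are joined by polynomial curves to a connected
    subset containing 1 has a connected closure: each curve is irreducible. *)
Lemma zconnected_linked S0 S : zconnected S0 -> S0 1%:M -> S0 `<=` S ->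
  S `<=` [set g | g \in unitmx] ->
  (forall g, S g -> exists c, [/\ S0 (ceval c 0), ceval c 1 = g & forall t, S (ceval c t)]) ->
  zconnected (alg_closure S).
Proof.
move=> cS0 S01 sub subU link C D cC cD cov disj.
wlog C1 : C D cC cD cov disj / C 1%:M.
  move=> H; have : (C `|` D) 1%:M by apply: cov; apply: (sub_alg_closure subU); apply: sub.
  case=> [|D1]; first exact: H.
  case: (H D C cD cC _ _ D1) => [||e|e]; [by rewrite setUC|by rewrite -setIA (setIC D) setIA| |].
    by right.
  by left.
right; have subS : S `<=` alg_closure S by apply: sub_alg_closure.
have S0C : S0 `<=` C.
  have [||e|e] := cS0 C D cC cD.
  - by move=> g /sub /subS; apply: cov.
  - rewrite -subset0 => g [[/sub /subS Sg Cg] Dg].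
    by rewrite -[set0]disj; split.
  - by have : set0 (1%:M : 'M[K]_n) by rewrite -e.
  move=> g S0g; have := cov g (subS _ (sub _ S0g)); case=> // Dg.
  by have : set0 g by rewrite -e.
have SC : S `<=` C.
  move=> g Sg; have [c [c0 c1 ct]] := link g Sg.
  have [F CE] := cC; have [F' DE] := cD; rewrite -c1 CE => p Fp.
  apply: contrapT => pc1; have nD0 : ~ D (ceval c 0).
    move=> D0; have : set0 (ceval c 0) by rewrite -disj; split=> //; split; [apply/subS/ct|apply: S0C].
    by [].
  have [q F'q q0] : exists2 q, F' q & mxeval q (ceval c 0) <> 0.
    apply: contrapT => nex; apply: nD0; rewrite DE => q F'q; apply: contrapT => q0.
    by apply: nex; exists q.
  have pq0 : pcomp p c * pcomp q c = 0.
    apply: (poly_eval0 charK) => i; rewrite hornerM !pcompE.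
    case: (cov _ (subS _ (ct i%:R))).
      by rewrite CE => /(_ p Fp)->; rewrite mul0r.
    by rewrite DE => /(_ q F'q)->; rewrite mulr0.
  move/eqP: pq0; rewrite mulf_eq0 => /orP[] /eqP e0.
    by apply: pc1; rewrite -pcompE e0 horner0.
  by apply: q0; rewrite -pcompE e0 horner0.
rewrite -subset0 => g [[Sg ug] Dg]; rewrite -[set0]disj; split=> //; split; first by split.
exact: (zclosure_min cC SC).
Qed.

Lemma zconnected1 : zconnected [set 1%:M : 'M[K]_n].
Proof.
move=> C D _ _ cov disj; have : (C `|` D) (1%:M : 'M[K]_n) by apply: cov.
case=> H1; [right|left]; rewrite -subset0 => g [-> H2]; rewrite -[set0]disj; split=> //.
all: by split.
Qed.

Definition eprod (xs : seq 'M[K]_n) := foldr (fun x g => expm x *m g) 1%:M xs.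

Definition exp_group S : set 'M[K]_n :=
  [set g | exists2 xs, (forall x, x \in xs -> S x) & g = eprod xs].

Section ExpGroup.
Variable S : set 'M[K]_n.
Hypotheses (Snilp : S `<=` @nilp K n) (SZ : forall a x, S x -> S (a *: x)).

Lemma eprod_cat xs ys : eprod (xs ++ ys) = eprod xs *m eprod ys.
Proof. by elim: xs => [|x xs IH] /=; rewrite ?mul1mx // IH mulmxA. Qed.

Lemma eprod_inv xs : (forall x, x \in xs -> S x) ->
  eprod xs *m eprod [seq - x | x <- rev xs] = 1%:M.
Proof.
elim: xs => [|x xs IH] Sxs; first by rewrite mulmx1.
rewrite rev_cons map_rcons -cats1 eprod_cat /= mulmx1 mulmxA -(mulmxA (expm x)) IH.
  by rewrite mulmx1 expmNK //; apply: Snilp; apply: Sxs; rewrite mem_head.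
by move=> y yxs; apply: Sxs; rewrite inE yxs orbT.
Qed.

Lemma exp_group_subgroup : subgroup_GL (exp_group S).
Proof.
split.
- by move=> _ [xs Sxs ->] /=; have := mulmx1_unit (eprod_inv Sxs); case.
- by exists [::].
- move=> _ _ [xs Sxs ->] [ys Sys ->]; exists (xs ++ ys); last by rewrite eprod_cat.
  by move=> x; rewrite mem_cat => /orP[/Sxs|/Sys].
move=> _ [xs Sxs ->]; exists [seq - x | x <- rev xs].
  by move=> _ /mapP [x + ->]; rewrite mem_rev -scaleN1r => /Sxs; apply: SZ.
have [ux _] := mulmx1_unit (eprod_inv Sxs).
by rewrite -[RHS]mul1mx -(mulVmx ux) -mulmxA eprod_inv // mulmx1.
Qed.

Lemma exp_group_expm x : S x -> exp_group S (expm x).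
Proof. by move=> Sx; exists [:: x] => /= [y|]; rewrite ?mulmx1 // inE => /eqP->. Qed.

Lemma eprod_curve xs : (forall x, x \in xs -> S x) ->
  exists c, ceval c 0 = 1%:M /\ forall t, ceval c t = eprod [seq t *: x | x <- xs].
Proof.
elim: xs => [|x xs IH] Sxs; first by exists (pc 1%:M); split=> [|t]; rewrite ceval_pc.
have nx : nilp x by apply/Snilp/Sxs; rewrite mem_head.
have [y yxs|c [c0 ct]] := IH; first by apply: Sxs; rewrite inE yxs orbT.
exists (ecurve x *m c); split=> [|t].
  by rewrite cevalM c0 mulmx1 ecurve0.
by rewrite cevalM ct ecurve_eval.
Qed.

Lemma exp_group_linked g : exp_group S g ->
  exists c, [/\ [set 1%:M] (ceval c 0), ceval c 1 = g & forall t, exp_group S (ceval c t)].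
Proof.
move=> [xs Sxs ->]; have [c [c0 ct]] := eprod_curve Sxs; exists c; split=> //.
  by rewrite ct; congr eprod; rewrite -[RHS]map_id; apply: eq_map => x; rewrite scale1r.
move=> t; rewrite ct; exists [seq t *: x | x <- xs] => // _ /mapP [x xxs ->].
exact: SZ (Sxs x xxs).
Qed.

Lemma exp_group_connected : zconnected (alg_closure (exp_group S)).
Proof.
have [sub S1 _ _] := exp_group_subgroup.
by apply: (@zconnected_linked [set 1%:M]) => //; [exact: zconnected1|move=> _ ->|exact: exp_group_linked].
Qed.

Lemma exp_group_sub G : algebraic_group G -> S `<=` Lie G -> exp_group S `<=` G.
Proof.
move=> aG SG _ [xs Sxs ->]; have [_ G1 GM _] := aG.1.
elim: xs Sxs => [//|x xs IH] Sxs /=; apply: GM.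
  by apply: lie_expm => //; [apply: SG|apply: Snilp]; apply: Sxs; rewrite mem_head.
by apply: IH => y yxs; apply: Sxs; rewrite inE yxs orbT.
Qed.

Lemma exp_group_conj g h : g \in unitmx -> (forall x, S x -> S (Ad g x)) ->
  exp_group S h -> exp_group S (Ad g h).
Proof.
move=> ug SA [xs Sxs ->]; exists (map (Ad g) xs); first by move=> _ /mapP [x /Sxs + ->]; apply: SA.
elim: xs Sxs => [|x xs IH] Sxs /=; first by rewrite /Ad mulmx1 mulmxV.
rewrite Ad_mul // Ad_expm //; last by apply/Snilp/Sxs; rewrite mem_head.
by rewrite IH // => y yxs; apply: Sxs; rewrite inE yxs orbT.
Qed.

Lemma almost_simple_exp_group G : almost_simple G -> S `<=` Lie G ->
  (forall g x, G g -> S x -> S (Ad g x)) ->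
  alg_closure (exp_group S) = [set 1%:M] \/ alg_closure (exp_group S) = G.
Proof.
move=> [aG _ _ simpleG] SG SA; apply: simpleG.
- exact: alg_closure_group exp_group_subgroup.
- exact: exp_group_connected.
have [subG _ _ _] := aG.1; have [subE _ _ _] := exp_group_subgroup.
split; first exact: alg_closure_min (exp_group_sub aG SG).
move=> g x Gg [clx ux]; have ug : g \in unitmx := subG g Gg.
split; last by rewrite /= !unitmx_mul unitmx_inv ug ux.
move/zclosureE: clx => clx; apply/zclosureE => F pF F0.
apply: (clx (fun a => F (g *m a *m invmx g))) => [|b Eb].
  apply: polyfun_comp pF; exact: polymap_conj.
by apply: F0; apply: exp_group_conj => // y; apply: SA.
Qed.

End ExpGroup.

Lemma expm_trivial x : nilp x -> (forall t, expm (t *: x) = 1%:M) -> x = 0.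
Proof.
move=> nx e1; have e : ecurve x = pc 1%:M.
  by apply: (curve_eq charK) => j; rewrite ecurve_eval // e1 ceval_pc.
have := congr1 (fun c => ceval (cderiv c) 0) e.
rewrite /= ecurve_deriv // cevalM ecurve0 // ceval_pc mul1mx cderiv_pc => ->.
by apply/matrixP => i j; rewrite !mxE horner0.
Qed.

Lemma zclosure_comm S : (forall x y, S x -> S y -> x *m y = y *m x) ->
  forall x y, zclosure S x -> zclosure S y -> x *m y = y *m x.
Proof.
move=> SC; have step (S1 S2 : set 'M[K]_n) : (forall x y, S1 x -> S2 y -> x *m y = y *m x) ->
    forall x y, zclosure S1 x -> S2 y -> x *m y = y *m x.
  move=> C12 x y /zclosureE cx Sy; apply: subr0_eq; apply/matrixP => i j.
  rewrite [RHS]mxE; apply: (cx (fun x => (x *m y - y *m x) i j)).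
    apply: (eq_polyfun (F := fun x => (x *m y) i j - (y *m x) i j)); first by move=> A; rewrite !mxE.
    by apply: polyfunB; apply: polymap_mul; [exact: polymap_id|exact: polymap_cst|exact: polymap_cst|exact: polymap_id].
  by move=> s Ss; rewrite C12 // subrr mxE.
move=> x y cx cy; apply/esym; apply: (step S (zclosure S)) cy cx => u v Su cv.
by apply/esym; apply: (step S S) cv Su.
Qed.

Lemma trace_Ad g x : g \in unitmx -> \tr (Ad g x) = \tr x.
Proof. by move=> ug; rewrite /Ad mxtrace_mulC mulKmx. Qed.

Lemma trace_Ad_mul g x y : g \in unitmx -> \tr (Ad g x *m y) = \tr (x *m Ad (invmx g) y).
Proof.
by move=> ug; rewrite -{1}(AdVK ug y) -Ad_mul // trace_Ad.
Qed.

Lemma trace_bracket x y z : \tr (bracket x y *m z) = \tr (x *m bracket y z).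
Proof.
by rewrite /bracket mulmxBl mulmxBr !raddfB /= !mulmxA -(mulmxA y) (mxtrace_mulC y).
Qed.

Lemma trace_eq_eigen (P x : 'M[K]_n) : bracket P x = 0 -> nilp x -> \tr (P *m x) = 0.
Proof.
move=> /eqP; rewrite subr_eq0 => /eqP cPx nx; apply: (nilp_trace).
by rewrite cPx; apply: nilpM nx; rewrite cPx.
Qed.

Variable G : set 'M[K]_n.
Hypothesis hG : almost_simple G.

Let aG : algebraic_group G. Proof. by case: hG. Qed.
Let sG : subgroup_GL G. Proof. by case: aG. Qed.
Let mG : monoid_mx G. Proof. exact: subgroup_monoid. Qed.
Let uG g : G g -> g \in unitmx. Proof. by case: sG => sub _ _ _; apply: sub. Qed.
Let GV g : G g -> G (invmx g). Proof. by case: sG => _ _ _; apply. Qed.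

Definition trace_radical : set 'M[K]_n :=
  [set x | Lie G x /\ forall y, Lie G y -> \tr (x *m y) = 0].

(** The semisimple part is orthogonal to its own rational replicas, which lie in
    the Lie algebra. *)
Lemma trace_radical_nilp x : trace_radical x -> nilp x.
Proof.
move=> [Lx x0]; have [P [m [d [uP xE cm nm _]]]] := jordan_decomposition x.
suff d0 : d = 0 by rewrite xE d0 /dg linear0 mulmx0 mul0mx add0r.
have Ld : Lie G (dg P d) by apply: (lie_semisimple_part charK uP mG _ cm nm); rewrite -xE.
apply: (replica_orthogonal_eq0 charK) => phi compat; pose c : 'rV[K]_n := map_mx ratr phi.
have Lc : Lie G (dg P c).
  by apply: (algebraic_replica charK uP mG _ compat) => d'; rewrite inE => /eqP->.
have cmc : bracket (dg P c) m = 0.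
  apply: (dg_comm uP _ cm) => i j dij.
  have := compat (fun k => k == i : nat) (fun k => k == j : nat).
  have E (e : 'rV[K]_n) k : \sum_l ((l == k) : nat)%:R * e 0 l = e 0 k.
    rewrite (bigD1 k) //= eqxx mul1r big1 ?addr0 // => l /negPf->.
    by rewrite mul0r.
  by rewrite !E; apply => d'; rewrite inE => /eqP->; rewrite !E.
have := x0 _ Lc; rewrite xE mulmxDl linearD /= dg_mul // trace_dg //.
rewrite mxtrace_mulC (trace_eq_eigen cmc nm) ?addr0 //.
by move=> e; rewrite -[RHS]e; apply: eq_bigr => j _; rewrite !mxE.
Qed.

Lemma trace_radical_ideal x y : Lie G x -> trace_radical y -> trace_radical (bracket x y).
Proof.
move=> Lx [Ly y0]; split; first exact: lie_bracket.
by move=> z Lz; rewrite bracketC mulNmx linearN /= trace_bracket y0 ?oppr0 //; apply: lie_bracket.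
Qed.

Lemma trace_radical_Ad g x : G g -> trace_radical x -> trace_radical (Ad g x).
Proof.
move=> Gg [Lx x0]; split; first exact: lie_conj.
move=> y Ly; rewrite trace_Ad_mul ?uG // x0 //; apply: lie_conj => //.
exact: GV.
Qed.

(** The radical of the trace form is an ideal of nilpotent matrices; by Engel's
    theorem its center would be nonzero if it were, and the exponentials of the
    center would generate a commutative normal subgroup. *)
Lemma trace_nondegenerate x :
  Lie G x -> (forall y, Lie G y -> \tr (x *m y) = 0) -> x = 0.
Proof.
move=> Lx x0; apply: contrapT => nx.
have [||R RP] := @vspace_of_pred K 'M[K]_n trace_radical.
- by split=> [|y _]; rewrite ?mul0mx ?linear0 //; apply: lie0.
- move=> a u v [Lu u0] [Lv v0]; split; first exact: lie_linear.
  by move=> y Ly; rewrite mulmxDl -scalemxAl linearD linearZ /= u0 // v0 // mulr0 addr0.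
have xR : x \in R by apply/RP.
have [||||| z [zR z0 Rz]] := @engel K n R 0%VS R.
- by move=> u v /RP [Lu _] vR; apply/RP; apply: trace_radical_ideal => //; apply/RP.
- by move=> u /RP; apply: trace_radical_nilp.
- by move=> u v _; rewrite memv0 => /eqP->; rewrite linear0 mem0v.
- by move=> u v /RP [Lu _] vR; apply/RP; apply: trace_radical_ideal => //; apply/RP.
- by apply/negP => /subvP/(_ x xR); rewrite memv0 => /eqP.
pose S : set 'M[K]_n := [set y | trace_radical y /\ forall u, trace_radical u -> bracket u y = 0].
have Sz : S z by split=> [|u /RP uR]; [apply/RP|apply/eqP; rewrite -memv0; apply: Rz].
have Sn : S `<=` @nilp K n by move=> y [/trace_radical_nilp].
have SZ a y : S y -> S (a *: y).
  move=> [/RP yR yC]; split=> [|u /yC]; first by apply/RP; rewrite rpredZ.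
  by rewrite bracketZr => ->; rewrite scaler0.
have SG : S `<=` Lie G by move=> y [[]].
have SA g y : G g -> S y -> S (Ad g y).
  move=> Gg [yR yC]; split=> [|u uR]; first exact: trace_radical_Ad.
  rewrite -(AdVK (uG Gg) u) -Ad_bracket ?uG // yC ?linear0 //.
  by apply: trace_radical_Ad => //; apply: GV.
have SC u v : exp_group S u -> exp_group S v -> u *m v = v *m u.
  have C1 a b : S a -> S b -> expm a *m expm b = expm b *m expm a.
    move=> Sa Sb; have /eqP := Sb.2 a Sa.1; rewrite subr_eq0 => /eqP ab.
    by rewrite -!(expmD charK) ?(addrC a) //; apply: Sn.
  have C2 a xs : S a -> (forall x, x \in xs -> S x) -> expm a *m eprod xs = eprod xs *m expm a.
    move=> Sa; elim: xs => [|y xs IH] Sxs /=; first by rewrite mulmx1 mul1mx.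
    rewrite mulmxA (C1 a y) //; last by apply: Sxs; rewrite mem_head.
    by rewrite -!mulmxA IH // => w wxs; apply: Sxs; rewrite inE wxs orbT.
  move=> [xs Sxs ->] [ys Sys ->]; elim: xs Sxs => [|y xs IH] Sxs /=; first by rewrite mulmx1 mul1mx.
  rewrite -mulmxA IH; last by move=> w wxs; apply: Sxs; rewrite inE wxs orbT.
  by rewrite !mulmxA C2 //; apply: Sxs; rewrite mem_head.
have [N1|NG] := almost_simple_exp_group Sn SZ hG SG SA.
  suff z00 : z = 0 by rewrite z00 mem0v in z0.
  apply: expm_trivial; first exact: Sn.
  move=> t; have : alg_closure (exp_group S) (expm (t *: z)).
    apply: sub_alg_closure; first by case: (exp_group_subgroup Sn SZ).
    by apply: exp_group_expm; apply: SZ.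
  by rewrite N1.
have [_ _ [a [b [Ga Gb nab]]] _] := hG; apply: nab.
rewrite -NG in Ga Gb; apply: (zclosure_comm SC); [exact: Ga.1|exact: Gb.1].
Qed.

End AlmostSimple.

(** * Tori *)

Section Torus.
Variable (K : closedFieldType).
Hypothesis charK : [pchar K] =i pred0.

(** Artin's independence of characters, relative to a subspace U. *)
Lemma character_independence (X : Type) (op : X -> X -> X) (A : set X) (W : lmodType K)
  (U : W -> Prop) (I : eqType) (s : seq I) (F : I -> X -> K) (v : I -> W) :
  U 0 -> (forall a u w, U u -> U w -> U (a *: u + w)) ->
  (forall a b, A a -> A b -> A (op a b)) -> uniq s ->
  (forall i a b, i \in s -> A a -> A b -> F i (op a b) = F i a * F i b) ->
  (forall i, i \in s -> exists2 a, A a & F i a != 0) ->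
  (forall i j, i \in s -> j \in s -> i != j -> exists2 b, A b & F i b != F j b) ->
  (forall a, A a -> U (\sum_(i <- s) F i a *: v i)) -> forall i, i \in s -> U (v i).
Proof.
move=> U0 UL Aop; have UB u w : U u -> U w -> U (u - w).
  by move=> Uu Uw; rewrite addrC -scaleN1r; apply: UL.
have UZ a u : U u -> U (a *: u) by move=> Uu; rewrite -[_ *: _]addr0; apply: UL.
elim: s v => [//|i0 s IH] v /andP[ni0 us] Fmul Fn0 Fne Us.
have in_s i : i \in s -> i \in i0 :: s by move=> si; rewrite inE si orbT.
have Uv i : i \in s -> U (v i).
  move=> si; have [b Ab ne] := Fne i i0 (in_s _ si) (mem_head _ _) (memPn ni0 _ si).
  have : U ((F i b - F i0 b) *: v i).
    apply: (IH (fun k => (F k b - F i0 b) *: v k)) => // [k x y ks|k ks|k l ks ls|a Aa].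
    - by apply: Fmul; apply: in_s.
    - by apply: Fn0; apply: in_s.
    - by apply: Fne; apply: in_s.
    have := UB _ _ (Us _ (Aop _ _ Aa Ab)) (UZ (F i0 b) _ (Us a Aa)).
    rewrite !big_cons Fmul ?mem_head // scalerDr scalerA mulrC opprD addrACA subrr add0r.
    rewrite scaler_sumr -sumrB big_seq [in X in _ -> X]big_seq.
    rewrite (eq_bigr (fun k => F k a *: ((F k b - F i0 b) *: v k))) // => k ks.
    by rewrite Fmul ?in_s // !scalerA mulrBr scalerBl [F i0 b * _]mulrC.
  by move/(UZ (F i b - F i0 b)^-1); rewrite scalerA mulVf ?scale1r // subr_eq0.
move=> i; rewrite inE => /orP[/eqP->|/Uv //].
have [a Aa na] := Fn0 i0 (mem_head _ _).
have := Us a Aa; rewrite big_cons => Ua.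
have : U (F i0 a *: v i0).
  rewrite -[_ *: v i0](addrK (\sum_(k <- s) F k a *: v k)); apply: UB => //.
  rewrite big_seq; apply: big_ind => // [u w Uu Uw|k /Uv]; last exact: UZ.
  by rewrite -[u]scale1r; apply: UL.
by move/(UZ (F i0 a)^-1); rewrite scalerA mulVf ?scale1r.
Qed.

Lemma idempotent_diagonalizable n (A : 'M[K]_n) : A *m A = A ->
  exists2 P : 'M_n, P \in unitmx & similar_diag P A.
Proof.
case: n A => [|n] A AA.
  by exists 1%:M; rewrite ?unitmx1 //; apply/similar_diagP; rewrite ?unitmx1 // => -[].
apply/diagonalizableP; exists [:: 0; 1]; first by rewrite /= inE eq_sym oner_eq0.
apply: mxminpoly_min; rewrite !big_cons big_nil mulr1 rmorphM /= !rmorphB /= horner_mx_X !horner_mx_C.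
by rewrite raddf0 subr0 mulrBr -mulmxE AA mulmx1 subrr.
Qed.

Lemma dg_diagonalizable n (P : 'M[K]_n) d : P \in unitmx ->
  exists2 P' : 'M_n, P' \in unitmx & similar_diag P' (dg P d).
Proof.
move=> uP; exists P => //; apply/similar_diagP => // i j ij.
by rewrite /dg !mulmxA mulmxV // mul1mx mulmxK // mxE -val_eqE /= (negPf ij) mulr0n.
Qed.

Lemma similar_dg n (P A : 'M[K]_n) : P \in unitmx -> similar_diag P A -> exists d, A = dg P d.
Proof.
move=> uP /(similar_diagLR uP) [d ->]; exists d.
by rewrite conjumx ?unitmx_inv // invmxK.
Qed.

Lemma prodz_exp (I : Type) (r : seq I) (F : I -> K) (k : int) : \prod_(i <- r) F i ^ k = (\prod_(i <- r) F i) ^ k.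
Proof. by elim/big_rec2: _ => [|i a b _ ->]; rewrite ?exp1rz // expfzMl. Qed.

Lemma prodz_sum (I : Type) (r : seq I) (z : K) (k : I -> int) : z != 0 ->
  \prod_(i <- r) z ^ k i = z ^ (\sum_(i <- r) k i).
Proof.
by move=> nz; elim/big_rec2: _ => [|i a b _ ->]; rewrite ?expr0z // expfzDr.
Qed.

Lemma prodz_neq0 (I : Type) (r : seq I) (F : I -> K) (k : I -> int) :
  (forall i, F i != 0) -> \prod_(i <- r) F i ^ k i != 0.
Proof.
by move=> nz; apply: (big_ind (fun x => x != 0)) => [|x y|i _]; rewrite ?oner_eq0 ?expfz_neq0 //; apply: mulf_neq0.
Qed.

Definition monorow n r (b : 'I_n -> 'I_r -> int) (z : 'I_r -> K) : 'rV[K]_n :=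
  \row_j \prod_i z i ^ b j i.

Section DiagonalTorus.
Variable r : nat.
Let D : set 'M[K]_r := @diagonal_torus K r.

Lemma diagonal_torus_neq0 d : D d -> forall i, d i i != 0.
Proof.
move=> [/is_diag_mxP dd ud] i; apply/eqP => di; move: ud.
rewrite unitmxE unitfE det_trig; last by apply/is_trig_mxP => a b ab; apply: dd; rewrite ltn_eqF.
by rewrite (bigD1 i) //= di mul0r eqxx.
Qed.

Lemma diagonal_torus_diag (z : 'I_r -> K) : (forall i, z i != 0) -> D (diag_mx (\row_i z i)).
Proof.
move=> nz; split; first exact: diag_mx_is_diag.
by rewrite unitmxE unitfE det_diag; apply/prodf_neq0 => i _; rewrite mxE.
Qed.

Lemma diagonal_torusE d : D d -> d = diag_mx (\row_i d i i).
Proof.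
move=> [/is_diag_mxP dd _]; apply/matrixP => i j; rewrite !mxE.
by case: (eqVneq i j) => [->|ne]; rewrite ?mulr1n // mulr0n dd.
Qed.

Lemma mul_diag_row (z z' : 'I_r -> K) :
  diag_mx (\row_i z i) *m diag_mx (\row_i z' i) = diag_mx (\row_i (z i * z' i)).
Proof. by rewrite mulmx_diag; congr diag_mx; apply/rowP => i; rewrite !mxE. Qed.

Lemma diagonal_torusM d d' : D d -> D d' -> D (d *m d').
Proof.
move=> Dd Dd'; rewrite (diagonal_torusE Dd) (diagonal_torusE Dd') mul_diag_row.
by apply: diagonal_torus_diag => i; rewrite mulf_neq0 ?diagonal_torus_neq0.
Qed.

Lemma diagonal_torusV d : D d -> invmx d = diag_mx (\row_i (d i i)^-1).
Proof.
move=> Dd; have [_ ud] := Dd.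
have e : d *m diag_mx (\row_i (d i i)^-1) = 1%:M.
  rewrite {1}(diagonal_torusE Dd) mul_diag_row -diag_const_mx; congr diag_mx; apply/rowP => i.
  by rewrite !mxE mulfV // diagonal_torus_neq0.
by rewrite -[LHS]mulmx1 -e mulKmx.
Qed.

Definition laurent (e : {ffun 'I_r -> int}) (d : 'M[K]_r) := \prod_i d i i ^ e i.

Lemma laurentM e d d' : D d -> D d' -> laurent e (d *m d') = laurent e d * laurent e d'.
Proof.
move=> Dd Dd'; rewrite /laurent -big_split; apply: eq_bigr => i _ /=.
rewrite -expfzMl; congr (_ ^ _); rewrite {1}(diagonal_torusE Dd) {1}(diagonal_torusE Dd') mul_diag_row.
by rewrite !mxE eqxx mulr1n.
Qed.

Lemma laurent_neq0 e d : D d -> laurent e d != 0.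
Proof. by move=> Dd; apply: prodz_neq0 => i; apply: diagonal_torus_neq0. Qed.

Lemma two_expz_eq1 (k : int) : (2%:R : K) ^ k = 1 -> k = 0.
Proof.
have pw (j : nat) : (2%:R : K) ^+ j = 1 -> j = 0%N.
  rewrite -natrX => /(natr_inj charK (x2 := 1%N)) /eqP; rewrite -{2}(expn0 2) eqn_exp2l //.
  by move/eqP.
case: k => k; first by move=> /pw->.
by rewrite NegzE -exprnN => /(congr1 GRing.inv); rewrite invrK invr1 => /pw.
Qed.

Lemma laurent_sep e e' : e != e' -> exists2 d, D d & laurent e d != laurent e' d.
Proof.
move=> ne; have [i nei] : exists i, e i != e' i.
  by apply/existsP; rewrite -negb_forall; apply: contra ne => /forallP h; apply/eqP/ffunP => i; apply/eqP.
pose z k : K := if k == i then 2%:R else 1.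
have nz k : z k != 0 by rewrite /z; case: ifP => _; rewrite ?oner_eq0 // (natr_neq0 charK).
exists (diag_mx (\row_k z k)); first exact: diagonal_torus_diag.
have E e0 : laurent e0 (diag_mx (\row_k z k)) = 2%:R ^ e0 i.
  rewrite /laurent (bigD1 i) //= !mxE eqxx mulr1n /z eqxx big1 ?mulr1 // => k /negPf ki.
  by rewrite !mxE eqxx mulr1n ki exp1rz.
have n2 : (2%:R : K) != 0 by apply: (natr_neq0 charK).
rewrite !E; apply: contra nei => /eqP e2; rewrite -subr_eq0; apply/eqP/two_expz_eq1.
by rewrite expfzDr // e2 -expfzDr // subrr expr0z.
Qed.

Lemma laurent_indep (V : lmodType K) (v : {ffun 'I_r -> int} -> V) (s : seq _) : uniq s ->
  (forall d, D d -> \sum_(e <- s) laurent e d *: v e = 0) -> forall e, e \in s -> v e = 0.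
Proof.
move=> us; apply: (@character_independence _ mulmx D V (fun u => u = 0)) => //.
- by move=> a u w -> ->; rewrite scaler0 addr0.
- exact: diagonal_torusM.
- by move=> i a b _; apply: laurentM.
- by move=> i _; exists 1%:M; [split; [apply: scalar_mx_is_diag|apply: unitmx1]|apply: laurent_neq0; split; [apply: scalar_mx_is_diag|apply: unitmx1]].
- by move=> i j _ _; apply: laurent_sep.
Qed.

(** On diagonal matrices a polynomial in d and its inverse is a combination of
    Laurent monomials. *)
Lemma regular_laurent n (f : 'M[K]_r -> 'M[K]_n) :
  (forall i j, regular_on D (fun d => f d i j)) ->
  exists (es : seq {ffun 'I_r -> int}) (A : {ffun 'I_r -> int} -> 'M[K]_n),
    uniq es /\ forall d, D d -> f d = \sum_(e <- es) laurent e d *: A e.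
Proof.
move=> freg.
pose off (m : 'X_{1..r * (r + r)}) := [exists i : 'I_r, exists j : 'I_r, (i != j) &&
   ((m (mxvec_index i (lshift r j)) != 0) || (m (mxvec_index i (rshift r j)) != 0))%N].
pose ex (m : 'X_{1..r * (r + r)}) : {ffun 'I_r -> int} := [ffun i =>
  (m (mxvec_index i (lshift r i)))%:Z - (m (mxvec_index i (rshift r i)))%:Z].
have monE (m : 'X_{1..r * (r + r)}) d : D d -> \prod_k (mxvec (row_mx d (invmx d)) 0 k) ^+ m k = if off m then 0 else laurent (ex m) d.
  move=> Dd; have [/is_diag_mxP dd _] := Dd.
  have dV i j : i != j -> invmx d i j = 0.
    by move=> ij; rewrite (diagonal_torusV Dd) !mxE (negPf ij) mulr0n.
  case: ifPn => [/existsP[i /existsP[j /andP[ij /orP[mij|mij]]]]|noff].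
  - rewrite (bigD1 (mxvec_index i (lshift r j))) //= mxvecE row_mxEl dd // expr0n.
    by rewrite (negPf mij) mul0r.
  - rewrite (bigD1 (mxvec_index i (rshift r j))) //= mxvecE row_mxEr dV // expr0n.
    by rewrite (negPf mij) mul0r.
  rewrite (reindex (uncurry (@mxvec_index r (r + r)))) /=; last exact: curry_mxvec_bij.
  transitivity (\prod_(i < r) \prod_(j < r + r) mxvec (row_mx d (invmx d)) 0 (mxvec_index i j) ^+ m (mxvec_index i j)).
    by rewrite pair_bigA /=; apply: eq_bigr => -[i j] _.
  rewrite /laurent; apply: eq_bigr => i _; rewrite big_split_ord /=.
  have noff' j : i != j -> m (mxvec_index i (lshift r j)) = 0%N /\ m (mxvec_index i (rshift r j)) = 0%N.
    move=> ij; move: noff; rewrite negb_exists => /forallP/(_ i); rewrite negb_exists => /forallP/(_ j).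
    by rewrite ij /= negb_or !negbK => /andP[/eqP-> /eqP->].
  rewrite (bigD1 i) //= big1 ?mulr1; last by move=> j; rewrite eq_sym => /noff' [-> _]; rewrite expr0.
  rewrite [X in _ * X](bigD1 i) //= big1 ?mulr1; last by move=> j; rewrite eq_sym => /noff' [_ ->]; rewrite expr0.
  rewrite !mxvecE row_mxEl row_mxEr (diagonal_torusV Dd) !mxE eqxx mulr1n ffunE.
  by rewrite expfzDr ?diagonal_torus_neq0 // -exprnN exprVn.
have preg i j : exists p : {mpoly K[r * (r + r)]}, forall d, D d -> f d i j = mxeval p (row_mx d (invmx d)) by apply: freg.
pose p i j := projT1 (cid (preg i j)).
have pE i j d : D d -> f d i j = mxeval (p i j) (row_mx d (invmx d)) by apply: (projT2 (cid (preg i j))).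
pose ms := flatten [seq flatten [seq (msupp (p i j) : seq _) | j <- enum 'I_n] | i <- enum 'I_n].
pose es := undup [seq ex m | m <- ms].
exists es, (fun e => \matrix_(i, j) \sum_(m <- msupp (p i j) | ~~ off m && (ex m == e)) (p i j)@_m).
split; first exact: undup_uniq.
move=> d Dd; apply/matrixP => i j; rewrite pE // summxE.
under [RHS]eq_bigr => e _ do rewrite !mxE mulr_sumr big_mkcond /=.
rewrite exchange_big /= /mxeval mevalE big_seq [RHS]big_seq; apply: eq_bigr => m mp.
rewrite monE //; case: ifPn => om.
  by rewrite mulr0 big1.
have me : ex m \in es.
  rewrite mem_undup map_f //; apply/flatten_mapP; exists i; first by rewrite mem_enum.
  by apply/flatten_mapP; exists j; rewrite ?mem_enum.
rewrite (bigD1_seq (ex m)) ?undup_uniq //= eqxx big1 ?addr0 1?mulrC // => e.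
by rewrite eq_sym => /negPf->.
Qed.

End DiagonalTorus.

Lemma dg_sum n (P : 'M[K]_n) I (s : seq I) (F : I -> 'rV[K]_n) :
  dg P (\sum_(i <- s) F i) = \sum_(i <- s) dg P (F i).
Proof.
rewrite (big_morph (dg P) (dg_add P) (id1 := 0)) //.
by rewrite /dg linear0 mulmx0 mul0mx.
Qed.

Lemma dgZ n (P : 'M[K]_n) a d : dg P (a *: d) = a *: dg P d.
Proof. by rewrite /dg linearZ /= -scalemxAr -scalemxAl. Qed.

(** A torus consists of matrices diagonal in some basis, with Laurent monomials
    as entries; the basis may be chosen to diagonalize also a given matrix
    commuting with the torus. *)
Lemma torus_monomial n (T : set 'M[K]_n) (P0 : 'M[K]_n) d0 : torus T -> P0 \in unitmx ->
  (forall t, T t -> bracket (dg P0 d0) t = 0) ->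
  exists (P : 'M[K]_n) r (b : 'I_n -> 'I_r -> int) d, [/\ P \in unitmx, dg P0 d0 = dg P d &
    forall t, T t <-> exists2 z, (forall i, z i != 0) & t = dg P (monorow b z)].
Proof.
move=> [[[subT T1 TM TV] _] [r [f [f' [[fT finj fsurj] ff' fM freg _]]]]] uP0 comT.
set D : set 'M[K]_r := @diagonal_torus K r in fT finj fsurj ff' fM freg.
have [es [A [ues fE]]] := regular_laurent freg.
have D1 : D 1%:M by split; [apply: scalar_mx_is_diag|apply: unitmx1].
have f1 : f 1%:M = 1%:M.
  have u1 : f 1%:M \in unitmx by apply/subT/fT.
  by rewrite -[LHS](mulKmx u1) -fM // mulmx1 mulVmx.
have Af e d : e \in es -> D d -> A e *m f d = laurent e d *: A e.
  move=> ee Dd; apply: subr0_eq.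
  apply: (laurent_indep (v := fun e => A e *m f d - laurent e d *: A e) ues) => // d' Dd'.
  under eq_bigr => e' _ do rewrite scalerBr scalerA -laurentM // scalemxAl.
  by rewrite sumrB -mulmx_suml -!fE ?fM ?subrr //; apply: diagonal_torusM.
have AA e e' : e \in es -> e' \in es -> A e *m A e' = A e *+ (e == e').
  move=> ee ee'; apply: subr0_eq.
  apply: (laurent_indep (v := fun e' => A e *m A e' - A e *+ (e == e')) ues) => // d Dd.
  under eq_bigr => k _ do rewrite scalerBr scalemxAr.
  rewrite sumrB -mulmx_sumr -fE // Af // (bigD1_seq e) //= eqxx mulr1n big1 ?addr0 ?subrr // => k.
  by rewrite eq_sym => /negPf->; rewrite mulr0n scaler0.
have xA e : e \in es -> bracket (dg P0 d0) (A e) = 0.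
  move=> ee; apply: (laurent_indep (v := fun e => bracket (dg P0 d0) (A e)) ues) => // d Dd.
  under eq_bigr => k _ do rewrite -bracketZr.
  by rewrite -bracket_sumr -fE //; apply/comT/fT.
have [P uP /allP /= PA] : exists2 P : 'M_n, P \in unitmx & all [pred B | similar_diag P B] (dg P0 d0 :: [seq A e | e <- es]).
  apply/codiagonalizableP; split=> [B C|B].
    have AC e e' : e \in es -> e' \in es -> comm_mx (A e) (A e').
      by move=> ee ee'; rewrite /comm_mx !AA // eq_sym; case: eqVneq => [->|]; rewrite ?mulr0n.
    have xC e : e \in es -> comm_mx (dg P0 d0) (A e).
      by move=> ee; apply: subr0_eq; apply/xA.
    rewrite !inE => /orP[/eqP->|/mapP[e ee ->]] /orP[/eqP->|/mapP[e' ee' ->]] //.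
    - exact: xC.
    - by apply/comm_mx_sym/xC.
    - exact: AC.
  rewrite inE => /orP[/eqP->|/mapP[e ee ->]]; first exact: dg_diagonalizable.
  by apply: idempotent_diagonalizable; rewrite AA // eqxx mulr1n.
have [d xE] := similar_dg uP (PA _ (mem_head _ _)).
have aex e : exists a, e \in es -> A e = dg P a.
  case ee: (e \in es); last by exists 0.
  by have [a aE] := similar_dg uP (PA _ (mem_behead (s := _ :: _) (map_f A ee))); exists a.
pose a e := projT1 (cid (aex e)).
have aE e : e \in es -> A e = dg P (a e) by exact: (projT2 (cid (aex e))).
have aa e e' j : e \in es -> e' \in es -> a e 0 j * a e' 0 j = a e 0 j *+ (e == e').
  move=> ee ee'; have := AA e e' ee ee'; rewrite !aE // dg_mul //.
  have -> : dg P (a e) *+ (e == e') = dg P (a e *+ (e == e')).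
    by case: (e == e'); rewrite ?mulr1n // !mulr0n /dg linear0 mulmx0 mul0mx.
  move/(dg_inj uP)/rowP/(_ j); rewrite !mxE => ->.
  by case: (e == e'); rewrite ?mulr1n // !mulr0n mxE.
have a1 j : \sum_(e <- es) a e 0 j = 1.
  have : dg P (\sum_(e <- es) a e) = 1%:M.
    rewrite dg_sum -f1 fE // big_seq [RHS]big_seq; apply: eq_bigr => e ee.
    rewrite -aE // /laurent big1 ?scale1r // => i _; by rewrite mxE eqxx exp1rz.
  rewrite -(dg1 uP) => /(dg_inj uP)/rowP/(_ j); rewrite summxE mxE; exact.
have ebj j : exists2 e, e \in es & a e 0 j != 0.
  apply: contrapT => nex; have := a1 j; rewrite big_seq big1 => [/eqP|e ee].
    by rewrite eq_sym oner_eq0.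
  by apply: contrapT => /eqP ne; apply: nex; exists e.
pose e_ j := s2val (cid2 (ebj j)).
have e_es j : e_ j \in es by exact: (s2valP (cid2 (ebj j))).
have ae j : a (e_ j) 0 j != 0 by exact: (s2valP' (cid2 (ebj j))).
have ajE e j : e \in es -> a e 0 j = (e == e_ j)%:R.
  move=> ee; have := aa e (e_ j) j ee (e_es j); case: eqVneq => [->|ne].
    by rewrite mulr1n => /(canRL (mulfK (ae j))); rewrite mulfV.
  by rewrite mulr0n => /eqP; rewrite mulf_eq0 (negPf (ae j)) orbF => /eqP.
pose b : 'I_n -> 'I_r -> int := fun j i => e_ j i.
have fdg (d' : 'M[K]_r) : D d' -> f d' = dg P (monorow b (fun i => d' i i)).
  move=> Dd'; rewrite fE //.
  have -> : \sum_(e <- es) laurent e d' *: A e = dg P (\sum_(e <- es) laurent e d' *: a e).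
    by rewrite dg_sum big_seq [RHS]big_seq; apply: eq_bigr => e ee; rewrite aE // dgZ.
  congr dg; apply/rowP => j; rewrite summxE !mxE (bigD1_seq (e_ j)) //= !mxE ajE // eqxx mulr1.
  rewrite big_seq_cond big1 ?addr0 // => e /andP[ee ne].
  by rewrite mxE ajE // (negPf ne) mulr0.
exists P, r, b, d; split=> // t; split=> [/fsurj [d' Dd' <-]|[z nz ->]].
  by exists (fun i => d' i i); [apply: diagonal_torus_neq0|apply: fdg].
have Dz := diagonal_torus_diag nz; have := fT _ Dz; rewrite /= fdg //.
congr (T (dg P _)); apply/rowP => j; rewrite !mxE; apply: eq_bigr => i _.
by rewrite !mxE eqxx mulr1n.
Qed.

End Torus.

(** ** Lattices of relations and maximality *)

Section Lattice.

Lemma clear_denominators n (C : 'M[rat]_n) : exists (N : int) (Q : 'M[int]_n),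
  N != 0 /\ map_mx intr Q = N%:~R *: C.
Proof.
exists (\prod_p denq (C p.1 p.2)),
  (\matrix_(i, j) (numq (C i j) * \prod_(p | p != (i, j)) denq (C p.1 p.2))); split.
  by apply/prodf_neq0 => p _; rewrite denq_eq0.
apply/matrixP => i j; rewrite !mxE [in RHS](bigD1 (i, j)) //= !intrM mulrAC; congr (_ * _).
by rewrite -{3}[C i j]divq_num_den mulrC divfK // intr_eq0 denq_eq0.
Qed.

(** The integral points of a rational subspace of Q^n form a direct summand of
    Z^n; a complement of it is given by the Smith normal form. *)
Lemma lattice_complement n (R : 'M[rat]_n) : exists s (L : 'I_n -> 'I_s -> int) (L' : 'I_s -> 'I_n -> int),
  (forall k l, \sum_j L' k j * L j l = (k == l)%:R) /\
  (forall m : 'I_n -> int, ((\row_j (m j)%:~R : 'rV[rat]_n) <= R)%MS <->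
     forall k, \sum_j m j * L j k = 0).
Proof.
have [N [Q [N0 QE]]] := clear_denominators (cokermx R).
have [L uL [U uU [d _ QS]]] := int_Smith_normal_form Q.
pose I := [pred i : 'I_n | d`_i != 0].
exists #|I|, (fun j k => L j (enum_val k)), (fun k j => invmx L (enum_val k) j); split.
  move=> k l; have /matrixP/(_ (enum_val k) (enum_val l)) := mulVmx uL; rewrite !mxE => ->.
  by rewrite (inj_eq enum_val_inj).
move=> m; pose v : 'rV[int]_n := \row_j m j.
have -> : (\row_j (m j)%:~R : 'rV[rat]_n) = map_mx intr v by apply/rowP => j; rewrite !mxE.
have E1 : (map_mx intr v <= R)%MS = (v *m Q == 0).
  rewrite submxE; have N0' : (N%:~R : rat) != 0 by rewrite intr_eq0.
  have -> : (map_mx intr v *m cokermx R == 0) = (map_mx intr v *m (N%:~R *: cokermx R) == 0).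
    by rewrite -scalemxAr scaler_eq0 (negPf N0').
  rewrite -QE -map_mxM; apply/eqP/eqP => [e|->]; last by rewrite map_mx0.
  apply/rowP => j; have /rowP/(_ j) := e; rewrite !mxE => /eqP.
  by rewrite intr_eq0 => /eqP.
have DE i : (v *m L *m \matrix_(i, j) (d`_i *+ (i == j))) 0 i = (v *m L) 0 i * d`_i.
  rewrite mxE (bigD1 i) //= (mxE _ _ i i) eqxx mulr1n big1 ?addr0 // => k /negPf ne.
  by rewrite (mxE _ _ k i) ne mulr0n mulr0.
have E2 : (v *m Q == 0) = [forall i, (v *m L) 0 i * d`_i == 0].
  rewrite QS !mulmxA; apply/eqP/forallP => [e i|e].
    have vD : v *m L *m \matrix_(i, j) (d`_i *+ (i == j)) = 0 by rewrite -[LHS](mulmxK uU) e mul0mx.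
    by rewrite -DE vD mxE.
  rewrite (_ : v *m L *m _ = 0) ?mul0mx //; apply/rowP => i.
  by rewrite DE (eqP (e i)) mxE.
have vL i : (v *m L) 0 i = \sum_j m j * L j i by rewrite mxE; apply: eq_bigr => j _; rewrite mxE.
rewrite E1 E2; split=> [/forallP e k|e]; last first.
  apply/forallP => i; rewrite vL mulf_eq0; case di: (d`_i == 0); first by rewrite orbT.
  have Ii : i \in I by rewrite inE di.
  by have := e (enum_rank_in Ii i); rewrite enum_rankK_in // => ->; rewrite eqxx.
have := e (enum_val k); rewrite vL mulf_eq0 => /orP[/eqP //|].
by have := enum_valP k; rewrite inE => /negPf->.
Qed.

End Lattice.

Section MaximalTorus.
Variable (K : closedFieldType).
Hypothesis charK : [pchar K] =i pred0.

Lemma regular_on_polyfun n (A : 'M[K]_n -> Prop) f (F : 'M[K]_(n, n + n) -> K) : polyfun F ->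
  (forall g, A g -> f g = F (row_mx g (invmx g))) -> regular_on A f.
Proof. by move=> [p pE] e; exists p => g Ag; rewrite e // pE. Qed.

(** With b = a^-1 this is a ^ k, but it stays polynomial in a and b. *)
Definition zpow (a b : K) (k : int) : K :=
  match k with Posz i => a ^+ i | Negz i => b ^+ i.+1 end.

Lemma zpowE a k : zpow a a^-1 k = a ^ k.
Proof. by case: k => i //=; rewrite NegzE -exprnN exprVn. Qed.

Lemma polyfun_zpow m n (F F' : 'M[K]_(m, n) -> K) k :
  polyfun F -> polyfun F' -> polyfun (fun A => zpow (F A) (F' A) k).
Proof. by case: k => i pF pF'; apply: polyfunX. Qed.

Lemma dg_coord n (P : 'M[K]_n) (d : 'rV[K]_n) : P \in unitmx -> P *m dg P d *m invmx P = diag_mx d.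
Proof. by move=> uP; rewrite /dg !mulmxA mulmxV // mul1mx mulmxK. Qed.

Lemma dg_inv n (P : 'M[K]_n) (d : 'rV[K]_n) : P \in unitmx -> (forall j, d 0 j != 0) ->
  invmx (dg P d) = dg P (\row_j (d 0 j)^-1).
Proof.
move=> uP nz; have ud := dg_unit uP nz.
rewrite -[RHS](mulKmx ud) dg_mul // (_ : \row_j _ = const_mx 1) ?dg1 ?mulmx1 //.
by apply/rowP => j; rewrite !mxE mulfV.
Qed.

Section LatticeTorus.
Variables (n s : nat) (P : 'M[K]_n) (L : 'I_n -> 'I_s -> int) (L' : 'I_s -> 'I_n -> int).
Hypotheses (uP : P \in unitmx) (LL : forall k l, \sum_j L' k j * L j l = (k == l)%:R).

Definition lattice_torus : set 'M[K]_n :=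
  [set t | exists c : 'I_n -> K, [/\ forall j, c j != 0,
     forall m : 'I_n -> int, (forall k, \sum_j m j * L j k = 0) -> \prod_j c j ^ m j = 1 &
     t = dg P (\row_j c j)]].

Lemma lattice_torus_param (z : 'I_s -> K) : (forall k, z k != 0) ->
  lattice_torus (dg P (monorow L z)).
Proof.
move=> nz; exists (fun j => \prod_k z k ^ L j k); split=> // [j|m mL].
  exact: prodz_neq0.
transitivity (\prod_j \prod_k z k ^ (L j k * m j)).
  by apply: eq_bigr => j _; rewrite -prodz_exp; apply: eq_bigr => k _; rewrite exprz_exp.
rewrite exchange_big big1 //= => k _; rewrite prodz_sum //.
under eq_bigr => j _ do rewrite mulrC.
by rewrite mL expr0z.
Qed.

Let zc (c : 'I_n -> K) k := \prod_j c j ^ L' k j.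

Lemma lattice_torus_coord (c : 'I_n -> K) : (forall j, c j != 0) ->
  (forall m : 'I_n -> int, (forall k, \sum_j m j * L j k = 0) -> \prod_j c j ^ m j = 1) ->
  monorow L (zc c) = \row_j c j.
Proof.
move=> nz cM; apply/rowP => j; rewrite !mxE.
have -> : \prod_k zc c k ^ L j k = \prod_l c l ^ (\sum_k L j k * L' k l).
  transitivity (\prod_k \prod_l c l ^ (L' k l * L j k)).
    by apply: eq_bigr => k _; rewrite -prodz_exp; apply: eq_bigr => l _; rewrite exprz_exp.
  rewrite exchange_big; apply: eq_bigr => l _ /=; rewrite prodz_sum //.
  by congr (_ ^ _); apply: eq_bigr => k _; rewrite mulrC.
have := cM (fun l => (l == j)%:R - \sum_k L j k * L' k l) _.
have cj : c j = \prod_l c l ^ ((l == j)%:R : int).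
  rewrite (bigD1 j) //= eqxx expr1z big1 ?mulr1 // => l /negPf->.
  by rewrite expr0z.
move=> H; rewrite [RHS]cj -[LHS]mul1r -[X in X * _]H.
  rewrite -big_split /=; apply: eq_bigr => l _.
  by rewrite -expfzDr // subrK.
move=> k; under eq_bigr => l _ do rewrite mulrBl.
rewrite sumrB (bigD1 j) //= eqxx mul1r big1 ?addr0; last by move=> l /negPf->; rewrite mul0r.
under [X in _ - X]eq_bigr => l _ do rewrite mulr_suml.
rewrite exchange_big /=; under [X in _ - X]eq_bigr => k' _.
  under eq_bigr => l _ do rewrite -mulrA.
  rewrite -mulr_sumr LL; over.
rewrite (bigD1 k) //= eqxx mulr1 big1 ?addr0 ?subrr // => k' /negPf->.
by rewrite mulr0.
Qed.

Lemma lattice_torus_group : algebraic_group lattice_torus.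
Proof.
have subU : lattice_torus `<=` [set g | g \in unitmx].
  by move=> _ [c [nz _ ->]]; apply: dg_unit => // j; rewrite mxE.
have sub : subgroup_GL lattice_torus.
  split=> //.
  - exists (fun=> 1); split=> [j|m _|]; rewrite ?oner_eq0 //; first by rewrite big1 // => j _; rewrite exp1rz.
    by rewrite -(dg1 uP); congr dg; apply/rowP => j; rewrite !mxE.
  - move=> _ _ [c [nz cM ->]] [c' [nz' cM' ->]]; exists (fun j => c j * c' j); split=> [j|m mL|].
    + by rewrite mulf_neq0.
    + under eq_bigr => j _ do rewrite expfzMl.
      by rewrite big_split /= cM // cM' // mulr1.
    by rewrite dg_mul //; congr dg; apply/rowP => j; rewrite !mxE.
  move=> _ [c [nz cM ->]]; exists (fun j => (c j)^-1); split=> [j|m mL|].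
  - by rewrite invr_eq0.
  - under eq_bigr => j _ do rewrite exprz_inv.
    have := cM (fun j => - m j); apply => k; under eq_bigr => j _ do rewrite mulNr.
    by rewrite sumrN mL oppr0.
  rewrite dg_inv // => [|j]; last by rewrite mxE.
  by congr dg; apply/rowP => j; rewrite !mxE.
suff <- : alg_closure lattice_torus = lattice_torus by apply: alg_closure_group.
apply/seteqP; split; last exact: sub_alg_closure.
move=> g [/zclosureE clg ug]; pose M := P *m g *m invmx P.
have pM i j : polyfun (fun A : 'M[K]_n => (P *m A *m invmx P) i j).
  exact: polymap_conj.
have Mij i j : i != j -> M i j = 0.
  move=> ij; apply: (clg _ (pM i j)) => _ [c [_ _ ->]].
  by rewrite dg_coord // mxE (negPf ij) mulr0n.
have ME : M = diag_mx (\row_j M j j).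
  apply/matrixP => i j; rewrite [RHS]mxE [X in X *+ _]mxE; case: eqVneq => [->|ij]; rewrite ?mulr1n //.
  by rewrite mulr0n; apply: Mij.
have gE : g = dg P (\row_j M j j) by rewrite /dg -ME /M !mulmxA mulVmx // mul1mx mulmxKV.
have nz j : M j j != 0.
  have : M \in unitmx by rewrite !unitmx_mul unitmx_inv uP ug.
  rewrite [X in X \in _]ME unitmxE unitfE det_diag => /prodf_neq0/(_ j isT).
  by rewrite (_ : (\row_j M j j) 0 j = M j j) // mxE.
exists (fun j => M j j); split=> // m mL.
pose F (A : 'M[K]_n) := \prod_j zpow ((P *m A *m invmx P) j j) 1 (m j) - \prod_j zpow 1 ((P *m A *m invmx P) j j) (m j).
have prodE (c : 'I_n -> K) : (forall j, c j != 0) -> \prod_j zpow (c j) 1 (m j) = \prod_j zpow 1 (c j) (m j) * \prod_j c j ^ m j.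
  move=> nc; rewrite -big_split /=; apply: eq_bigr => j _; case: (m j) => k /=.
    by rewrite expr1n mul1r.
  by rewrite expr1n NegzE -exprnN mulfV // expf_neq0.
have : F g = 0.
  apply: clg => [|_ [c [nc cM ->]]].
    by apply: polyfunB; apply: polyfun_prod => j _; apply: polyfun_zpow => //; exact: polyfun_cst.
  rewrite /F dg_coord //; under eq_bigr => j _ do rewrite !mxE eqxx mulr1n.
  under [X in _ - X]eq_bigr => j _ do rewrite !mxE eqxx mulr1n.
  by rewrite prodE // cM // mulr1 subrr.
rewrite /F -/M prodE // => /eqP; rewrite -{2}[\prod_j zpow _ _ _]mulr1 -mulrBr mulf_eq0.
case/orP => [/prodf_eq0 [j _]|]; last by rewrite subr_eq0 => /eqP.
by case: (m j) => k /=; rewrite ?expr1n ?oner_eq0 // expf_eq0 (negPf (nz j)).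
Qed.

Lemma lattice_torus_torus : torus lattice_torus.
Proof.
split; first exact: lattice_torus_group.
pose co (g : 'M[K]_n) j := (P *m g *m invmx P) j j.
exists s, (fun d => dg P (monorow L (fun k => d k k))), (fun g => diag_mx (\row_k zc (co g) k)).
have coE c j : co (dg P (\row_j c j)) j = c j by rewrite /co dg_coord // !mxE eqxx mulr1n.
have fK (d : 'M[K]_s) : @diagonal_torus K s d ->
    diag_mx (\row_k zc (co (dg P (monorow L (fun k => d k k)))) k) = d.
  move=> Dd; rewrite [RHS](diagonal_torusE Dd); congr diag_mx; apply/rowP => k; rewrite !mxE.
  have nz := diagonal_torus_neq0 Dd.
  transitivity (\prod_j \prod_l d l l ^ (L j l * L' k j)).
    apply: eq_bigr => j _; rewrite /co dg_coord // !mxE eqxx mulr1n -prodz_exp.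
    by apply: eq_bigr => l _; rewrite exprz_exp.
  rewrite exchange_big /=; under eq_bigr => l _.
    rewrite prodz_sum //; under eq_bigr => j _ do rewrite mulrC.
    rewrite LL; over.
  rewrite (bigD1 k) //= eqxx expr1z big1 ?mulr1 // => l.
  by rewrite eq_sym => /negPf->; rewrite expr0z.
split.
- split.
  + by move=> d Dd; apply: lattice_torus_param; apply: diagonal_torus_neq0.
  + by move=> d d' /set_mem Dd /set_mem Dd' e; rewrite -(fK _ Dd) e fK.
  move=> _ [c [nz cM ->]]; exists (diag_mx (\row_k zc c k)).
    by apply: diagonal_torus_diag => k; apply: prodz_neq0.
  rewrite -(lattice_torus_coord nz cM); congr dg; apply/rowP => j; rewrite !mxE.
  by apply: eq_bigr => k _; rewrite !mxE eqxx mulr1n.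
- exact: fK.
- move=> d d' Dd Dd'; rewrite dg_mul //; congr dg; apply/rowP => j; rewrite !mxE -big_split /=.
  apply: eq_bigr => k _; rewrite -expfzMl; congr (_ ^ _).
  by rewrite {1}(diagonal_torusE Dd) {1}(diagonal_torusE Dd') mul_diag_row !mxE eqxx mulr1n.
- move=> i j; pose F (A : 'M[K]_(s, s + s)) := \sum_l invmx P i l *
     (\prod_k zpow (A k (lshift s k)) (A k (rshift s k)) (L l k)) * P l j.
  apply: (@regular_on_polyfun _ _ _ F).
    apply: polyfun_sum => l _; apply: polyfunM; last exact: polyfun_cst.
    apply: polyfunM; first exact: polyfun_cst.
    by apply: polyfun_prod => k _; apply: polyfun_zpow; apply: polyfun_entry.
  move=> d Dd; rewrite /F /dg mxE; apply: eq_bigr => l _; rewrite mul_mx_diag !mxE.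
  congr (_ * _ * _); apply: eq_bigr => k _.
  by rewrite row_mxEl row_mxEr (diagonal_torusV Dd) !mxE eqxx mulr1n zpowE.
move=> i j; pose F (A : 'M[K]_(n, n + n)) := (i == j)%:R *
   \prod_l zpow (co (lsubmx A) l) (co (rsubmx A) l) (L' j l).
have pco f l : polymap f -> polyfun (fun A : 'M[K]_(n, n + n) => co (f A) l).
  by move=> pf; do 2?apply: polymap_mul; [exact: polymap_cst|exact: pf|exact: polymap_cst].
apply: (@regular_on_polyfun _ _ _ F).
  apply: polyfunM; first exact: polyfun_cst.
  by apply: polyfun_prod => l _; apply: polyfun_zpow; apply: pco; [apply: polymap_lsub|apply: polymap_rsub].
move=> _ [c [nz cM ->]]; rewrite /F row_mxKl row_mxKr !mxE.
case: eqVneq => [->|_]; rewrite ?mulr0n ?mul0r // mulr1n mul1r; apply: eq_bigr => l _.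
rewrite dg_inv //; last by move=> k; rewrite mxE.
have -> : \row_k ((\row_j c j) 0 k)^-1 = \row_k (c k)^-1 by apply/rowP => k; rewrite !mxE.
by rewrite !coE zpowE.
Qed.

End LatticeTorus.

Section Maximal.
Variable n : nat.
Implicit Types (G T : set 'M[K]_n) (P : 'M[K]_n).

Lemma lie_one_param_torus T P r (b : 'I_n -> 'I_r -> int) i : torus T -> P \in unitmx ->
  (forall t, T t <-> exists2 z, (forall i, z i != 0) & t = dg P (monorow b z)) ->
  Lie T (dg P (\row_j (b j i)%:~R)).
Proof.
move=> tT uP TP; apply: lie_one_param => //; first by apply: subgroup_monoid; case: tT => -[].
move=> z nz; apply/TP; exists (fun k => if k == i then z else 1).
  by move=> k; case: ifP; rewrite ?oner_eq0.
congr dg; apply/rowP => j; rewrite !mxE (bigD1 i) //= eqxx big1 ?mulr1 //.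
by move=> k /negPf->; rewrite exp1rz.
Qed.

(** Maximality: enlarging T by the semisimple element x and taking the group of
    all diagonal matrices satisfying the common integral relations gives a torus
    of G, hence T itself. *)
Lemma maximal_torus_semisimple G T P0 d0 : algebraic_group G -> maximal_torus G T ->
  P0 \in unitmx -> (forall t, T t -> bracket (dg P0 d0) t = 0) ->
  Lie G (dg P0 d0) -> Lie T (dg P0 d0).
Proof.
move=> aG [tT TG Tmax] uP0 com Lx; have mT : monoid_mx T by apply: subgroup_monoid; case: tT => -[].
have [P [r [b [d [uP xE TP]]]]] := torus_monomial charK tT uP0 com.
pose rel (v : 'rV[rat]_n) := \sum_j ratr (v 0 j) * d 0 j = 0 /\
  forall i, \sum_j v 0 j * (b j i)%:~R = 0.
have r0 : ratr 0 = 0 :> K by rewrite -[0 in LHS]/(0%:~R) ratrK_int.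
have [||R RP] := @mx_of_pred rat n rel.
- by split=> [|i]; rewrite big1 // => j _; rewrite mxE ?r0 mul0r.
- move=> a u v [u1 u2] [v1 v2]; split=> [|i].
    under eq_bigr => j _ do rewrite !mxE ratrK_add // ratrK_mul // mulrDl -mulrA.
    by rewrite big_split /= -mulr_sumr u1 v1 mulr0 addr0.
  under eq_bigr => j _ do rewrite !mxE mulrDl -mulrA.
  by rewrite big_split /= -mulr_sumr u2 v2 mulr0 addr0.
have [s [L [L' [LL LP]]]] := lattice_complement R.
have relE (m : 'I_n -> int) : (forall k, \sum_j m j * L j k = 0) <->
   (\sum_j (m j)%:~R * d 0 j = 0 /\ forall i, \sum_j m j * b j i = 0).
  rewrite -LP RP /rel; split=> -[e1 e2]; split=> [|i].
  - by rewrite -[RHS]e1; apply: eq_bigr => j _; rewrite mxE ratrK_int.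
  - apply: (intr_inj (R := rat)); rewrite -[RHS](e2 i) rmorph_sum; apply: eq_bigr => j _.
    by rewrite mxE rmorphM.
  - by rewrite -[RHS]e1; apply: eq_bigr => j _; rewrite mxE ratrK_int.
  rewrite -[RHS]/(0%:~R) -(e2 i) rmorph_sum; apply: eq_bigr => j _.
  by rewrite mxE rmorphM.
pose T' := lattice_torus P L.
have TT' : T `<=` T'.
  move=> t /TP [z nz ->]; exists (fun j => \prod_i z i ^ b j i); split=> // [j|m /relE [_ mb]].
    exact: prodz_neq0.
  transitivity (\prod_j \prod_i z i ^ (b j i * m j)).
    by apply: eq_bigr => j _; rewrite -prodz_exp; apply: eq_bigr => k _; rewrite exprz_exp.
  rewrite exchange_big big1 //= => k _; rewrite prodz_sum //.
  under eq_bigr => j _ do rewrite mulrC.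
  by rewrite mb expr0z.
pose ds := d :: [seq \row_j (b j i)%:~R | i <- enum 'I_r].
have T'G : T' `<=` G.
  move=> _ [c [nz cM ->]]; apply: (@algebraic_diag _ charK _ P uP _ ds) => //.
  - move=> d'; rewrite inE => /orP[/eqP->|/mapP [i _ ->]]; first by rewrite -xE.
    by apply: lie_mono TG _ _; apply: lie_one_param_torus TP.
  - by move=> j; rewrite mxE.
  move=> a a' aa'; pose m j : int := (a j)%:Z - (a' j)%:Z.
  have : \prod_j c j ^ m j = 1.
    apply/cM/relE; split=> [|i].
      under eq_bigr => j _ do rewrite /m rmorphB /= mulrBl.
      by rewrite sumrB (aa' d) ?mem_head // subrr.
    apply: (intr_injK charK); rewrite /= rmorph_sum.
    under eq_bigr => j _ do rewrite /m rmorphM rmorphB /= mulrBl.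
    have E (y : 'I_n -> nat) : \sum_j (y j)%:R * (\row_j (b j i)%:~R : 'rV[K]_n) 0 j = \sum_j (y j)%:R * (b j i)%:~R.
      by apply: eq_bigr => j _; rewrite mxE.
    rewrite sumrB -!E aa' ?subrr //.
    by rewrite inE; apply/orP; right; apply: map_f; rewrite mem_enum.
  have -> : \prod_j c j ^ m j = (\prod_j c j ^+ a j) / (\prod_j c j ^+ a' j).
    by rewrite -prodfV -big_split /=; apply: eq_bigr => j _; rewrite /m expfzDr // -exprnN.
  have na' : \prod_j c j ^+ a' j != 0 by apply/prodf_neq0 => j _; apply: expf_neq0.
  move/(congr1 (fun y => y * \prod_j c j ^+ a' j)); rewrite divfK // mul1r => e.
  under eq_bigr => j _ do rewrite mxE.
  under [RHS]eq_bigr => j _ do rewrite mxE.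
  exact: e.
have T'E : T' = T by apply: Tmax => //; apply: lattice_torus_torus LL.
rewrite xE; apply: (@algebraic_replica _ charK _ P uP _ [seq \row_j (b j i)%:~R | i <- enum 'I_r]) => //.
  by move=> _ /mapP [i _ ->]; apply: lie_one_param_torus TP.
move=> a a' aa'; pose m j : int := (a j)%:Z - (a' j)%:Z.
have mb i : \sum_j m j * b j i = 0.
  apply: (intr_injK charK); rewrite /= rmorph_sum.
  under eq_bigr => j _ do rewrite /m rmorphM rmorphB /= mulrBl.
  have E (y : 'I_n -> nat) : \sum_j (y j)%:R * (\row_j (b j i)%:~R : 'rV[K]_n) 0 j = \sum_j (y j)%:R * (b j i)%:~R.
    by apply: eq_bigr => j _; rewrite mxE.
  rewrite sumrB -!E aa' ?subrr //.
  by apply: map_f; rewrite mem_enum.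
suff /relE [e _] : forall k, \sum_j m j * L j k = 0.
  apply/eqP; rewrite -subr_eq0 -sumrB; apply/eqP; rewrite -[RHS]e; apply: eq_bigr => j _.
  by rewrite /m rmorphB /= mulrBl.
move=> k; have n2 : (2%:R : K) != 0 by apply: (natr_neq0 charK).
pose z l : K := if l == k then 2%:R else 1.
have nz l : z l != 0 by rewrite /z; case: ifP; rewrite ?oner_eq0.
have : T' (dg P (monorow L z)) by apply: lattice_torus_param.
rewrite T'E => /TP [y ny /(dg_inj uP)/rowP e].
apply: (two_expz_eq1 charK); rewrite -prodz_sum //.
transitivity (\prod_j (\prod_i y i ^ b j i) ^ m j).
  apply: eq_bigr => j _; have := e j; rewrite !mxE => <-.
  rewrite (bigD1 k) //= /z eqxx big1 ?mulr1; last by move=> l /negPf->; rewrite exp1rz.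
  by rewrite exprz_exp mulrC.
transitivity (\prod_j \prod_i y i ^ (b j i * m j)).
  by apply: eq_bigr => j _; rewrite -prodz_exp; apply: eq_bigr => l _; rewrite exprz_exp.
rewrite exchange_big big1 //= => i _; rewrite prodz_sum //.
under eq_bigr => j _ do rewrite mulrC.
by rewrite mb expr0z.
Qed.

End Maximal.
End MaximalTorus.

(** * Representations of sl2 *)

Section Sl2.
Variable (K : closedFieldType).
Hypothesis charK : [pchar K] =i pred0.

Record sl2_module (W : lmodType K) (E F H : W -> W) : Prop := Sl2Module {
  sl2_EL : linear E;
  sl2_FL : linear F;
  sl2_HE : forall v, H (E v) = E (H v) + 2%:R *: E v;
  sl2_HF : forall v, H (F v) = F (H v) - 2%:R *: F v;
  sl2_EF : forall v, E (F v) = F (E v) + H v;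
  sl2_nilE : exists N, forall v, iter N E v = 0;
  sl2_nilF : exists N, forall v, iter N F v = 0
}.

Lemma linear_at0 (V W : lmodType K) (f : V -> W) : linear f -> f 0 = 0.
Proof. by move=> L; have := L (-1) 0 0; rewrite scaler0 addr0 => e; rewrite e scaleN1r addNr. Qed.

Lemma linear_scale (V W : lmodType K) (f : V -> W) a v : linear f -> f (a *: v) = a *: f v.
Proof. by move=> L; have := L a v 0; rewrite !addr0 (linear_at0 L) addr0. Qed.

Section Module.
Variables (W : lmodType K) (E F H : W -> W).
Hypothesis M : sl2_module E F H.

Let E0 : E 0 = 0. Proof. exact: linear_at0 (sl2_EL M). Qed.
Let F0 : F 0 = 0. Proof. exact: linear_at0 (sl2_FL M). Qed.
Let EZ a v : E (a *: v) = a *: E v. Proof. exact: linear_scale (sl2_EL M). Qed.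
Let FZ a v : F (a *: v) = a *: F v. Proof. exact: linear_scale (sl2_FL M). Qed.
Let ED u v : E (u + v) = E u + E v. Proof. by have := sl2_EL M 1 u v; rewrite !scale1r. Qed.
Let FD u v : F (u + v) = F u + F v. Proof. by have := sl2_FL M 1 u v; rewrite !scale1r. Qed.

Lemma sl2_Hdef v : H v = E (F v) - F (E v).
Proof. by rewrite (sl2_EF M) addrAC subrr add0r. Qed.

Lemma sl2_module_sym : sl2_module F E (fun v => - H v).
Proof.
split; [exact: sl2_FL M|exact: sl2_EL M| | | |exact: sl2_nilF M|exact: sl2_nilE M].
- by move=> v; rewrite (sl2_HF M) -[- H v]scaleN1r FZ scaleN1r opprB addrC.
- by move=> v; rewrite (sl2_HE M) -[- H v]scaleN1r EZ scaleN1r opprD.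
- by move=> v; rewrite (sl2_EF M) addrK.
Qed.

Lemma sl2_wtE c v : H v = c *: v -> H (E v) = (c + 2%:R) *: E v.
Proof. by move=> Hv; rewrite (sl2_HE M) Hv EZ scalerDl. Qed.

Lemma sl2_wtF c v : H v = c *: v -> H (F v) = (c - 2%:R) *: F v.
Proof. by move=> Hv; rewrite (sl2_HF M) Hv FZ scalerBl. Qed.

(** Apply E until v dies: the relation EF - FE = H adds up the weights passed. *)
Lemma sl2_eigenEF c m v : v != 0 -> H v = c *: v -> E (F v) = m *: v ->
  exists j : nat, m = j.+1%:R * (c + j%:R).
Proof.
have [N EN] := sl2_nilE M; have := EN v.
elim: N c m v {EN} => [|N IH] c m v; first by move=> /= -> ; rewrite eqxx.
rewrite iterSr => EN nv Hv EFv; have [Ev|nEv] := eqVneq (E v) 0.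
  exists 0%N; move: EFv; rewrite (sl2_EF M) Ev F0 add0r Hv => /eqP.
  by rewrite -subr_eq0 -scalerBl scaler_eq0 (negPf nv) orbF subr_eq0 mul1r addr0 => /eqP.
have [||j jE] := IH (c + 2%:R) (m - c) (E v) EN nEv.
- exact: sl2_wtE.
- have -> : F (E v) = (m - c) *: v by rewrite scalerBl -EFv -Hv (sl2_EF M) addrK.
  by rewrite EZ.
exists j.+1; rewrite -[m](subrK c) jE -[j.+2]addn1 -[j.+1]addn1 !natrD.
ring.
Qed.

Lemma sl2_weight_int c v : v != 0 -> H v = c *: v -> exists z : int, c = z%:~R.
Proof.
have [N EN] := sl2_nilE M; have := EN v; elim: N c v {EN} => [|N IH] c v; first by move=> /= ->; rewrite eqxx.
rewrite iterSr => EN nv Hv; have [Ev|nEv] := eqVneq (E v) 0; last first.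
  have [z zE] := IH _ _ EN nEv (sl2_wtE Hv); exists (z - 2%:Z).
  by rewrite rmorphB /= -zE addrK.
have [M' FN] := sl2_nilF M.
have exj : exists j, iter j F v == 0 by exists M'; rewrite FN.
case: (ex_minnP exj) => -[|j] Fj minj; first by rewrite /= (negPf nv) in Fj.
have nFj : iter j F v != 0 by apply/negP => /minj; rewrite ltnn.
have Hk k : H (iter k F v) = (c - 2%:R * k%:R) *: iter k F v.
  elim: k => [|k IHk]; first by rewrite mulr0 subr0.
  rewrite iterS (sl2_wtF IHk) -addn1 natrD; congr (_ *: _); ring.
have EFk k : E (iter k.+1 F v) = (k.+1%:R * (c - k%:R)) *: iter k F v.
  elim: k => [|k IHk]; first by rewrite /= (sl2_EF M) Ev F0 add0r Hv subr0 mul1r.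
  rewrite iterS (sl2_EF M) IHk FZ Hk -iterS -scalerDl; congr (_ *: _).
  by rewrite -[k.+2]addn1 -[k.+1]addn1 !natrD; ring.
have := EFk j; rewrite (eqP Fj) E0 => /esym/eqP; rewrite scaler_eq0 (negPf nFj) orbF mulf_eq0.
rewrite (negPf (natr_neq0 charK _)) subr_eq0 => /eqP->; by exists j.
Qed.

End Module.

Section Module2.
Variables (W : lmodType K) (E F H : W -> W).
Hypothesis M : sl2_module E F H.
Let M' := sl2_module_sym M.
Let EZ a v : E (a *: v) = a *: E v. Proof. exact: linear_scale (sl2_EL M). Qed.
Let ED u v : E (u + v) = E u + E v. Proof. by have := sl2_EL M 1 u v; rewrite !scale1r. Qed.

(** E ^ i is injective on the space of weight -c for i <= c, because F^i E^i acts
    there with positive eigenvalues. *)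
Lemma sl2_injE (c i : nat) v : H v = - c%:R *: v -> (i <= c)%N -> iter i E v = 0 -> v = 0.
Proof.
have Hi k u : H u = - c%:R *: u -> H (iter k E u) = (- c%:R + 2%:R * k%:R) *: iter k E u.
  move=> Hu; elim: k => [|k IH]; first by rewrite mulr0 addr0.
  by rewrite iterS (sl2_wtE M IH) -addn1 natrD; congr (_ *: _); ring.
have FEi k u : H u = - c%:R *: u ->
    F (E (iter k E u)) = iter k E (F (E u)) + (k%:R * (c%:R - k%:R - 1)) *: iter k E u.
  move=> Hu; elim: k => [|k IH]; first by rewrite mul0r scale0r addr0.
  have -> : F (E (iter k.+1 E u)) = E (F (E (iter k E u))) - H (iter k.+1 E u).
    by rewrite iterS [in RHS](sl2_EF M) addrK.
  rewrite IH ED EZ (Hi k.+1 u Hu) -iterS -addrA -scaleNr -scalerDl -iterS; congr (_ + _ *: _).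
  by rewrite -addn1 natrD; ring.
have it0 k : iter k F 0 = 0.
  elim: k => //= k ->; have := sl2_FL M (-1) 0 0; rewrite scaler0 addr0 => e.
  by rewrite e scaleN1r addNr.
have main : forall i, (i <= c)%N -> forall u, H u = - c%:R *: u -> iter i F (iter i E u) = 0 -> u = 0.
  elim=> {i v}[//|i IH] ic u Hu.
  rewrite iterSr iterS FEi // => e; have {}e : iter i F (iter i E (F (E u) + (i%:R * (c%:R - i%:R - 1)) *: u)) = 0.
    have itE k a x y : iter k E (x + a *: y) = iter k E x + a *: iter k E y.
      by elim: k => //= k ->; rewrite ED EZ.
    by rewrite itE.
  have HFE : H (F (E u)) = - c%:R *: F (E u).
    by have := sl2_wtF M (sl2_wtE M Hu); rewrite addrK.
  have HD x y : H (x + y) = H x + H y.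
    have FD a b : F (a + b) = F a + F b by have := sl2_FL M 1 a b; rewrite !scale1r.
    by rewrite !(sl2_Hdef M) FD !ED FD opprD addrACA.
  have HZ a x : H (a *: x) = a *: H x.
    have FZ b y : F (b *: y) = b *: F y.
      have := sl2_FL M b y 0; rewrite !addr0 => ->; have := it0 1%N; rewrite /= => ->.
      by rewrite addr0.
    by rewrite !(sl2_Hdef M) FZ !EZ FZ scalerBr.
  have /eqP : F (E u) + (i%:R * (c%:R - i%:R - 1)) *: u = 0.
    apply: IH => //; first exact: ltnW.
    by rewrite HD HZ HFE Hu scalerDr !scalerA [_ * - _]mulrC.
  rewrite addr_eq0 -scaleNr => /eqP FEu; apply/eqP; apply: contraT => nu.
  have [|j] := sl2_eigenEF M' (c := c%:R) nu _ FEu; first by rewrite Hu scaleNr opprK.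
  move=> /eqP; rewrite eq_sym -addr_eq0 => /eqP.
  have -> : j.+1%:R * (c%:R + j%:R) + i%:R * (c%:R - i%:R - 1) = (j.+1 * (c + j) + i * (c - i - 1))%N%:R :> K.
    by rewrite natrD !natrM natrD -subnDA natrB ?natrD ?addn1 //; ring.
  move=> /eqP; rewrite (pcharf0P K).1 // addn_eq0 muln_eq0 /= addn_eq0.
  by case: (c) ic.
move=> Hv ic e; apply: (main i ic v Hv); by rewrite e it0.
Qed.

End Module2.

(** EF is injective on the space of weight d + 1, hence bijective by finiteness of
    the dimension. *)
Lemma sl2_surjE (W : vectType K) (E F H : W -> W) (U : {vspace W}) (d : nat) v :
  sl2_module E F H -> (forall u, u \in U -> E u \in U) -> (forall u, u \in U -> F u \in U) ->
  v \in U -> H v = d.+1%:R *: v ->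
  exists u, [/\ u \in U, H u = (d.+1%:R - 2%:R) *: u & E u = v].
Proof.
move=> M UE UF vU Hv.
have EL := sl2_EL M; have FL := sl2_FL M.
have EFL : linear (fun u => E (F u)) by move=> a x y; rewrite FL EL.
pose EF := GRing.isLinear.Build K W W _ (fun u => E (F u)) EFL.
pose EFl : {linear W -> W} := HB.pack (fun u => E (F u)) EF.
have HL : linear H by move=> a x y; rewrite !(sl2_Hdef M) FL !EL FL scalerBr opprD addrACA.
have H0 := linear_at0 HL.
have [|a x y|V VP] := @vspace_of_pred K W (fun u => u \in U /\ H u = d.+1%:R *: u).
- by rewrite mem0v scaler0.
- by move=> [xU Hx] [yU Hy]; rewrite rpredD ?rpredZ // HL Hx Hy scalerDr scalerA mulrC -scalerA.
pose f := linfun EFl.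
have fV u : u \in V -> f u \in V.
  move=> /VP [uU Hu]; apply/VP; rewrite lfunE /=; split; first by apply/UE/UF.
  by have := sl2_wtE M (sl2_wtF M Hu); rewrite subrK.
have finj u : u \in V -> f u = 0 -> u = 0.
  move=> /VP [uU Hu]; rewrite lfunE /= => fu; apply/eqP; apply: contraT => nu.
  have [|j] := sl2_eigenEF M (m := 0) nu Hu; first by rewrite fu scale0r.
  by move/esym/eqP; rewrite mulf_eq0 -natrD !(pcharf0P K).1.
have fVE : (f @: V = V)%VS.
  apply/eqP; rewrite eqEdim; apply/andP; split.
    by apply/subvP => _ /memv_imgP [u uV ->]; apply: fV.
  rewrite limg_dim_eq //; apply/eqP; rewrite -subv0; apply/subvP => u; rewrite memv_cap memv_ker => /andP[uV /eqP fu].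
  by rewrite memv0 (finj u).
have : v \in V by apply/VP.
rewrite -fVE => /memv_imgP [u /VP [uU Hu] ->]; exists (F u); rewrite lfunE /=; split=> //.
  exact: UF.
exact: (sl2_wtF M Hu).
Qed.

Section MatrixSl2.
Variable n : nat.
Implicit Types (e h f x y : 'M[K]_n).

Lemma sl2_module_ad e h f : sl2_triple e h f -> nilp e -> nilp f ->
  sl2_module (bracket e) (bracket f) (bracket h).
Proof.
move=> [he hf ef] ne nf; split.
- exact: bracket_linear_r.
- exact: bracket_linear_r.
- by move=> v; rewrite jacobi he bracketZl addrC.
- by move=> v; rewrite jacobi hf bracketNl bracketZl addrC.
- by move=> v; rewrite jacobi ef addrC.
- exact: ad_nilp.
- exact: ad_nilp.
Qed.

Lemma sl2_module_vect e h f : sl2_triple e h f -> nilp e -> nilp f ->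
  sl2_module (mulmx e : 'cV[K]_n -> 'cV[K]_n) (mulmx f) (mulmx h).
Proof.
move=> [he hf ef] ne nf.
have it x (v : 'cV[K]_n) k : iter k (mulmx x) v = x ^+ k *m v.
  by elim: k => [|k IH] /=; rewrite ?expr0 ?mul1mx // IH mulmxA mulmxE -exprS.
have B x y (v : 'cV[K]_n) : x *m (y *m v) = y *m (x *m v) + bracket x y *m v.
  by rewrite /bracket mulmxBl !mulmxA addrC subrK.
split.
- by move=> a u v; rewrite mulmxDr -scalemxAr.
- by move=> a u v; rewrite mulmxDr -scalemxAr.
- by move=> v; rewrite B he -scalemxAl.
- by move=> v; rewrite B hf mulNmx -scalemxAl.
- by move=> v; rewrite B ef.
- by have [N eN] := ne; exists N => v; rewrite it eN mul0mx.
- by have [N eN] := nf; exists N => v; rewrite it eN mul0mx.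
Qed.

Lemma bracket_dg (P x : 'M[K]_n) d : P \in unitmx ->
  P *m bracket (dg P d) x *m invmx P = \matrix_(i, j) ((d 0 i - d 0 j) * (P *m x *m invmx P) i j).
Proof.
move=> uP; rewrite /bracket /dg mulmxBr mulmxBl; apply/matrixP => i j; rewrite [RHS]mxE mulrBl mxE.
congr (_ + _).
  by rewrite !mulmxA mulmxV // mul1mx -!mulmxA mul_diag_mx mxE.
rewrite [LHS]mxE; congr (- _).
transitivity (((P *m x *m invmx P) *m diag_mx d) i j); first by rewrite !mulmxA mulmxK.
by rewrite mul_mx_diag mxE mulrC.
Qed.

(** The eigenvalues form a finite set, so repeated shifts by c leave it. *)
Lemma nilp_shift (P x : 'M[K]_n) d c : P \in unitmx -> c != 0 ->
  bracket (dg P d) x = c *: x -> nilp x.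
Proof.
move=> uP c0 hx; have hxk k : bracket (dg P d) (x ^+ k) = (k%:R * c) *: x ^+ k.
  elim: k => [|k IH]; first by rewrite expr0 mul0r scale0r /bracket mulmx1 mul1mx subrr.
  have BM (a u v : 'M[K]_n) : bracket a (u *m v) = bracket a u *m v + u *m bracket a v.
    by rewrite /bracket mulmxBl mulmxBr !mulmxA addrA subrK.
  rewrite exprS -[_ * _]/(_ *m _) BM hx IH -scalemxAl -scalemxAr -scalerDl -add1n natrD.
  by congr (_ *: _); ring.
apply: contrapT => nx.
have ex (k : 'I_(n * n).+1) : exists p : 'I_n * 'I_n, d 0 p.1 - d 0 p.2 = k%:R * c.
  apply: contrapT => nex; apply: nx; exists k; apply/eqP; apply: contraT => nxk.
  have : P *m x ^+ k *m invmx P != 0.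
    apply: contra nxk => /eqP e; rewrite -[x ^+ k](mulKmx uP) -[P *m _](mulmxKV uP) e.
    by rewrite mul0mx mulmx0.
  case/matrix0Pn => i [j ne]; case: nex; exists (i, j) => /=.
  have := bracket_dg (x ^+ k) d uP; rewrite hxk -scalemxAr -scalemxAl => /matrixP/(_ i j).
  by rewrite [LHS]mxE [RHS]mxE => /(mulIf ne).
pose p k := projT1 (cid (ex k)); have pE k : d 0 (p k).1 - d 0 (p k).2 = k%:R * c := projT2 (cid (ex k)).
have pinj : injective p.
  move=> k l kl; have := pE k; rewrite kl pE => /(mulIf c0)/(natr_inj charK) e.
  by apply/val_inj.
by have := leq_card p pinj; rewrite card_ord card_prod card_ord ltnn.
Qed.

End MatrixSl2.
End Sl2.

(** * The centralizer of the torus and the roots *)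

Section Centralizer.
Variable (K : closedFieldType).
Hypothesis charK : [pchar K] =i pred0.
Variables (n : nat) (G T : set 'M[K]_n).
Hypotheses (hG : almost_simple G) (hT : maximal_torus G T).
Variables (P : 'M[K]_n) (r : nat) (b : 'I_n -> 'I_r -> int).
Hypotheses (uP : P \in unitmx)
  (TP : forall t, T t <-> exists2 z, (forall i, z i != 0) & t = dg P (monorow b z)).
Implicit Types (x y z : 'M[K]_n).

Let aG : algebraic_group G. Proof. by case: hG. Qed.
Let mG : monoid_mx G. Proof. exact: subgroup_monoid aG.1. Qed.
Let tT : torus T. Proof. by case: hT. Qed.
Let TG : T `<=` G. Proof. by case: hT. Qed.
Let aT : algebraic_group T. Proof. by case: tT. Qed.
Let mT : monoid_mx T. Proof. exact: subgroup_monoid aT.1. Qed.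

Fact cc_subproof : {c : 'M[K]_n -> 'M[K]_n | forall x, c x = P *m x *m invmx P}.
Proof. by exists (fun x => P *m x *m invmx P). Qed.

(** The matrix of x in the basis diagonalizing T, sealed against unfolding. *)
Definition cc := sval cc_subproof.

Lemma ccE x : cc x = P *m x *m invmx P. Proof. exact: (svalP cc_subproof). Qed.

Lemma cc_linear a x y : cc (a *: x + y) = a *: cc x + cc y.
Proof. by rewrite !ccE mulmxDr mulmxDl -scalemxAr -scalemxAl. Qed.

Lemma cc_mul x y : cc (x *m y) = cc x *m cc y.
Proof. by rewrite !ccE !mulmxA mulmxKV. Qed.

Lemma cc_inj x y : cc x = cc y -> x = y.
Proof.
move=> e; have E z : z = invmx P *m cc z *m P by rewrite ccE !mulmxA mulVmx // mul1mx mulmxKV.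
by rewrite (E x) e -E.
Qed.

Lemma cc0 : cc 0 = 0. Proof. by rewrite ccE mulmx0 mul0mx. Qed.

Lemma polyfun_cc i j : polyfun (fun x => cc x i j).
Proof.
apply: (eq_polyfun (F := fun x => (P *m x *m invmx P) i j)); first by move=> x; rewrite ccE.
exact: polymap_conj.
Qed.

Lemma cc_dg d : cc (dg P d) = diag_mx d. Proof. by rewrite ccE dg_coord. Qed.

Lemma cc_bracket d x i j : cc (bracket (dg P d) x) i j = (d 0 i - d 0 j) * cc x i j.
Proof. by rewrite !ccE bracket_dg // mxE. Qed.

Lemma ccdg d i j : cc (dg P d) i j = d 0 i *+ (i == j).
Proof. by rewrite cc_dg mxE. Qed.

Lemma ccdgE x : (forall i j, i != j -> cc x i j = 0) -> x = dg P (\row_j cc x j j).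
Proof.
move=> x0; apply: cc_inj; apply/matrixP => i j; rewrite ccdg [X in X *+ _]mxE.
by case: eqVneq => [->|/x0 ->].
Qed.

Lemma lie_linear_functional H (F : 'M[K]_n -> K) x : polyfun F ->
  (forall a u v, F (a *: u + v) = a * F u + F v) -> H 1%:M -> (forall h, H h -> F h = 0) ->
  Lie H x -> F x = 0.
Proof.
move=> [p pE] FL H1 F0 Lx; have Ip : vanishing_ideal H p by move=> h Hh; rewrite -pE F0.
have := Lx p Ip; rewrite mxderiv_line.
have -> : pcomp p (line 1%:M x) = F x *: 'X; last by rewrite derivZ derivX hornerZ hornerC mulr1.
apply: (poly_evalP charK) => s; rewrite pcompE -pE line_eval addrC FL (F0 _ H1) addr0.
by rewrite hornerZ hornerX mulrC.
Qed.

Lemma ccD x y i j : cc (x + y) i j = cc x i j + cc y i j.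
Proof. by have := cc_linear 1 x y; rewrite !scale1r => ->; rewrite mxE. Qed.

Lemma lie_torus_diag x : Lie T x -> x = dg P (\row_j cc x j j).
Proof.
move=> Lx; apply: ccdgE => i j ij; apply: (lie_linear_functional (polyfun_cc i j) _ mT.1 _ Lx).
  by move=> a u v; rewrite cc_linear !mxE.
by move=> _ /TP [z _ ->]; rewrite ccdg (negPf ij).
Qed.

Definition cochar i : 'rV[K]_n := \row_j (b j i)%:~R.

Lemma lie_cochar i : Lie T (dg P (cochar i)).
Proof. exact: lie_one_param_torus. Qed.

(** Integral relations between the differentials of weights hold for the weights
    themselves. *)
Lemma torus_relation (m : 'I_n -> int) t :
  (forall x, Lie T x -> \sum_j (m j)%:~R * cc x j j = 0) -> T t ->
  \prod_j cc t j j ^ m j = 1.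
Proof.
move=> rel /TP [z nz ->].
have mb i : \sum_j b j i * m j = 0.
  apply: (intr_injK charK); rewrite /= -[RHS](rel _ (lie_cochar i)) rmorph_sum.
  by apply: eq_bigr => j _; rewrite ccdg eqxx mulr1n mxE rmorphM mulrC.
transitivity (\prod_j \prod_i z i ^ (b j i * m j)).
  apply: eq_bigr => j _; rewrite ccdg eqxx mulr1n mxE -prodz_exp; apply: eq_bigr => i _.
  by rewrite exprz_exp.
rewrite exchange_big big1 //= => i _; rewrite prodz_sum //.
by rewrite mb expr0z.
Qed.

Lemma torus_weight_eq k l : (forall x, Lie T x -> cc x k k = cc x l l) ->
  forall t, T t -> cc t k k = cc t l l.
Proof.
move=> e t Tt; have := @torus_relation (fun j => (j == k)%:R - (j == l)%:R) t _ Tt.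
have nz j : cc t j j != 0.
  by move/TP: Tt => [z nz ->]; rewrite ccdg eqxx mulr1n mxE; apply: prodz_neq0.
have E (F : 'I_n -> K) i : \sum_j ((j == i)%:R : int)%:~R * F j = F i.
  rewrite (bigD1 i) //= eqxx mul1r big1 ?addr0 // => j /negPf->; by rewrite mul0r.
have -> : \prod_j cc t j j ^ ((j == k)%:R - (j == l)%:R) = cc t k k / cc t l l.
  under eq_bigr => j _ do rewrite expfzDr //.
  rewrite big_split /= (bigD1 k) //= eqxx expr1z big1 ?mulr1; last by move=> j /negPf->; rewrite expr0z.
  rewrite (bigD1 l) //= eqxx big1 ?mulr1; last by move=> j /negPf->; rewrite oppr0 expr0z.
  by rewrite -exprz_inv expr1z.
move=> H; apply: (divIf (nz l)); rewrite H ?divff //.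
move=> x Lx; under eq_bigr => j _ do rewrite rmorphB /= mulrBl.
by rewrite sumrB !E e // subrr.
Qed.

Lemma Ad_torus t x i j : T t -> cc (Ad t x) i j = cc t i i / cc t j j * cc x i j.
Proof.
move=> /TP [z nz ->]; have nzr k : monorow b z 0 k != 0 by rewrite mxE; apply: prodz_neq0.
rewrite /Ad dg_inv // 2!cc_mul !cc_dg mul_mx_diag mul_diag_mx !mxE !eqxx !mulr1n; ring.
Qed.

Lemma comm_torus_block x : (forall t, T t -> bracket x t = 0) ->
  forall i j, cc x i j != 0 -> forall t, T t -> cc t i i = cc t j j.
Proof.
move=> cx i j nx t Tt; have := cx t Tt; have /TP [z nz ->] := Tt.
rewrite bracketC => /eqP; rewrite oppr_eq0 => /eqP e.
have := cc_bracket (monorow b z) x i j; rewrite e cc0 [X in X = _ -> _]mxE => /esym/eqP; rewrite mulf_eq0 (negPf nx) orbF subr_eq0 => /eqP.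
by rewrite !ccdg !eqxx.
Qed.

Let pr j := dg P (\row_k (`[< forall t, T t -> cc t k k = cc t j j >])%:R : 'rV[K]_n).

Let pr_comm j x : (forall t, T t -> bracket x t = 0) -> bracket (pr j) x = 0.
Proof.
move=> cx; apply: cc_inj; rewrite cc0; apply/matrixP => k l.
rewrite cc_bracket !mxE; have [->|nx] := eqVneq (cc x k l) 0; first by rewrite mulr0.
have e := comm_torus_block cx nx.
have -> : `[< forall t, T t -> cc t k k = cc t j j >] = `[< forall t, T t -> cc t l l = cc t j j >].
  by apply: asbool_equiv_eq; split=> h t Tt; rewrite -h // e.
by rewrite subrr mul0r.
Qed.

Let tr_pr j x : Lie T x -> \tr (pr j *m x) =
  (\sum_k (`[< forall t, T t -> cc t k k = cc t j j >])%:R) * cc x j j.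
Proof.
move=> Lx; rewrite {1}(lie_torus_diag Lx) dg_mul // trace_dg // mulr_suml; apply: eq_bigr => k _.
rewrite !mxE; case: asboolP => [e|_]; rewrite ?mul0r // !mul1r.
apply: subr0_eq.
apply: (lie_linear_functional (F := fun x => cc x k k - cc x j j) _ _ mT.1 _ Lx).
- by apply: polyfunB; apply: polyfun_cc.
- by move=> a u v; rewrite cc_linear !mxE mulrBr opprD addrACA.
by move=> t Tt; rewrite e // subrr.
Qed.

Definition centT x := Lie G x /\ forall t, T t -> bracket x t = 0.

Lemma centT_semisimple_part x : centT x -> exists s m,
  [/\ Lie T s, x = s + m, bracket s m = 0, nilp m & centT m].
Proof.
move=> [Lx cx]; have [P' [m [d [uP' xE cm nm cs]]]] := jordan_decomposition x.
have Ls : Lie G (dg P' d) by apply: (lie_semisimple_part charK uP' mG _ cm nm); rewrite -xE.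
have cst t : T t -> bracket (dg P' d) t = 0.
  by move=> Tt; rewrite bracketC cs ?oppr0 // bracketC cx ?oppr0.
exists (dg P' d), m; split=> //.
  exact: (maximal_torus_semisimple charK aG hT uP').
have mE : m = x - dg P' d by rewrite xE addrAC subrr add0r.
split; first by rewrite mE; apply: lie_sub.
by move=> t Tt; rewrite mE bracketBl cx // cst // subrr.
Qed.

(** Nilpotent elements of the centralizer are orthogonal to it: adding one to y
    does not change the semisimple part of y, hence not the trace of y^2. *)
Lemma centT_nilp_orthogonal x y : centT x -> nilp x -> centT y -> \tr (x *m y) = 0.
Proof.
move=> Cx nx Cy; have Cxy : centT (x + y).
  split=> [|t Tt]; first by apply: lieD; [case: Cx|case: Cy].
  by rewrite bracketDl Cx.2 // Cy.2 // addr0.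
have [s [m [Ls yE cm nm Cm]]] := centT_semisimple_part Cy.
have [s' [m' [Ls' xyE cm' nm' Cm']]] := centT_semisimple_part Cxy.
have tr0 j u : centT u -> nilp u -> \tr (pr j *m u) = 0.
  by move=> Cu nu; apply: (trace_eq_eigen _ nu); apply: pr_comm Cu.2.
have ss : s' = s.
  rewrite (lie_torus_diag Ls) (lie_torus_diag Ls'); congr dg; apply/rowP => j; rewrite !mxE.
  have : \tr (pr j *m s') = \tr (pr j *m s).
    have -> : s' = x + s + (m - m') by rewrite -(addrK m' s') -xyE yE !addrA.
    rewrite !mulmxDr !linearD /= mulmxN linearN /= (tr0 _ x) ?(tr0 _ m) ?(tr0 _ m') //.
    by rewrite subrr addr0 add0r.
  rewrite (tr_pr j Ls') (tr_pr j Ls); apply: mulfI; rewrite -natr_sum (pcharf0P K).1 // -lt0n.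
  rewrite (bigD1 j) //=; have -> : `[< forall t, T t -> cc t j j = cc t j j >] by apply/asboolP.
  by [].
have tr2 u v : bracket u v = 0 -> nilp v -> \tr ((u + v) *m (u + v)) = \tr (u *m u).
  move=> cuv nv; rewrite mulmxDl !mulmxDr !linearD /= (trace_eq_eigen cuv nv) addr0.
  have /eqP := cuv; rewrite subr_eq0 => /eqP <-; rewrite (trace_eq_eigen cuv nv) add0r.
  by rewrite (nilp_trace (nilpM _ nv)) ?addr0.
have : \tr ((x + y) *m (x + y)) = \tr (y *m y).
  by rewrite {1 2}xyE ss {1 2}yE !tr2 //; rewrite -ss.
rewrite mulmxDl !mulmxDr !linearD /= (nilp_trace (nilpM _ nx)) // add0r mxtrace_mulC addrA.
move=> /eqP; rewrite -subr_eq0 addrK -mulr2n -mulr_natl mulf_eq0 (negPf (natr_neq0 charK 1)) /=.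
by rewrite mxtrace_mulC => /eqP.
Qed.

Definition wcomp (e : {ffun 'I_r -> int}) x : 'M[K]_n :=
  invmx P *m (\matrix_(i, j) (cc x i j *+ ([ffun k => b i k - b j k] == e))) *m P.

Lemma cc_wcomp e x i j : cc (wcomp e x) i j = cc x i j *+ ([ffun k => b i k - b j k] == e).
Proof. by rewrite [in LHS]ccE /wcomp !mulmxA mulmxV // mul1mx mulmxK // mxE. Qed.

Definition weights : seq {ffun 'I_r -> int} :=
  undup [seq [ffun k => b p.1 k - b p.2 k] | p <- enum (('I_n * 'I_n)%type : finType)].

Lemma cc_sum I (s : seq I) (F : I -> 'M[K]_n) i j :
  cc (\sum_(k <- s) F k) i j = \sum_(k <- s) cc (F k) i j.
Proof. by elim: s => [|k s IH]; rewrite ?big_nil ?cc0 ?mxE // !big_cons ccD IH. Qed.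

Lemma ccZ a x i j : cc (a *: x) i j = a * cc x i j.
Proof. by have := cc_linear a x 0; rewrite addr0 cc0 addr0 => ->; rewrite mxE. Qed.

Lemma wcomp_sum x : x = \sum_(e <- weights) wcomp e x.
Proof.
apply: cc_inj; apply/matrixP => i j.
rewrite cc_sum.
rewrite (bigD1_seq [ffun k => b i k - b j k]) ?undup_uniq //=.
  rewrite cc_wcomp eqxx mulr1n big1 ?addr0 // => e; rewrite eq_sym cc_wcomp => /negPf->.
  by rewrite mulr0n.
by rewrite mem_undup; apply/mapP; exists (i, j); rewrite ?mem_enum.
Qed.

Lemma wcomp_stable (U : 'M[K]_n -> Prop) x : U 0 ->
  (forall a u w, U u -> U w -> U (a *: u + w)) -> (forall t, T t -> U (Ad t x)) ->
  forall e, U (wcomp e x).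
Proof.
move=> U0 UL UT e; case ee: (e \in weights); last first.
  suff -> : wcomp e x = 0 by [].
  apply: cc_inj; rewrite cc0; apply/matrixP => i j; rewrite cc_wcomp mxE.
  case: eqP => [eE|_]; last by rewrite mulr0n.
  move/negP: ee; case; rewrite -eE mem_undup.
  by apply/mapP; exists (i, j); rewrite ?mem_enum.
apply: (@character_independence K _ mulmx (@diagonal_torus K r) 'M[K]_n U _ weights (@laurent K r) (wcomp^~ x)) => //.
- exact: diagonal_torusM.
- exact: undup_uniq.
- by move=> i y z _; apply: laurentM.
- move=> i _; have D1 : @diagonal_torus K r 1%:M by split; [apply: scalar_mx_is_diag|apply: unitmx1].
  by exists 1%:M => //; apply: laurent_neq0.
- by move=> i j _ _; apply: laurent_sep.
move=> d Dd; pose z i := d i i; have nz i : z i != 0 by apply: diagonal_torus_neq0.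
have Tt : T (dg P (monorow b z)) by apply/TP; exists z.
suff <- : Ad (dg P (monorow b z)) x = \sum_(i <- weights) laurent i d *: wcomp i x by apply: UT.
apply: cc_inj; apply/matrixP => i j; rewrite Ad_torus //.
rewrite cc_sum; under eq_bigr => k _ do rewrite ccZ.
rewrite (bigD1_seq [ffun k => b i k - b j k]) ?undup_uniq //=; last first.
  by rewrite mem_undup; apply/mapP; exists (i, j); rewrite ?mem_enum.
rewrite cc_wcomp eqxx mulr1n big1 ?addr0 => [|a]; last first.
  by rewrite eq_sym cc_wcomp => /negPf->; rewrite mulr0n mulr0.
congr (_ * _); rewrite !ccdg !eqxx !mulr1n !mxE /laurent -prodfV -big_split /=.
apply: eq_bigr => k _; rewrite ffunE (expfzDr _ _ (nz k)). by rewrite invr_expz.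
Qed.

Lemma wcomp_lie e x : Lie G x -> Lie G (wcomp e x).
Proof.
move=> Lx; apply: wcomp_stable; first exact: lie0.
  by move=> a u w; apply: lie_linear.
by move=> t Tt; apply: lie_conj => //; [case: aG|apply: TG].
Qed.

Lemma wcomp_Ad e x (z : 'I_r -> K) : (forall i, z i != 0) ->
  Ad (dg P (monorow b z)) (wcomp e x) = (\prod_i z i ^ e i) *: wcomp e x.
Proof.
move=> nz; have Tt : T (dg P (monorow b z)) by apply/TP; exists z.
apply: cc_inj; apply/matrixP => i j; rewrite Ad_torus //.
rewrite ccZ cc_wcomp; case: eqP => [eE|]; rewrite ?mulr0n ?mulr0 // mulr1n; congr (_ * _).
rewrite !ccdg !eqxx !mulr1n !mxE -prodfV -big_split /=.
by apply: eq_bigr => k _; rewrite -eE ffunE expfzDr // invr_expz.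
Qed.

(** The semisimple part lies in the Lie algebra of T by maximality; the nilpotent
    part is orthogonal to the centralizer, hence to all of the Lie algebra. *)
Lemma centT_lie x : centT x -> Lie T x.
Proof.
move=> Cx; have [s [m [Ls xE cm nm Cm]]] := centT_semisimple_part Cx.
suff m0 : m = 0 by rewrite xE m0 addr0.
apply: (trace_nondegenerate charK hG Cm.1) => y Ly.
rewrite (wcomp_sum y) mulmx_sumr raddf_sum big1 //= => e _.
have [[z [nz ne]]|nex] := pselect (exists z : 'I_r -> K, (forall i, z i != 0) /\ \prod_i z i ^ e i != 1).
  set t := dg P (monorow b z); have Tt : T t by apply/TP; exists z.
  have ut : t \in unitmx by case: aT => -[+ _ _ _] _; apply.
  have tm : Ad t m = m.
    by have /eqP := Cm.2 t Tt; rewrite subr_eq0 => /eqP e1; rewrite /Ad -e1 mulmxK.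
  have : \tr (m *m wcomp e y) = (\prod_i z i ^ e i) * \tr (m *m wcomp e y).
    by rewrite -{1}(trace_Ad _ ut) Ad_mul // tm wcomp_Ad // -scalemxAr linearZ.
  move=> /eqP; rewrite -subr_eq0 -{1}[\tr _]mul1r -mulrBl mulf_eq0 subr_eq0 eq_sym (negPf ne) /=.
  by move/eqP.
apply: centT_nilp_orthogonal Cm nm _; split; first exact: wcomp_lie.
move=> t /TP [z nz tE]; have := wcomp_Ad e y nz; rewrite -tE.
have -> : \prod_i z i ^ e i = 1.
  by apply: contrapT => /eqP ne; apply: nex; exists z.
have ut : t \in unitmx by rewrite tE; apply: dg_unit => // j; rewrite mxE; apply: prodz_neq0.
rewrite scale1r /Ad => /(congr1 (mulmx^~ t)); rewrite mulmxKV // => e1.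
by rewrite /bracket e1 subrr.
Qed.

Lemma lie_torus_comm x t : Lie T x -> T t -> bracket x t = 0.
Proof.
by move=> /lie_torus_diag -> /TP [z _ ->]; rewrite /bracket !dg_mul //; apply/eqP; rewrite subr_eq0;
  apply/eqP; congr dg; apply/rowP => j; rewrite !mxE mulrC.
Qed.

Definition wchr (k l : 'I_n) : chr K n := fun t => if `[< T t >] then cc t k k / cc t l l else 0.

Lemma wchrE k l t : T t -> wchr k l t = cc t k k / cc t l l.
Proof. by move=> Tt; rewrite /wchr; case: asboolP. Qed.

Lemma cc_torus_neq0 t j : T t -> cc t j j != 0.
Proof. by move=> /TP [z nz ->]; rewrite ccdg eqxx mulr1n mxE; apply: prodz_neq0. Qed.

Lemma wchr_character k l : character T (wchr k l).
Proof.
split=> [x nT|t Tt|s t Ts Tt|].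
- by rewrite /wchr; case: asboolP.
- by rewrite wchrE // mulf_neq0 ?invr_eq0 ?cc_torus_neq0.
- rewrite !wchrE //; last exact: mT.2.
  have E j : cc (s *m t) j j = cc s j j * cc t j j.
    move/TP: Ts => [z nz ->]; rewrite cc_mul cc_dg mul_diag_mx !mxE.
    by rewrite eqxx mulr1n.
  rewrite !E; have := cc_torus_neq0 l Ts; have := cc_torus_neq0 l Tt.
  move: (cc s k k) (cc s l l) (cc t k k) (cc t l l) => u1 u2 u3 u4 h4 h2.
  by field; apply/andP.
pose F (A : 'M[K]_(n, n + n)) := cc (lsubmx A) k k * cc (rsubmx A) l l.
apply: (@regular_on_polyfun _ _ _ _ F).
  apply: polyfunM.
    by apply: (polyfun_comp (f := @lsubmx _ _ _ _) (F := fun A => cc A k k)); [exact: polymap_lsub|exact: polyfun_cc].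
  by apply: (polyfun_comp (f := @rsubmx _ _ _ _) (F := fun A => cc A l l)); [exact: polymap_rsub|exact: polyfun_cc].
move=> t Tt; rewrite wchrE // /F row_mxKl row_mxKr; congr (_ * _).
move/TP: Tt => [z nz ->]; rewrite dg_inv //; last by move=> j; rewrite mxE; apply: prodz_neq0.
by rewrite !ccdg !eqxx !mulr1n !mxE.
Qed.

Lemma root_wchr a x : root_space G T a x -> x <> 0 -> character T a ->
  exists k l, cc x k l != 0 /\ a = wchr k l.
Proof.
move=> [Lx xa] nx [a0 _ _ _]; have nc : cc x != 0 by apply/eqP => e; apply: nx; apply: cc_inj; rewrite e cc0.
case/matrix0Pn: nc => k [l ne]; exists k, l; split=> //; apply/funext => t.
case: (pselect (T t)) => Tt; last by rewrite a0 // /wchr; case: asboolP.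
have := congr1 (fun y => cc y k l) (xa t Tt); rewrite /= Ad_torus //.
rewrite ccZ => /(mulIf ne).
by rewrite wchrE.
Qed.

(** Differentiating Ad t x = a(t) x. *)
Lemma chr_diff_bracket a x h : root_space G T a x -> character T a -> Lie T h ->
  bracket h x = chr_diff T a h *: x.
Proof.
move=> [Lx xa] [_ _ _ areg] Lh; rewrite /chr_diff; case: xgetP => [_ -> [p pa ->]|none]; last first.
  have [p pa] := areg; case: (none (mxderiv p (row_mx 1%:M 1%:M) (row_mx h (- h)))).
  by exists p.
have subT : T `<=` [set g | g \in unitmx] by case: aT => -[].
apply/matrixP => i j.
have [q qE] : polyfun (fun A : 'M[K]_(n, n + n) => (lsubmx A *m x *m rsubmx A) i j).
  apply: polymap_mul; last exact: polymap_rsub.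
  by apply: polymap_mul; [exact: polymap_lsub|exact: polymap_cst].
have := @regular_deriv0 _ charK n T h (q - (x i j)%:MP * p) subT mT.1 _ Lh.
rewrite -[- _]mulN1r -[-1]/(- 1%:MP) -mpolyCN mxderivD !mxderivM !mxderivC /mxeval !mevalC -!/(mxeval _ _).
rewrite !mul0r !add0r mulN1r => H.
have : mxderiv q (row_mx 1%:M 1%:M) (row_mx h (- h)) = (bracket h x) i j.
  rewrite mxderiv_line.
  have -> : pcomp q (line (row_mx 1%:M 1%:M) (row_mx h (- h))) =
     (x i j)%:P + (bracket h x) i j *: 'X - (h *m x *m h) i j *: 'X^2.
    apply: (poly_evalP charK) => t; rewrite pcompE -qE line_eval scale_row_mx add_row_mx row_mxKl row_mxKr.
    have -> : (1%:M + t *: h) *m x *m (1%:M + t *: - h) = x + t *: bracket h x - (t ^+ 2) *: (h *m x *m h).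
      rewrite scalerN mulmxDl mul1mx mulmxDr mulmx1 mulmxN mulmxDl -!scalemxAl -!scalemxAr scalerA -expr2.
      rewrite /bracket scalerBr; move: (h *m x *m h) (h *m x) (x *m h) => u1 u2 u3.
      by rewrite opprD !addrA.
    by move: (bracket h x) (h *m x *m h) => u1 u2; rewrite !mxE !hornerE; rewrite /=; ring.
  rewrite !derivE !hornerE /=; ring.
move=> E; rewrite -E [RHS]mxE mulrC; apply: subr0_eq; apply: H.
move=> t Tt; rewrite /mxeval mevalD !mevalM !mevalC mulN1r -!/(mxeval _ _) -qE row_mxKl row_mxKr -pa //.
by have := xa t Tt; rewrite /Ad => ->; rewrite mxE mulrC subrr.
Qed.

End Centralizer.

(** * Derived groups and regular functions *)

Section Groups.
Variables (K : closedFieldType).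
Hypothesis charK : [pchar K] =i pred0.
Variable n : nat.
Implicit Types (H A : set 'M[K]_n) (x y g u : 'M[K]_n).

(** The level set of one value and the union of the others are both closed. *)
Lemma regular_finite_const A (F : 'M[K]_(n, n + n) -> K) (s : seq K) : polyfun F ->
  A `<=` [set g | g \in unitmx] -> zconnected A ->
  (forall g, A g -> F (row_mx g (invmx g)) \in s) ->
  forall g g', A g -> A g' -> F (row_mx g (invmx g)) = F (row_mx g' (invmx g')).
Proof.
move=> [p pE] Au cA Fs g0 g' A0 A'; have [N [q [qE _]]] := clear_det charK p.
pose v := F (row_mx g0 (invmx g0)).
pose f w g := mxeval q g - w * \det g ^+ N.
have pf w : polyfun (f w).
  apply: polyfunB; first exact: polyfun_mxeval.
  by apply: polyfunM; [apply: polyfun_cst|apply: polyfunX; apply: polyfun_det; apply: polymap_id].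
have f0 w g : A g -> (f w g == 0) = (F (row_mx g (invmx g)) == w).
  move=> Ag; have ug := Au _ Ag; rewrite /f qE // -pE [w * _]mulrC -mulrBr mulf_eq0 subr_eq0.
  by rewrite expf_eq0 [X in _ && X](_ : _ = false) ?andbF // -[X in X = _]negbK -unitfE -unitmxE ug.
have [||||H|H] := cA [set g | forall i : unit, True -> f v g = 0]
  [set g | forall i : unit, True -> \prod_(w <- s | w != v) f w g = 0].
- by apply: zclosed_zeros => _ _; apply: pf.
- by apply: zclosed_zeros => _ _; apply: polyfun_prod => w _; apply: pf.
- move=> g Ag; have [e|ne] := eqVneq (F (row_mx g (invmx g))) v.
    by left=> _ _; apply/eqP; rewrite f0 // e.
  right=> _ _; apply/eqP; rewrite prodf_seq_eq0; apply/hasP; exists (F (row_mx g (invmx g))); first exact: Fs.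
  by rewrite ne f0 // eqxx.
- apply/seteqP; split=> // g [[Ag /(_ tt I)/eqP C] /(_ tt I)/eqP].
  rewrite prodf_seq_eq0 => /hasP [w _ /andP [wv]]; move: C; rewrite !f0 // => /eqP ->.
  by rewrite eq_sym (negPf wv).
- have : (A `&` [set g | forall i : unit, True -> f v g = 0]) g0.
    by split=> // _ _; apply/eqP; rewrite f0.
  by rewrite H.
have [e|ne] := eqVneq (F (row_mx g' (invmx g'))) v; first by rewrite e.
have : (A `&` [set g | forall i : unit, True -> \prod_(w <- s | w != v) f w g = 0]) g'.
  split=> // _ _; apply/eqP; rewrite prodf_seq_eq0; apply/hasP; exists (F (row_mx g' (invmx g'))); first exact: Fs.
  by rewrite ne f0 // eqxx.
by rewrite H.
Qed.

Lemma derived_comm H x y : H x -> H y -> derived_group H (x *m y *m invmx x *m invmx y).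
Proof. by move=> Hx Hy L _; apply. Qed.

Lemma derived_sub H L : subgroup_GL L ->
  (forall x y, H x -> H y -> L (x *m y *m invmx x *m invmx y)) -> derived_group H `<=` L.
Proof. by move=> sL Hc x; apply. Qed.

Lemma derived_mono H H' : H `<=` H' -> derived_group H `<=` derived_group H'.
Proof. by move=> HH x Hx L sL Lc; apply: Hx => // y z /HH Hy /HH Hz; apply: Lc. Qed.

Lemma iter_derived_mono k H H' : H `<=` H' -> iter k (@derived_group K n) H `<=` iter k (@derived_group K n) H'.
Proof. by elim: k => //= k IH HH; apply: derived_mono; apply: IH. Qed.

Lemma unit_subgroup : subgroup_GL [set g : 'M[K]_n | g \in unitmx].
Proof.
by split=> //= [|g g' ug ug'|g ug]; rewrite ?unitmx1 ?unitmx_mul ?unitmx_inv ?ug.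
Qed.

Lemma derived_subgroup H : H `<=` [set g | g \in unitmx] -> subgroup_GL (derived_group H).
Proof.
move=> Hu; split.
- apply: derived_sub; first exact: unit_subgroup.
  by move=> x y /Hu /= ux /Hu /= uy; rewrite !unitmx_mul !unitmx_inv ux uy.
- by move=> L [].
- by move=> g g' Hg Hg' L sL Lc; have [_ _ + _] := sL; apply; [apply: Hg|apply: Hg'].
by move=> g Hg L sL Lc; have [_ _ _ +] := sL; apply; apply: Hg.
Qed.

Lemma iter_derived_subgroup k H : subgroup_GL H -> subgroup_GL (iter k (@derived_group K n) H).
Proof. by move=> sH; elim: k => //= k [Hu _ _ _]; apply: derived_subgroup. Qed.

(** Commutators of a closure lie in the closure of the commutators, one variable
    at a time. *)
Lemma derived_alg_closure H : subgroup_GL H -> derived_group (alg_closure H) `<=` alg_closure (derived_group H).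
Proof.
move=> sH; have [Hu _ _ _] := sH; have sD := derived_subgroup Hu; have [Du _ _ _] := sD.
have aD := alg_closure_group charK sD; apply: derived_sub; first by case: aD.
have step1 x y : alg_closure H x -> H y -> alg_closure (derived_group H) (x *m y *m invmx x *m invmx y).
  move=> [zx ux] Hy; split; last by rewrite /= !unitmx_mul !unitmx_inv ux; have /= -> := Hu _ Hy.
  apply/zclosureE => F pF F0.
  have := @regular_zclosure K charK n H (fun M => F (lsubmx M *m y *m rsubmx M *m invmx y)) _ Hu _ x zx ux.
  rewrite row_mxKl row_mxKr; apply.
    apply: (polyfun_comp (f := fun M => lsubmx M *m y *m rsubmx M *m invmx y)) pF.
    apply: polymap_mul; last exact: polymap_cst.
    apply: polymap_mul; last exact: polymap_rsub.
    by apply: polymap_mul; [exact: polymap_lsub|exact: polymap_cst].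
  by move=> g Hg; rewrite row_mxKl row_mxKr; apply: F0; apply: derived_comm.
move=> x y Hx [zy uy]; have [zx ux] := Hx; split; last by rewrite /= !unitmx_mul !unitmx_inv ux uy.
apply/zclosureE => F pF F0.
have := @regular_zclosure K charK n H (fun M => F (x *m lsubmx M *m invmx x *m rsubmx M)) _ Hu _ y zy uy.
rewrite row_mxKl row_mxKr; apply.
  apply: (polyfun_comp (f := fun M => x *m lsubmx M *m invmx x *m rsubmx M)) pF.
  apply: polymap_mul; last exact: polymap_rsub.
  apply: polymap_mul; last exact: polymap_cst.
  by apply: polymap_mul; [exact: polymap_cst|exact: polymap_lsub].
move=> g Hg; rewrite row_mxKl row_mxKr; have [/zclosureE zz _] := step1 x g Hx Hg.
by apply: zz.
Qed.

Lemma iter_derived_alg_closure k H : subgroup_GL H ->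
  iter k (@derived_group K n) (alg_closure H) `<=` alg_closure (iter k (@derived_group K n) H).
Proof.
move=> sH; elim: k => //= k IH; apply: subset_trans (derived_mono IH) _.
by apply: derived_alg_closure; apply: iter_derived_subgroup.
Qed.

Lemma alg_closure1 : alg_closure [set 1%:M : 'M[K]_n] `<=` [set 1%:M].
Proof.
move=> x [/zclosureE zx _] /=; apply/matrixP => i j; apply: subr0_eq.
apply: (zx (fun x => x i j - (1%:M : 'M[K]_n) i j)); last by move=> _ ->; rewrite subrr.
by apply: polyfunB; [apply: polyfun_entry|apply: polyfun_cst].
Qed.

End Groups.

(** * Projections along a projective line *)

Section Elimination.
Variable K : closedFieldType.
Variables m n : nat.
Implicit Types (A : 'M[K]_(m, n)) (q : {poly K}) (R : 'M[K]_(m, n) -> {poly K}).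

(** Univariate polynomials of bounded degree whose coefficients depend
    polynomially on a parameter matrix. *)
Definition pfam R := (exists N, forall A, (size (R A) <= N)%N) /\ forall i, polyfun (fun A => (R A)`_i).

Lemma pfam_cst q : pfam (fun=> q).
Proof. by split=> [|i]; [exists (size q)|apply: polyfun_cst]. Qed.

Lemma pfam_polyC f : polyfun f -> pfam (fun A => (f A)%:P).
Proof.
move=> pf; split=> [|i]; first by exists 1%N => A; apply: size_polyC_leq1.
have [->|/negPf i0] := eqVneq i 0%N; first by apply: eq_polyfun pf => A; rewrite coefC.
by apply: eq_polyfun (polyfun_cst _ _ 0) => A; rewrite coefC i0.
Qed.

Lemma pfamD R R' : pfam R -> pfam R' -> pfam (fun A => R A + R' A).
Proof.
move=> [[N sR] pR] [[N' sR'] pR']; split.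
  exists (maxn N N') => A; apply: leq_trans (size_polyD _ _) _.
  by rewrite geq_max !leq_max sR sR' orbT.
by move=> i; apply: eq_polyfun (polyfunD (pR i) (pR' i)) => A; rewrite coefD.
Qed.

Lemma pfamM R R' : pfam R -> pfam R' -> pfam (fun A => R A * R' A).
Proof.
move=> [[N sR] pR] [[N' sR'] pR']; split.
  exists (N + N')%N => A; apply: leq_trans (size_polyMleq _ _) _.
  by apply: leq_trans (leq_pred _) _; apply: leq_add.
move=> i; apply: (eq_polyfun (F := fun A => \sum_(j < i.+1) (R A)`_j * (R' A)`_(i - j))).
  by move=> A; rewrite coefM.
by apply: polyfun_sum => j _; apply: polyfunM.
Qed.

Lemma pfam_sum (I : finType) (F : I -> 'M[K]_(m, n) -> {poly K}) :
  (forall i, pfam (F i)) -> pfam (fun A => \sum_i F i A).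
Proof.
move=> pF; elim: (index_enum I) => [|i s IH].
  by have := pfam_cst 0; congr pfam; apply: funext => A; rewrite big_nil.
by have := pfamD (pF i) IH; congr pfam; apply: funext => A; rewrite big_cons.
Qed.

Definition cfam p r (C : 'M[K]_(m, n) -> 'M[{poly K}]_(p, r)) := forall i j, pfam (fun A => C A i j).

Lemma cfam_mul p r s (C : 'M[K]_(m, n) -> 'M[{poly K}]_(p, r)) (D : 'M[K]_(m, n) -> 'M[{poly K}]_(r, s)) :
  cfam C -> cfam D -> cfam (fun A => C A *m D A).
Proof.
move=> pC pD i j; have := pfam_sum (fun k => pfamM (pC i k) (pD k j)).
by congr pfam; apply: funext => A; rewrite mxE.
Qed.

Lemma pfam_pcomp p r (f : {mpoly K[p * r]}) (C : 'M[K]_(m, n) -> 'M[{poly K}]_(p, r)) :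
  cfam C -> pfam (fun A => pcomp f (C A)).
Proof.
move=> pC; elim/mpoly_ringind: f => [a|i|f g IHf IHg|f g IHf IHg].
- by have := pfam_cst a%:P; congr pfam; apply: funext => A; rewrite /pcomp mmapC.
- case/mxvec_indexP: i => i j; have := pC i j.
  by congr pfam; apply: funext => A; rewrite /pcomp mmapX mmap1U mxvecE.
- by have := pfamD IHf IHg; congr pfam; apply: funext => A; rewrite /pcomp mmapD.
- by have := pfamM IHf IHg; congr pfam; apply: funext => A; rewrite /pcomp (rmorphM (mmap _ _)).
Qed.

(** The Sylvester matrix of R A and E A is singular when they have a common
    root, the powers of which form a kernel vector. *)
Lemma sylvester R E N M A0 : pfam R -> pfam E -> (forall A, size (R A) <= N.+2)%N ->
  (forall A, size (E A) <= M.+1)%N -> R A0 = 1 -> (E A0)`_M != 0 ->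
  exists F, [/\ polyfun F, F A0 <> 0 & forall A c, (R A).[c] = 0 -> (E A).[c] = 0 -> F A = 0].
Proof.
move=> [_ pR] [_ pE] sR sE R1 eM.
pose q A (i : nat) := if (i < M)%N then 'X^i * R A else 'X^(i - M) * E A.
pose S A : 'M[K]_((M + N).+1) := \matrix_(i, j) (q A i)`_j.
have sq A (i : 'I_(M + N).+1) : (size (q A i) <= (M + N).+1)%N.
  rewrite /q; case: ltnP => iM; apply: leq_trans (size_polyMleq _ _) _; rewrite size_polyXn.
    by have := sR A; lia.
  by have := sE A; have := ltn_ord i; lia.
exists (fun A => \det (S A)); split.
- apply: polyfun_det => i j; case: (ltnP i M) => iM.
    case: (ltnP j i) => ji; last by apply: eq_polyfun (pR (j - i)%N) => A; rewrite mxE /q iM coefXnM ltnNge ji.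
    by apply: eq_polyfun (polyfun_cst _ _ 0) => A; rewrite mxE /q iM coefXnM ji.
  have iM' : (i < M)%N = false by apply/negbTE; rewrite -leqNgt.
  case: (ltnP j (i - M)) => ji.
    by apply: eq_polyfun (polyfun_cst _ _ 0) => A; rewrite mxE /q iM' coefXnM ji.
  by apply: eq_polyfun (pE (j - (i - M))%N) => A; rewrite mxE /q iM' coefXnM ltnNge ji.
- apply/eqP; rewrite det_trig; last first.
    apply/is_trig_mxP => i j ij; rewrite mxE /q; case: ltnP => iM.
      by rewrite R1 mulr1 coefXn gtn_eqF.
    by rewrite coefXnM; case: ltnP => // ji; apply: nth_default; apply: leq_trans (sE _) _; lia.
  apply/prodf_neq0 => i _; rewrite mxE /q; case: ltnP => iM.
    by rewrite R1 mulr1 coefXn eqxx oner_neq0.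
  by rewrite coefXnM ltnNge leq_subr /= subKn.
- move=> A c Rc Ec; apply/eqP; rewrite -det_tr; apply/det0P.
  exists (\row_j c ^+ j); first by apply/eqP => /rowP /(_ 0); rewrite !mxE expr0 => /eqP; rewrite oner_eq0.
  apply/rowP => i; rewrite !mxE.
  transitivity (q A i).[c]; last by rewrite /q; case: ifP => _; rewrite hornerM ?Rc ?Ec mulr0.
  by rewrite (horner_coef_wide _ (sq A i)); apply: eq_bigr => j _; rewrite !mxE mulrC.
Qed.

(** Nullstellensatz in one variable. *)
Lemma poly_ideal_unit (J : {poly K} -> Prop) : (forall p q, J p -> J q -> J (p + q)) ->
  (forall r p, J p -> J (r * p)) -> (forall c, exists2 p, J p & p.[c] != 0) -> J 1.
Proof.
move=> JD JM Jc.
have ex : exists k, `[< exists p, [/\ J p, p != 0 & size p = k] >].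
  have [p Jp p0] := Jc 0; exists (size p); apply/asboolP; exists p; split=> //.
  by apply: contraNneq p0 => ->; rewrite horner0.
case: (ex_minnP ex) => k /asboolP [p [Jp pn <-]] pmin.
have [/eqP s1|s1] := boolP (size p == 1%N).
  have /size_poly1P [c c0 pE] : size p == 1%N by rewrite s1.
  by have := JM c^-1%:P _ Jp; rewrite pE -polyCM mulVf.
have [c pc0] := closed_rootP _ s1.
have [p' Jp' /negP[]] := Jc c; rewrite (divp_eq p' p) hornerD hornerM (rootP pc0) mulr0 add0r.
suff /eqP -> : p' %% p == 0 by rewrite horner0.
apply: contraT => r0; have : (size (modp p' p) < size p)%N by rewrite ltn_modp.
rewrite ltnNge pmin //; apply/asboolP; exists (modp p' p); split=> //.
have -> : modp p' p = p' + - (divp p' p) * p by rewrite {2}(divp_eq p' p) mulNr addrC addKr.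
by apply: (JD) => //; apply: (JM).
Qed.

Definition revp M q : {poly K} := \poly_(k < M.+1) q`_(M - k).

Lemma revpE M q c : (size q <= M)%N -> q.[c^-1] = 0 \/ c = 0 -> (revp M q).[c] = 0.
Proof.
move=> sq; have [->|c0] := eqVneq c 0.
  by rewrite horner_coef0 coef_poly subn0 nth_default.
case=> [q0|/eqP]; last by rewrite (negPf c0).
suff -> : (revp M q).[c] = c ^+ M * q.[c^-1] by rewrite q0 mulr0.
rewrite horner_poly (@horner_coef_wide _ M.+1) 1?leqW //.
rewrite mulr_sumr (reindex_inj rev_ord_inj) /=; apply: eq_bigr => k _ /=; rewrite subSS subKn -1?ltnS //.
by rewrite exprVn mulrCA expfB_cond // (negPf c0) /= add0n -ltnS.
Qed.

(** The space of pairs of A and a point of the projective line, with C and C'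
    describing a family of maps on the affine line and near infinity, projects
    to a closed set: if A0 is outside, then the equations of the points over A0
    generate the unit ideal, and with an equation at infinity they give a
    resultant separating A0. *)
Lemma projective_line_closed p r (C C' : 'M[K]_(m, n) -> 'M[{poly K}]_(p, r)) (Y : set 'M[K]_(p, r)) :
  cfam C -> cfam C' -> zclosed Y ->
  (forall A c, c != 0 -> Y (ceval (C A) c) -> Y (ceval (C' A) c^-1)) ->
  zclosed [set A | (exists c, Y (ceval (C A) c)) \/ Y (ceval (C' A) 0)].
Proof.
move=> pC pC' cY YC; apply: zclosed_by => A0 nA0.
have sep y : ~ Y y -> exists2 f, vanishing_ideal Y f & mxeval f y != 0.
  move=> nY; apply: contrapT => nex; apply: nY; rewrite -(zclosedE cY) => f If.
  by apply/eqP; apply: contraT => f0; case: nex; exists f.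
have [g Ig g0] := sep _ (fun y0 => nA0 (or_intror y0)).
pose J q := exists R, [/\ pfam R, forall A c, Y (ceval (C A) c) -> (R A).[c] = 0 & R A0 = q].
have [R [pR R0 R1]] : J 1.
  apply: poly_ideal_unit.
  - move=> q1 q2 [R1 [p1 z1 <-]] [R2 [p2 z2 <-]]; exists (fun A => R1 A + R2 A).
    by split=> // [|A c Yc]; [apply: pfamD|rewrite hornerD z1 // z2 // addr0].
  - move=> q q1 [R1 [p1 z1 <-]]; exists (fun A => q * R1 A).
    by split=> // [|A c Yc]; [apply: pfamM => //; apply: pfam_cst|rewrite hornerM z1 // mulr0].
  - move=> c; have [f If f0] := sep _ (fun y0 => nA0 (or_introl (ex_intro _ c y0))).
    exists (pcomp f (C A0)); last by rewrite pcompE.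
    exists (fun A => pcomp f (C A)); split=> // [|A d Yd]; first exact: pfam_pcomp.
    by rewrite pcompE If.
have [[N sR] _] := pR; have pB := pfam_pcomp g pC'; have [[M sB] pB'] := pB.
pose E A := revp M (pcomp g (C' A)).
have pE : pfam E.
  split; first by exists M.+1 => A; apply: size_poly.
  move=> i; have [iM|iM] := ltnP i M.+1.
    by apply: eq_polyfun (pB' (M - i)%N) => A; rewrite coef_poly iM.
  by apply: eq_polyfun (polyfun_cst _ _ 0) => A; rewrite coef_poly ltnNge iM.
have eM A : (E A)`_M = mxeval g (ceval (C' A) 0).
  by rewrite coef_poly ltnSn subnn -horner_coef0 pcompE.
have [|||Fs [pF F0 FZ]] := @sylvester R E N M A0 pR pE _ _ R1.
- by move=> A; have := sR A; lia.
- by move=> A; apply: size_poly.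
- by rewrite eM.
exists (fun A => (E A)`_M * Fs A); split.
- by apply: polyfunM => //; case: pE.
- move=> A [[c Yc]|Y0]; last by rewrite eM Ig ?mul0r.
  rewrite (FZ A c) ?mulr0 //; first exact: R0.
  apply: revpE => //; have [->|c0] := eqVneq c 0; [by right|left].
  by rewrite pcompE; apply: Ig; apply: YC.
- by apply/eqP; rewrite mulf_neq0 ?eM //; apply/eqP.
Qed.
End Elimination.

Lemma polyfun_mxderiv_r (K : closedFieldType) n (p : {mpoly K[n * n]}) (y : 'M[K]_n) : polyfun (fun u => mxderiv p y u).
Proof.
apply: polyfun_sum => i _; apply: polyfunM; first exact: polyfun_cst.
case/mxvec_indexP: i => i j.
by apply: eq_polyfun (polyfun_entry K i j) => A; rewrite mxvecE.
Qed.

(** * Tangent directions *)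

Section Density.
Variables (K : closedFieldType) (n : nat).
Hypothesis charK : [pchar K] =i pred0.
Implicit Types (x y u k : 'M[K]_n) (Y : set 'M[K]_n).

Lemma polyfun_mxderiv (p : {mpoly K[n * n]}) u : polyfun (fun y => mxderiv p y u).
Proof.
apply: polyfun_sum => i _; apply: polyfunM; last exact: polyfun_cst.
exact: polyfun_mxeval.
Qed.

(** If the derivative in the direction u maps the ideal of Y to itself, all the
    Taylor coefficients along the line y + t u of an equation of Y vanish. *)
Lemma zclosure_tangent Y y u :
  (forall p, vanishing_ideal Y p -> forall z, Y z -> mxderiv p z u = 0) -> Y y -> zclosure Y (y + u).
Proof.
move=> DY Yy p Ip; have [|d dE] := @choice _ _ (fun (q : {mpoly K[n * n]}) q' => forall z, mxderiv q z u = mxeval q' z).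
  by move=> q; have [q' q'E] := polyfun_mxderiv q u; exists q'.
have Id (k : nat) : vanishing_ideal Y (iter k d p).
  by elim: k => //= k IH z Yz; rewrite -dE; apply: DY.
suff p0 : pcomp p (line y u) = 0.
  by have := pcompE p (line y u) 1; rewrite line_eval scale1r p0 horner0.
apply: (@poly_deriv_eq0 K charK _ 0) => k.
have -> : (pcomp p (line y u))^`(k) = pcomp (iter k d p) (line y u).
  elim: k => [|k IH]; first by rewrite derivn0.
  rewrite derivnS IH; apply: (poly_evalP charK) => t.
  by rewrite deriv_pcompE line_deriv pcompE dE.
by rewrite pcompE line_eval scale0r addr0; apply: Id.
Qed.

Lemma polyfun_conj (p : {mpoly K[n * n]}) y :
  polyfun (fun A : 'M[K]_(n, n + n) => mxeval p (lsubmx A *m y *m rsubmx A)).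
Proof.
apply: (polyfun_comp (f := fun A : 'M[K]_(n, n + n) => lsubmx A *m y *m rsubmx A)); last exact: polyfun_mxeval.
by apply: polymap_mul (@polymap_rsub _ _ _ _); apply: polymap_mul (@polymap_cst _ _ _ _ _ _); apply: polymap_lsub.
Qed.

(** The differential at 1 of g |-> Ad g y is ad y, up to sign. *)
Lemma mxderiv_orbit (C : set 'M[K]_n) p y k : C `<=` [set g | g \in unitmx] -> C 1%:M ->
  (forall g, C g -> mxeval p (Ad g y) = 0) -> Lie C k -> mxderiv p y (bracket k y) = 0.
Proof.
move=> sub C1 p0 Lk; have [q qE] := polyfun_conj p y.
have := @regular_deriv0 _ charK n C k q sub C1 _ Lk.
have -> : mxderiv q (row_mx 1%:M 1%:M) (row_mx k (- k)) = mxderiv p y (bracket k y).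
  pose c := line 1%:M k *m pc y *m line 1%:M (- k).
  have cE t : ceval c t = (1%:M + t *: k) *m y *m (1%:M + t *: - k).
    by rewrite !cevalM ceval_pc !line_eval.
  rewrite mxderiv_line.
  have -> : pcomp q (line (row_mx 1%:M 1%:M) (row_mx k (- k))) = pcomp p c.
    apply: (poly_evalP charK) => t.
    by rewrite !pcompE -qE line_eval scale_row_mx add_row_mx row_mxKl row_mxKr cE.
  rewrite deriv_pcompE cE !scale0r !addr0 mul1mx mulmx1; congr mxderiv.
  rewrite !cderivM cderiv_pc mulmx0 addr0 cevalD !cevalM !ceval_pc !line_eval !line_deriv.
  by rewrite !scale0r !addr0 mulmx1 mul1mx mulmxN.
by apply=> g Cg; rewrite -qE row_mxKl row_mxKr; apply: p0.
Qed.

End Density.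

(** * Reflections of SL2 *)

Section Integers.
Variable (K : closedFieldType).
Hypothesis charK : [pchar K] =i pred0.

Definition toint (x : K) : int := xget 0 [set z : int | x = z%:~R].

Lemma tointE x : (exists z : int, x = z%:~R) -> x = (toint x)%:~R.
Proof. by case=> z xz; rewrite /toint; case: xgetP => [y _ //|/(_ z)]. Qed.

Lemma tointK z : toint z%:~R = z.
Proof. by apply: (intr_injK charK); rewrite /= -tointE //; exists z. Qed.

End Integers.

Section Theta.
Variable (K : closedFieldType).
Hypothesis charK : [pchar K] =i pred0.
Variable n : nat.
Implicit Types (e f h x y z w g : 'M[K]_n).

Lemma Ad_expm1 x y z : nilp x -> bracket x y = z -> bracket x z = 0 -> Ad (expm x) y = y + z.
Proof.
move=> nx xy xz; rewrite (@Ad_expm_ad _ charK _ x y 2) //= ?xy // !big_ord_recr big_ord0 /= xy.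
by rewrite add0r invr1 !scale1r.
Qed.

Lemma Ad_expm2 x y z w : nilp x -> bracket x y = z -> bracket x z = w -> bracket x w = 0 ->
  Ad (expm x) y = y + z + 2%:R^-1 *: w.
Proof.
move=> nx xy xz xw; rewrite (@Ad_expm_ad _ charK _ x y 3) //= ?xy ?xz // !big_ord_recr big_ord0 /= xy xz.
by rewrite add0r invr1 !scale1r.
Qed.

(** The element of SL2 exchanging the two root lines. *)
Definition theta e f : 'M[K]_n := expm e *m expm (- f) *m expm e.

Lemma theta_unit e f : nilp e -> nilp f -> theta e f \in unitmx.
Proof. by move=> ne nf; rewrite !unitmx_mul !expm_unit //; apply: nilpN. Qed.

Lemma Ad_theta e f x : nilp e -> nilp f ->
  Ad (theta e f) x = Ad (expm e) (Ad (expm (- f)) (Ad (expm e) x)).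
Proof.
move=> ne nf; have ue := expm_unit charK ne; have uf := expm_unit charK (nilpN nf).
by rewrite /theta !AdM // unitmx_mul ue.
Qed.

Lemma AdD g x y : Ad g (x + y) = Ad g x + Ad g y.
Proof. by rewrite /Ad mulmxDr mulmxDl. Qed.
Lemma AdZ g c x : Ad g (c *: x) = c *: Ad g x.
Proof. by rewrite /Ad -scalemxAr -scalemxAl. Qed.
Lemma AdN g x : Ad g (- x) = - Ad g x.
Proof. by rewrite -scaleN1r AdZ scaleN1r. Qed.
Lemma AdB g x y : Ad g (x - y) = Ad g x - Ad g y.
Proof. by rewrite AdD AdN. Qed.
Lemma Ad0 g : Ad g 0 = 0.
Proof. by rewrite /Ad mulmx0 mul0mx. Qed.
Lemma Ad_sum g I (s : seq I) (F : I -> 'M[K]_n) :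
  Ad g (\sum_(i <- s) F i) = \sum_(i <- s) Ad g (F i).
Proof. by elim: s => [|i s IH]; rewrite ?big_nil ?Ad0 // !big_cons AdD IH. Qed.

(** The reflection computed along the two exponentials: a and a' are the
    components of h moved by e and f. *)
Lemma theta_refl e f h a a' h' : nilp e -> nilp f ->
  bracket e h = - a -> bracket e a = 0 -> bracket f h = a' -> bracket f a' = 0 ->
  bracket f a = - h' -> bracket f h' = 2%:R *: a' -> bracket e h' = - (2%:R *: a) ->
  Ad (theta e f) h = h - h'.
Proof.
move=> ne nf eh ea fh fa' fa fh' eh'; rewrite Ad_theta //.
have n2 : (2%:R : K) != 0 by apply: (natr_neq0 charK).
rewrite (@Ad_expm1 e h (- a)) ?bracketNr ?ea ?oppr0 // (AdB (expm (- f))).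
rewrite (@Ad_expm1 (- f) h (- a')) ?bracketNl ?bracketNr ?fh ?fa' ?oppr0 //; last exact: nilpN.
rewrite (@Ad_expm2 (- f) a h' (- (2%:R *: a'))); last first.
- by rewrite bracketNl bracketNr bracketZr fa' scaler0 !oppr0.
- by rewrite bracketNl fh'.
- by rewrite bracketNl fa opprK.
- exact: nilpN.
have -> : h - a' - (a + h' + 2%:R^-1 *: - (2%:R *: a')) = h - a - h'.
  rewrite scalerN scalerA mulVf // scale1r; apply/matrixP => i j; rewrite !mxE; ring.
rewrite !AdB (@Ad_expm1 e h (- a)) ?bracketNr ?ea ?oppr0 //.
rewrite (@Ad_expm1 e a 0) ?bracket0r // addr0.
rewrite (@Ad_expm1 e h' (- (2%:R *: a))) ?bracketNr ?bracketZr ?ea ?scaler0 ?oppr0 //.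
rewrite scaler_nat mulr2n; apply/matrixP => i j; rewrite !mxE; ring.
Qed.

Lemma theta_sl2 e h f : sl2_triple e h f -> nilp e -> nilp f ->
  [/\ Ad (theta e f) e = - f, Ad (theta e f) f = - e & Ad (theta e f) h = - h].
Proof.
case=> he hf ef ne nf; have n2 : (2%:R : K) != 0 by apply: (natr_neq0 charK).
have eh : bracket e h = - (2%:R *: e) by rewrite bracketC he.
have fh : bracket f h = 2%:R *: f by rewrite bracketC hf opprK.
have fe : bracket f e = - h by rewrite bracketC ef.
have h2 : 2%:R^-1 *: (2%:R *: e) = e by rewrite scalerA mulVf // scale1r.
have f2 : 2%:R^-1 *: (2%:R *: f) = f by rewrite scalerA mulVf // scale1r.
have Ee : Ad (expm e) e = e by rewrite Ad_expm_fix // bracketxx.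
have Ef : Ad (expm e) f = f + h - e.
  rewrite (@Ad_expm2 e f h (- (2%:R *: e))) // ?scalerN ?h2 //.
  by rewrite bracketNr bracketZr bracketxx scaler0 oppr0.
have Eh : Ad (expm e) h = h - 2%:R *: e.
  by rewrite (@Ad_expm1 e h (- (2%:R *: e))) // bracketNr bracketZr bracketxx scaler0 oppr0.
have Ff : Ad (expm (- f)) f = f by rewrite Ad_expm_fix ?bracketNl ?bracketxx ?oppr0 //; apply: nilpN.
have Fe : Ad (expm (- f)) e = e + h - f.
  rewrite (@Ad_expm2 (- f) e h (- (2%:R *: f))) ?scalerN ?f2 //; first exact: nilpN.
  - by rewrite bracketNl fe opprK.
  - by rewrite bracketNl fh.
  by rewrite bracketNl bracketNr bracketZr bracketxx scaler0 !oppr0.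
have Fh : Ad (expm (- f)) h = h - 2%:R *: f.
  rewrite (@Ad_expm1 (- f) h (- (2%:R *: f))) ?bracketNl ?fh //; first exact: nilpN.
  by rewrite bracketNr bracketZr bracketxx scaler0 !oppr0.
have Te : Ad (theta e f) e = - f.
  rewrite Ad_theta // Ee Fe AdB AdD Ee Eh Ef scaler_nat mulr2n.
  by apply/matrixP => i j; rewrite !mxE; ring.
have Tf : Ad (theta e f) f = - e.
  rewrite Ad_theta // Ef (AdB (expm (- f))) (AdD (expm (- f))) Ff Fh Fe !scaler_nat !mulr2n.
  have -> : f + (h - (f + f)) - (e + h - f) = - e by apply/matrixP => i j; rewrite !mxE; ring.
  by rewrite AdN Ee.
split=> //; have uT := theta_unit ne nf.
by rewrite -ef Ad_bracket // Te Tf bracketNl bracketNr opprK bracketC.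
Qed.

Lemma Ad_theta_conj g e f : g \in unitmx -> nilp e -> nilp f ->
  Ad g (theta e f) = theta (Ad g e) (Ad g f).
Proof. by move=> ug ne nf; rewrite /theta !Ad_mul // !Ad_expm ?AdN //; apply: nilpN. Qed.

Lemma expm_theta e f : nilp e -> nilp f -> expm (- f) = expm (- e) *m theta e f *m expm (- e).
Proof.
move=> ne nf; rewrite /theta !mulmxA; have := expmNK charK (nilpN ne); rewrite opprK => ->.
by rewrite mul1mx -!mulmxA expmNK // mulmx1.
Qed.

Lemma Ad_Ad g t x : g \in unitmx -> t \in unitmx -> Ad (Ad g t) (Ad g x) = Ad g (Ad t x).
Proof.
move=> ug ut; have uV : invmx g \in unitmx by rewrite unitmx_inv.
by rewrite -[Ad g t]/(g *m t *m invmx g) AdM ?unitmx_mul ?ug // AdK // AdM.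
Qed.


End Theta.

(** * Roots as elements of the Lie algebra of the torus *)

(** A maximal torus together with a basis of the natural representation in
    which it is diagonal, its entries being Laurent monomials. *)
Record torus_frame (K : closedFieldType) (n : nat) (G T : set 'M[K]_n) : Type := TorusFrame {
  tf_char : [pchar K] =i pred0;
  tf_G : almost_simple G;
  tf_T : maximal_torus G T;
  tf_P : 'M[K]_n;
  tf_r : nat;
  tf_b : 'I_n -> 'I_tf_r -> int;
  tf_unit : tf_P \in unitmx;
  tf_param : forall t, T t <-> exists2 z, (forall i, z i != 0) & t = dg tf_P (monorow tf_b z)
}.

Section RootDef.
Variables (K : closedFieldType) (n : nat).
Implicit Types (x y h a : 'M[K]_n) (c : K).

(** The trace form; it identifies the Lie algebra of the torus with its dual, so
    that roots become matrices. *)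
Definition rt a h : K := \tr (a *m h).

Lemma rtC a h : rt a h = rt h a. Proof. exact: mxtrace_mulC. Qed.
Lemma rtDl a b h : rt (a + b) h = rt a h + rt b h. Proof. by rewrite /rt mulmxDl linearD. Qed.
Lemma rtDr a h h' : rt a (h + h') = rt a h + rt a h'. Proof. by rewrite /rt mulmxDr linearD. Qed.
Lemma rtZl c a h : rt (c *: a) h = c * rt a h. Proof. by rewrite /rt -scalemxAl linearZ. Qed.
Lemma rtZr c a h : rt a (c *: h) = c * rt a h. Proof. by rewrite /rt -scalemxAr linearZ. Qed.
Lemma rtNl a h : rt (- a) h = - rt a h. Proof. by rewrite -scaleN1r rtZl mulN1r. Qed.
Lemma rtNr a h : rt a (- h) = - rt a h. Proof. by rewrite -scaleN1r rtZr mulN1r. Qed.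
Lemma rtBl a b h : rt (a - b) h = rt a h - rt b h. Proof. by rewrite rtDl rtNl. Qed.
Lemma rtBr a h h' : rt a (h - h') = rt a h - rt a h'. Proof. by rewrite rtDr rtNr. Qed.
Lemma rt0l h : rt 0 h = 0. Proof. by rewrite -(scale0r 0) rtZl mul0r. Qed.
Lemma rt0r a : rt a 0 = 0. Proof. by rewrite rtC rt0l. Qed.
Lemma rt_suml I (s : seq I) (F : I -> 'M[K]_n) h : rt (\sum_(i <- s) F i) h = \sum_(i <- s) rt (F i) h.
Proof. by elim: s => [|i s IH]; rewrite ?big_nil ?rt0l // !big_cons rtDl IH. Qed.
Lemma rt_sumr I (s : seq I) (F : I -> 'M[K]_n) a : rt a (\sum_(i <- s) F i) = \sum_(i <- s) rt a (F i).
Proof. by rewrite rtC rt_suml; apply: eq_bigr => i _; rewrite rtC. Qed.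

Variables (G T : set 'M[K]_n).

(** The weight space of the linear form represented by a. *)
Definition rsp a x := Lie G x /\ forall h, Lie T h -> bracket h x = rt a h *: x.

Definition is_root a := [/\ Lie T a, exists2 h, Lie T h & rt a h <> 0
  & exists2 x, rsp a x & x <> 0].

Definition coroot a : 'M[K]_n := (2%:R / rt a a) *: a.

Lemma rsp_linear a c x y : rsp a x -> rsp a y -> rsp a (c *: x + y).
Proof.
move=> [Lx Hx] [Ly Hy]; split=> [|h Lh]; first exact: lie_linear.
by rewrite bracketDr bracketZr Hx // Hy // scalerDr !scalerA mulrC.
Qed.

Lemma rsp0v a : rsp a 0.
Proof. by split=> [|h _]; rewrite ?bracket0r ?scaler0 //; apply: lie0. Qed.

Lemma rspZ a c x : rsp a x -> rsp a (c *: x).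
Proof. by move=> Hx; rewrite -[_ *: _]addr0; apply: rsp_linear => //; apply: rsp0v. Qed.

End RootDef.

Lemma torus_frame_exists (K : closedFieldType) (n : nat) (G T : set 'M[K]_n) : [pchar K] =i pred0 ->
  almost_simple G -> maximal_torus G T -> exists R : torus_frame G T, True.
Proof.
move=> charK hG hT; have [tT _ _] := hT.
have [|t _|P [r [b [d [uP _ TP]]]]] := @torus_monomial K charK n T 1%:M 0 tT; first exact: unitmx1.
  suff -> : dg 1%:M (0 : 'rV[K]_n) = 0 by rewrite bracket0l.
  by rewrite /dg linear0 mulmx0 mul0mx.
by exists (TorusFrame charK hG hT uP TP).
Qed.

(** * Roots *)

Section Frame.
Variables (K : closedFieldType) (n : nat) (G T : set 'M[K]_n) (R : torus_frame G T).
Let charK := tf_char R.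
Let hG := tf_G R.
Let hT := tf_T R.
Let uP := tf_unit R.
Let TP := tf_param R.
Let natr0 := natr_neq0 charK.
Let invmx_exp := @invmx_expm K charK n.
Let Ad_exp_fix := @Ad_expm_fix K charK n.
Local Notation P := (tf_P R).
Local Notation rsp := (rsp G T).
Local Notation is_root := (is_root G T).
Lemma intr_eq (z z' : int) : z%:~R = z'%:~R :> K -> z = z'.
Proof. exact: (intr_injK charK). Qed.

Section Roots.
Implicit Types (x y h a b : 'M[K]_n) (c : K).

Lemma frame_aG : algebraic_group G. Proof. by case: hG. Qed.
Lemma frame_mG : monoid_mx G. Proof. exact: subgroup_monoid frame_aG.1. Qed.
Lemma frame_TG : T `<=` G. Proof. by case: hT. Qed.
Lemma frame_aT : algebraic_group T. Proof. by case: hT => -[]. Qed.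
Lemma Gunit x : G x -> x \in unitmx. Proof. by case: frame_aG => -[+ _ _ _] _; apply. Qed.
Lemma Tunit x : T x -> x \in unitmx. Proof. by move/frame_TG; apply: Gunit. Qed.

Lemma liet_g h : Lie T h -> Lie G h.
Proof. exact: (lie_mono frame_TG). Qed.

Lemma lieG_bracket x y : Lie G x -> Lie G y -> Lie G (bracket x y).
Proof. exact: lie_bracket frame_mG. Qed.

Lemma lieG_Ad x y : G x -> Lie G y -> Lie G (Ad x y).
Proof. by move=> Gx; apply: lie_conj => //; case: frame_aG. Qed.

Lemma liet_diag h : Lie T h -> h = dg P (\row_j cc P h j j).
Proof. exact: (lie_torus_diag charK hT uP TP). Qed.

Lemma dg_bracket0 d d' : bracket (dg P d) (dg P d') = 0.
Proof.
rewrite /bracket !dg_mul //; apply/eqP; rewrite subr_eq0; apply/eqP.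
by congr dg; apply/rowP => j; rewrite !mxE mulrC.
Qed.

Lemma liet_comm h h' : Lie T h -> Lie T h' -> bracket h h' = 0.
Proof. by move=> /liet_diag -> /liet_diag ->; apply: dg_bracket0. Qed.

Lemma liet_bracket h x i j : Lie T h ->
  cc P (bracket h x) i j = (cc P h i i - cc P h j j) * cc P x i j.
Proof. by move=> /liet_diag hE; rewrite {1}hE cc_bracket // !mxE. Qed.

Lemma rsp_entry a x i j h : rsp a x -> cc P x i j != 0 -> Lie T h ->
  rt a h = cc P h i i - cc P h j j.
Proof.
move=> [_ Hx] nx Lh; apply: (mulIf nx); rewrite -liet_bracket // Hx //.
by rewrite ccZ.
Qed.

Lemma liet_Ad_fix x : (forall t, T t -> Ad t x = x) -> forall t, T t -> bracket x t = 0.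
Proof. by move=> H t Tt; rewrite /bracket -{1}(H t Tt) /Ad mulmxKV ?subrr //; apply: Tunit. Qed.

Lemma rsp0_liet x : Lie G x -> (forall h, Lie T h -> bracket h x = 0) -> Lie T x.
Proof.
move=> Lx Hx; apply: (centT_lie charK hG hT uP TP); split=> // t Tt.
rewrite bracketC; apply/eqP; rewrite oppr_eq0; apply/eqP; apply: (cc_inj uP); rewrite cc0.
apply/matrixP => i j; have [z nz tE] := (TP t).1 Tt; rewrite tE cc_bracket // [in RHS]mxE.
have [->|nx] := eqVneq (cc P x i j) 0; first by rewrite mulr0.
have: cc P t i i = cc P t j j.
  apply: (torus_weight_eq charK hT uP TP) => // h Lh; apply: subr0_eq.
  by apply: (mulIf nx); rewrite -liet_bracket // Hx // cc0 mxE mul0r.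
by rewrite tE !ccdg // !eqxx !mulr1n => ->; rewrite subrr mul0r.
Qed.

Lemma rsp_bracket a b x y : rsp a x -> rsp b y -> rsp (a + b) (bracket x y).
Proof.
move=> [Lx Hx] [Ly Hy]; split=> [|h Lh]; first exact: lieG_bracket.
by rewrite jacobi (Hx h Lh) (Hy h Lh) bracketZl bracketZr rtDl scalerDl.
Qed.

Lemma wcomp_root_space e x : Lie G x -> wcomp P (@tf_b _ _ _ _ R) e x <> 0 ->
  exists ch : chr K n, character T ch /\ root_space G T ch (wcomp P (@tf_b _ _ _ _ R) e x).
Proof.
move=> Lx /eqP nw; set w := wcomp _ _ e x; have : cc P w != 0.
  by apply: contraNneq nw => w0; apply/eqP; apply: (cc_inj uP); rewrite w0 cc0.
case/matrix0Pn => k [l nkl]; exists (wchr T P k l); split; first exact: (wchr_character hT uP TP).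
split=> [|t Tt]; first exact: (wcomp_lie charK hG hT uP TP).
have [z nz tE] := (TP t).1 Tt; have := wcomp_Ad uP TP e x nz; rewrite -tE -/w => E.
rewrite E; congr (_ *: _); apply: (mulIf nkl).
by rewrite -ccZ -E (Ad_torus uP TP) // wchrE.
Qed.

(** A root vector has a partner of opposite weight for the trace form, and their
    bracket represents the root. *)
Lemma root_dual (a : chr K n) x : character T a -> root_space G T a x -> x <> 0 -> exists al y,
  [/\ Lie T al, forall h, Lie T h -> rt al h = chr_diff T a h,
      rsp al x, rsp (- al) y & bracket x y = al].
Proof.
move=> Ca xa nx; have [Lx ax] := xa.
have [y0 Ly0 ny0] : exists2 y, Lie G y & \tr (x *m y) <> 0.
  apply: contrapT => no; apply: nx; apply: (trace_nondegenerate charK hG Lx) => y Ly.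
  by apply: contrapT => ny; apply: no; exists y.
have [e ne] : exists e, \tr (x *m wcomp P (@tf_b _ _ _ _ R) e y0) <> 0.
  apply: contrapT => no; apply: ny0; rewrite (wcomp_sum (@tf_b _ _ _ _ R) uP y0) mulmx_sumr raddf_sum.
  by rewrite big1 //= => e _; apply: contrapT => ne; apply: no; exists e.
set w := wcomp _ _ e y0 in ne.
have [|a' [Ca' wa']] := @wcomp_root_space e y0 Ly0.
  by move=> w0; apply: ne; rewrite /w w0 mulmx0 linear0.
have [Lw aw] := wa'.
pose y := (\tr (x *m w))^-1 *: w.
have yw : \tr (x *m y) = 1 by rewrite -scalemxAr linearZ /= mulVf //; apply/eqP.
have Ly : Lie G y by apply: lieZ.
have Ldif h : Lie T h -> bracket h x = chr_diff T a h *: x by move=> Lh; apply: (chr_diff_bracket charK hT).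
have Ldif' h : Lie T h -> bracket h y = chr_diff T a' h *: y.
  by move=> Lh; rewrite bracketZr (chr_diff_bracket charK hT wa') // !scalerA mulrC.
have Ay t : T t -> Ad t y = a' t *: y.
  by move=> Tt; rewrite /y /Ad -scalemxAr -scalemxAl -/(Ad t w) aw // !scalerA mulrC.
clearbody y; have dopp h : Lie T h -> chr_diff T a' h = - chr_diff T a h.
  move=> Lh; have := trace_bracket x h y; rewrite bracketC Ldif // Ldif' // mulNmx linearN /=.
  by rewrite -scalemxAl -scalemxAr !linearZ /= yw !mulr1.
have opp t : T t -> a t * a' t = 1.
  move=> Tt; have ut := Tunit Tt.
  have : \tr (Ad t (x *m y)) = 1 by rewrite trace_Ad.
  rewrite Ad_mul // ax // Ay //.
  by rewrite -scalemxAl -scalemxAr !linearZ /= yw mulr1.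
have Lal : Lie T (bracket x y).
  apply: (centT_lie charK hG hT uP TP); split; first exact: lieG_bracket.
  apply: liet_Ad_fix => t Tt; have ut := Tunit Tt.
  rewrite Ad_bracket // ax // Ay //.
  by rewrite bracketZl bracketZr scalerA opp // scale1r.
have rtE h : Lie T h -> rt (bracket x y) h = chr_diff T a h.
  move=> Lh; rewrite rtC /rt -trace_bracket Ldif // -scalemxAl linearZ /= yw mulr1.
  by [].
exists (bracket x y), y; split=> //.
  by split=> // h Lh; rewrite rtE // Ldif.
by split=> // h Lh; rewrite rtNl rtE // Ldif' // dopp.
Qed.

(** A T-stable subspace is the sum of its weight spaces, each of which lies in the
    Lie algebra of T or in a root space. *)
Lemma weight_ind (U V : 'M[K]_n -> Prop) :
  (forall x, U x -> Lie G x) -> U 0 -> (forall c x y, U x -> U y -> U (c *: x + y)) ->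
  (forall t x, T t -> U x -> U (Ad t x)) ->
  V 0 -> (forall c x y, V x -> V y -> V (c *: x + y)) ->
  (forall x, U x -> Lie T x -> V x) ->
  (forall a x, U x -> is_root a -> rsp a x -> V x) ->
  forall x, U x -> V x.
Proof.
move=> UG U0 UL UT V0 VL Vt Va x Ux; rewrite (wcomp_sum (@tf_b _ _ _ _ R) uP x).
have VD y z : V y -> V z -> V (y + z) by move=> Vy Vz; rewrite -[y]scale1r; apply: VL.
apply: (big_ind V) => // e _; set w := wcomp _ _ e x.
have Uw : U w by apply: (wcomp_stable charK uP TP) => // t Tt; apply: UT.
have [->//|nw] := pselect (w = 0).
have [a [Ca wa]] := wcomp_root_space (UG _ Ux) nw.
have [al [y [Lal alE rw _ _]]] := root_dual Ca wa nw.
have [nal|al0] := pselect (exists2 h, Lie T h & rt al h <> 0).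
  by apply: (Va al) => //; split=> //; exists w.
apply: Vt => //; apply: rsp0_liet; first exact: UG.
move=> h Lh; rewrite rw.2 //; suff -> : rt al h = 0 by rewrite scale0r.
by apply: contrapT => nh; apply: al0; exists h.
Qed.

Lemma lieG_ind (V : 'M[K]_n -> Prop) : V 0 -> (forall c x y, V x -> V y -> V (c *: x + y)) ->
  (forall x, Lie T x -> V x) -> (forall a x, is_root a -> rsp a x -> V x) ->
  forall x, Lie G x -> V x.
Proof.
move=> V0 VL Vt Va x Lx; apply: (@weight_ind (Lie G) V) Lx => //.
- exact: lie0.
- by move=> *; apply: lie_linear.
- by move=> t y Tt; apply: lieG_Ad; apply: frame_TG.
- by move=> y _; apply: Vt.
by move=> a y _; apply: Va.
Qed.

Lemma rt_rsp_eq0 a b x y : Lie T a -> Lie T b -> rsp a x -> rsp b y ->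
  (exists2 h, Lie T h & rt (a + b) h <> 0) -> rt x y = 0.
Proof.
move=> La Lb [Lx Hx] [Ly Hy] [h Lh nh]; have : rt (bracket h x) y + rt x (bracket h y) = 0.
  by rewrite /rt (bracketC h x) mulNmx linearN /= trace_bracket addNr.
by rewrite Hx // Hy // rtZl rtZr -mulrDl -rtDl => /eqP; rewrite mulf_eq0 => /orP[/eqP//|/eqP].
Qed.

Lemma liet_nondeg h : Lie T h -> (forall h', Lie T h' -> rt h h' = 0) -> h = 0.
Proof.
move=> Lh H; apply: (trace_nondegenerate charK hG (liet_g Lh)) => y Ly; rewrite -/(rt h y).
elim/lieG_ind: y / Ly => //; first by rewrite rt0r.
  by move=> c x y hx hy; rewrite rtDr rtZr hx hy mulr0 addr0.
move=> a x [La [h' Lh' nh'] _] rx.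
apply: (@rt_rsp_eq0 0 a) => //; [exact: lie0| |by exists h' => //; rewrite add0r].
by split=> [|h2 Lh2]; [exact: liet_g|rewrite rt0l scale0r; apply: liet_comm].
Qed.


Lemma is_root_neq0 a : is_root a -> a <> 0.
Proof. by case=> _ [h _ nh] _ a0; apply: nh; rewrite a0 rt0l. Qed.

Lemma is_rootP a x : Lie T a -> a <> 0 -> rsp a x -> x <> 0 -> is_root a.
Proof.
move=> La na rx nx; split=> //; last by exists x.
by apply: contrapT => no; apply: na; apply: liet_nondeg => // h Lh; apply: contrapT => nh; apply: no; exists h.
Qed.

Lemma rsp_uniq a b x : Lie T a -> Lie T b -> rsp a x -> rsp b x -> x <> 0 -> a = b.
Proof.
move=> La Lb [_ ax] [_ bx] /eqP nx; apply: subr0_eq; apply: liet_nondeg.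
  exact: lie_sub.
move=> h Lh; have := ax h Lh; rewrite bx // => /eqP; rewrite eq_sym -subr_eq0 -scalerBl scaler_eq0 (negPf nx) orbF.
by rewrite rtBl => /eqP.
Qed.

Lemma rsp_diag a x j : is_root a -> rsp a x -> cc P x j j = 0.
Proof.
move=> [_ [h Lh nh] _] rx; apply: contrapT => /eqP nx; apply: nh.
by rewrite (rsp_entry rx nx Lh) subrr.
Qed.

Lemma prod_delta (c : 'I_n -> K) k : \prod_j c j ^ ((j == k)%:R : int) = c k.
Proof. by rewrite (bigD1 k) //= eqxx expr1z big1 ?mulr1 // => j /negPf->; rewrite expr0z. Qed.

Lemma wchr_rel i j k l p q (z : int) t :
  (forall h, Lie T h -> cc P h i i - cc P h j j =
     (cc P h k k - cc P h l l) + z%:~R * (cc P h p p - cc P h q q)) -> T t ->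
  wchr T P i j t = wchr T P k l t * wchr T P p q t ^ z.
Proof.
move=> rel Tt; rewrite !wchrE //.
pose d (u : 'I_n) j : int := (j == u)%:R.
have := @torus_relation K charK n G T hT P _ _ uP TP
   (fun u => (d i u - d j u) - (d k u - d l u) - z * (d p u - d q u)) t _ Tt.
have nz u : cc P t u u != 0 by apply: (cc_torus_neq0 uP TP).
have E u (F : 'I_n -> K) : \sum_v (d u v)%:~R * F v = F u.
  rewrite (bigD1 u) //= /d eqxx mul1r big1 ?addr0 // => v /negPf->; by rewrite mul0r.
under eq_bigr => u _ do rewrite !expfzDr //.
rewrite !big_split /=.
have N u : \prod_v cc P t v v ^ (- d u v) = (cc P t u u)^-1.
  by under eq_bigr => v _ do rewrite -invr_expz; rewrite prodfV prod_delta.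
have N2 : \prod_v cc P t v v ^ (- (d k v - d l v)) = (cc P t k k / cc P t l l)^-1.
  under eq_bigr => v _ do rewrite -invr_expz expfzDr //.
  by rewrite prodfV big_split /= prod_delta N.
have N3 : \prod_v cc P t v v ^ (- (z * (d p v - d q v))) = ((cc P t p p / cc P t q q) ^ z)^-1.
  under eq_bigr => v _ do rewrite -invr_expz mulrC -exprz_exp expfzDr // .
  by rewrite prodfV prodz_exp big_split /= prod_delta N.
rewrite prod_delta N N2 N3 => H.
have nk : cc P t k k / cc P t l l != 0 by rewrite mulf_neq0 ?invr_eq0.
have np : (cc P t p p / cc P t q q) ^ z != 0 by rewrite expfz_neq0 // mulf_neq0 ?invr_eq0.
apply: (mulIf (invr_neq0 np)); apply: (mulIf (invr_neq0 nk)).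
rewrite -mulrA [_^-1 * _]mulrC mulrA H; last first.
  move=> h Lh; under eq_bigr => v _ do rewrite !rmorphB rmorphM !rmorphB /= !mulrBl -mulrA mulrBl mulrBr.
  rewrite !sumrB -!mulr_sumr !E (rel h Lh); ring.
by rewrite mulfK // divff.
Qed.

Lemma rsp_root_space a x k l : rsp a x -> cc P x k l != 0 -> root_space G T (wchr T P k l) x.
Proof.
move=> rx nx; split=> [|t Tt]; first by case: rx.
apply: (cc_inj uP); apply/matrixP => i j; rewrite (Ad_torus uP TP) // ccZ.
have [->|nij] := eqVneq (cc P x i j) 0; first by rewrite !mulr0.
congr (_ * _); rewrite -(wchrE P i j Tt) (@wchr_rel i j k l i j 0) ?expr0z ?mulr1 // => h Lh.
by rewrite mul0r addr0 -(rsp_entry rx nij Lh) (rsp_entry rx nx Lh).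
Qed.

Lemma rsp_entry_neq0 x : x <> 0 -> exists k l, cc P x k l != 0.
Proof.
move/eqP => nx; have : cc P x != 0.
  by apply: contraNneq nx => w0; apply/eqP; apply: (cc_inj uP); rewrite w0 cc0.
by case/matrix0Pn => k [l nkl]; exists k, l.
Qed.

Lemma root_partner a x : is_root a -> rsp a x -> x <> 0 ->
  exists2 y, rsp (- a) y & bracket x y = a.
Proof.
move=> [La _ _] rx nx; have [k [l nkl]] := rsp_entry_neq0 nx.
have [al [y [Lal alE rx' ry xy]]] := root_dual (wchr_character hT uP TP k l) (rsp_root_space rx nkl) nx.
have aal : a = al by apply: rsp_uniq rx rx' nx.
by exists y; rewrite aal.
Qed.

Lemma is_rootN a : is_root a -> is_root (- a).
Proof.
move=> ra; have [La _ [x rx nx]] := ra; have [y ry xy] := root_partner ra rx nx.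
apply: (is_rootP _ _ ry); first by rewrite -sub0r; apply: lie_sub => //; apply: lie0.
  by move/eqP; rewrite oppr_eq0 => /eqP; apply: is_root_neq0.
by move=> y0; move: (is_root_neq0 ra); rewrite -xy y0 bracket0r.
Qed.

(** A root vanishing on itself would be orthogonal to all rational replicas of
    the element representing it. *)
Lemma rt_root_neq0 a : is_root a -> rt a a != 0.
Proof.
move=> ra; have [La _ [x rx nx]] := ra; apply/eqP => a0; apply: (is_root_neq0 ra).
have cx : bracket a x = 0 by case: rx => _ ->; rewrite // a0 scale0r.
rewrite (liet_diag La); set d := \row_j _; suff -> : d = 0.
  by rewrite /dg linear0 mulmx0 mul0mx.
apply: (replica_orthogonal_eq0 charK) => phi compat.
have Lz : Lie T (dg P (map_mx ratr phi)).
  apply: (algebraic_replica charK uP (subgroup_monoid frame_aT.1) _ compat) => d'.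
  by rewrite inE => /eqP ->; rewrite -liet_diag.
have : bracket (dg P (map_mx ratr phi)) x = 0.
  apply: (dg_comm (d := d) uP); last by rewrite -liet_diag.
  move=> i j dij; have := compat (fun k => (k == i) : nat) (fun k => (k == j) : nat).
  have E (e : 'rV[K]_n) k : \sum_l ((l == k) : nat)%:R * e 0 l = e 0 k.
    by rewrite (bigD1 k) //= eqxx mul1r big1 ?addr0 // => l /negPf->; rewrite mul0r.
  by rewrite !E; apply => d'; rewrite inE => /eqP ->; rewrite !E.
case: rx => _ -> // => /eqP; rewrite scaler_eq0 => /orP[|/eqP//].
rewrite {1}(liet_diag La) /rt dg_mul // trace_dg // => /eqP e; rewrite -[RHS]e.
by apply: eq_bigr => j _; rewrite !mxE.
Qed.

Lemma coroot_lie a : is_root a -> Lie T (coroot a).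
Proof. by case=> La _ _; apply: lieZ. Qed.

Lemma rt_coroot a : is_root a -> rt a (coroot a) = 2%:R.
Proof. by move=> ra; rewrite rtZr divfK // rt_root_neq0. Qed.

Lemma corootN a : coroot (- a) = - coroot a.
Proof. by rewrite /coroot rtNl rtNr opprK scalerN. Qed.

Lemma rsp_nilp a x : is_root a -> rsp a x -> nilp x.
Proof.
move=> ra [_ Hx]; have Lc := coroot_lie ra.
apply: (@nilp_shift K charK n P x (\row_j cc P (coroot a) j j) 2%:R) => //.
by rewrite -liet_diag // Hx // rt_coroot.
Qed.

Lemma root_sl2 a x : is_root a -> rsp a x -> x <> 0 ->
  exists f, [/\ rsp (- a) f, f <> 0 & sl2_triple x (coroot a) f].
Proof.
move=> ra rx nx; have [y ry xy] := root_partner ra rx nx; have na := rt_root_neq0 ra.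
have n2 : (2%:R : K) != 0 by apply: natr0.
have La := coroot_lie ra.
exists ((2%:R / rt a a) *: y); split; first exact: rspZ.
  move/eqP; rewrite scaler_eq0 mulf_eq0 (negPf n2) invr_eq0 (negPf na) /= => /eqP y0.
  by apply: (is_root_neq0 ra); rewrite -xy y0 bracket0r.
split.
- by case: rx => _ ->; rewrite // rt_coroot.
- have [_ ->] := rspZ (2%:R / rt a a) ry; last by [].
  by rewrite rtNl rt_coroot // scaleNr.
by rewrite bracketZr xy.
Qed.

(** The part of a second root vector orthogonal to f commutes with f, which is
    impossible in positive weight. *)
Lemma rsp_dim1 a x x' : is_root a -> rsp a x -> x <> 0 -> rsp a x' -> exists c, x' = c *: x.
Proof.
move=> ra rx nx rx'; have [f [rf nf S]] := root_sl2 ra rx nx; have Lc := coroot_lie ra.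
have ntr : rt x f <> 0.
  move=> x0; have [_ _ xf] := S; have : rt a (coroot a) = 0.
    rewrite -xf rtC /rt trace_bracket; have [_ Hf] := rf.
    have [La _ _] := ra; rewrite bracketC Hf // -scaleNr -scalemxAr linearZ /= -/(rt x f) x0.
    by rewrite mulr0.
  by rewrite rt_coroot // => /eqP; rewrite (negPf (natr0 1)).
pose u := (- (rt x' f / rt x f)) *: x + x'; exists (rt x' f / rt x f).
apply/eqP; rewrite -subr_eq0 addrC -scaleNr -/u; apply/eqP.
have ru : rsp a u by apply: rsp_linear.
have uf0 : rt u f = 0 by rewrite rtDl rtZl mulNr divfK ?addNr //; apply/eqP.
have uf : bracket u f = 0.
  apply: liet_nondeg => [|h Lh].
    have [Lu Hu] := ru; have [Lf Hf] := rf.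
    apply: rsp0_liet; first exact: lieG_bracket.
    move=> h Lh; have [_ ->] := rsp_bracket ru rf; last by [].
    by rewrite subrr rt0l scale0r.
  have [_ Hu] := ru.
  by rewrite rtC /rt -trace_bracket Hu // -scalemxAl linearZ /= -/(rt u f) uf0 mulr0.
have M := sl2_module_ad S (rsp_nilp ra rx) (rsp_nilp (is_rootN ra) rf).
apply: (@sl2_injE K charK _ _ _ _ (sl2_module_sym M) 2 1) => //.
  by case: ru => _ ->; rewrite // rt_coroot // scaleNr.
by rewrite /= bracketC uf oppr0.
Qed.
End Roots.


Section Strings.
Implicit Types (x y h a b : 'M[K]_n) (c : K).

Definition integral h := Lie T h /\ exists k : 'I_n -> int, h = dg P (\row_j (k j)%:~R).

Lemma integral0 : integral 0.
Proof.
split; first exact: lie0.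
by exists (fun=> 0); rewrite (_ : \row_j _ = 0) ?/dg ?linear0 ?mulmx0 ?mul0mx //; apply/rowP => j; rewrite !mxE.
Qed.

Lemma integralD h h' : integral h -> integral h' -> integral (h + h').
Proof.
move=> [Lh [k hE]] [Lh' [k' h'E]]; split; first exact: lieD.
exists (fun j => k j + k' j); rewrite hE h'E -dg_add; congr dg; apply/rowP => j.
by rewrite !mxE rmorphD.
Qed.

Lemma integral_sum_seq (s : seq 'M[K]_n) (F : 'M[K]_n -> 'M[K]_n) :
  (forall a, a \in s -> integral (F a)) -> integral (\sum_(a <- s) F a).
Proof. by move=> H; rewrite big_seq; elim/big_ind: _ => //; [apply: integral0|apply: integralD]. Qed.

Lemma integral_root a h : is_root a -> integral h -> exists z : int, rt a h = z%:~R.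
Proof.
case=> _ _ [x rx nx] [Lh [k hE]]; have [i [j nij]] := rsp_entry_neq0 nx.
exists (k i - k j); rewrite (rsp_entry rx nij Lh) hE !ccdg // !eqxx !mulr1n !mxE.
by rewrite rmorphB.
Qed.

Lemma sl2_integral e h f : Lie T h -> sl2_triple e h f -> nilp e -> nilp f -> integral h.
Proof.
move=> Lh S ne nf; split=> //.
have H j : exists z : int, cc P h j j = z%:~R.
  have M := sl2_module_vect S ne nf.
  have := @sl2_weight_int K charK _ _ _ _ M (cc P h j j) (invmx P *m delta_mx j 0); apply.
    apply/eqP => /(congr1 (mulmx P)); rewrite mulmxA mulmxV // mul1mx mulmx0 => /matrixP/(_ j 0).
    by rewrite !mxE !eqxx => /eqP; rewrite oner_eq0.
  rewrite {1}(liet_diag Lh) /dg -!mulmxA mulKVmx // scalemxAr; congr (_ *m _).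
  rewrite mul_diag_mx; apply/matrixP => i l; rewrite !mxE.
  by case: eqP => [->|_] //=; rewrite ?mulr0.
have [k kE] := choice H; exists k; rewrite {1}(liet_diag Lh).
by congr dg; apply/rowP => j; rewrite !mxE kE.
Qed.

Lemma integral_coroot a : is_root a -> integral (coroot a).
Proof.
move=> ra; have [_ _ [x rx nx]] := ra; have [f [rf nf S]] := root_sl2 ra rx nx.
apply: (sl2_integral (coroot_lie ra) S); first exact: (rsp_nilp ra rx).
exact: (rsp_nilp (is_rootN ra) rf).
Qed.

Definition cartan a b : int := toint (rt a (coroot b)).

Lemma cartanE a b : is_root a -> is_root b -> rt a (coroot b) = (cartan a b)%:~R.
Proof. by move=> ra rb; apply: tointE; apply: integral_root => //; apply: integral_coroot. Qed.

Lemma cartanaa a : is_root a -> cartan a a = 2.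
Proof. by move=> ra; apply: intr_eq; rewrite -cartanE // rt_coroot. Qed.

Lemma cartanNr a b : is_root a -> is_root b -> cartan a (- b) = - cartan a b.
Proof.
move=> ra rb; apply: intr_eq; rewrite rmorphN /= -!cartanE ?corootN ?rtNr //.
exact: is_rootN.
Qed.

Lemma cartanNl a b : is_root a -> is_root b -> cartan (- a) b = - cartan a b.
Proof.
move=> ra rb; apply: intr_eq; rewrite rmorphN /= -!cartanE ?rtNl //.
exact: is_rootN.
Qed.

Lemma cartanD a b d : is_root a -> is_root b -> is_root (a + b) -> is_root d ->
  cartan (a + b) d = cartan a d + cartan b d.
Proof.
by move=> ra rb rab rc; apply: intr_eq; rewrite rmorphD /= -!cartanE // rtDl.
Qed.

(** Squared lengths of roots are positive rationals: the coroot has integral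
    eigenvalues in the natural representation. *)
Lemma rt_root_pos a : is_root a -> exists2 N : int, 0 < N & rt a a * N%:~R = 4.
Proof.
move=> ra; have [_ [k kE]] := integral_coroot ra; have na := rt_root_neq0 ra.
exists (\sum_j k j ^+ 2).
  rewrite lt_neqAle sumr_ge0 ?andbT; last by move=> j _; rewrite sqr_ge0.
  rewrite eq_sym; apply/eqP => s0.
  have k0 j : k j = 0 by apply/eqP; rewrite -sqrf_eq0 (psumr_eq0P _ s0) // => i _; rewrite sqr_ge0.
  have := rt_coroot ra; rewrite kE (_ : \row_j _ = 0).
    by rewrite /dg linear0 mulmx0 mul0mx rt0r => /esym/eqP; rewrite (negPf (natr0 1)).
  by apply/rowP => j; rewrite !mxE k0.
have : rt (coroot a) (coroot a) = (\sum_j k j ^+ 2)%:~R.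
  rewrite {1 2}kE /rt dg_mul // trace_dg // rmorph_sum; apply: eq_bigr => j _.
  by rewrite !mxE rmorphXn expr2.
move=> <-; rewrite rtZl rtZr; field.
by [].
Qed.

Lemma cartan_rt a b : is_root a -> is_root b -> (cartan a b)%:~R * rt b b = 2 * rt a b.
Proof. by move=> ra rb; rewrite -cartanE // rtZr; field; exact: (rt_root_neq0 rb). Qed.

Lemma cartan_sym a b : is_root a -> is_root b ->
  exists N M : int, [/\ 0 < N, 0 < M & cartan a b * N = cartan b a * M].
Proof.
move=> ra rb; have [N N0 NE] := rt_root_pos ra; have [M M0 ME] := rt_root_pos rb.
exists N, M; split=> //; apply: intr_eq; rewrite !rmorphM /=.
have n4 : (4 : K) != 0 by apply: natr0.
apply: (mulIf n4); rewrite -{1}ME -NE.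
have := cartan_rt ra rb; have := cartan_rt rb ra; rewrite (rtC b a) => e1 e2.
transitivity ((cartan a b)%:~R * rt b b * N%:~R * M%:~R); first by ring.
by rewrite e2 -e1; ring.
Qed.

Lemma cartan_gt0 a b : is_root a -> is_root b -> (0 < cartan a b) = (0 < cartan b a).
Proof.
move=> ra rb; have [N [M [N0 M0 E]]] := cartan_sym ra rb.
by rewrite -(pmulr_lgt0 _ N0) E pmulr_lgt0.
Qed.

Lemma cartan_lt0 a b : is_root a -> is_root b -> (cartan a b < 0) = (cartan b a < 0).
Proof.
move=> ra rb; have [N [M [N0 M0 E]]] := cartan_sym ra rb.
by rewrite -(pmulr_llt0 _ N0) E pmulr_llt0.
Qed.

Lemma cartan_eq0 a b : is_root a -> is_root b -> (cartan a b == 0) = (cartan b a == 0).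
Proof. by move=> ra rb; rewrite !eq_le !leNgt cartan_gt0 // cartan_lt0. Qed.

Lemma rsp_iter a b x y i : rsp a x -> rsp b y -> rsp (b + i%:R *: a) (iter i (bracket x) y).
Proof.
move=> rx ry; elim: i => [|i IH] /=; first by rewrite scale0r addr0.
have -> : b + i.+1%:R *: a = a + (b + i%:R *: a) by rewrite -natr1 scalerDl scale1r addrA addrC.
exact: rsp_bracket.
Qed.

Lemma root_ad_iter a b x y (i : nat) : is_root a -> is_root b -> rsp a x -> x <> 0 -> rsp b y -> y <> 0 ->
  (i%:Z <= - cartan b a) -> iter i (bracket x) y <> 0.
Proof.
move=> ra rb rx nx ry ny le0 i0; apply: ny.
have [f [rf nf S]] := root_sl2 ra rx nx.
have M := sl2_module_ad S (rsp_nilp ra rx) (rsp_nilp (is_rootN ra) rf).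
have [c cE] : exists c : nat, - cartan b a = c.
  by case: (- cartan b a) le0 => // c _; exists c.
apply: (@sl2_injE K charK _ _ _ _ M c i) => //; last by move: le0; rewrite cE.
have [_ ->] := ry; last exact: (coroot_lie ra).
by rewrite cartanE // -[cartan b a]opprK cE rmorphN /= scaleNr.
Qed.

Lemma root_liet a : is_root a -> Lie T a. Proof. by case. Qed.

Lemma root_string a b (i : nat) : is_root a -> is_root b -> (i%:Z <= - cartan b a) ->
  b + i%:R *: a <> 0 -> is_root (b + i%:R *: a).
Proof.
move=> ra rb le nz; have [La _ [x rx nx]] := ra; have [Lb _ [y ry ny]] := rb.
apply: (is_rootP _ nz (rsp_iter i rx ry)); last exact: (root_ad_iter ra rb).
by rewrite addrC; apply: lie_linear.
Qed.

Lemma root_add a b : is_root a -> is_root b -> cartan b a < 0 -> b + a <> 0 -> is_root (b + a).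
Proof.
move=> ra rb lt nz; have := @root_string a b 1 ra rb; rewrite scale1r; apply=> //.
by rewrite lerNr -ltzD1 addNr.
Qed.

Lemma root_sub a b : is_root a -> is_root b -> 0 < cartan b a -> b <> a -> is_root (b - a).
Proof.
move=> ra rb lt nz; apply: root_add => //; [exact: is_rootN|by rewrite cartanNr // oppr_lt0|].
by move/eqP; rewrite subr_eq0 => /eqP.
Qed.

Lemma root_refl a b : is_root a -> is_root b -> is_root (b - (cartan b a)%:~R *: a).
Proof.
move=> ra rb; have nz : b - (cartan b a)%:~R *: a <> 0.
  move=> E; have := congr1 (fun u => rt u (coroot a)) E; rewrite /= rtBl rtZl rt0l rt_coroot // cartanE //.
  rewrite mulr_natr mulr2n opprD addrA subrr sub0r => /eqP; rewrite oppr_eq0 (intr_eq0K charK) => /eqP c0.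
  by apply: (is_root_neq0 rb); move: E; rewrite c0 scale0r subr0.
case E: (cartan b a) nz => [k|k] nz.
  have -> : b - k%:~R *: a = b + k%:R *: - a by rewrite scalerN.
  apply: root_string => //; [exact: is_rootN|by rewrite cartanNr // opprK E|by rewrite scalerN].
have -> : b - (Negz k)%:~R *: a = b + k.+1%:R *: a by rewrite NegzE rmorphN /= scaleNr opprK.
apply: root_string => //; first by rewrite E NegzE opprK.
by move: nz; rewrite NegzE rmorphN /= scaleNr opprK.
Qed.

(** By sl2-theory along the string of b, after exchanging a and b if needed, the
    bracket does not vanish. *)
Lemma root_bracket_neq0 a b x y : is_root a -> is_root b -> is_root (a + b) ->
  rsp a x -> x <> 0 -> rsp b y -> y <> 0 -> bracket x y <> 0.
Proof.
move=> ra rb rab rx nx ry ny; have [lt|ge] := ltP (cartan b a) 0.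
  by apply: (@root_ad_iter a b x y 1) => //; rewrite lerNr -ltzD1 addNr.
have [f [rf nf S]] := root_sl2 ra rx nx.
have M := sl2_module_ad S (rsp_nilp ra rx) (rsp_nilp (is_rootN ra) rf).
have La := root_liet ra; have Lc := coroot_lie ra; have Lb := root_liet rb.
pose Q u := Lie G u /\ forall h, Lie T h -> rt a h = 0 -> bracket h u = rt b h *: u.
have Qadd s (d : 'M[K]_n) u v : rsp d v -> (forall h, rt a h = 0 -> rt d h = 0) -> Q u -> Q (s *: bracket v u).
  move=> [Lv Hv] c0 [Lu Hu]; split=> [|h Lh ah]; first by apply: lieZ; apply: lieG_bracket.
  by rewrite bracketZr jacobi Hv // c0 // scale0r bracket0l add0r Hu // bracketZr !scalerA mulrC.
have [|c u v [Lu Hu] [Lv Hv]|U UE] := @vspace_of_pred K _ Q.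
- by split=> [|h _ _]; rewrite ?bracket0r ?scaler0 //; apply: lie0.
- split=> [|h Lh ah]; first exact: lie_linear.
  by rewrite bracketDr bracketZr Hu // Hv // scalerDr !scalerA mulrC.
have [_ _ [w rw nw]] := rab.
have [m mE] : exists m : nat, cartan (a + b) a = m.+1.
  rewrite cartanD // cartanaa //; case: (cartan b a) ge => // k _.
  by exists k.+1.
have [||| |u [/UE [Lu Hu] hu eu]] := @sl2_surjE K charK _ _ _ _ U m w M.
- by move=> u /UE Qu; apply/UE; rewrite -[bracket _ _]scale1r; apply: (Qadd 1 a).
- move=> u /UE Qu; apply/UE; rewrite -[bracket _ _]scale1r; apply: (Qadd 1 (- a)) => // h ah.
  by rewrite rtNl ah oppr0.
- apply/UE; split=> [|h Lh ah]; first by case: rw.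
  by have [_ ->] := rw; rewrite // rtDl ah add0r.
- by have [_ ->] := rw; rewrite // cartanE // mE.
have ru : rsp b u.
  split=> // h Lh; pose h1 := h - (rt a h / 2) *: coroot a.
  have n2 : (2 : K) != 0 by apply: natr0.
  have Lh1 : Lie T h1 by apply: lie_sub => //; apply: lieZ.
  have ah1 : rt a h1 = 0 by rewrite rtBr rtZr rt_coroot // divfK // subrr.
  have -> : h = h1 + (rt a h / 2) *: coroot a by rewrite subrK.
  rewrite bracketDl bracketZl Hu // hu scalerA rtDr rtZr [in RHS]scalerDl; congr (_ + _ *: _).
  congr (_ * _); have := cartanE rab ra; rewrite rtDl rt_coroot // mE => E.
  by rewrite -[X in _ - X]addr0; apply/eqP; rewrite subr_eq addrC addr0; apply/eqP; rewrite E.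
have [c ycu] := rsp_dim1 rb ry ny ru => xy0; apply: nw.
by rewrite -eu ycu bracketZr xy0 scaler0.
Qed.

Lemma root_twice a : is_root a -> is_root (2%:R *: a) -> False.
Proof.
move=> ra r2.
have n3 : is_root (3%:R *: a) -> False.
  move=> r3; have := cartanE ra r3; rewrite rtZr !rtZl !rtZr.
  have na := rt_root_neq0 ra; have n3 : (3 : K) != 0 by apply: natr0.
  have -> : 2 / (3 * (3 * rt a a)) * (3 * rt a a) = 2 / 3 :> K by field; rewrite na n3.
  move/(congr1 (fun u => u * 3)); rewrite divfK // => E.
  have : (2 : int) = cartan a (3%:R *: a) * 3 by apply: intr_eq; rewrite rmorphM.
  lia.
have [_ _ [x rx nx]] := ra; have [_ _ [w rw nw]] := r2.
have [f [rf nf [he hf ef]]] := root_sl2 ra rx nx.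
have xw : bracket x w = 0.
  apply: contrapT => nxw; apply: n3.
  have -> : 3%:R *: a = a + 2%:R *: a by rewrite -{2}[a]scale1r -scalerDl.
  apply: (is_rootP _ _ (rsp_bracket rx rw) nxw).
    by rewrite -{1}[a]scale1r -scalerDl; apply: lieZ; apply: root_liet.
  rewrite -{1}[a]scale1r -scalerDl => /eqP; rewrite scaler_eq0 -[1 + 2]/(3%:R) (negPf (natr0 2)) /=.
  by move/eqP; apply: (is_root_neq0 ra).
have rfw : rsp a (bracket f w).
  have := rsp_bracket rf rw; suff -> : - a + 2%:R *: a = a by [].
  by rewrite scaler_nat mulr2n addrA addNr add0r.
have [c cE] := rsp_dim1 ra rx nx rfw.
have : bracket (coroot a) w = 0.
  by rewrite -ef; have := jacobi x f w; rewrite xw bracket0r addr0 => <-; rewrite cE bracketZr bracketxx scaler0.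
have [_ ->] := rw; last exact: (coroot_lie ra).
by rewrite rtZl rt_coroot // => /eqP; rewrite scaler_eq0 -natrM (negPf (natr0 3)) /= => /eqP.
Qed.
End Strings.


Section Reflections.
Implicit Types (x y h a b g : 'M[K]_n) (c : K).

Lemma expmG x : Lie G x -> nilp x -> G (expm x).
Proof. exact: lie_expm frame_aG. Qed.

Lemma theta_G e f : Lie G e -> Lie G f -> nilp e -> nilp f -> G (theta e f).
Proof.
move=> Le Lf ne nf; have [_ GM] := frame_mG; apply: (GM); first apply: (GM); apply: expmG => //.
  by rewrite -scaleN1r; apply: lieZ.
exact: nilpN.
Qed.

Lemma GV g : G g -> G (invmx g).
Proof. by move=> Gg; have [[_ _ _ +] _] := frame_aG; apply. Qed.

Lemma Ad_invert g t : g \in unitmx -> t \in unitmx -> t *m g *m t = g -> Ad g t = invmx t.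
Proof.
move=> ug ut E; have E2 : g *m t = invmx t *m g by rewrite -{2}E -!mulmxA mulKmx.
by rewrite /Ad E2 mulmxK.
Qed.

Lemma Ad_inverted g t : g \in unitmx -> t \in unitmx -> Ad g t = invmx t -> Ad t g = t *m t *m g.
Proof.
move=> ug ut; rewrite /Ad => /(congr1 (mulmx^~ g)); rewrite mulmxKV // => E.
have E2 : t *m g *m t = g by rewrite -mulmxA E mulKVmx.
by rewrite -{1}E2 -!mulmxA mulmxV // mulmx1.
Qed.

(** An element of G normalizing the torus algebra normalizes the torus, the
    torus being cut out by the relations between weights. *)
Lemma torus_Ad g t : G g -> (forall h, Lie T h -> Lie T (Ad g h)) -> T t -> T (Ad g t).
Proof.
move=> Gg gt Tt; have ug := Gunit Gg; have uV : invmx g \in unitmx by rewrite unitmx_inv.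
have uP' : P *m invmx g \in unitmx by rewrite unitmx_mul uV (uP : P \in unitmx).
have dgA d : dg (P *m invmx g) d = Ad g (dg P d).
  by rewrite /dg /Ad invmx_mul // invmxK !mulmxA.
have [z nz tE] := (TP t).1 Tt; rewrite tE -dgA.
have [||Q QP] := @mx_of_pred K n (fun d => Lie T (dg P d)).
- by rewrite /dg linear0 mulmx0 mul0mx; apply: lie0.
- by move=> c d d' Ld Ld'; rewrite dg_add dgZ; apply: lie_linear.
apply: (algebraic_diag charK uP' frame_aT (ds := [seq row i Q | i <- enum 'I_n])).
- by move=> d /mapP [i _ ->]; rewrite dgA; apply: gt; apply/QP; apply: row_sub.
- by move=> j; rewrite mxE; apply: prodz_neq0.
move=> u v H; have mc j : monorow (@tf_b _ _ _ _ R) z 0 j != 0 by rewrite mxE; apply: prodz_neq0.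
set V := \prod_j _ ^+ v j.
have nV : V != 0 by apply/prodf_neq0 => j _; rewrite expf_neq0.
suff E : \prod_j monorow (@tf_b _ _ _ _ R) z 0 j ^ ((u j)%:Z - (v j)%:Z) = 1.
  move: E; under eq_bigr => j _ do rewrite expfzDr // -invr_expz.
  rewrite big_split /= prodfV => E.
  by rewrite -[LHS](divfK nV) E mul1r.
have := @torus_relation K charK n G T (tf_T R) P _ _ uP TP (fun j => (u j)%:Z - (v j)%:Z) t _ Tt.
rewrite tE; under eq_bigr => j _ do rewrite ccdg // eqxx mulr1n.
apply=> x Lx; under eq_bigr => j _ do rewrite rmorphB /= mulrBl.
rewrite sumrB; apply/eqP; rewrite subr_eq0; apply/eqP.
have := Lx; rewrite {1}(liet_diag Lx) => /QP /submxP [w wE].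
have E (m : 'I_n -> nat) : \sum_j (m j)%:R * cc P x j j = \sum_i w 0 i * \sum_j (m j)%:R * (row i Q) 0 j.
  have xE j : cc P x j j = \sum_i w 0 i * Q i j by move/rowP: wE => /(_ j); rewrite !mxE.
  under eq_bigr => j _ do rewrite xE mulr_sumr.
  rewrite exchange_big; apply: eq_bigr => i _; rewrite mulr_sumr.
  by apply: eq_bigr => j _; rewrite mxE mulrCA.
rewrite -[LHS]/(\sum_j (u j)%:R * cc P x j j) -[RHS]/(\sum_j (v j)%:R * cc P x j j) !E.
by apply: eq_bigr => i _; rewrite H //; apply/mapP; exists i; rewrite ?mem_enum.
Qed.


Lemma norm_torus g : G g -> (forall h, Lie T h -> Lie T (Ad g h)) ->
  (forall h, Lie T h -> Lie T (Ad (invmx g) h)) -> normalizer G T g.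
Proof.
move=> Gg gt gt'; split=> //; apply/seteqP; split=> [_ [t Tt <-]|t Tt]; first exact: torus_Ad.
exists (Ad (invmx g) t); first by apply: torus_Ad => //; apply: GV.
by rewrite AdVK //; apply: Gunit.
Qed.

Lemma rsp_Ad g a x : G g -> (forall h, Lie T h -> Lie T (Ad g h)) ->
  (forall h, Lie T h -> Lie T (Ad (invmx g) h)) -> rsp a x -> rsp (Ad g a) (Ad g x).
Proof.
move=> Gg gt gt' [Lx Hx]; have ug := Gunit Gg.
split=> [|h Lh]; first exact: lieG_Ad.
rewrite -{1}(AdVK ug h) -Ad_bracket // Hx; last exact: gt'.
by rewrite AdZ /rt trace_Ad_mul.
Qed.

Lemma is_root_Ad g a : G g -> (forall h, Lie T h -> Lie T (Ad g h)) ->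
  (forall h, Lie T h -> Lie T (Ad (invmx g) h)) -> is_root a -> is_root (Ad g a).
Proof.
move=> Gg gt gt' ra; have ug := Gunit Gg; have [La _ [x rx nx]] := ra.
apply: (is_rootP _ _ (rsp_Ad Gg gt gt' rx)); first exact: gt.
- by move=> E; apply: (is_root_neq0 ra); rewrite -(AdK ug a) E Ad0.
- by move=> E; apply: nx; rewrite -(AdK ug x) E Ad0.
Qed.

Lemma coroot_Ad g a : g \in unitmx -> coroot (Ad g a) = Ad g (coroot a).
Proof. by move=> ug; rewrite /coroot AdZ /rt trace_Ad_mul // AdK. Qed.

Lemma rt_Ad g a h : g \in unitmx -> rt (Ad g a) (Ad g h) = rt a h.
Proof. by move=> ug; rewrite /rt trace_Ad_mul // AdK. Qed.

(** The one-parameter subgroup of an integral element of the torus algebra. *)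
Lemma integral_torus h z : integral h -> z != 0 -> exists t, [/\ T t,
  forall a x (m : int), rsp a x -> rt a h = m%:~R -> Ad t x = z ^ m *: x &
  forall g, g \in unitmx -> Ad g h = - h -> Ad g t = invmx t].
Proof.
move=> [Lh [k hE]] nz; pose c : 'rV[K]_n := \row_j z ^ k j.
have nc j : c 0 j != 0 by rewrite mxE expfz_neq0.
have Tt : T (dg P c).
  apply: (algebraic_diag charK uP frame_aT (ds := [:: \row_j (k j)%:~R])) => //.
    by move=> d; rewrite inE => /eqP ->; rewrite -hE.
  move=> u v /(_ _ (mem_head _ _)) H.
  have E (w : 'I_n -> nat) : \prod_j c 0 j ^+ w j = z ^ (\sum_j (w j)%:Z * k j).
    rewrite -prodz_sum //; apply: eq_bigr => j _.
    by rewrite mxE -[_ ^+ w j]/(_ ^ (w j)%:Z) exprz_exp mulrC.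
  rewrite !E; congr (z ^ _); apply: intr_eq; rewrite !rmorph_sum.
  under eq_bigr => j _ do rewrite rmorphM.
  under [RHS]eq_bigr => j _ do rewrite rmorphM.
  have F (w : 'I_n -> nat) : \sum_j (w j)%:R * (\row_j0 (k j0)%:~R : 'rV[K]_n) 0 j =
      \sum_j ((w j)%:Z)%:~R * (k j)%:~R by apply: eq_bigr => j _; rewrite mxE.
  by move: H; rewrite !F.
have ut : dg P c \in unitmx by apply: dg_unit.
have ek h' i : h' = h -> cc P h' i i = (k i)%:~R by move=> ->; rewrite hE ccdg // eqxx mulr1n mxE.
exists (dg P c); split=> // [a x m rx am|g ug gh].
  apply: (cc_inj uP); apply/matrixP => i j; rewrite (Ad_torus uP TP) // ccZ !ccdg // !eqxx !mulr1n !mxE.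
  have [->|nx] := eqVneq (cc P x i j) 0; first by rewrite !mulr0.
  congr (_ * _); have := rsp_entry rx nx Lh; rewrite am !ek // -rmorphB => /intr_eq ->.
  by rewrite expfzDr // -invr_expz.
suff E : dg P c *m g *m dg P c = g.
  exact: Ad_invert E.
apply: (cc_inj uP); apply/matrixP => i j; rewrite (cc_mul uP) (cc_mul uP (dg P c) g) !cc_dg // mul_mx_diag mul_diag_mx !mxE.
have [->|ng] := eqVneq (cc P g i j) 0; first by rewrite mulr0 mul0r.
have hg : g *m h = - h *m g by rewrite -gh /Ad mulmxKV.
have := congr1 (fun u => cc P u i j) hg; rewrite /= mulNmx -scaleN1r ccZ mulN1r !cc_mul // hE cc_dg //.
rewrite mul_mx_diag mul_diag_mx !mxE mulrC => E.
have : (k j)%:~R = - (k i)%:~R :> K by apply: (mulIf ng); rewrite E mulNr.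
rewrite -rmorphN => /intr_eq ->; rewrite mulrAC -expfzDr // subrr.
by rewrite mul1r.
Qed.

Section OneRoot.
Variables (a e f : 'M[K]_n).
Hypotheses (ra : is_root a) (re : rsp a e) (rf : rsp (- a) f) (S : sl2_triple e (coroot a) f).

Lemma root_nilpE : nilp e. Proof. exact: (rsp_nilp ra re). Qed.
Lemma root_nilpF : nilp f. Proof. exact: (rsp_nilp (is_rootN ra) rf). Qed.

Lemma theta_root_G : G (theta e f).
Proof. by apply: theta_G; [case: re|case: rf|exact: root_nilpE|exact: root_nilpF]. Qed.

Lemma theta_root_refl h : Lie T h -> Ad (theta e f) h = h - rt a h *: coroot a.
Proof.
move=> Lh; have [he hf ef] := S; have [_ He] := re; have [_ Hf] := rf.
apply: (theta_refl charK (a := rt a h *: e) (a' := rt a h *: f) root_nilpE root_nilpF).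
- by rewrite bracketC He.
- by rewrite bracketZr bracketxx scaler0.
- by rewrite bracketC Hf // rtNl scaleNr opprK.
- by rewrite bracketZr bracketxx scaler0.
- by rewrite bracketZr bracketC ef scalerN.
- by rewrite bracketZr bracketC hf opprK !scalerA mulrC.
- by rewrite bracketZr bracketC he scalerN !scalerA mulrC.
Qed.

Lemma theta_root_lie h : Lie T h -> Lie T (Ad (theta e f) h).
Proof.
by move=> Lh; rewrite theta_root_refl //; apply: lie_sub => //; apply: lieZ; apply: (coroot_lie ra).
Qed.

Lemma theta_root_invol h : Lie T h -> Ad (theta e f) (Ad (theta e f) h) = h.
Proof.
move=> Lh; rewrite (theta_root_refl Lh) AdB AdZ !theta_root_refl //; last exact: (coroot_lie ra).
rewrite rt_coroot // scaler_nat mulr2n.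
by apply/matrixP => i j; rewrite !mxE; ring.
Qed.

Lemma theta_root_inv h : Lie T h -> Ad (invmx (theta e f)) h = Ad (theta e f) h.
Proof.
move=> Lh; have ut := Gunit theta_root_G.
by rewrite -{1}(theta_root_invol Lh) AdK.
Qed.

Lemma theta_root_lieV h : Lie T h -> Lie T (Ad (invmx (theta e f)) h).
Proof. by move=> Lh; rewrite theta_root_inv //; apply: theta_root_lie. Qed.

(** With z^2 = c, the coroot gives an element of T scaling e by c, and the
    reflection inverts it. *)
Lemma theta_scale c : c != 0 -> exists2 t, T t & theta (c *: e) (c^-1 *: f) = t *m theta e f.
Proof.
move=> nc; have [z zE] : exists z : K, z ^+ 2 = c.
  have [z] := @solve_monicpoly K 2 (fun i => if i == 0%N then c else 0) isT.
  by rewrite !big_ord_recl big_ord0 /= mul0r !addr0 expr0 mulr1 => zE; exists z.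
have nz : z != 0 by apply: contraNneq nc => z0; rewrite -zE z0 expr0n.
have [t [Tt tE tV]] := integral_torus (integral_coroot ra) nz.
have ut := Tunit Tt; have [_ _ th] := theta_sl2 charK S root_nilpE root_nilpF.
have utheta := theta_unit charK root_nilpE root_nilpF.
have Tt2 : T (t *m t) by have [_ TM] := subgroup_monoid frame_aT.1; apply: TM.
exists (t *m t) => //.
have -> : c *: e = Ad t e by rewrite (tE a e 2) // ?rt_coroot // -zE.
have -> : c^-1 *: f = Ad t f by rewrite (tE (- a) f (- 2)) // ?rtNl ?rt_coroot ?rmorphN // -zE exprnP invr_expz.
rewrite -Ad_theta_conj //; [|exact: root_nilpE|exact: root_nilpF].
by rewrite (Ad_inverted utheta ut (tV _ utheta th)).
Qed.

End OneRoot.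
End Reflections.


(** * Gradings *)
Section Filtration.
Implicit Types (x y z h a b g u : 'M[K]_n) (c : K) (d e : int).

Definition kk h (i : 'I_n) : int := toint (cc P h i i).

Lemma kkE h i : integral h -> cc P h i i = (kk h i)%:~R.
Proof.
case=> _ [k ->]; apply: tointE; exists (k i).
by rewrite ccdg // eqxx mulr1n mxE.
Qed.

(** The matrices raising the weights of h by at least d. *)
Definition fil h d x := forall i j, cc P x i j != 0 -> d <= kk h i - kk h j.

Definition ival a h : int := toint (rt a h).

Lemma ivalE a h : is_root a -> integral h -> rt a h = (ival a h)%:~R.
Proof. by move=> ra ih; apply: tointE; apply: (integral_root ra ih). Qed.

Lemma ivalDr a h h' : is_root a -> integral h -> integral h' -> ival a (h + h') = ival a h + ival a h'.
Proof.
move=> ra ih ih'; apply: intr_eq; rewrite rmorphD /= -!ivalE ?rtDr //.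
exact: integralD.
Qed.

Lemma ivalDl a b h : is_root a -> is_root b -> is_root (a + b) -> integral h ->
  ival (a + b) h = ival a h + ival b h.
Proof. by move=> ra rb rab ih; apply: intr_eq; rewrite rmorphD /= -!ivalE ?rtDl. Qed.

Lemma ivalN a h : is_root a -> integral h -> ival (- a) h = - ival a h.
Proof.
move=> ra ih; apply: intr_eq; rewrite rmorphN /= -!ivalE ?rtNl //.
exact: is_rootN.
Qed.

Lemma fil0 h d : fil h d 0. Proof. by move=> i j; rewrite cc0 mxE eqxx. Qed.

Lemma fil_linear h d c x y : fil h d x -> fil h d y -> fil h d (c *: x + y).
Proof.
move=> Hx Hy i j; rewrite ccD ccZ => nz; have [x0|/Hx//] := eqVneq (cc P x i j) 0.
by apply: Hy; move: nz; rewrite x0 mulr0 add0r.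
Qed.

Lemma filZ h d c x : fil h d x -> fil h d (c *: x).
Proof. by move=> Hx; rewrite -[_ *: _]addr0; apply: fil_linear => //; apply: fil0. Qed.
Lemma filD h d x y : fil h d x -> fil h d y -> fil h d (x + y).
Proof. by move=> Hx Hy; rewrite -[x]scale1r; apply: fil_linear. Qed.
Lemma filB h d x y : fil h d x -> fil h d y -> fil h d (x - y).
Proof. by move=> Hx Hy; rewrite addrC -scaleN1r; apply: fil_linear. Qed.
Lemma filN h d x : fil h d x -> fil h d (- x).
Proof. by rewrite -scaleN1r; apply: filZ. Qed.
Lemma fil_sum h d I (s : seq I) (F : I -> 'M[K]_n) : (forall i, fil h d (F i)) -> fil h d (\sum_(i <- s) F i).
Proof. by move=> H; elim/big_ind: _ => //; [apply: fil0|apply: filD]. Qed.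

Lemma fil_le h d e x : d <= e -> fil h e x -> fil h d x.
Proof. by move=> de Hx i j /Hx; apply: le_trans. Qed.

Lemma fil_mul h d e x y : fil h d x -> fil h e y -> fil h (d + e) (x *m y).
Proof.
move=> Hx Hy i j; rewrite cc_mul // mxE => nz.
have [l nl] : exists l, cc P x i l * cc P y l j != 0.
  apply: contrapT => no; move/eqP: nz; apply; rewrite big1 // => l _.
  by apply: contrapT => /eqP nl; apply: no; exists l.
move: nl; rewrite mulf_eq0 negb_or => /andP [/Hx h1 /Hy h2].
by have := lerD h1 h2; rewrite addrA subrK.
Qed.

Lemma fil_bracket h d e x y : fil h d x -> fil h e y -> fil h (d + e) (bracket x y).
Proof. by move=> Hx Hy; apply: filB; [|rewrite addrC]; apply: fil_mul. Qed.

Lemma fil1 h : fil h 0 1%:M.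
Proof.
move=> i j; rewrite ccE mulmx1 mulmxV // mxE.
by case: (eqVneq i j) => [->|_]; rewrite ?subrr // eqxx.
Qed.

Lemma fil_torus h h' : Lie T h' -> fil h 0 h'.
Proof.
move=> /liet_diag -> i j; rewrite ccdg //.
by case: (eqVneq i j) => [->|_]; rewrite ?subrr // mulr0n eqxx.
Qed.

Lemma fil_rsp h a x : is_root a -> integral h -> rsp a x -> fil h (ival a h) x.
Proof.
move=> ra ih rx i j nz; have [Lh _] := ih; have := rsp_entry rx nz Lh.
by rewrite ivalE // !kkE // -rmorphB => /intr_eq ->.
Qed.

Lemma fil_bound h : exists N : nat, forall x, fil h N%:Z x -> x = 0.
Proof.
pose N := (\max_i `|kk h i|)%N; have le i : `|kk h i| <= N%:Z.
  by rewrite -abszE lez_nat; apply: (@leq_bigmax _ (fun i => `|kk h i|%N) i).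
exists (N + N).+1 => x Hx; apply: (cc_inj uP); rewrite cc0; apply/matrixP => i j; rewrite [RHS]mxE.
apply: contrapT => /eqP /Hx; have := le i; have := le j; lia.
Qed.

Lemma fil_exprS h d x k : 0 <= d -> fil h d x -> fil h d (x ^+ k.+1).
Proof.
move=> d0 Hx; elim: k => // k IH; rewrite exprS; apply: (@fil_le h d (d + d)).
  by rewrite lerDl.
exact: fil_mul.
Qed.

Lemma fil_nilp h x : fil h 1 x -> nilp x.
Proof.
move=> Hx; have [N HN] := fil_bound h; exists N; apply: (HN).
elim: N {HN} => [|N IH]; first by rewrite expr0; apply: fil1.
by rewrite exprS -[N.+1]addn1 addnC PoszD; apply: fil_mul.
Qed.

Lemma fil_expr0 h x k : fil h 0 x -> fil h 0 (x ^+ k).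
Proof. by case: k => [|k] Hx; [rewrite expr0; apply: fil1|apply: fil_exprS]. Qed.

Lemma fil_expm0 h x : nilp x -> fil h 0 x -> fil h 0 (expm x).
Proof.
move=> [N N0] Hx; rewrite (expNE N0); apply: fil_sum => k; apply: filZ; exact: fil_expr0.
Qed.

Lemma fil_expm_congr h x y : nilp x -> nilp y -> fil h 0 x -> fil h 0 y -> fil h 1 (x - y) ->
  fil h 1 (expm x - expm y).
Proof.
move=> [N N0] [M M0] Hx Hy Hxy.
have N1 : x ^+ (N + M) = 0 by rewrite exprD N0 mul0r.
have M1 : y ^+ (N + M) = 0 by rewrite exprD M0 mulr0.
rewrite (expNE N1) (expNE M1) -sumrB; apply: fil_sum => k; rewrite -scalerBr; apply: filZ.
elim: {N0 M0 N1 M1}(k : nat) => [|m IH]; first by rewrite !expr0 subrr; apply: fil0.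
have -> : x ^+ m.+1 - y ^+ m.+1 = (x - y) * x ^+ m + y * (x ^+ m - y ^+ m).
  by rewrite !exprS mulrBl mulrBr addrA subrK.
apply: filD; first by rewrite -[1]addr0; apply: fil_mul => //; apply: fil_expr0.
by rewrite -[1]add0r; apply: fil_mul.
Qed.

Lemma fil_expm_sub1 h x : fil h 1 x -> fil h 1 (expm x - 1%:M).
Proof.
move=> Hx; rewrite -(expm0 K n); apply: fil_expm_congr => //; [exact: fil_nilp Hx|exact: nilp0| |exact: fil0|].
  exact: fil_le Hx.
by rewrite subr0.
Qed.

Lemma fil_expm2 h d x : 1 <= d -> fil h d x -> fil h (d + 1) (expm x - 1%:M - x).
Proof.
move=> d1 Hx; have [N N0] := fil_nilp (fil_le d1 Hx).
have N2 : x ^+ N.+2 = 0 by rewrite !exprSr N0 !mul0r.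
rewrite (expNE N2) /expN 2!big_ord_recl /= expr0 expr1 invr1 !scale1r.
rewrite -[1%:M]/(1 : 'M[K]_n) [1 + _]addrC addrK [x + _]addrC addrK.
apply: fil_sum => k; apply: filZ; rewrite /bump /= !add1n exprS.
apply: (@fil_le h _ (d + d)); first by rewrite lerD2l.
by apply: fil_mul => //; apply: fil_exprS => //; apply: le_trans d1.
Qed.

Definition gr h d x : 'M[K]_n :=
  invmx P *m (\matrix_(i, j) (cc P x i j *+ (kk h i - kk h j == d))) *m P.

Lemma cc_gr h d x i j : cc P (gr h d x) i j = cc P x i j *+ (kk h i - kk h j == d).
Proof. by rewrite [in LHS]ccE /gr !mulmxA mulmxV // mul1mx mulmxK // mxE. Qed.

Lemma fil_gr h d x : fil h d (gr h d x).
Proof. by move=> i j; rewrite cc_gr; case: (_ =P d) => [->//|_]; rewrite mulr0n eqxx. Qed.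

Lemma fil_sub_gr h d x : fil h d x -> fil h (d + 1) (x - gr h d x).
Proof.
move=> Hx i j; rewrite -scaleN1r ccD ccZ cc_gr; case: (_ =P d) => [_|ne].
  by rewrite mulr1n mulN1r subrr eqxx.
rewrite mulr0n mulr0 addr0 => /Hx; rewrite le_eqVlt => /orP[/eqP e|]; first by case: ne.
by rewrite lezD1.
Qed.

Lemma bracket_gr h d x : integral h -> bracket h (gr h d x) = d%:~R *: gr h d x.
Proof.
move=> ih; apply: (cc_inj uP); apply/matrixP => i j; have [Lh _] := ih.
rewrite liet_bracket // ccZ cc_gr !kkE // -rmorphB.
by case: eqP => [->//|_]; rewrite mulr0n !mulr0.
Qed.

Lemma gr_stable (U : 'M[K]_n -> Prop) h d x : integral h -> U 0 ->
  (forall c u v, U u -> U v -> U (c *: u + v)) -> (forall u, U u -> U (bracket h u)) ->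
  U x -> U (gr h d x).
Proof.
move=> ih U0 UL Uh Ux; pose ws := undup [seq ((kk h p.1 - kk h p.2)%:~R : K) | p <- enum (('I_n * 'I_n)%type : finType)].
have [wd|nd] := boolP ((d%:~R : K) \in ws); last first.
  suff -> : gr h d x = 0 by [].
  apply: (cc_inj uP); rewrite cc0; apply/matrixP => i j; rewrite cc_gr [RHS]mxE.
  case: eqP => [e|_]; last by rewrite mulr0n.
  by case/negP: nd; rewrite mem_undup; apply/mapP; exists (i, j); rewrite ?mem_enum //= e.
rewrite -(tointK charK d).
apply: (@gen_eigen_component K _ (bracket h) U U0 UL Uh ws (fun w => gr h (toint w) x)) wd => //.
- exact: undup_uniq.
- move=> w; rewrite mem_undup => /mapP [p _ ->]; exists 1%N; rewrite /= (tointK charK).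
  by rewrite bracket_gr // subrr.
suff <- : x = \sum_(w <- ws) gr h (toint w) x by [].
apply: (cc_inj uP); apply/matrixP => i j; rewrite cc_sum.
rewrite (bigD1_seq ((kk h i - kk h j)%:~R : K)) ?undup_uniq //=; last first.
  by rewrite mem_undup; apply/mapP; exists (i, j); rewrite ?mem_enum.
rewrite cc_gr (tointK charK) eqxx mulr1n big_seq_cond big1 ?addr0 // => w /andP [].
rewrite mem_undup => /mapP [p _ ->] ne; rewrite cc_gr (tointK charK); case: eqP => // e.
by rewrite e eqxx in ne.
Qed.

(** ** The unipotent group of an integral element *)

Definition nil_alg h : set 'M[K]_n := [set x | Lie G x /\ fil h 1 x].
Definition unip h : set 'M[K]_n := [set g | G g /\ fil h 1 (g - 1%:M)].

Lemma unip_expm h x : nil_alg h x -> unip h (expm x).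
Proof.
by move=> [Lx Hx]; split; [apply: expmG => //; apply: fil_nilp Hx|apply: fil_expm_sub1].
Qed.

Lemma unip_log h u : unip h u -> exists2 y, nil_alg h y & u = expm y.
Proof.
move=> [Gu Hu]; have [y [ny uE [N [s yE]] Ly]] := logarithm charK (fil_nilp Hu).
exists y => //; split; first by apply: Ly => //; apply: frame_mG.
rewrite yE; apply: fil_sum => k; apply: filZ; exact: fil_exprS.
Qed.

Lemma nil_alg_linear h c x y : nil_alg h x -> nil_alg h y -> nil_alg h (c *: x + y).
Proof. by move=> [Lx Hx] [Ly Hy]; split; [apply: lie_linear|apply: fil_linear]. Qed.

Lemma unip1 h : unip h 1%:M.
Proof. by split; [case: frame_mG|rewrite subrr; apply: fil0]. Qed.

Lemma unip_fil0 h u : unip h u -> fil h 0 u.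
Proof.
move=> [_ Hu]; rewrite -(subrK 1%:M u); apply: filD; last exact: fil1.
exact: fil_le Hu.
Qed.

Lemma unipM h u v : unip h u -> unip h v -> unip h (u *m v).
Proof.
move=> Hu Hv; split; first by have [_ GM] := frame_mG; apply: GM; [case: Hu|case: Hv].
have -> : u *m v - 1%:M = u *m (v - 1%:M) + (u - 1%:M) by rewrite mulmxBr mulmx1 addrA subrK.
apply: filD; last by case: Hu.
by rewrite -[1]add0r; apply: fil_mul; [apply: unip_fil0|case: Hv].
Qed.

Lemma unipV h u : unip h u -> unip h (invmx u).
Proof.
move=> /unip_log [y Hy ->]; rewrite invmx_expm //; last by case: Hy => _; apply: fil_nilp.
by apply: unip_expm; rewrite -scaleN1r -[_ *: _]addr0; apply: nil_alg_linear => //; split; [apply: lie0|apply: fil0].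
Qed.

Lemma fil_comm h g : integral h -> bracket g h = 0 -> fil h 0 g.
Proof.
move=> ih gh i j nz; have [Lh _] := ih.
have := liet_bracket g i j Lh; rewrite bracketC gh oppr0 cc0 [LHS]mxE !kkE // -rmorphB => /esym/eqP.
by rewrite mulf_eq0 (negPf nz) orbF (intr_eq0K charK) => /eqP ->.
Qed.

Lemma commV g h : g \in unitmx -> bracket g h = 0 -> bracket (invmx g) h = 0.
Proof.
move=> ug /eqP; rewrite subr_eq0 => /eqP gh; apply/eqP; rewrite subr_eq0; apply/eqP.
by rewrite -{1}(mulmxK ug h) -gh !mulmxA mulVmx // mul1mx.
Qed.

Lemma unip_conj h g u : integral h -> G g -> bracket g h = 0 -> unip h u -> unip h (Ad g u).
Proof.
move=> ih Gg gh [Gu Hu]; have ug := Gunit Gg; split.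
  by have [_ GM] := frame_mG; apply: (GM); [apply: (GM)|apply: GV].
have -> : Ad g u - 1%:M = g *m (u - 1%:M) *m invmx g.
  by rewrite mulmxBr mulmx1 mulmxBl mulmxV.
rewrite -[1]addr0 -[1]add0r; apply: fil_mul; last by apply: fil_comm => //; apply: commV.
by apply: fil_mul => //; apply: fil_comm.
Qed.

Lemma unip_comm_expm h x y : nilp x -> nilp y -> fil h 0 x -> fil h 0 y -> fil h 1 (x - y) ->
  Lie G x -> Lie G y -> unip h (expm x *m expm (- y)).
Proof.
move=> nx ny Hx Hy Hxy Lx Ly; split.
  have [_ GM] := frame_mG; apply: GM; apply: expmG => //; last exact: nilpN.
  by rewrite -scaleN1r; apply: lieZ.
have <- : (expm x - expm y) *m expm (- y) = expm x *m expm (- y) - 1%:M.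
  by rewrite mulmxBl expmNK.
rewrite -[1]addr0; apply: fil_mul; first exact: fil_expm_congr.
by apply: fil_expm0; [apply: nilpN|apply: filN].
Qed.

(** Successive approximation: if all conjugates of x0 under a set stable by the
    exponentials of c lie in h + c, then h is one of them. *)
Lemma unip_normalize h (Q : set 'M[K]_n) (c : set 'M[K]_n) x0 : integral h ->
  (forall b, Q b -> b \in unitmx) -> c 0 ->
  (forall s x y, c x -> c y -> c (s *: x + y)) -> (forall x, c x -> c (bracket h x)) ->
  (forall x, c x -> fil h 1 x) -> (forall b, Q b -> c (Ad b x0 - h)) ->
  (forall y b, c y -> Q b -> Q (expm y *m b)) ->
  forall b, Q b -> exists2 b', Q b' & Ad b' x0 = h.
Proof.
move=> ih Qu c0 cL ch cF Qc Qe b Qb; have [N HN] := fil_bound h.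
suff [b' Qb' Fb'] : exists2 b', Q b' & fil h N.+1%:Z (Ad b' x0 - h).
  by exists b' => //; apply: subr0_eq; apply: HN; apply: fil_le Fb'; rewrite lez_nat.
elim: N {HN} => [|N [b' Qb' Fb']]; first by exists b => //; apply: cF; apply: Qc.
set d := N.+1%:Z in Fb'; set m := Ad b' x0 - h in Fb'.
have nd : (d%:~R : K) != 0 by rewrite (intr_eq0K charK).
pose y := (d%:~R)^-1 *: gr h d m.
have cm : c m by apply: Qc.
have cg : c (gr h d m) by exact: (@gr_stable c h d m ih c0 cL ch cm).
have cy : c y by rewrite /y -[_ *: _]addr0; apply: cL.
have Fy : fil h d y by apply: filZ; apply: fil_gr.
have ny : nilp y by apply: (@fil_nilp h); apply: cF.
exists (expm y *m b'); first exact: Qe.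
have uy := expm_unit charK ny; rewrite AdM //; last exact: Qu.
have -> : Ad b' x0 = h + m by rewrite addrC subrK.
have -> : Ad (expm y) (h + m) - h =
    (bracket (expm y - 1%:M - y) h + (expm y - 1%:M) *m m + (m - gr h d m)) *m invmx (expm y).
  have grE : gr h d m = - bracket y h.
    by rewrite bracketC /y bracketZr bracket_gr // opprK scalerA mulVf // scale1r.
  rewrite grE /Ad; apply: (can_inj (mulmxK uy)); rewrite mulmxKV // mulmxBl mulmxKV //.
  rewrite /bracket !(mulmxBl, mulmxBr, mulmxDr, mul1mx, mulmx1).
  move: (expm y *m h) (expm y *m m) (h *m expm y) (y *m h) (h *m y) => z1 z2 z3 z4 z5.
  by apply/matrixP => i j; rewrite !mxE; ring.
have -> : (N.+2%:Z = (d + 1) + 0)%R by rewrite addr0 /d -addn1 PoszD.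
have Fe : fil h (d + 1) (expm y - 1%:M - y) by apply: fil_expm2.
apply: fil_mul; last first.
  rewrite invmx_expm //; apply: fil_expm0; first exact: nilpN.
  by apply: filN; apply: fil_le Fy.
apply: filD; last exact: fil_sub_gr.
apply: filD.
  by rewrite -[d + 1]addr0; apply: fil_bracket => //; apply: fil_torus; case: ih.
rewrite addrC; apply: fil_mul => //; apply: fil_expm_sub1; exact: cF.
Qed.

(** ** Spans of root spaces *)

Inductive rspan (Q : 'M[K]_n -> Prop) : 'M[K]_n -> Prop :=
| rspan0 : rspan Q 0
| rspan_linear c x y : rspan Q x -> rspan Q y -> rspan Q (c *: x + y)
| rspan_rsp a x : is_root a -> Q a -> rsp a x -> rspan Q x.

Lemma rspan_elim Q (V : 'M[K]_n -> Prop) x : V 0 -> (forall c u v, V u -> V v -> V (c *: u + v)) ->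
  (forall a v, is_root a -> Q a -> rsp a v -> V v) -> rspan Q x -> V x.
Proof.
by move=> V0 VL Va; elim=> [//|c u v _ Vu _ Vv|a u ra Qa ru]; [exact: VL|exact: Va ru].
Qed.

Lemma rspanD Q x y : rspan Q x -> rspan Q y -> rspan Q (x + y).
Proof. by move=> Hx Hy; rewrite -[x]scale1r; apply: rspan_linear. Qed.
Lemma rspanZ Q c x : rspan Q x -> rspan Q (c *: x).
Proof. by move=> Hx; rewrite -[_ *: _]addr0; apply: rspan_linear => //; apply: rspan0. Qed.
Lemma rspanS (Q Q' : 'M[K]_n -> Prop) x : (forall a, is_root a -> Q a -> Q' a) -> rspan Q x -> rspan Q' x.
Proof.
move=> QQ; apply: rspan_elim; [exact: rspan0|by move=> *; apply: rspan_linear|].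
by move=> a v ra Qa rv; apply: rspan_rsp rv => //; apply: QQ.
Qed.

Lemma rspan_lie Q x : rspan Q x -> Lie G x.
Proof. by apply: rspan_elim; [apply: lie0|move=> *; apply: lie_linear|move=> a v _ _ []]. Qed.

Lemma rspan_split (Q S : 'M[K]_n -> Prop) x : rspan Q x -> exists y z,
  [/\ x = y + z, rspan (fun a => Q a /\ S a) y & rspan (fun a => Q a /\ ~ S a) z].
Proof.
apply: (@rspan_elim Q (fun x => exists y z, [/\ x = y + z, rspan (fun a => Q a /\ S a) y &
  rspan (fun a => Q a /\ ~ S a) z])).
- by exists 0, 0; rewrite addr0; split=> //; apply: rspan0.
- move=> c u v [y [z [-> Hy Hz]]] [y' [z' [-> Hy' Hz']]]; exists (c *: y + y'), (c *: z + z').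
  by split; [rewrite scalerDr addrACA|apply: rspan_linear|apply: rspan_linear].
move=> a v ra Qa rv; have [Sa|nS] := pselect (S a).
  by exists v, 0; rewrite addr0; split=> //; [apply: (rspan_rsp ra)|apply: rspan0].
by exists 0, v; rewrite add0r; split=> //; [apply: rspan0|apply: (rspan_rsp ra)].
Qed.

Lemma rspan_bracket (Q Q' Q'' : 'M[K]_n -> Prop) x y :
  (forall a b, is_root a -> is_root b -> Q a -> Q' b -> a + b <> 0 /\ (is_root (a + b) -> Q'' (a + b))) ->
  rspan Q x -> rspan Q' y -> rspan Q'' (bracket x y).
Proof.
move=> H Hx Hy; apply: (rspan_elim (V := fun x => rspan Q'' (bracket x y))) Hx => [|c u v Hu Hv|a u ra Qa ru]; first by rewrite bracket0l; apply: rspan0.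
  by rewrite bracketDl bracketZl; apply: rspan_linear.
apply: (rspan_elim (V := fun y => rspan Q'' (bracket u y))) Hy => [|c v w Hv Hw|b v rb Qb rv]; first by rewrite bracket0r; apply: rspan0.
  by rewrite bracketDr bracketZr; apply: rspan_linear.
have [n0 ab] := H a b ra rb Qa Qb; have ruv := rsp_bracket ru rv.
have [->|nz] := pselect (bracket u v = 0); first exact: rspan0.
have rab : is_root (a + b).
  apply: (is_rootP _ n0 ruv nz).
  by apply: lieD; [case: ra|case: rb].
exact: (rspan_rsp rab (ab rab)).
Qed.

Lemma rspan_fil Q h d x : integral h -> (forall a, is_root a -> Q a -> d <= ival a h) -> rspan Q x -> fil h d x.
Proof.
move=> ih Qd; apply: rspan_elim; [exact: fil0|by move=> *; apply: fil_linear|].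
by move=> a v ra Qa rv; apply: (@fil_le h _ (ival a h)); [apply: Qd|apply: fil_rsp].
Qed.

Lemma rspan_diag Q x j : rspan Q x -> cc P x j j = 0.
Proof.
apply: (rspan_elim (V := fun x => cc P x j j = 0)); first by rewrite cc0 mxE.
  by move=> c u v hu hv; rewrite ccD ccZ hu hv mulr0 addr0.
by move=> a v ra _ rv; apply: rsp_diag ra rv.
Qed.

Lemma liet_rspan_eq h h' Q x : Lie T h -> Lie T h' -> rspan Q x -> h = h' + x -> h = h'.
Proof.
move=> Lh Lh' Hx E; rewrite (liet_diag Lh) (liet_diag Lh'); congr dg; apply/rowP => j; rewrite !mxE.
by rewrite E ccD (rspan_diag j Hx) addr0.
Qed.

Lemma cc_Ad_T_neq0 t x i j : T t -> cc P (Ad t x) i j != 0 -> cc P x i j != 0.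
Proof. by move=> Tt; rewrite (Ad_torus uP TP) //; apply: contraNneq => ->; rewrite mulr0. Qed.

Lemma nil_alg_rspan h x : integral h -> nil_alg h x -> rspan (fun a => 0 < ival a h) x.
Proof.
move=> ih; apply: (@weight_ind (nil_alg h)) => //.
- by move=> y [].
- by split; [apply: lie0|apply: fil0].
- by move=> *; apply: nil_alg_linear.
- move=> t y Tt [Ly Hy]; split; first by apply: lieG_Ad => //; apply: frame_TG.
  by move=> i j /(cc_Ad_T_neq0 Tt) /Hy.
- exact: rspan0.
- by move=> *; apply: rspan_linear.
- move=> y [_ Hy] Ly; suff -> : y = 0 by apply: rspan0.
  rewrite (liet_diag Ly) (_ : \row_j _ = 0) ?/dg ?linear0 ?mulmx0 ?mul0mx //.
  apply/rowP => j; rewrite !mxE; apply: contrapT => /eqP /Hy.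
  by rewrite subrr.
move=> a y [_ Hy] ra ry; have [->|ny] := pselect (y = 0); first exact: rspan0.
apply: (rspan_rsp ra _ ry); have [i [j nij]] := rsp_entry_neq0 ny.
have := Hy i j nij; have [Lh _] := ih; have := rsp_entry ry nij Lh.
rewrite !kkE // -rmorphB ivalE // => /intr_eq -> /=; lia.
Qed.

Lemma rspan_nil_alg h x : integral h -> rspan (fun a => 0 < ival a h) x -> nil_alg h x.
Proof. by move=> ih Hx; split; [apply: rspan_lie Hx|apply: rspan_fil Hx => // a _; lia]. Qed.
End Filtration.


(** * Positive systems of roots *)
Section PositiveSystems.
Implicit Types (x y h a b : 'M[K]_n) (c : K) (S Q : 'M[K]_n -> Prop) (l : seq 'M[K]_n).

Definition root_seq : seq 'M[K]_n := undup [seq a <- [seq xget 0 [set a | is_root a /\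
  exists2 x, rsp a x & cc P x p.1 p.2 != 0] | p <- enum (('I_n * 'I_n)%type : finType)] | `[< is_root a >]].

Lemma mem_root_seq a : (a \in root_seq) <-> is_root a.
Proof.
rewrite mem_undup mem_filter; split=> [/andP [/asboolP] //|ra].
apply/andP; split; first exact/asboolP.
have [La _ [x rx nx]] := ra; have [k [l nkl]] := rsp_entry_neq0 nx.
apply/mapP; exists (k, l); rewrite ?mem_enum //=.
case: xgetP => [b _ [rb [y ry ny]]|/(_ a)]; last by case; split=> //; exists x.
apply: subr0_eq; apply: liet_nondeg.
  by apply: lie_sub => //; case: rb.
by move=> h Lh; rewrite rtBl (rsp_entry rx nkl Lh) (rsp_entry ry ny Lh) subrr.
Qed.

Definition closed_anti S := [/\ forall a, S a -> is_root a,
  forall a b, S a -> S b -> is_root (a + b) -> S (a + b) & forall a, S a -> ~ S (- a)].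

(** A nonempty sum of elements of S is not zero: otherwise two summands have a
    negative pairing and may be replaced by their sum. *)
Lemma closed_anti_sum S l : closed_anti S -> (forall a, a \in l -> S a) ->
  \sum_(a <- l) a = 0 -> l = [::].
Proof.
move=> [SR SA SN]; move: {2}(size l) (leqnn (size l)) => N; elim: N l => [|N IH] [|a l] //=.
rewrite ltnS => szl Sl; rewrite big_cons => sum0; have Sa : S a by apply: Sl; rewrite mem_head.
have Sl' b : b \in l -> S b by move=> bl; apply: Sl; rewrite inE bl orbT.
have [b bl lt] : exists2 b, b \in l & cartan b a < 0.
  apply: contrapT => no; have: 0 <= \sum_(b <- l) cartan b a.
    rewrite big_seq; apply: sumr_ge0 => b bl; rewrite leNgt; apply/negP => lt.
    by apply: no; exists b.
  suff -> : \sum_(b <- l) cartan b a = - 2 by [].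
  apply: intr_eq; rewrite rmorphN rmorph_sum /=.
  have := congr1 (fun x => rt x (coroot a)) sum0; rewrite /= rtDl rt0l rt_suml rt_coroot; last exact: SR.
  rewrite big_seq; under eq_bigr => b bl do rewrite (cartanE (SR _ (Sl' _ bl)) (SR _ Sa)).
  by rewrite -big_seq => /eqP; rewrite addrC addr_eq0 => /eqP.
have nba : b + a <> 0.
  by move/eqP; rewrite addr_eq0 => /eqP bE; apply: (SN a Sa); rewrite -bE; apply: Sl'.
have rba := root_add (SR _ Sa) (SR _ (Sl' _ bl)) lt nba.
have Sba : S (b + a) by apply: SA => //; apply: Sl'.
have := IH ((b + a) :: rem b l); move=> H; suff : (b + a) :: rem b l = [::] by [].
apply: H => /=.
- rewrite size_rem //; case: (l) bl szl => //=.
- by move=> u; rewrite inE => /orP[/eqP->//|/mem_rem]; apply: Sl'.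
by rewrite big_cons -[RHS]sum0 [in RHS](perm_big _ (perm_to_rem bl)) /= big_cons addrA [a + b]addrC.
Qed.

Lemma count_lt (s : seq 'M[K]_n) (p q : pred 'M[K]_n) x :
  {in s, forall y, p y -> q y} -> x \in s -> q x -> ~~ p x -> (count p s < count q s)%N.
Proof.
move=> pq xs qx px; have := count_predC p [seq y <- s | q y].
rewrite size_filter => <-; rewrite count_filter.
have -> : count (predI p q) s = count p s.
  by apply: eq_in_count => y /pq /=; case: (p y) => // ->.
rewrite -[ltnLHS]addn0 ltn_add2l -has_count; apply/hasP; exists x => //.
by rewrite mem_filter qx.
Qed.

Lemma closed_anti_maximal S : closed_anti S -> exists S', [/\ closed_anti S', forall a, S a -> S' a &
  forall Q, closed_anti Q -> (forall a, S' a -> Q a) -> forall a, Q a -> S' a].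
Proof.
pose cnt S := count (fun a => `[< S a >]) root_seq.
move: {2}(size root_seq - cnt S)%N (leqnn (size root_seq - cnt S)) => N.
elim: N S => [|N IH] S le CS.
  exists S; split=> // Q CQ SQ a Qa; apply: contrapT => nS.
  have ra : a \in root_seq by apply/mem_root_seq; case: CQ => + _ _; apply.
  have : (cnt S < cnt Q)%N.
    apply: (@count_lt _ _ _ a) => //; [|exact/asboolP|exact/asboolP].
    by move=> y _ /asboolP Sy; apply/asboolP; apply: SQ.
  have : (cnt Q <= size root_seq)%N by apply: count_size.
  by move: le; rewrite leqn0 subn_eq0; lia.
have [[Q [CQ SQ [a Qa nS]]]|no] := pselect (exists Q, [/\ closed_anti Q, forall a, S a -> Q a & exists2 a, Q a & ~ S a]).
  have ra : a \in root_seq by apply/mem_root_seq; case: CQ => + _ _; apply.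
  have : (cnt S < cnt Q)%N.
    apply: (@count_lt _ _ _ a) => //; [|exact/asboolP|exact/asboolP].
    by move=> y _ /asboolP Sy; apply/asboolP; apply: SQ.
  have : (cnt Q <= size root_seq)%N by apply: count_size.
  move=> h1 h2; have [|S' [C' QS' M']] := IH Q _ CQ; first by lia.
  by exists S'; split=> // b /SQ /QS'.
exists S; split=> // Q CQ SQ a Qa; apply: contrapT => nS.
by apply: no; exists Q; split=> //; exists a.
Qed.

Definition positive_system S := closed_anti S /\ forall a, is_root a -> S a \/ S (- a).

Lemma sum_nseq m l : \sum_(a <- flatten (nseq m l)) a = m%:R *: \sum_(a <- l) a.
Proof.
elim: m => [|m IH] /=; first by rewrite big_nil scale0r.
by rewrite big_cat /= IH -natr1 scalerDl scale1r addrC.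
Qed.

(** If neither a nor - a lies in S, then by maximality adding either one generates
    opposite roots; so a positive multiple of a, and one of - a, cancels a sum of
    elements of S, and together these contradict the previous lemma. *)
Lemma closed_anti_total S : closed_anti S ->
  (forall Q, closed_anti Q -> (forall a, S a -> Q a) -> forall a, Q a -> S a) -> positive_system S.
Proof.
move=> CS Smax; split=> // a0 ra0; apply: contrapT => no; have [SR SA SN] := CS.
have dir a : is_root a -> ~ S a -> exists m l, [/\ (0 < m)%N, (forall b, b \in l -> S b) &
    m%:R *: a + \sum_(b <- l) b = 0].
  move=> ra nSa; pose Q b := is_root b /\ exists m l, (forall d, d \in l -> S d) /\ b = m%:R *: a + \sum_(d <- l) d.
  have [[b [[rb [m [l [Sl bE]]]] [_ [m' [l' [Sl' bE']]]]]]|anti] := pselect (exists b, Q b /\ Q (- b)).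
    have Sll d : d \in l ++ l' -> S d by rewrite mem_cat => /orP[/Sl|/Sl'].
    have E : (m + m')%:R *: a + \sum_(d <- l ++ l') d = 0.
      by rewrite natrD scalerDl big_cat /= addrACA -bE -bE' subrr.
    exists (m + m')%N, (l ++ l'); split=> //; rewrite lt0n; apply/eqP => mm.
    move: E; rewrite mm scale0r add0r => /(closed_anti_sum CS Sll) ll0.
    have m0 : m = 0%N by lia.
    have l0 : l = [::] by case: (l) ll0.
    by apply: (is_root_neq0 rb); rewrite bE m0 l0 scale0r big_nil addr0.
  case: nSa; apply: (Smax Q); first last.
  - by split=> //; exists 1%N, [::]; rewrite big_nil addr0 scale1r.
  - move=> b Sb; split; first exact: SR.
    by exists 0%N, [:: b]; rewrite big_seq1 scale0r add0r; split=> // d; rewrite inE => /eqP->.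
  split; first by move=> b [].
  - move=> b d [rb [m [l [Sl bE]]]] [rd [m' [l' [Sl' dE]]]] rbd; split=> //.
    exists (m + m')%N, (l ++ l'); split; first by move=> u; rewrite mem_cat => /orP[/Sl|/Sl'].
    by rewrite bE dE natrD scalerDl big_cat /= addrACA.
  by move=> b Qb QNb; apply: anti; exists b.
have [|m [l [m0 Sl E]]] := dir a0 ra0; first by move=> Sa; apply: no; left.
have [|m' [l' [m0' Sl' E']]] := dir (- a0) (is_rootN ra0); first by move=> Sa; apply: no; right.
have sum0 : \sum_(b <- flatten (nseq m' l) ++ flatten (nseq m l')) b = 0.
  have E1 : \sum_(b <- l) b = - (m%:R *: a0) by apply/eqP; rewrite -addr_eq0 addrC E.
  have E2 : \sum_(b <- l') b = - (m'%:R *: - a0) by apply/eqP; rewrite -addr_eq0 addrC E'.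
  rewrite big_cat /= !sum_nseq E1 E2.
  by rewrite !scalerN opprK !scalerA mulrC addNr.
have Sll b : b \in flatten (nseq m' l) ++ flatten (nseq m l') -> S b.
  by rewrite mem_cat => /orP[] /flattenP [s /nseqP [-> _]]; [exact: Sl|exact: Sl'].
have := closed_anti_sum CS Sll sum0.
case: m' {E' Sll sum0} m0' => // m' _ /=; case: (l) E => // + _.
rewrite big_nil addr0 => /eqP; rewrite scaler_eq0 => /orP[/eqP m00|/eqP/(is_root_neq0 ra0)//].
by case: m m0 m00 => // m _ /eqP; rewrite (negPf (natr0 m)).
Qed.

Definition srefl a x : 'M[K]_n := x - rt x (coroot a) *: a.

Lemma srefl_rt a x y : is_root a -> rt (srefl a x) (srefl a y) = rt x y.
Proof.
move=> ra; have na := rt_root_neq0 ra.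
rewrite /srefl /coroot !(rtBl, rtBr, rtZl, rtZr) (rtC a y); field.
by [].
Qed.

Lemma sreflE a x : is_root a -> srefl a x = x - rt a x *: coroot a.
Proof. by move=> ra; rewrite /srefl /coroot rtZr scalerA (rtC a x) mulrC. Qed.

Lemma integral_intr z h : integral h -> integral (z%:~R *: h).
Proof.
move=> [Lh [k hE]]; split; first exact: lieZ.
exists (fun j => z * k j); rewrite hE -dgZ; congr dg; apply/rowP => j; by rewrite !mxE rmorphM.
Qed.

Lemma srefl_integral a h : is_root a -> integral h -> integral (srefl a h).
Proof.
move=> ra ih; rewrite sreflE // (ivalE ra ih) -scaleNr -rmorphN; apply: integralD => //.
by apply: integral_intr; apply: integral_coroot.
Qed.

Lemma srefl_invol a x : is_root a -> srefl a (srefl a x) = x.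
Proof.
move=> ra; rewrite /srefl rtBl rtZl rt_coroot //; set c := rt x _.
have -> : c - c * 2 = - c by rewrite mulr_natr mulr2n opprD addrA subrr add0r.
by rewrite scaleNr opprK subrK.
Qed.

Lemma srefl_self a : is_root a -> srefl a a = - a.
Proof. by move=> ra; rewrite /srefl rt_coroot // scaler_nat mulr2n opprD addrA subrr add0r. Qed.

Lemma sreflZ a c x : srefl a (c *: x) = c *: srefl a x.
Proof. by rewrite /srefl rtZl scalerBr scalerA. Qed.

Lemma srefl_coroot a b : is_root a -> coroot (srefl a b) = srefl a (coroot b).
Proof. by move=> ra; rewrite /coroot srefl_rt // sreflZ. Qed.

Lemma srefl_root a b : is_root a -> is_root b -> is_root (srefl a b).
Proof. by move=> ra rb; rewrite /srefl cartanE //; apply: root_refl. Qed.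

Section Positive.
Variable S : 'M[K]_n -> Prop.
Hypothesis PS : positive_system S.

Definition simple a := S a /\ forall b d, S b -> S d -> a <> b + d.

Let CS : closed_anti S. Proof. by case: PS. Qed.
Let SR a : S a -> is_root a. Proof. by case: CS => + _ _; apply. Qed.

Lemma pos_ind Q : (forall a, simple a -> Q a) ->
  (forall b d, S b -> S d -> S (b + d) -> Q b -> Q d -> Q (b + d)) -> forall b, S b -> Q b.
Proof.
move=> Qs QD; pose below b := fun d => `[< S d /\ exists l, (forall u, u \in l -> S u) /\ b = d + \sum_(u <- l) u >].
have belowD b d : S d -> S b -> S (b + d) -> (count (below b) root_seq < count (below (b + d)%R) root_seq)%N.
  move=> Sd Sb Sbd; apply: (@count_lt _ _ _ (b + d)).
  - move=> y _ /asboolP [Sy [l [Sl yE]]]; apply/asboolP; split=> //; exists (d :: l).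
    by split=> [u|]; [rewrite inE => /orP[/eqP->|/Sl]|rewrite big_cons yE addrAC addrA].
  - by apply/mem_root_seq; apply: SR.
  - by apply/asboolP; split=> //; exists [::]; rewrite big_nil addr0.
  apply/negP => /asboolP [_ [l [Sl bE]]]; suff : d :: l = [::] by [].
  apply: (closed_anti_sum CS) => [u|]; first by rewrite inE => /orP[/eqP->|/Sl].
  by rewrite big_cons; apply: (addrI b); rewrite addr0 addrA -bE.
move=> b; move: {2}(count _ _) (leqnn (count (below b) root_seq)) => N.
elim: N b => [|N IH] b; last first.
  move=> le Sb; have [sb|ns] := pselect (simple b); first exact: Qs.
  have [u [v [Su Sv bE]]] : exists u v, [/\ S u, S v & b = u + v].
    apply: contrapT => no; apply: ns; split=> // u v Su Sv bE; apply: no; by exists u, v.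
  move: le Sb; rewrite bE => le Sb; apply: QD => //; apply: IH => //.
    by rewrite -ltnS; apply: leq_trans le; apply: belowD.
  by rewrite -ltnS; apply: leq_trans le; rewrite addrC; apply: belowD; rewrite // addrC.
move=> le Sb; move: le; rewrite leqn0 => /eqP c0; have : has (below b) root_seq.
  apply/hasP; exists b; first by apply/mem_root_seq; apply: SR.
  by apply/asboolP; split=> //; exists [::]; rewrite big_nil addr0.
by rewrite has_count c0.
Qed.

(** The reflection in a simple root permutes the other positive roots: along the
    string from b to its image no step can leave S. *)
Lemma simple_refl a b : simple a -> S b -> b <> a -> S (srefl a b) /\ srefl a b <> a.
Proof.
move=> [Sa sa] Sb ba; have ra := SR Sa; have rb := SR Sb.
have sE : srefl a b = b - (cartan b a)%:~R *: a by rewrite /srefl cartanE.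
have rs := srefl_root ra rb; have [_ tot] := PS.
split; last first.
  move=> E; have := srefl_invol b ra; rewrite E srefl_self // => bE.
  by have [_ _ /(_ a Sa)] := CS; rewrite bE.
have [le0|gt0] := lerP (cartan b a) 0.
  have [//|SN] := tot _ rs; have [k kE] : exists k : nat, - cartan b a = k.
    by case: (- cartan b a) (oppr_ge0 (cartan b a)) => [k _|k]; [exists k|rewrite le0].
  suff : [:: b, - srefl a b & flatten (nseq k [:: a])] = [::] by [].
  apply: (closed_anti_sum CS) => [u|].
    rewrite !inE => /orP[/eqP->//|/orP[/eqP->//|/flattenP [s /nseqP [-> _]]]].
    by rewrite inE => /eqP ->.
  rewrite !big_cons sum_nseq big_seq1 sE -[cartan b a]opprK kE rmorphN scaleNr opprK opprD.
  by rewrite addrA addrA subrr add0r addNr.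
have [k kE] : exists k : nat, cartan b a = k by case: (cartan b a) gt0 => // k _; exists k.
suff H (i : nat) : (i <= k)%N -> S (b - i%:R *: a) /\ b - i%:R *: a <> a.
  by rewrite sE kE; have [] := H k (leqnn k).
elim: i => [|i IH] ik; first by rewrite scale0r subr0.
have [Si ni] := IH (ltnW ik).
have E : b - i.+1%:R *: a = (b - i%:R *: a) - a by rewrite -natr1 scalerDl scale1r opprD addrA.
have n2 : b - i.+1%:R *: a <> a.
  rewrite E => /eqP; rewrite subr_eq -mulr2n -scaler_nat => /eqP e.
  by apply: (root_twice ra); rewrite -e; apply: SR.
have ri : is_root (b - i.+1%:R *: a).
  rewrite -scalerN; apply: root_string => //; first exact: is_rootN.
    by rewrite cartanNr // opprK kE.
  by rewrite scalerN E => /eqP; rewrite subr_eq0 => /eqP.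
split=> //; have [//|SN] := tot _ ri; case: (sa _ _ Si SN).
by rewrite E opprB addrC subrK.
Qed.

Definition rho_vee : 'M[K]_n := \sum_(b <- root_seq | `[< S b >]) coroot b.

Lemma rho_vee_integral : integral rho_vee.
Proof.
rewrite /rho_vee -big_filter; apply: integral_sum_seq => b; rewrite mem_filter => /andP [/asboolP Sb _].
by apply: integral_coroot; apply: SR.
Qed.

Lemma simple_rho a : simple a -> ival a rho_vee = 2.
Proof.
move=> sa; have Sa : S a by case: sa.
have ra := SR Sa; apply: intr_eq; rewrite -(ivalE ra rho_vee_integral).
have aP : a \in root_seq by apply/mem_root_seq.
rewrite /rho_vee -big_filter rt_sumr (bigD1_seq a) ?filter_uniq ?undup_uniq //=; last first.
  by rewrite mem_filter aP andbT; apply/asboolP.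
rewrite rt_coroot // -[RHS]addr0; congr (_ + _); rewrite -big_filter.
set L := [seq _ <- _ | _].
have LP b : (b \in L) <-> S b /\ b <> a.
  rewrite !mem_filter; split=> [/and3P [/eqP nb /asboolP Sb _] //|[Sb /eqP nb]].
  by apply/and3P; split=> //; [apply/asboolP|apply/mem_root_seq; apply: SR].
have pL : perm_eq L (map (srefl a) L).
  have inj : injective (srefl a) by apply: (can_inj (g := srefl a)) => x; apply: srefl_invol.
  have uL : uniq L by rewrite !filter_uniq // undup_uniq.
  apply: uniq_perm => //; first by rewrite map_inj_uniq.
  move=> b; apply/idP/mapP => [/LP [Sb nb]|[d /LP [Sd nd] ->]].
    exists (srefl a b); last by rewrite srefl_invol.
    by apply/LP; apply: simple_refl.
  by apply/LP; apply: simple_refl.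
have : \sum_(b <- L) rt a (coroot b) = - \sum_(b <- L) rt a (coroot b).
  rewrite {1}(perm_big _ pL) big_map -sumrN; apply: eq_bigr => b _.
  by rewrite srefl_coroot // -(srefl_rt a _ ra) srefl_invol // srefl_self // rtNl.
move/eqP; rewrite -subr_eq0 opprK -mulr2n -mulr_natl mulf_eq0 (negPf (natr0 1)) /=.
by move/eqP.
Qed.

Lemma pos_rho a : S a -> 0 < ival a rho_vee.
Proof.
apply: (@pos_ind (fun a => 0 < ival a rho_vee)) => [b sb|b d Sb Sd Sbd h1 h2]; first by rewrite simple_rho.
by rewrite (ivalDl (SR Sb) (SR Sd) (SR Sbd) rho_vee_integral) addr_gt0.
Qed.

Lemma pos_rhoP a : is_root a -> S a <-> 0 < ival a rho_vee.
Proof.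
move=> ra; split; first exact: pos_rho.
have [_ tot] := PS; have [//|SN] := tot a ra; have := pos_rho SN.
by rewrite (ivalN ra rho_vee_integral); lia.
Qed.

Lemma rho_neq0 a : is_root a -> ival a rho_vee <> 0.
Proof.
move=> ra E; have [_ tot] := PS; have [Sa|SN] := tot a ra; first by have := pos_rho Sa; rewrite E.
by have := pos_rho SN; rewrite (ivalN ra rho_vee_integral) E.
Qed.

(** The sum kills a and is positive on the other positive roots. *)
Lemma simple_pos_rho a b : simple a -> S b -> b <> a -> 0 < ival b (rho_vee + srefl a rho_vee).
Proof.
move=> sa Sb nb; have ra := SR sa.1; have rb := SR Sb; have [Ss _] := simple_refl sa Sb nb.
have rs := SR Ss; have irho := rho_vee_integral.
have irefl := srefl_integral ra irho.
rewrite (ivalDr rb irho irefl); apply: addr_gt0; first exact: pos_rho.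
suff -> : ival b (srefl a rho_vee) = ival (srefl a b) rho_vee by apply: pos_rho.
apply: (intr_injK charK); by rewrite /= -(ivalE rb irefl) -(ivalE rs irho) -(srefl_rt b _ ra) srefl_invol.
Qed.

End Positive.
End PositiveSystems.


(** * The Borel subgroup *)


Section Borel.
Variable B : set 'M[K]_n.
Hypotheses (hB : borel_subgroup G B) (hTB : T `<=` B).
Implicit Types (x y h a b g u : 'M[K]_n) (c : K).

Lemma borel_alg : algebraic_group B. Proof. by case: hB => -[]. Qed.
Lemma borel_sub : B `<=` G. Proof. by case: hB => -[]. Qed.
Lemma borel_mon : monoid_mx B. Proof. exact: subgroup_monoid borel_alg.1. Qed.
Lemma borelM x y : B x -> B y -> B (x *m y). Proof. by have [_ BM] := borel_mon; apply: BM. Qed.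
Lemma borelV x : B x -> B (invmx x). Proof. by have [[_ _ _ BV] _] := borel_alg; apply: BV. Qed.
Lemma borel_unit x : B x -> x \in unitmx. Proof. by move/borel_sub; apply: Gunit. Qed.
Lemma lieB_G x : Lie B x -> Lie G x. Proof. exact: (lie_mono borel_sub). Qed.
Lemma lieT_B x : Lie T x -> Lie B x. Proof. exact: (lie_mono hTB). Qed.
Lemma lieB_Ad x y : B x -> Lie B y -> Lie B (Ad x y).
Proof. by move=> Bx; apply: lie_conj => //; case: borel_alg. Qed.
Lemma lieB_bracket x y : Lie B x -> Lie B y -> Lie B (bracket x y).
Proof. exact: lie_bracket borel_mon. Qed.
Lemma borel_expm x : Lie B x -> nilp x -> B (expm x).
Proof. exact: lie_expm borel_alg. Qed.

Definition broot a := is_root a /\ forall x, rsp a x -> Lie B x.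

Lemma brootP a x : is_root a -> rsp a x -> x <> 0 -> Lie B x -> broot a.
Proof. by move=> ra rx nx Bx; split=> // y ry; have [c ->] := rsp_dim1 ra rx nx ry; apply: lieZ. Qed.

(** Two opposite roots would generate a copy of SL2 equal to its derived group. *)
Lemma broot_anti a : broot a -> ~ broot (- a).
Proof.
move=> [ra Ba] [_ BNa]; have [_ _ [e re ne]] := ra; have [f [rf nf S]] := root_sl2 ra re ne.
have nie := rsp_nilp ra re; have nif := rsp_nilp (is_rootN ra) rf.
have [he hf ef] := S; have n2 : (2 : K) != 0 by apply: natr0.
have nzf c : nilp (c *: f) by apply: nilpZ.
have nze c : nilp (c *: e) by apply: nilpZ.
suff H k : forall c, iter k (@derived_group K n) B (expm (c *: e)) /\ iter k (@derived_group K n) B (expm (c *: f)).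
  have [_ [k kE]] : connected_solvable_subgroup G B /\ solvable_group B by case: hB => -[].
  by apply: ne; apply: (expm_trivial charK nie) => t; have [+ _] := H k t; rewrite kE.
elim: k => [|k IH] c /=.
  split; apply: borel_expm => //; apply: lieZ; [exact: Ba|exact: BNa].
set D := iter k _ B in IH *; have sD : subgroup_GL D by apply: iter_derived_subgroup; case: borel_alg.
have [Du _ DM DV] := sD.
have Dt d : d != 0 -> D (theta (d *: e) (d^-1 *: f)).
  move=> nd; apply: (DM); first apply: (DM); try exact: (IH d).1.
  by rewrite -scaleNr; exact: (IH _).2.
have S2 : sl2_triple (2 *: e) (coroot a) (2^-1 *: f).
  split; first by rewrite bracketZr he !scalerA mulrC.
    by rewrite bracketZr hf scalerN !scalerA mulrC.
  by rewrite bracketZr bracketZl scalerA mulVf // scale1r.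
have [t1e t1f _] := theta_sl2 charK S nie nif.
have [t2e t2f _] := theta_sl2 charK S2 (nze 2) (nzf 2^-1).
have D1 : D (theta e f) by have := Dt 1 (oner_neq0 _); rewrite invr1 !scale1r.
have D2 := Dt 2 n2; set t1 := theta e f in t1e t1f D1; set t2 := theta _ _ in t2e t2f D2.
pose s := t2 *m invmx t1; have u1 := Du _ D1; have u2 := Du _ D2; simpl in u1, u2.
have Ds : D s by apply: DM => //; apply: DV.
have us : s \in unitmx by rewrite unitmx_mul unitmx_inv u2.
have uV1 : invmx t1 \in unitmx by rewrite unitmx_inv.
have se : Ad s e = 4 *: e.
  have t2f' : Ad t2 f = - (4 *: e).
    apply: (scalerI (invr_neq0 n2)); rewrite -AdZ t2f scalerN scalerA; congr (- (_ *: _)).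
    by field.
  by rewrite AdM // -[e in LHS]opprK -t1f AdN AdK // AdN t2f' opprK.
have sf : Ad s f = 4^-1 *: f.
  have t2e' : Ad t2 e = - (4^-1 *: f).
    apply: (scalerI n2); rewrite -AdZ t2e scalerN scalerA; congr (- (_ *: _)).
    by rewrite (_ : 4 = 2 * 2) ?invfM ?mulrA ?mulfV ?mul1r //; ring.
  by rewrite AdM // -[f in LHS]opprK -t1e AdN AdK // AdN t2e' opprK.
have comm x : nilp x -> D (expm x) -> derived_group D (expm (Ad s x) *m expm (- x)).
  move=> nx Dx; have := derived_comm Ds Dx; rewrite -invmx_expm // -Ad_expm //.
have n3 : (3 : K) != 0 by apply: natr0.
have n4 : (4 : K) != 0 by apply: natr0.
have expc x p q : nilp x -> expm (p *: x) *m expm (- (q *: x)) = expm ((p - q) *: x).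
  move=> nx; rewrite -scaleNr -expmD -?scalerDl //; try exact: nilpZ.
  by rewrite -!scalemxAl -!scalemxAr !scalerA mulrC.
split.
  have := comm _ (nze (c / 3)) (IH _).1; rewrite AdZ se scalerA expc //.
  suff -> : c / 3 * 4 - c / 3 = c by [].
  by field.
have := comm _ (nzf (- (c * 4 / 3))) (IH _).2; rewrite AdZ sf scalerA expc //.
suff -> : - (c * 4 / 3) * 4^-1 - - (c * 4 / 3) = c by [].
by field; rewrite n3 n4.
Qed.

Lemma broot_closed_anti : closed_anti broot.
Proof.
split; [by move=> a []| |exact: broot_anti].
move=> a b [ra Ba] [rb Bb] rab; have [_ _ [x rx nx]] := ra; have [_ _ [y ry ny]] := rb.
apply: (brootP rab (rsp_bracket rx ry)); first exact: (root_bracket_neq0 ra rb).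
by apply: lieB_bracket; [apply: Ba|apply: Bb].
Qed.

Lemma lieB_decomp x : Lie B x -> exists h y, [/\ Lie T h, rspan broot y & x = h + y].
Proof.
apply: (@weight_ind (Lie B) (fun x => exists h y, [/\ Lie T h, rspan broot y & x = h + y])).
- exact: lieB_G.
- exact: lie0.
- by move=> *; apply: lie_linear.
- by move=> t y Tt; apply: lieB_Ad; apply: hTB.
- by exists 0, 0; rewrite addr0; split=> //; [apply: lie0|apply: rspan0].
- move=> c u v [h [y [Lh ry ->]]] [h' [y' [Lh' ry' ->]]]; exists (c *: h + h'), (c *: y + y').
  by split; [apply: lie_linear|apply: rspan_linear|rewrite scalerDr addrACA].
- by move=> y _ Ly; exists y, 0; rewrite addr0; split=> //; apply: rspan0.
move=> a y By ra ry; exists 0, y; rewrite add0r; split=> //; first exact: lie0.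
have [->|ny] := pselect (y = 0); first exact: rspan0.
by apply: (rspan_rsp ra _ ry); apply: brootP By.
Qed.

Lemma rspan_broot_lie y : rspan broot y -> Lie B y.
Proof.
apply: rspan_elim; first exact: lie0.
  by move=> *; apply: lie_linear.
by move=> a v _ [_ Ba]; apply: Ba.
Qed.

Section Order.
Variable S : 'M[K]_n -> Prop.
Hypotheses (PS : positive_system S) (SB : forall a, broot a -> S a).
Let h0 := rho_vee S.
Let ih0 : integral h0. Proof. exact: rho_vee_integral. Qed.

Lemma broot_fil y : rspan broot y -> fil h0 1 y.
Proof. by apply: rspan_fil => // a ra /SB /(pos_rho PS). Qed.

Lemma dg_mul_fil (u v : 'rV[K]_n) x y : fil h0 1 x -> fil h0 1 y ->
  exists2 z, fil h0 1 z & (dg P u + x) *m (dg P v + y) = dg P (\row_j (u 0 j * v 0 j)) + z.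
Proof.
move=> Hx Hy; exists (dg P u *m y + x *m dg P v + x *m y); last first.
  by rewrite mulmxDl !mulmxDr dg_mul // !addrA.
have Fd w : fil h0 0 (dg P w).
  by move=> i j; rewrite ccdg //; case: (eqVneq i j) => [->|_]; rewrite ?subrr // mulr0n eqxx.
apply: filD; first apply: filD.
- by rewrite -[1]add0r; apply: fil_mul.
- by rewrite -[1]addr0; apply: fil_mul.
by apply: (@fil_le _ _ (1 + 1)) => //; apply: fil_mul.
Qed.

Lemma scalar_dg c : c%:M = dg P (const_mx c) :> 'M[K]_n.
Proof. by rewrite -scalemx1 -(dg1 uP) -dgZ; congr dg; apply/rowP => j; rewrite !mxE mulr1. Qed.

(** The diagonal of a conjugate of h under B consists of eigenvalues of h, hence
    does not vary. *)
Lemma borel_Ad_torus b h : B b -> Lie T h -> exists2 y, rspan broot y & Ad b h = h + y.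
Proof.
move=> Bb Lh.
have dec g : B g -> exists h' y, [/\ Lie T h', rspan broot y & Ad g h = h' + y].
  by move=> Bg; apply: lieB_decomp; apply: lieB_Ad => //; apply: lieT_B.
pose d i := cc P h i i.
have vals g j : B g -> cc P (Ad g h) j j \in [seq d i | i <- enum 'I_n].
  move=> Bg; have ug := borel_unit Bg; have [h' [y [Lh' ry E]]] := dec g Bg.
  have jE : cc P (Ad g h) j j = cc P h' j j by rewrite E ccD (rspan_diag j ry) addr0.
  have [z Fz zE] : exists2 z, fil h0 1 z & \prod_(i <- enum 'I_n) (Ad g h - (d i)%:M) =
      dg P (\row_j \prod_(i <- enum 'I_n) (cc P h' j j - d i)) + z.
    elim: (enum 'I_n) => [|i s [z Fz IH]].
      exists 0; first exact: fil0.
      rewrite big_nil addr0 -[1]/(1%:M) -(dg1 uP); congr dg; apply/rowP => k.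
      by rewrite !mxE big_nil.
    have [|z' Fz' z'E] := @dg_mul_fil (\row_j (cc P h' j j - d i)) (\row_j \prod_(i <- s) (cc P h' j j - d i)) y z _ Fz.
      exact: broot_fil.
    exists z' => //; rewrite big_cons IH.
    have -> : Ad g h - (d i)%:M = dg P (\row_j (cc P h' j j - d i)) + y.
      rewrite E {1}(liet_diag Lh') scalar_dg addrAC; congr (_ + _).
      by rewrite -scaleN1r -dgZ -dg_add; congr dg; apply/rowP => k; rewrite !mxE mulN1r.
    rewrite -[_ * _]/(_ *m _) z'E; congr (dg P _ + _); apply/rowP => k.
    by rewrite !mxE big_cons.
  have prod0 : \prod_(i <- enum 'I_n) (Ad g h - (d i)%:M) = 0.
    have H s : \prod_(i <- s) (Ad g h - (d i)%:M) = Ad g (dg P (\row_j \prod_(i <- s) (d j - d i))).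
      elim: s => [|i s IH].
        rewrite big_nil (_ : \row_j _ = const_mx 1) ?dg1 //; last by apply/rowP => k; rewrite !mxE big_nil.
        by rewrite /Ad mulmx1 mulmxV.
      rewrite big_cons IH -[_ * _]/(_ *m _); have -> : (d i)%:M = Ad g (d i)%:M.
        by rewrite /Ad scalar_mxC mulmxK.
      rewrite -AdB -Ad_mul // {1}(liet_diag Lh) scalar_dg -scaleN1r -dgZ -dg_add dg_mul //.
      by congr (Ad g (dg P _)); apply/rowP => k; rewrite !mxE big_cons mulN1r.
    rewrite H (_ : \row_j _ = 0) ?/dg ?linear0 ?mulmx0 ?mul0mx ?Ad0 //.
    apply/rowP => k; rewrite !mxE; apply/eqP; rewrite prodf_seq_eq0; apply/hasP.
    by exists k; rewrite ?mem_enum //= subrr.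
  have : \prod_(i <- enum 'I_n) (cc P h' j j - d i) == 0.
    have := congr1 (fun x => cc P x j j) zE; rewrite /= prod0 cc0 mxE ccD ccdg // eqxx mulr1n mxE.
    have -> : cc P z j j = 0 by apply: contrapT => /eqP /Fz; rewrite subrr.
    by rewrite addr0 => <-.
  rewrite prodf_seq_eq0 => /hasP [i _ /=]; rewrite subr_eq0 jE => /eqP ->.
  by apply/mapP; exists i; rewrite ?mem_enum.
have const j : cc P (Ad b h) j j = cc P h j j.
  have B1 : B 1%:M by case: borel_mon.
  pose F (A : 'M[K]_(n, n + n)) := cc P (lsubmx A *m h *m rsubmx A) j j.
  have pF : polyfun F.
    apply: (polyfun_comp (f := fun A => lsubmx A *m h *m rsubmx A) (F := fun x => cc P x j j)); last exact: polyfun_cc.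
    apply: polymap_mul; last exact: polymap_rsub.
    by apply: polymap_mul; [exact: polymap_lsub|exact: polymap_cst].
  have [[_ _ cB _] _] := hB.
  have := @regular_finite_const K charK n B F _ pF (fun g => @borel_unit g) cB _ b 1%:M Bb B1.
  rewrite /F !row_mxKl !row_mxKr -!/(Ad _ _) Ad1; apply=> g Bg.
  by rewrite row_mxKl row_mxKr; apply: vals.
have [h' [y [Lh' ry E]]] := dec b Bb; exists y => //; rewrite E; congr (_ + y).
rewrite (liet_diag Lh') (liet_diag Lh); congr dg; apply/rowP => j; rewrite !mxE -const.
by rewrite E ccD (rspan_diag j ry) addr0.
Qed.

(** Successive corrections by U make b fix h0; then b fixes the whole torus
    algebra, since it moves it by positive degrees only. *)
Lemma borel_factor b : B b -> exists u m, [/\ unip h0 u, B u, B m,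
  (forall h, Lie T h -> Ad m h = h) & b = u *m m].
Proof.
move=> Bb; pose Q b' := exists u, [/\ unip h0 u, B u & b' = u *m b].
pose c := [set x | Lie B x /\ fil h0 1 x].
have QB b' : Q b' -> B b' by move=> [u [_ Bu ->]]; apply: borelM.
have [Lh0 _] := ih0.
have [||||||||b' Qb' E] := @unip_normalize h0 Q c h0 ih0 _ _ _ _ _ _ _ b.
- by move=> b' /QB; apply: borel_unit.
- by split; [apply: lie0|apply: fil0].
- by move=> s x y [Lx Hx] [Ly Hy]; split; [apply: lie_linear|apply: fil_linear].
- move=> x [Lx Hx]; split; first by apply: lieB_bracket => //; apply: lieT_B.
  by rewrite -[1]add0r; apply: fil_bracket => //; apply: fil_torus.
- by move=> x [].
- move=> b' /QB Bb'; have [y ry ->] := borel_Ad_torus Bb' Lh0.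
  by rewrite addrAC subrr add0r; split; [apply: rspan_broot_lie|apply: broot_fil].
- move=> y b' [Ly Hy] [u [Uu Bu ->]]; exists (expm y *m u); rewrite mulmxA; split=> //.
    by apply: unipM => //; apply: unip_expm; split=> //; apply: lieB_G.
  by apply: borelM => //; apply: borel_expm => //; apply: fil_nilp Hy.
- by exists 1%:M; rewrite mul1mx; split=> //; [apply: unip1|case: borel_mon].
have Bb' := QB _ Qb'; have [u [Uu Bu b'E]] := Qb'; have ub' := borel_unit Bb'; have uu := borel_unit Bu.
exists (invmx u), b'; split=> //; [exact: unipV|exact: borelV| |by rewrite b'E mulKmx].
move=> h Lh; have [y ry yE] := borel_Ad_torus Bb' Lh; rewrite yE.
suff -> : y = 0 by rewrite addr0.
have hy : bracket h0 y = 0.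
  have -> : y = Ad b' h - h by rewrite yE addrAC subrr add0r.
  by rewrite bracketBr -{1}E -Ad_bracket // !(liet_comm Lh0 Lh) Ad0 subr0.
apply: (cc_inj uP); rewrite cc0; apply/matrixP => i j; rewrite [RHS]mxE.
apply: contrapT => /eqP nz; have := broot_fil ry nz; have := fil_comm ih0 (g := y).
by rewrite bracketC hy oppr0 => /(_ erefl j i) => H; have := liet_bracket y i j Lh0; rewrite hy cc0 mxE !(kkE _ ih0) -rmorphB => /esym/eqP; rewrite mulf_eq0 (negPf nz) orbF (intr_eq0K charK) => /eqP ->.
Qed.

End Order.
End Borel.


Section BorelStructure.
Variable B : set 'M[K]_n.
Hypotheses (hB : borel_subgroup G B) (hTB : T `<=` B).
Implicit Types (x y h a b g u : 'M[K]_n) (c : K).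
Variable S : 'M[K]_n -> Prop.
Hypotheses (PS : positive_system S) (SB : forall a, broot B a -> S a).
Let h0 := rho_vee S.
Let ih0 : integral h0. Proof. exact: rho_vee_integral. Qed.
Let U := unip h0.
Let UM u v : U u -> U v -> U (u *m v). Proof. exact: unipM. Qed.
Let UV u : U u -> U (invmx u). Proof. exact: unipV. Qed.
Let Bu x : B x -> x \in unitmx. Proof. exact: (borel_unit hB). Qed.
Let Uu x : U x -> x \in unitmx. Proof. by case=> Gx _; apply: Gunit. Qed.

Lemma borel_norm_unip b u : B b -> U u -> U (Ad b u).
Proof.
move=> Bb Hu; have [v [m [Hv Bv Bm mt ->]]] := borel_factor hB hTB PS SB Bb.
have [Lh0 _] := ih0; have um := Bu Bm.
rewrite AdM ?(Bu Bv) //; have Hm : U (Ad m u).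
  apply: unip_conj => //; first exact: (borel_sub hB).
  have := mt _ Lh0; rewrite /Ad => /(congr1 (mulmx^~ m)); rewrite mulmxKV // => e.
  by rewrite /bracket e subrr.
by rewrite {1}/Ad; apply: UM; [apply: UM|apply: UV].
Qed.

Lemma unipV_fil d u : 1 <= d -> G u -> fil h0 d (u - 1%:M) -> fil h0 d (invmx u - 1%:M).
Proof.
move=> d1 Gu Fu; have Hu : U u by split=> //; apply: fil_le Fu.
have -> : invmx u - 1%:M = - (invmx u *m (u - 1%:M)).
  by rewrite mulmxBr mulVmx ?mulmx1 ?opprB //; apply: Gunit.
apply: filN; rewrite -[d]add0r; apply: fil_mul => //; apply: unip_fil0; exact: UV.
Qed.

Lemma unip_filtration k : iter k (@derived_group K n) U `<=` [set u | G u /\ fil h0 k.+1%:Z (u - 1%:M)].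
Proof.
elim: k => [|k IH] //=; apply: subset_trans (derived_mono IH) _.
have [[_ G1 GM GV] _] := frame_aG.
have F0 d u : 1 <= d -> G u -> fil h0 d (u - 1%:M) -> fil h0 0 u.
  by move=> d1 Gu Fu; apply: (@unip_fil0); split=> //; apply: fil_le Fu.
have d1 : 1 <= k.+1%:Z by []. have d2 : 1 <= k.+2%:Z by [].
apply: derived_sub.
  split=> [u [Gu _]||u v [Gu Fu] [Gv Fv]|u [Gu Fu]] /=.
  - exact: Gunit.
  - by split=> //; rewrite subrr; apply: fil0.
  - split; first exact: GM.
    have -> : u *m v - 1%:M = u *m (v - 1%:M) + (u - 1%:M) by rewrite mulmxBr mulmx1 addrA subrK.
    by apply: filD => //; rewrite -[X in fil _ X]add0r; apply: fil_mul => //; apply: (F0 k.+2%:Z).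
  by split; [apply: GV|apply: unipV_fil].
move=> x y [Gx Fx] [Gy Fy] /=; have ux := Gunit Gx; have uy := Gunit Gy.
split; first by apply: (GM); [apply: (GM); [apply: (GM)|apply: (GV)]|apply: (GV)].
have -> : x *m y *m invmx x *m invmx y - 1%:M =
    ((x - 1%:M) *m (y - 1%:M) - (y - 1%:M) *m (x - 1%:M)) *m (invmx x *m invmx y).
  have -> : (x - 1%:M) *m (y - 1%:M) - (y - 1%:M) *m (x - 1%:M) = x *m y - y *m x.
    by rewrite !(mulmxBl, mulmxBr) !(mul1mx, mulmx1); apply/matrixP => i j; rewrite !mxE; ring.
  rewrite mulmxBl !mulmxA mulmxK // mulmxV //.
rewrite -[k.+2%:Z]addr0; apply: fil_mul.
  apply: (@fil_le _ _ (k.+1%:Z + k.+1%:Z)); first by lia.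
  by apply: filB; apply: fil_mul.
rewrite -[0]addr0; apply: fil_mul; apply: (F0 k.+1%:Z) => //; try exact: GV; exact: unipV_fil.
Qed.

Let prodU (A : set 'M[K]_n) : set 'M[K]_n := [set g | exists x u, [/\ A x, U u & g = x *m u]].

Lemma prodU_group A : subgroup_GL A -> A `<=` B -> subgroup_GL (prodU A).
Proof.
move=> [Au A1 AM AV] AB; have U1 : U 1%:M by apply: unip1.
have conjU x u : A x -> U u -> U (invmx x *m u *m x).
  move=> Ax Hu; have := borel_norm_unip (borelV hB (AB _ Ax)) Hu.
  by rewrite /Ad invmxK.
split.
- by move=> _ [x [u [Ax Hu ->]]] /=; rewrite unitmx_mul (Uu Hu) andbT; apply: Au.
- by exists 1%:M, 1%:M; rewrite mulmx1.
- move=> _ _ [x [u [Ax Hu ->]]] [y [v [Ay Hv ->]]]; exists (x *m y), (invmx y *m u *m y *m v).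
  split; [exact: AM|by apply: UM => //; apply: conjU|].
  by have /= uy := Au _ Ay; rewrite !mulmxA; congr (_ *m _); rewrite mulmxK.
move=> _ [x [u [Ax Hu ->]]]; have /= ux := Au _ Ax.
exists (invmx x), (x *m invmx u *m invmx x); split; first exact: AV.
  by have := conjU _ _ (AV _ Ax) (UV Hu); rewrite invmxK.
by rewrite invmx_mul ?(Uu Hu) // !mulmxA mulVmx // mul1mx.
Qed.

Lemma derived_prodU A : subgroup_GL A -> A `<=` B -> derived_group (prodU A) `<=` prodU (derived_group A).
Proof.
move=> sA AB; have [Au A1 AM AV] := sA; have sD := derived_subgroup Au.
have DA : derived_group A `<=` A.
  by apply: derived_sub => // x y Ax Ay; apply: (AM); [apply: (AM); [apply: (AM)|apply: (AV)]|apply: (AV)].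
apply: derived_sub; first by apply: prodU_group => // x /DA /AB.
move=> _ _ [x [u [Ax Hu ->]]] [y [v [Ay Hv ->]]].
have Bx := AB _ Ax; have By := AB _ Ay; have ux := Bu Bx; have uy := Bu By; have uu := Uu Hu; have uv := Uu Hv.
exists (x *m y *m invmx x *m invmx y), (Ad y (Ad x (Ad (invmx y) u *m v *m invmx u) *m invmx v)); split.
- exact: derived_comm.
- apply: borel_norm_unip => //; apply: UM; last exact: UV.
  apply: borel_norm_unip => //; apply: UM; last exact: UV.
  by apply: UM => //; apply: borel_norm_unip => //; apply: (borelV hB).
rewrite !invmx_mul // /Ad invmxK; rewrite !mulmxA.
rewrite (mulmxKV uy) (mulmxKV ux).
by rewrite (mulmxK uy).
Qed.

Lemma prodU_solvable : solvable_group (alg_closure (prodU B)).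
Proof.
have sB : subgroup_GL B by case: (borel_alg hB).
have [_ [k kE]] : connected_solvable_subgroup G B /\ solvable_group B by case: hB => -[].
have iterB j : iter j (@derived_group K n) B `<=` B /\ subgroup_GL (iter j (@derived_group K n) B).
  elim: j => [|j [IH sIH]]; first by split.
  split; last exact: (iter_derived_subgroup j.+1 sB).
  have [Du D1 DM DV] := sIH.
  apply: subset_trans IH; rewrite /=; apply: derived_sub => // x y Ax Ay.
  by apply: (DM); [apply: (DM); [apply: (DM)|apply: (DV)]|apply: (DV)].
have DkU : iter k (@derived_group K n) (prodU B) `<=` U.
  suff H j : iter j (@derived_group K n) (prodU B) `<=` prodU (iter j (@derived_group K n) B).
    by move=> g /H [x [u [+ Hu ->]]]; rewrite kE => ->; rewrite mul1mx.
  elim: j => //= j IH; apply: subset_trans (derived_mono IH) _.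
  by have [DB sD] := iterB j; apply: derived_prodU.
have [N HN] := fil_bound h0; exists (N + k)%N; apply/seteqP; split; last first.
  move=> _ ->; have sP := prodU_group sB (@subset_refl _ B).
  have [sC _] := alg_closure_group charK sP.
  by have [_ + _ _] := iter_derived_subgroup (N + k) sC.
apply: subset_trans (@iter_derived_alg_closure K charK n _ _ (prodU_group sB (@subset_refl _ B))) _.
apply: subset_trans (@alg_closure1 K n) => x [zx ux]; split=> //; apply: zclosureS zx => g.
rewrite iterD => /(iter_derived_mono DkU) /unip_filtration [_ Fg] /=.
apply: subr0_eq; apply: HN; apply: fil_le Fg; by rewrite lez_nat.
Qed.

(** The group generated by B and U is connected and solvable, hence equal to B. *)
Lemma unip_borel u : U u -> B u.
Proof.
have sB : subgroup_GL B by case: (borel_alg hB).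
have sP := prodU_group sB (@subset_refl _ B); have [Pu _ _ _] := sP.
have BP : B `<=` prodU B by move=> x Bx; exists x, 1%:M; rewrite mulmx1; split=> //; apply: unip1.
have [[_ BG cB _] Bmax] := hB.
have <- : alg_closure (prodU B) = B.
  apply: Bmax; last exact: subset_trans BP (sub_alg_closure Pu).
  split; [exact: alg_closure_group| | |exact: prodU_solvable].
    apply: alg_closure_min; first exact: frame_aG.
    move=> _ [x [v [Bx [Gv _] ->]]]; have [_ GM] := frame_mG; apply: GM => //; exact: BG.
  apply: (@zconnected_linked K charK n B) => //; first by case: (borel_mon hB).
  move=> _ [x [v [Bx Hv ->]]]; have [y Hy ->] := unip_log Hv.
  have ny : nilp y by case: Hy => _; apply: fil_nilp.
  exists (pc x *m ecurve y); split.
  - by rewrite cevalM ceval_pc ecurve0 // mulmx1.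
  - by rewrite cevalM ceval_pc ecurve_eval // scale1r.
  move=> t; exists x, (expm (t *: y)); rewrite cevalM ceval_pc ecurve_eval //; split=> //.
  apply: unip_expm; rewrite -[_ *: _]addr0; apply: nil_alg_linear => //.
  by split; [apply: lie0|apply: fil0].
move=> Hu; apply: sub_alg_closure => //; exists 1%:M, u; rewrite mul1mx; split=> //.
by case: (borel_mon hB).
Qed.

Lemma broot_pos a : is_root a -> broot B a <-> S a.
Proof.
move=> ra; split=> [|Sa]; first exact: SB.
split=> // x rx; apply: (lie_of_expm charK (borel_alg hB) (rsp_nilp ra rx)) => t.
apply: unip_borel; apply: unip_expm; apply: (rspan_nil_alg ih0).
by apply: (rspan_rsp ra); [apply: (pos_rho PS)|apply: rspZ].
Qed.
End BorelStructure.


(** The structure of B needed below: a positive system S with sum of coroots h0,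
    such that B is the product of the unipotent group of h0 with a group
    centralizing the torus algebra. *)
Record borel_frame (B : set 'M[K]_n) : Type := BorelFrame {
  bf_borel : borel_subgroup G B;
  bf_TB : T `<=` B;
  bf_pos : 'M[K]_n -> Prop;
  bf_sys : positive_system bf_pos;
  bf_broot : forall a, is_root a -> (broot B a <-> bf_pos a)
}.

Lemma borel_frame_exists (B : set 'M[K]_n) : borel_subgroup G B -> T `<=` B -> exists F : borel_frame B, True.
Proof.
move=> hB hTB; have [S [CS BS Smax]] := closed_anti_maximal (broot_closed_anti hB).
have PS := closed_anti_total CS Smax.
by exists (@BorelFrame B hB hTB S PS (broot_pos hB hTB PS BS)).
Qed.


(** * Sets of orthogonal roots and injectivity *)
Section Orthogonal.
Implicit Types (x y h a b g u : 'M[K]_n) (c : K) (S : seq 'M[K]_n).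

Definition root_family S v := forall a, a \in S -> rsp a (v a) /\ v a <> 0.

(** The property of a characteristic of an element of height at most 2. *)
Definition height2 h := integral h /\ forall a, is_root a -> ival a h <= 2.

Definition orth_roots h S := [/\ uniq S, forall a, a \in S -> is_root a /\ ival a h = 2 &
  forall a b, a \in S -> b \in S -> a <> b -> cartan a b = 0].

Lemma height2_ge h a : height2 h -> is_root a -> - 2 <= ival a h.
Proof. by move=> [ih H] ra; have := H _ (is_rootN ra); rewrite (ivalN ra ih); lia. Qed.

Lemma bracket_nonroot a b x y : is_root a -> is_root b -> rsp a x -> rsp b y -> a + b <> 0 ->
  ~ is_root (a + b) -> bracket x y = 0.
Proof.
move=> ra rb rx ry nz nr; apply: contrapT => nb; apply: nr.
apply: (is_rootP _ nz (rsp_bracket rx ry) nb).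
by apply: lieD; [case: ra|case: rb].
Qed.

Lemma height2_sum h a b : height2 h -> is_root a -> is_root b -> ival a h = 2 -> ival b h = 2 ->
  a + b <> 0 /\ ~ is_root (a + b).
Proof.
move=> [ih H] ra rb ah bh; split.
  move=> ab; have bE : b = - a by apply/eqP; rewrite -addr_eq0 addrC ab.
  by move: bh; rewrite bE (ivalN ra ih) ah.
by move=> rab; have := H _ rab; rewrite (ivalDl ra rb rab ih) ah bh.
Qed.

Lemma height2_cartan h a b : height2 h -> is_root a -> is_root b -> ival a h = 2 -> ival b h = 2 ->
  0 <= cartan a b.
Proof.
move=> hh ra rb ah bh; rewrite leNgt; apply/negP => lt.
have [nz nr] := height2_sum hh ra rb ah bh; apply: nr.
exact: (root_add rb ra lt).
Qed.

(** Orthogonal roots of degree 2 are strongly orthogonal: if their difference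
    were a root, so would be their sum, of degree 4. *)
Lemma strongly_orth h a b : height2 h -> is_root a -> is_root b -> ival a h = 2 -> ival b h = 2 ->
  a <> b -> cartan a b = 0 -> ~ is_root (a - b).
Proof.
move=> hh ra rb ah bh ab c0 rab; have [nz nr] := height2_sum hh ra rb ah bh; apply: nr.
have E : (a - b) + 2%:R *: b = a + b by rewrite scaler_nat mulr2n addrA subrK.
rewrite -E; apply: root_string => //; last by rewrite E.
by rewrite (cartanD ra (is_rootN rb) rab rb) cartanNl // c0 cartanaa.
Qed.

Lemma height2_fil h x : height2 h -> Lie G x -> fil h (- 2) x.
Proof.
move=> hh; apply: (@lieG_ind (fil h (- 2))) => [|c u v|y Ly|a y ra ry]; first exact: fil0.
- exact: fil_linear.
- by apply: (@fil_le _ _ 0) => //; apply: fil_torus.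
by apply: (@fil_le _ _ (ival a h)); [apply: height2_ge|apply: fil_rsp => //; case: hh].
Qed.

Lemma height2_fil_eq0 h x : height2 h -> Lie G x -> fil h 3 x -> x = 0.
Proof.
move=> [ih hh] Lx Fx; apply: (@weight_ind [set x | Lie G x /\ fil h 3 x] (fun x => x = 0)) => //.
- by move=> y [].
- by split; [apply: lie0|apply: fil0].
- by move=> c y z [Ly Fy] [Lz Fz]; split; [apply: lie_linear|apply: fil_linear].
- move=> t y Tt [Ly Fy]; split; first by apply: lieG_Ad => //; apply: frame_TG.
  by move=> i j /(cc_Ad_T_neq0 Tt) /Fy.
- by move=> c y z -> ->; rewrite scaler0 addr0.
- move=> y [_ Fy] Ly; rewrite (liet_diag Ly) (_ : \row_j _ = 0) ?/dg ?linear0 ?mulmx0 ?mul0mx //.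
  by apply/rowP => j; rewrite !mxE; apply: contrapT => /eqP /Fy; rewrite subrr.
move=> a y [_ Fy] ra ry; apply: contrapT => ny; have [i [j nij]] := rsp_entry_neq0 ny.
have := Fy i j nij; have [Lh _] := ih; have := rsp_entry ry nij Lh.
rewrite !(kkE _ ih) -rmorphB (ivalE ra ih) => /intr_eq <-; have := hh a ra; lia.
Qed.

Lemma integralN h : integral h -> integral (- h).
Proof. by move=> ih; have := integral_intr (-1) ih; rewrite rmorphN scaleN1r. Qed.

Lemma ivalNr a h : is_root a -> integral h -> ival a (- h) = - ival a h.
Proof.
move=> ra ih; apply: intr_eq; rewrite rmorphN /= -(ivalE ra ih).
by rewrite -(ivalE ra (integralN ih)) rtNr.
Qed.

(** ** The sl2-triple of a set of orthogonal roots *)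
Section OrthTriple.
Variables (h : 'M[K]_n) (S : seq 'M[K]_n) (v f : 'M[K]_n -> 'M[K]_n).
Hypotheses (hh : height2 h) (oS : orth_roots h S).
Hypothesis vf : forall a, a \in S -> [/\ rsp a (v a), rsp (- a) (f a) & sl2_triple (v a) (coroot a) (f a)].

Let uS : uniq S. Proof. by case: oS. Qed.
Let rS a : a \in S -> is_root a. Proof. by case: oS => _ + _ => /(_ a) H /H []. Qed.
Let dS a : a \in S -> ival a h = 2. Proof. by case: oS => _ + _ => /(_ a) H /H []. Qed.
Let cS a b : a \in S -> b \in S -> a <> b -> cartan a b = 0. Proof. by case: oS => _ _; apply. Qed.
Let ih : integral h. Proof. by case: hh. Qed.

Definition osum (w : 'M[K]_n -> 'M[K]_n) := \sum_(a <- S) w a.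
Definition eta := osum (@coroot K n).

Let rv a : a \in S -> rsp a (v a). Proof. by case/vf. Qed.
Let rf a : a \in S -> rsp (- a) (f a). Proof. by case/vf. Qed.

Lemma orth_vv a b : a \in S -> b \in S -> bracket (v a) (v b) = 0.
Proof.
move=> aS bS; have [nz nr] := height2_sum hh (rS aS) (rS bS) (dS aS) (dS bS).
exact: bracket_nonroot (rS aS) (rS bS) (rv aS) (rv bS) nz nr.
Qed.

Lemma orth_ff a b : a \in S -> b \in S -> bracket (f a) (f b) = 0.
Proof.
move=> aS bS; have [nz nr] := height2_sum hh (rS aS) (rS bS) (dS aS) (dS bS).
apply: bracket_nonroot (is_rootN (rS aS)) (is_rootN (rS bS)) (rf aS) (rf bS) _ _.
  by rewrite -opprD => /eqP; rewrite oppr_eq0 => /eqP.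
by rewrite -opprD => /is_rootN; rewrite opprK.
Qed.

Lemma orth_vf a b : a \in S -> b \in S -> a <> b -> bracket (v a) (f b) = 0.
Proof.
move=> aS bS ab; apply: bracket_nonroot (rS aS) (is_rootN (rS bS)) (rv aS) (rf bS) _ _.
  by move/eqP; rewrite subr_eq0 => /eqP.
exact: strongly_orth hh (rS aS) (rS bS) (dS aS) (dS bS) ab (cS aS bS ab).
Qed.

Lemma orth_sum_delta (w : 'M[K]_n -> 'M[K]_n) a : a \in S ->
  (forall b, b \in S -> a <> b -> w b = 0) -> \sum_(b <- S) w b = w a.
Proof.
move=> aS H; rewrite (bigD1_seq a) //= big_seq_cond big1 ?addr0 // => b /andP [bS /eqP ba].
by apply: H => // e; apply: ba.
Qed.

Lemma eta_lie : Lie T eta.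
Proof. by rewrite /eta /osum big_seq; apply: lie_sum => a aS; apply: coroot_lie; apply: rS. Qed.

Lemma eta_integral : integral eta.
Proof. by apply: integral_sum_seq => a aS; apply: integral_coroot; apply: rS. Qed.

Lemma rt_eta a : a \in S -> rt a eta = 2.
Proof.
move=> aS; rewrite /eta /osum rt_sumr (bigD1_seq a) //= rt_coroot; last exact: rS.
rewrite big_seq_cond big1 ?addr0 // => b /andP [bS /eqP ba].
by rewrite (cartanE (rS aS) (rS bS)) cS // => e; apply: ba.
Qed.

Lemma ival_eta a : a \in S -> ival a eta = 2.
Proof. by move=> aS; apply: intr_eq; rewrite -(ivalE (rS aS) eta_integral) rt_eta. Qed.

Lemma osum_fil2 : fil h 2 (osum v).
Proof.
rewrite /osum big_seq; elim/big_ind: _ => [|x y|a aS]; [exact: fil0|exact: filD|].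
by rewrite -(dS aS); apply: fil_rsp (rS aS) ih (rv aS).
Qed.

Lemma osum_nilp : nilp (osum v).
Proof. by apply: (@fil_nilp h); apply: fil_le osum_fil2. Qed.

Lemma osum_nilpF : nilp (osum f).
Proof.
apply: (@fil_nilp (- h)); apply: (@fil_le _ _ 2) => //.
rewrite /osum big_seq; elim/big_ind: _ => [|x y|a aS]; [exact: fil0|exact: filD|].
have ra := is_rootN (rS aS); have <- : ival (- a) (- h) = 2.
  by rewrite ivalNr // (ivalN (rS aS) ih) dS.
exact: fil_rsp ra (integralN ih) (rf aS).
Qed.

Lemma osum_lie : Lie G (osum v).
Proof. by rewrite /osum big_seq; apply: lie_sum => a aS; case: (rv aS). Qed.

Lemma osum_triple : sl2_triple (osum v) eta (osum f).
Proof.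
split.
- rewrite /osum bracket_sumr scaler_sumr !big_seq; apply: eq_bigr => a aS.
  by have [_ ->] := rv aS; [rewrite rt_eta|apply: eta_lie].
- rewrite /osum bracket_sumr scaler_sumr -sumrN !big_seq; apply: eq_bigr => a aS.
  by have [_ ->] := rf aS; [rewrite rtNl rt_eta // scaleNr|apply: eta_lie].
rewrite /eta /osum bracket_suml !big_seq; apply: eq_bigr => a aS; rewrite bracket_sumr -big_seq.
have [_ _ [_ _ <-]] := vf aS.
by have /= -> := @orth_sum_delta (fun b => bracket (v a) (f b)) a aS (fun b bS ab => orth_vf aS bS ab).
Qed.

Lemma osum_module : sl2_module (bracket (osum v)) (bracket (osum f)) (bracket eta).
Proof. exact: sl2_module_ad osum_triple osum_nilp osum_nilpF. Qed.

Lemma eta_height2 : height2 eta.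
Proof.
have H a : is_root a -> - 2 <= ival a eta.
  move=> ra; rewrite leNgt; apply/negP => lt; have [_ _ [x rx nx]] := ra; apply: nx.
  have [c cE] : exists c : nat, ival a eta = - c%:Z by case: (ival a eta) lt => // c _; exists c.+1.
  apply: (@sl2_injE K charK _ _ _ _ osum_module c 3).
  - by have [_ ->] := rx; [rewrite (ivalE ra eta_integral) cE rmorphN scaleNr|apply: eta_lie].
  - by move: lt; rewrite cE; lia.
  have [Lx _] := rx.
  apply: (height2_fil_eq0 hh).
    have E y : Lie G y -> Lie G (bracket (osum v) y).
      by move=> Ly; apply: lieG_bracket => //; exact: osum_lie.
    by rewrite /=; do 3!apply: (E).
  have F := height2_fil hh Lx; have E := osum_fil2.
  apply: (@fil_le _ _ (2 + (2 + (2 + (- 2))))) => //=.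
  by do 3!(apply: fil_bracket => //).
split; first exact: eta_integral.
by move=> a ra; have := H _ (is_rootN ra); rewrite (ivalN ra eta_integral); lia.
Qed.

Definition orefl x := x - \sum_(a <- S) rt a x *: coroot a.

Lemma otheta_refl x : Lie T x -> Ad (theta (osum v) (osum f)) x = orefl x.
Proof.
move=> Lx; pose A := \sum_(a <- S) rt a x *: v a; pose A' := \sum_(a <- S) rt a x *: f a.
have Le := eta_lie; apply: (theta_refl charK (a := A) (a' := A') osum_nilp osum_nilpF).
- rewrite bracketC /osum bracket_sumr /A !big_seq; congr (- _); apply: eq_bigr => a aS.
  by have [_ ->] := rv aS.
- rewrite /osum /A bracket_sumr big_seq big1 // => a aS; rewrite bracketZr bracket_suml big_seq big1 ?scaler0 // => b bS.
  exact: orth_vv.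
- rewrite bracketC /osum bracket_sumr /A' !big_seq -sumrN; apply: eq_bigr => a aS.
  by have [_ ->] := rf aS; rewrite // rtNl scaleNr opprK.
- rewrite /osum /A' bracket_sumr big_seq big1 // => a aS; rewrite bracketZr bracket_suml big_seq big1 ?scaler0 // => b bS.
  exact: orth_ff.
- rewrite /osum /A bracket_sumr !big_seq -sumrN; apply: eq_bigr => a aS.
  rewrite bracketZr bracketC bracket_sumr -?big_seq scalerN; congr (- (_ *: _)).
  have [_ _ [_ _ <-]] := vf aS.
  by have /= -> := @orth_sum_delta (fun b => bracket (v a) (f b)) a aS (fun b bS ab => orth_vf aS bS ab).
- rewrite bracketC bracket_suml scaler_sumr !big_seq -sumrN; apply: eq_bigr => a aS.
  have H b : b \in S -> a <> b -> bracket (coroot a) (f b) = 0.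
    move=> bS ab; have [_ ->] := rf bS; last by apply: coroot_lie; apply: rS.
    by rewrite rtNl (cartanE (rS bS) (rS aS)) cS ?oppr0 ?scale0r // => e; apply: ab.
  rewrite bracketZl bracket_sumr; have /= -> := @orth_sum_delta (fun b => bracket (coroot a) (f b)) a aS H.
  by have [_ _ [_ -> _]] := vf aS; rewrite scalerN opprK !scalerA mulrC.
rewrite bracketC bracket_suml scaler_sumr !big_seq; congr (- _); apply: eq_bigr => a aS.
have H b : b \in S -> a <> b -> bracket (coroot a) (v b) = 0.
  move=> bS ab; have [_ ->] := rv bS; last by apply: coroot_lie; apply: rS.
  by rewrite (cartanE (rS bS) (rS aS)) cS ?scale0r // => e; apply: ab.
rewrite bracketZl bracket_sumr; have /= -> := @orth_sum_delta (fun b => bracket (coroot a) (v b)) a aS H.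
by have [_ _ [-> _ _]] := vf aS; rewrite !scalerA mulrC.
Qed.

Lemma orefl_lie x : Lie T x -> Lie T (orefl x).
Proof.
move=> Lx; apply: lie_sub => //; rewrite big_seq; apply: lie_sum => a aS.
by apply: lieZ; apply: coroot_lie; apply: rS.
Qed.

Lemma otheta_diag Q y j : rspan Q y -> cc P (Ad (theta (osum v) (osum f)) y) j j = 0.
Proof.
have ut : theta (osum v) (osum f) \in unitmx := theta_unit charK osum_nilp osum_nilpF.
apply: (rspan_elim (V := fun y => cc P (Ad (theta (osum v) (osum f)) y) j j = 0)).
- by rewrite Ad0 cc0 mxE.
- by move=> c x z hx hz; rewrite AdD AdZ ccD ccZ hx hz mulr0 addr0.
move=> a x ra _ [Lx Hx]; have [La _ _] := ra; have na := rt_root_neq0 ra.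
have -> : x = (rt a a)^-1 *: bracket a x by rewrite Hx // scalerA mulVf // scale1r.
rewrite AdZ ccZ Ad_bracket // otheta_refl // liet_bracket ?subrr ?mul0r ?mulr0 //.
exact: orefl_lie.
Qed.

End OrthTriple.

(** Applied to the coroot of b, the equality of the products of reflections makes it
    a combination with nonnegative coefficients of coroots of S'; as the elements
    of S' are pairwise orthogonal, only one of them can pair positively with b, so
    b is a multiple of it, of the same degree. *)
Lemma orefl_inj h h' S S' : height2 h -> height2 h' -> orth_roots h S -> orth_roots h' S' ->
  height2 (eta S) -> eta S = eta S' ->
  (forall x, Lie T x -> orefl S x = orefl S' x) -> forall a, a \in S -> a \in S'.
Proof.
move=> hh hh' oS oS' heta eE reflE b bS; have [uS rS cS] := oS; have [uS' rS' cS'] := oS'.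
have rb := (rS b bS).1; have Lc a : a \in S' -> Lie T (coroot a) by move/rS' => [ra _]; apply: (coroot_lie ra).
have sumE x : Lie T x -> \sum_(a <- S) rt a x *: coroot a = \sum_(a <- S') rt a x *: coroot a.
  by move=> Lx; have /addrI/oppr_inj := reflE x Lx.
have iS a : a \in S -> ival a (eta S) = 2 by exact: (ival_eta oS).
have iS' a : a \in S' -> ival a (eta S) = 2 by rewrite eE; exact: (ival_eta oS').
have ge0 a g : a \in S' -> g \in S -> 0 <= cartan a g.
  by move=> aS' gS; apply: (height2_cartan heta (rS' _ aS').1 (rS _ gS).1); [apply: iS'|apply: iS].
have ge0' a g : a \in S' -> g \in S -> 0 <= cartan g a.
  by move=> aS' gS; apply: (height2_cartan heta (rS _ gS).1 (rS' _ aS').1); [apply: iS|apply: iS'].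
have two : 2 *: coroot b = \sum_(a <- S') (cartan a b)%:~R *: coroot a.
  transitivity (\sum_(a <- S') rt a (coroot b) *: coroot a).
    rewrite -sumE; last exact: (coroot_lie rb).
    rewrite (bigD1_seq b) //= rt_coroot // big_seq_cond big1 ?addr0 // => a /andP [aS /eqP ab].
    by rewrite (cartanE (rS _ aS).1 rb) cS // scale0r.
  by rewrite !big_seq; apply: eq_bigr => a aS'; rewrite (cartanE (rS' _ aS').1 rb).
have one a g : a \in S' -> g \in S' -> a <> g -> 0 < cartan a b -> cartan g b = 0.
  move=> aS' gS' ag pos; have ra := (rS' _ aS').1; have rg := (rS' _ gS').1.
  have : \sum_(d <- S) cartan d a * cartan g d = 0.
    apply: intr_eq; rewrite rmorph_sum /=.
    have := congr1 (fun x => rt g x) (sumE _ (Lc a aS')).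
    rewrite /= !rt_sumr => E; transitivity (\sum_(d <- S) rt g (rt d (coroot a) *: coroot d)).
      rewrite !big_seq; apply: eq_bigr => d dS; have rd := (rS _ dS).1.
      by rewrite rmorphM rtZr (cartanE rd ra) (cartanE rg rd).
    rewrite E big_seq big1 // => d dS'; have rd := (rS' _ dS').1; rewrite rtZr.
    have [da|/eqP da] := eqVneq d a; last by rewrite (cartanE rd ra) cS' // mul0r.
    by rewrite da (cartanE rg ra) cS' ?mulr0 // => e; apply: ag.
  rewrite big_seq => /eqP; rewrite psumr_eq0 => [/allP /(_ b bS)|d dS]; last first.
    by apply: mulr_ge0; [apply: ge0'|apply: ge0].
  rewrite bS /= mulf_eq0 => /orP[] /eqP e //; move: pos; rewrite cartan_gt0 // e ltxx.
  by [].
have [a aS' pos] : exists2 a, a \in S' & 0 < cartan a b.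
  apply: contrapT => no; have : 2 *: coroot b = 0.
    rewrite two big_seq big1 // => a aS'; suff -> : cartan a b = 0 by rewrite scale0r.
    by apply/eqP; rewrite eq_le ge0 // andbT leNgt; apply/negP => lt; apply: no; exists a.
  move/(congr1 (rt b)); rewrite rtZr rt_coroot // rt0r -natrM => /eqP.
  by rewrite (negPf (natr0 3)).
have ra := (rS' _ aS').1.
have bE : 2 *: coroot b = (cartan a b)%:~R *: coroot a.
  rewrite two (bigD1_seq a) //= big_seq_cond big1 ?addr0 // => g /andP [gS' /eqP ga].
  by rewrite (one a g) // ?scale0r // => e; apply: ga.
have n2 : (2 : K) != 0 by apply: natr0.
have nb := rt_root_neq0 rb.
have [s sE] : exists s, b = s *: a.
  exists (rt b b / 2 * ((cartan a b)%:~R / 2) * (2 / rt a a)); move: bE; rewrite /coroot !scalerA => bE.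
  apply: (scalerI (_ : 2 * (2 / rt b b) != 0)); first by rewrite !mulf_neq0 // invr_eq0.
  rewrite bE scalerA; congr (_ *: _); field.
  by rewrite nb n2 (rt_root_neq0 ra).
have := rt_eta oS bS; rewrite sE rtZl eE (rt_eta oS' aS') -[RHS]mul1r => /(mulIf n2) s1.
by rewrite s1 scale1r.
Qed.
End Orthogonal.


(** * The part of degree 2 *)
Section DegreeTwoPart.
Implicit Types (x y u k a b g t : 'M[K]_n) (c : K).

Lemma TV t : T t -> T (invmx t).
Proof. by move=> Tt; have [[_ _ _ +] _] := frame_aT; apply. Qed.

Lemma AdT_fix t h : T t -> Lie T h -> Ad t h = h.
Proof.
move=> Tt Lh; have ut := Tunit Tt.
have /eqP := lie_torus_comm charK (tf_T R) (tf_unit R) (tf_param R) Lh Tt; rewrite subr_eq0 => /eqP e.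
by rewrite /Ad -e mulmxK.
Qed.

Lemma Ad_fix_comm g h : g \in unitmx -> Ad g h = h -> bracket g h = 0.
Proof. by move=> ug; rewrite /Ad => /(congr1 (mulmx^~ g)); rewrite mulmxKV // => e; rewrite /bracket e subrr. Qed.

Lemma rsp_AdT t b x : T t -> rsp b x -> rsp b (Ad t x).
Proof.
move=> Tt [Lx Hx]; have ut := Tunit Tt.
split=> [|h Lh]; first by apply: lieG_Ad => //; apply: frame_TG.
by rewrite -{1}(AdT_fix Tt Lh) -Ad_bracket // Hx // AdZ.
Qed.

Definition deg2 h : set 'M[K]_n := [set x | Lie G x /\ bracket h x = 2 *: x].

Lemma deg2_Ad g h x : G g -> deg2 h x -> deg2 (Ad g h) (Ad g x).
Proof.
move=> Gg [Lx hx]; split; first exact: lieG_Ad.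
by rewrite -Ad_bracket ?(Gunit Gg) // hx AdZ.
Qed.

Section Height2.
Variable h : 'M[K]_n.
Hypothesis hh : height2 h.
Let ih : integral h. Proof. by case: hh. Qed.
Let Lh : Lie T h. Proof. by case: ih. Qed.

Lemma deg2_linear c x y : deg2 h x -> deg2 h y -> deg2 h (c *: x + y).
Proof.
move=> [Lx hx] [Ly hy]; split; first by apply: lieD => //; apply: lieZ.
by rewrite bracketDr bracketZr hx hy scalerDr !scalerA mulrC.
Qed.

Lemma deg2_0 : deg2 h 0.
Proof. by split; [apply: lie0|rewrite bracket0r scaler0]. Qed.

Lemma deg2_fil x : deg2 h x -> fil h 2 x.
Proof.
move=> [_ hx] i j nz; have := liet_bracket x i j Lh; rewrite hx ccZ => /(mulIf nz).
by rewrite !(kkE _ ih) -rmorphB -[2]/(2%:~R) => /intr_eq <-.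
Qed.

Lemma deg2_rspan x : deg2 h x -> rspan (fun a => ival a h = 2) x.
Proof.
apply: weight_ind => [y []//||||||y|a y] //.
- exact: deg2_0.
- by move=> c u v; apply: deg2_linear.
- by move=> t y Tt; rewrite -{2}(AdT_fix Tt Lh); apply: deg2_Ad; apply: frame_TG.
- exact: rspan0.
- by move=> c u v; apply: rspan_linear.
- move=> [_ hy] Ly; suff -> : y = 0 by apply: rspan0.
  move: hy; rewrite (liet_comm Lh Ly) => /esym/eqP; rewrite scaler_eq0.
  by rewrite (negPf (natr0 1)) => /eqP.
- move=> [_ hy] ra ry; have [->|ny] := pselect (y = 0); first exact: rspan0.
  apply: (rspan_rsp ra _ ry); apply: intr_eq; rewrite -(ivalE ra ih).
  case: ry => _ /(_ h Lh); rewrite hy => /eqP; rewrite eq_sym -subr_eq0 -scalerBl scaler_eq0 subr_eq0.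
  by case/orP => /eqP.
Qed.

Lemma deg2_closed : zclosed (deg2 h).
Proof.
pose P (i : {mpoly K[n * n]} + 'I_n * 'I_n) := if i is inl p then vanishing_ideal G p else True.
pose E i x := match i with inl p => mxderiv p 1%:M x | inr ij => bracket h x ij.1 ij.2 - 2 * x ij.1 ij.2 end.
have := @zclosed_zeros K n n _ P E; have -> : [set A | forall i, P i -> E i A = 0] = deg2 h.
  apply/seteqP; split=> x /=.
    move=> PE; split; first by move=> p Ip; apply: (PE (inl p)).
    apply/matrixP => i j; have /eqP := PE (inr (i, j)) I; rewrite /= subr_eq0 => /eqP ->.
    by rewrite [RHS]mxE.
  by move=> [Lx hx] [p /Lx //|[i j] _]; rewrite /= hx mxE subrr.
apply=> -[p _|[i j] _]; first exact: polyfun_mxderiv_r.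
apply: polyfunB; last by apply: polyfunM; [apply: polyfun_cst|apply: polyfun_entry].
apply: (eq_polyfun (F := fun x => (h *m x) i j - (x *m h) i j)).
  by move=> x; rewrite /bracket !mxE.
by apply: polyfunB; apply: polymap_mul; solve [exact: polymap_cst|exact: polymap_id].
Qed.

Lemma deg2_bracket0 b v x : is_root b -> rsp b v -> 0 < ival b h -> deg2 h x -> bracket v x = 0.
Proof.
move=> rb rv b1 dx; apply: (height2_fil_eq0 hh); first by apply: lieG_bracket; [case: rv|case: dx].
apply: (@fil_le _ _ (ival b h + 2)); first by lia.
by apply: fil_bracket; [apply: fil_rsp|apply: deg2_fil].
Qed.

Lemma deg2_bracket y x : rspan (fun b => 0 <= ival b h) y -> deg2 h x -> deg2 h (bracket y x).
Proof.
move=> sy dx; have [Lx hx] := dx; apply: (rspan_elim (V := fun y => deg2 h (bracket y x)) _ _ _ sy).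
- by rewrite bracket0l; apply: deg2_0.
- by move=> c u v du dv; rewrite bracketDl bracketZl; apply: deg2_linear.
move=> b v rb pb rv; have Lb : Lie G (bracket v x) by apply: lieG_bracket => //; case: rv.
move: pb; rewrite le_eqVlt => /orP[/eqP b0|b1]; last by rewrite (deg2_bracket0 rb rv b1 dx); apply: deg2_0.
split=> //; rewrite jacobi; case: rv => _ -> //.
by rewrite (ivalE rb ih) -b0 scale0r bracket0l add0r hx bracketZr.
Qed.

Lemma deg2_expm y x : nilp y -> rspan (fun b => 0 <= ival b h) y -> deg2 h x -> deg2 h (Ad (expm y) x).
Proof.
move=> ny sy dx; have dk (k : nat) : deg2 h (iter k (bracket y) x) by elim: k => //= k; apply: deg2_bracket.
have [N N0] := ad_nilp ny; rewrite (@Ad_expm_ad K charK n y x N ny (N0 x)).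
elim/big_ind: _ => [|w v dw dv|i _]; first exact: deg2_0.
  by rewrite -[w]scale1r; apply: deg2_linear.
by rewrite -[_ *: _]addr0; apply: deg2_linear => //; apply: deg2_0.
Qed.

End Height2.
End DegreeTwoPart.


Section Characteristic.
Implicit Types (x y u k a b g : 'M[K]_n) (c : K).
Variables (h e f : 'M[K]_n).
Hypotheses (Lh : Lie T h) (Le : Lie G e) (Lf : Lie G f).
Hypothesis sl2 : sl2_triple e h f.
Hypothesis e3 : forall x, Lie G x -> iter 3 (bracket e) x = 0.

Lemma char_nilp : nilp e /\ nilp f.
Proof.
have [he hf _] := sl2; have hd := liet_diag Lh.
pose d := \row_j cc (tf_P R) h j j; rewrite -/d in hd.
split; [apply: (@nilp_shift K charK n _ e d 2 (tf_unit R))|apply: (@nilp_shift K charK n _ f d (- 2) (tf_unit R))].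
- exact: natr0 1.
- by rewrite -hd.
- by rewrite oppr_eq0; apply: natr0 1.
- by rewrite -hd hf scaleNr.
Qed.

(** A root of degree m > 2 would have its opposite root space killed by
    (ad e)^3, which is injective there. *)
Lemma char_height2 : height2 h.
Proof.
have [ne nf] := char_nilp; have ih := sl2_integral Lh sl2 ne nf.
split=> // a ra; rewrite leNgt; apply/negP => gt.
have rNa := is_rootN ra; have [_ _ [x rx nx]] := rNa; apply: nx.
have [m mE] : exists m : nat, ival a h = m%:Z by exists (absz (ival a h)); lia.
apply: (@sl2_injE K charK _ _ _ _ (sl2_module_ad sl2 ne nf) m 3); last by apply: e3; case: rx.
  by case: rx => _ ->; rewrite // rtNl (ivalE ra ih) mE.
by move: gt; rewrite mE; lia.
Qed.
Definition cent_h : set 'M[K]_n := [set g | G g /\ Ad g h = h].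

Lemma cent_h_monoid : monoid_mx cent_h.
Proof.
split; first by split; [case: frame_mG|rewrite Ad1].
move=> g g' [Gg gh] [Gg' gh']; split; first by case: frame_mG => _; apply.
by rewrite AdM ?(Gunit Gg) ?(Gunit Gg') // gh'.
Qed.

Lemma torus_cent_h t : T t -> cent_h t.
Proof. by move=> Tt; split; [apply: frame_TG|apply: AdT_fix]. Qed.

(** The centralizer of h has Lie algebra g(0), and ad e maps g(0) onto g(2):
    so its orbit of e is dense in g(2). *)
Lemma lie_cent_h k : Lie G k -> bracket h k = 0 -> Lie cent_h k.
Proof.
move=> Lk hk; have := conj Lk hk; move: (k) => {Lk hk}; apply: weight_ind => [y []//||||||y|a y] //.
- by split; [apply: lie0|rewrite bracket0r].
- move=> c x y [Lx hx] [Ly hy]; split; first by apply: lieD => //; apply: lieZ.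
  by rewrite bracketDr bracketZr hx hy scaler0 addr0.
- move=> t y Tt [Ly hy]; have [Gt th] := torus_cent_h Tt; split; first exact: lieG_Ad.
  by rewrite -{1}th -Ad_bracket ?(Gunit Gt) // hy linear0.
- exact: lie0.
- by move=> c x y; apply: lie_linear.
- by move=> _ Ly; apply: lie_mono Ly => t; apply: torus_cent_h.
move=> [Ly hy] ra ry; have ny := rsp_nilp ra ry.
have := @lie_curve K charK n cent_h (ecurve y) _ (ecurve0 ny).
rewrite (ecurve_deriv charK ny) cevalM ceval_pc (ecurve0 ny) mul1mx; apply=> t.
apply: sub_zclosure; rewrite ecurve_eval //; split.
  by apply: expmG; [apply: lieZ|apply: nilpZ].
by apply: (Ad_exp_fix); [apply: nilpZ|rewrite bracketZl bracketC hy oppr0 scaler0].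
Qed.

Lemma deg2_dense : deg2 h `<=` zclosure (orbit_Ad G e).
Proof.
have cu : cent_h `<=` [set g | g \in unitmx] by move=> g [Gg _]; apply: Gunit.
have [c1 cM] := cent_h_monoid; have [ne nf] := char_nilp; have [he hf ef] := sl2.
pose Y := orbit_Ad cent_h e; have sub : Y `<=` orbit_Ad G e by move=> _ [g [Gg _] <-]; exists g.
have Ye : Y e by exists 1%:M => //; rewrite Ad1.
have de : deg2 h e by [].
move=> x dx; apply: (zclosureS sub); have -> : x = e + (x - e) by rewrite addrC subrK.
apply: (zclosure_tangent charK) => // p Ip _ [g cg <-]; have ug := cu _ cg; have [Gg gh] := cg.
have du : deg2 h (x - e) by rewrite addrC -scaleN1r; apply: deg2_linear.
set u := x - e in du *.
have S : sl2_triple (Ad g e) h (Ad g f).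
  by split; rewrite -{1}gh -Ad_bracket // ?he ?hf ?ef ?linearN ?linearZ ?gh.
have [||U UP] := @vspace_of_pred K 'M[K]_n (Lie G); first exact: lie0.
  by move=> c y z; apply: lie_linear.
have M := sl2_module_ad S (nilp_conj ug ne) (nilp_conj ug nf).
have [||||k [/UP Lk hk ku]] := @sl2_surjE K charK _ _ _ _ U 1 u M.
- by move=> y /UP Ly; apply/UP; apply: lieG_bracket => //; apply: lieG_Ad.
- by move=> y /UP Ly; apply/UP; apply: lieG_bracket => //; apply: lieG_Ad.
- by apply/UP; case: du.
- by case: du.
rewrite -ku bracketC -bracketNl; apply: (mxderiv_orbit charK cu) => //.
  by move=> g' cg'; apply: Ip; exists (g' *m g); [apply: cM|rewrite AdM // cu].
by rewrite -scaleN1r; apply: lieZ; apply: lie_cent_h => //; rewrite hk subrr scale0r.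
Qed.
End Characteristic.


(** * Roots as characters and as elements of the Cartan subalgebra *)
Section Characters.
Local Notation roots := (Defs.roots G T).
Implicit Types (a b c : chr K n) (x y h w g t : 'M[K]_n) (s : seq 'M[K]_n).

Let T1 : T 1%:M. Proof. by case: frame_aT => -[]. Qed.
Let Tu : T `<=` [set g | g \in unitmx]. Proof. by case: frame_aT => -[]. Qed.

Lemma chr_diffE a p h : regular_repr T a p -> Lie T h ->
  chr_diff T a h = mxderiv p (row_mx 1%:M 1%:M) (row_mx h (- h)).
Proof.
move=> pa Lh; rewrite /chr_diff; case: xgetP => [_ -> [q qa ->]|none]; last first.
  by case: (none (mxderiv p (row_mx 1%:M 1%:M) (row_mx h (- h)))); exists p.
have := @regular_deriv0 _ charK n T h (q + (-1)%:MP * p) Tu T1 _ Lh.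
rewrite mxderivD mxderivM mxderivC mul0r add0r /mxeval mevalC mulN1r => H.
apply: subr0_eq; apply: H => t Tt.
by rewrite mevalD mevalM mevalC mulN1r -!/(mxeval _ _) -qa // -pa // subrr.
Qed.

Lemma chr1 a : character T a -> a 1%:M = 1.
Proof.
move=> [_ n0 aM _]; apply: (mulfI (n0 _ T1)).
by rewrite -aM // mulmx1 mulr1.
Qed.

Lemma chr_addP a b : character T a -> character T b -> character T (chr_add a b) /\
  forall h, Lie T h -> chr_diff T (chr_add a b) h = chr_diff T a h + chr_diff T b h.
Proof.
move=> ca cb; have [a0 an aM [p pa]] := ca; have [b0 bn bM [q qb]] := cb.
have pq : regular_repr T (chr_add a b) (p * q).
  by move=> t Tt; rewrite /mxeval mevalM -!/(mxeval _ _) -pa // -qb.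
split.
  split=> [x nT|t Tt|u t Uu Tt|]; last by exists (p * q).
  - by rewrite /chr_add a0 // mul0r.
  - by rewrite /chr_add mulf_neq0 ?an ?bn.
  - by rewrite /chr_add aM // bM // mulrACA.
move=> h Lh; rewrite (chr_diffE pq) // (chr_diffE pa) // (chr_diffE qb) // mxderivM.
have := pa _ T1; have := qb _ T1; rewrite !chr1 // invmx1 => <- <-.
by rewrite mulr1 mul1r.
Qed.

Lemma trivial_chrP : character T (trivial_chr T).
Proof.
have [_ _ TM _] := frame_aT.1.
split=> [x nT|t Tt|u t Uu Tt|]; rewrite /trivial_chr.
- by rewrite asboolF.
- by rewrite asboolT ?oner_neq0.
- by rewrite !asboolT ?mulr1 //; apply: TM.
by exists 1%:MP => t Tt; rewrite asboolT // /mxeval mevalC.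
Qed.

(** The element of the Cartan subalgebra representing the differential of a
    root for the trace form. *)
Definition mr a : 'M[K]_n := xget 0 [set al | Lie T al /\ forall h, Lie T h -> rt al h = chr_diff T a h].

Lemma chr_ext a b x : character T a -> character T b -> x <> 0 ->
  root_space G T a x -> root_space G T b x -> a = b.
Proof.
move=> [a0 _ _ _] [b0 _ _ _] nx [_ ax] [_ bx]; apply: funext => t.
have [Tt|nT] := pselect (T t); last by rewrite a0 // b0.
apply: subr0_eq; apply: contrapT => /eqP n0; apply: nx.
by apply: (scalerI n0); rewrite scaler0 scalerBl -ax // -bx // subrr.
Qed.

Lemma mrP a : roots a -> [/\ Lie T (mr a), is_root (mr a),
  forall h, Lie T h -> rt (mr a) h = chr_diff T a h & forall x, root_space G T a x <-> rsp (mr a) x].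
Proof.
move=> [ca ntr [x rx nx]]; have [al [y [Lal alE ralx _ _]]] := root_dual ca rx nx.
have mE : mr a = al.
  rewrite /mr; case: xgetP => [m _ [Lm mE]|/(_ al)]; last by case.
  apply: subr0_eq; apply: liet_nondeg.
    by rewrite -scaleN1r addrC; apply: lie_linear.
  by move=> h' Lh'; rewrite rtBl mE // alE // subrr.
have nal : al <> 0.
  move=> al0; apply: ntr; have [k [l [nz aE]]] := root_wchr uP TP rx nx ca.
  have kl := @torus_weight_eq K charK n G T hT P _ _ uP TP k l.
  apply: funext => t; rewrite aE /trivial_chr /wchr; case: asboolP => // Tt.
  rewrite kl // ?divff //; first exact: (cc_torus_neq0 uP TP).
  move=> h Lh; apply/eqP; rewrite -subr_eq0 -(rsp_entry ralx nz Lh) al0 rt0l.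
  by [].
have ral := is_rootP Lal nal ralx nx; rewrite mE; split=> // z.
split=> [[Lz az]|rz].
  by split=> // h Lh; rewrite alE //; apply: (chr_diff_bracket charK hT _ ca Lh).
have [d ->] := rsp_dim1 ral ralx nx rz; have [Lx ax] := rx; split; first exact: lieZ.
by move=> t Tt; rewrite AdZ ax // !scalerA mulrC.
Qed.

Lemma mr_inj a b : roots a -> roots b -> mr a = mr b -> a = b.
Proof.
move=> ra rb E; have [_ _ _ aE] := mrP ra; have [_ _ _ bE] := mrP rb.
have [ca _ [x rx nx]] := ra; have [cb _ _] := rb.
by apply: (chr_ext ca cb nx rx); apply/bE; rewrite -E; apply/aE.
Qed.

Lemma mr_surj al : is_root al -> exists2 a, roots a & mr a = al.
Proof.
move=> ral; have [Lal [h0 Lh0 nh0] [x rx nx]] := ral.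
have [k [l nz]] := rsp_entry_neq0 nx; have ax := rsp_root_space rx nz.
have ca := @wchr_character K n G T hT P _ _ uP TP k l.
have ra : roots (wchr T P k l).
  split=> // [E|]; last by exists x.
  apply: nh0; have fx t : T t -> Ad t x = x.
    by move=> Tt; case: ax => _ -> //; rewrite E /trivial_chr asboolT // scale1r.
  have Lx : Lie T x.
    by apply: (centT_lie charK (tf_G R) hT uP TP); split; [case: rx|apply: liet_Ad_fix].
  have := liet_comm Lh0 Lx; case: rx => _ -> // /eqP; rewrite scaler_eq0 => /orP[/eqP //|/eqP].
  by [].
exists (wchr T P k l) => //; have [Lm _ _ mE] := mrP ra.
by apply: (rsp_uniq Lm Lal _ rx nx); apply/mE.
Qed.

Definition cr al : chr K n := xget (trivial_chr T) [set a | roots a /\ mr a = al].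

Lemma crP al : is_root al -> roots (cr al) /\ mr (cr al) = al.
Proof. by move=> /mr_surj [a ra aE]; rewrite /cr; case: xgetP => [_ -> []|/(_ a)[]]. Qed.

Lemma crK a : roots a -> cr (mr a) = a.
Proof.
move=> ra; have [_ r _ _] := mrP ra; have [r' E] := crP r.
exact: mr_inj.
Qed.

(** ** The Weyl group *)

Lemma normalizerV w : normalizer G T w -> normalizer G T (invmx w).
Proof.
move=> [Gw E]; have uw := Gunit Gw; split; first exact: GV.
apply/seteqP; split=> [_ [t Tt <-]|t Tt].
  by move: Tt; rewrite -{1}E => -[s Ts <-]; rewrite AdK.
by exists (Ad w t); [rewrite -E; exists t|rewrite AdK].
Qed.

Lemma normalizerM w w' : normalizer G T w -> normalizer G T w' -> normalizer G T (w *m w').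
Proof.
move=> [Gw E] [Gw' E']; have [uw uw'] := (Gunit Gw, Gunit Gw').
split; first by case: frame_mG => _; apply.
apply/seteqP; split=> [_ [t Tt <-]|t].
  by rewrite AdM // -E; exists (Ad w' t) => //; rewrite -E'; exists t.
rewrite -{1}E => -[s Ts <-]; move: Ts; rewrite -{1}E' => -[r Tr <-].
by exists r => //; rewrite AdM.
Qed.

Lemma normalizer_lie w : normalizer G T w -> forall h, Lie T h -> Lie T (Ad w h).
Proof.
move=> [Gw E] h Lh p Ip; have uw := Gunit Gw.
have [q qE] : polyfun (fun A : 'M[K]_n => mxeval p (w *m A *m invmx w)).
  apply: (polyfun_comp (f := fun A : 'M[K]_n => w *m A *m invmx w)); last exact: polyfun_mxeval.
  exact: polymap_conj.
have := mxderiv_mulmx charK 1%:M h (fun A => esym (qE A)); rewrite mulmx1 mulmxV // => <-.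
by apply: Lh => t Tt; rewrite -qE; apply: Ip; rewrite -E; exists t.
Qed.

Section Weyl.
Variable w : 'M[K]_n.
Hypothesis Nw : normalizer G T w.
Let Gw : G w. Proof. by case: Nw. Qed.
Let uw : w \in unitmx. Proof. exact: Gunit. Qed.
Let wl := normalizer_lie Nw.
Let wiL := normalizer_lie (normalizerV Nw).

Lemma normalizer_root al : is_root al -> is_root (Ad w al).
Proof. by apply: is_root_Ad. Qed.

Lemma normalizer_cartan al be : cartan (Ad w al) (Ad w be) = cartan al be.
Proof. by rewrite /cartan coroot_Ad // rt_Ad. Qed.

(** Both sides give the action of T on the conjugate by w of a root vector. *)
Lemma weyl_actE a : roots a -> weyl_act w a = cr (Ad w (mr a)).
Proof.
move=> ra; have [Lm rm _ mE] := mrP ra; have rw := normalizer_root rm.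
have [rb bE] := crP rw; have [_ _ _ bE'] := mrP rb; rewrite bE in bE'.
have [ca _ [x rx nx]] := ra; have [cb _ _] := rb; have [a0 _ _ _] := ca; have [b0 _ _ _] := cb.
have [_ NE] := normalizerV Nw.
have [_ bx] : root_space G T (cr (Ad w (mr a))) (Ad w x).
  by apply/bE'; apply: rsp_Ad => //; apply/mE.
apply: funext => t; rewrite /weyl_act; have [Tt|nT] := pselect (T t); last first.
  rewrite b0 // a0 // => Tw; apply: nT; rewrite -(AdVK uw t); case: Nw => _ <-.
  by exists (Ad (invmx w) t).
have Tw : T (Ad (invmx w) t) by rewrite -NE; exists t.
have nwx : Ad w x <> 0 by move=> /(congr1 (Ad (invmx w))); rewrite AdK // linear0.
have := bx t Tt; have {1}-> : t = Ad w (Ad (invmx w) t) by rewrite AdVK.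
rewrite Ad_Ad ?(Tu Tw) //; case: rx => _ -> //; rewrite AdZ => /eqP.
by rewrite -subr_eq0 -scalerBl scaler_eq0 subr_eq0 => /orP[/eqP|/eqP].
Qed.

End Weyl.

Lemma root_reflection a b : roots a -> roots b -> exists2 w, normalizer G T w &
  weyl_act w a = cr (srefl (mr b) (mr a)) /\ weyl_act w b = cr (- mr b).
Proof.
move=> ra rb; have [La rma _ _] := mrP ra; have [Lb rmb _ _] := mrP rb.
have [_ _ [e re ne]] := rmb; have [f [rf nf sl2]] := root_sl2 rmb re ne.
have lE := theta_root_lie rmb re rf sl2.
have Nn : normalizer G T (theta e f).
  by apply: norm_torus => //; [apply: (theta_root_G rmb)|apply: (theta_root_lieV rmb re rf sl2)].
exists (theta e f) => //; rewrite !weyl_actE // !(theta_root_refl rmb re rf sl2) //.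
by rewrite -!(sreflE _ rmb) (srefl_self rmb).
Qed.

(** ** Orthogonality *)

Section InnerProduct.
Variable ip : chr K n -> chr K n -> rat.
Hypothesis hip : weyl_inner_product G T ip.

Lemma ip_trivial c : character T c -> ip (trivial_chr T) c = 0.
Proof.
move=> cc; have [_ ipD _ _] := hip; have tc := trivial_chrP.
have E : chr_add (trivial_chr T) (trivial_chr T) = trivial_chr T.
  by apply: funext => t; rewrite /chr_add /trivial_chr; case: ifP; rewrite ?mulr1 ?mulr0.
by have := ipD _ _ _ tc tc cc; rewrite E => /eqP; rewrite -{1}[ip _ _]addr0 (inj_eq (addrI _)) => /eqP.
Qed.

(** The bracket of root vectors for b and its opposite is a nonzero element of the
    torus algebra, on which T acts trivially. *)
Lemma cr_opp b : roots b -> chr_add b (cr (- mr b)) = trivial_chr T.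
Proof.
move=> rb; have [Lb rmb _ bE] := mrP rb; have [rb' bE'] := crP (is_rootN rmb).
have [_ _ _ bE''] := mrP rb'; rewrite bE' in bE''.
have [[b0 _ _ _] _ [x rx nx]] := rb.
have [y ry xy] := root_partner rmb ((bE x).1 rx) nx.
have [Lx bx] := rx; have [Ly b'y] := (bE'' y).2 ry.
have nm := is_root_neq0 rmb.
apply: funext => t; rewrite /chr_add /trivial_chr; case: asboolP => [Tt|nT]; last by rewrite b0 ?mul0r.
have := AdT_fix Tt Lb; rewrite -{1}xy Ad_bracket ?(Tu Tt) // bx // b'y // bracketZl bracketZr scalerA xy.
move=> /eqP; move: (b t * _) => d; rewrite -{2}[mr b]scale1r -subr_eq0 -scalerBl scaler_eq0 subr_eq0.
by case/orP => /eqP.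
Qed.

Lemma ip_opp a b : roots a -> roots b -> ip a (cr (- mr b)) = - ip a b.
Proof.
move=> ra rb; have [ipC ipD _ _] := hip; have [_ rmb _ _] := mrP rb.
have [[cb' _ _] _] := crP (is_rootN rmb).
have [[ca _ _] [cb _ _]] := (ra, rb).
have := ip_trivial ca; rewrite -(cr_opp rb) ipD // => /eqP.
by rewrite addrC addr_eq0 (ipC _ a) // (ipC b a) // => /eqP.
Qed.

Lemma ip_srefl a b : roots a -> roots b -> ip (cr (srefl (mr b) (mr a))) b = - ip a b.
Proof.
move=> ra rb; have [_ _ _ ipW] := hip; have [w Nw [aE bE]] := root_reflection ra rb.
have [_ rma _ _] := mrP ra; have [_ rmb _ _] := mrP rb.
have [rs _] := crP (srefl_root rmb rma); have [[ca _ _] [cb _ _]] := (ra, rb).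
by have := ipW w a b Nw ca cb; rewrite aE bE ip_opp // => <-; rewrite opprK.
Qed.

Lemma chr_iter a b k : character T a -> character T b -> character T (iter k (chr_add b) a) /\
  ip (iter k (chr_add b) a) b = ip a b + k%:R * ip b b.
Proof.
move=> ca cb; have [_ ipD _ _] := hip; elim: k => [|k [ck IH]] /=; first by rewrite mul0r addr0.
have [cS _] := chr_addP cb ck; split=> //.
by rewrite ipD // IH -natr1 mulrDl mul1r addrCA [_ + ip b b]addrC addrA [ip a b + _]addrC -addrA addrCA.
Qed.

(** Invariance under the reflection of b gives 2 ip a b = k ip b b where k is
    the Cartan integer. *)
Lemma ip_cartan a b (k : nat) : roots a -> roots b -> cartan (mr a) (mr b) = k ->
  2 * ip a b = k%:R * ip b b.
Proof.
move=> ra rb kE; have [La rma _ aE] := mrP ra; have [Lb rmb _ bE] := mrP rb.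
have rs := srefl_root rmb rma; have [rc cE] := crP rs; set c := cr _ in rc cE.
have [ca _ [x rx nx]] := ra; have [cb _ [y ry ny]] := rb; have [cc _ [z rz nz]] := rc.
have [_ _ _ cE'] := mrP rc; rewrite cE in cE'.
have [i [j [xij ai]]] := root_wchr uP TP rx nx ca; have [p [q [ypq bi]]] := root_wchr uP TP ry ny cb.
have [l [m [zlm ci]]] := root_wchr uP TP rz nz cc.
have E : a = iter k (chr_add b) c.
  apply: funext => t; have [Tt|nT] := pselect (T t); last first.
    by have [[c0 _ _ _] _] := chr_iter k cc cb; have [a0 _ _ _] := ca; rewrite a0 // c0.
  have -> : iter k (chr_add b) c t = b t ^+ k * c t.
    by elim: (k) => [|k' IH] /=; rewrite ?mul1r // /chr_add IH exprS mulrA.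
  rewrite ai bi ci; transitivity (wchr T P l m t * wchr T P p q t ^ (k%:Z)); last by rewrite -exprnP mulrC.
  apply: (@wchr_rel i j l m p q k t _ Tt) => h Lh.
  rewrite -(rsp_entry ((aE x).1 rx) xij Lh) -(rsp_entry ((bE y).1 ry) ypq Lh).
  rewrite -(rsp_entry ((cE' z).1 rz) zlm Lh) /srefl rtBl rtZl (cartanE rma rmb) kE.
  by rewrite subrK.
have := (chr_iter k cc cb).2; rewrite -E ip_srefl // => H.
by rewrite mulr_natl mulr2n {1}H addrAC addNr add0r.
Qed.

End InnerProduct.
End Characters.


Section BorelFrame.
Variables (B : set 'M[K]_n) (F : borel_frame B).
Local Notation pos := (bf_pos F).
Let PS := bf_sys F.


(** * Injectivity *)
Section Injectivity.
Implicit Types (x y h a b g u : 'M[K]_n) (c : K) (S : seq 'M[K]_n).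
Let hB := bf_borel F.
Let TB := bf_TB F.
Definition bf_h0 := rho_vee pos.

Lemma bf_h0_integral : integral bf_h0. Proof. exact: rho_vee_integral. Qed.

Lemma bf_broot_pos a : broot B a -> pos a.
Proof. by move=> Ba; have [ra _] := Ba; apply/(bf_broot F). Qed.

Lemma bf_posP a : is_root a -> pos a <-> 0 < ival a bf_h0.
Proof. exact: (pos_rhoP PS). Qed.

Lemma bf_unip u : unip bf_h0 u -> B u.
Proof. exact: (unip_borel hB TB PS bf_broot_pos). Qed.

Lemma bf_Ad_torus b h : B b -> Lie T h -> exists2 y, rspan (broot B) y & Ad b h = h + y.
Proof. exact: (borel_Ad_torus hB TB PS bf_broot_pos). Qed.

Lemma gr_mull h d x y e : (forall i j, cc P x i j != 0 -> kk h i - kk h j = e) ->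
  gr h (e + d) (x *m y) = x *m gr h d y.
Proof.
move=> Hx; apply: (cc_inj uP); apply/matrixP => i j; rewrite cc_gr cc_mul // !mxE -sumrMnl.
rewrite cc_mul // mxE; apply: eq_bigr => l _; rewrite cc_gr.
have [->|nx] := eqVneq (cc P x i l) 0; first by rewrite !mul0r mul0rn.
rewrite mulrnAr; congr (_ *+ _); have := Hx _ _ nx; move: (kk h i) (kk h l) (kk h j) => p q s E.
by congr nat_of_bool; apply/eqP/eqP; lia.
Qed.

Lemma gr_mulr h d x y e : (forall i j, cc P x i j != 0 -> kk h i - kk h j = e) ->
  gr h (e + d) (y *m x) = gr h d y *m x.
Proof.
move=> Hx; apply: (cc_inj uP); apply/matrixP => i j; rewrite cc_gr cc_mul // !mxE -sumrMnl.
rewrite cc_mul // mxE; apply: eq_bigr => l _; rewrite cc_gr.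
have [->|nx] := eqVneq (cc P x l j) 0; first by rewrite !mulr0 mul0rn.
rewrite mulrnAl; congr (_ *+ _); have := Hx _ _ nx; move: (kk h i) (kk h l) (kk h j) => p q s E.
by congr nat_of_bool; apply/eqP/eqP; lia.
Qed.

Lemma gr_bracket h d x y e : (forall i j, cc P x i j != 0 -> kk h i - kk h j = e) ->
  gr h (e + d) (bracket x y) = bracket x (gr h d y).
Proof.
move=> Hx; rewrite /bracket -(gr_mull _ _ Hx) -(gr_mulr _ _ Hx).
apply: (cc_inj uP); apply/matrixP => i j; rewrite -!scaleN1r !(cc_gr, ccD, ccZ).
by rewrite mulrnDl !mulN1r mulNrn.
Qed.

Lemma sl2_cent_image e h f k : integral h -> sl2_triple e h f -> nilp e -> nilp f ->
  bracket e (bracket e k) = 0 -> fil h 1 (bracket e k).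
Proof.
move=> ih S ne nf ek0; set m := bracket e k; have M := sl2_module_ad S ne nf.
have [he hf ef] := S; have [Lh _] := ih.
have pure i j : cc P e i j != 0 -> kk h i - kk h j = 2.
  move=> nz; have := liet_bracket e i j Lh; rewrite he ccZ => /(mulIf nz).
  by rewrite !(kkE _ ih) -rmorphB -[2]/(2%:~R) => /intr_eq.
have eg d : bracket e (gr h d m) = 0.
  apply: (@gr_stable [set x | bracket e x = 0]) => //=.
  - by rewrite bracket0r.
  - by move=> c u v u0 v0; rewrite bracketDr bracketZr u0 v0 scaler0 addr0.
  by move=> u u0; rewrite jacobi u0 bracket0r addr0 [bracket e h]bracketC he bracketNl bracketZl u0 scaler0 oppr0.
have g0 d : d <= 0 -> gr h d m = 0.
  rewrite le_eqVlt => /orP[/eqP ->|lt].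
    have E : gr h 0 m = bracket e (gr h (- 2) k) by rewrite -(gr_bracket (- 2) k pure).
    rewrite E; suff -> : gr h (- 2) k = 0 by rewrite bracket0r.
    apply: (@sl2_injE K charK _ _ _ _ M 2 2) => //=; last by rewrite -E.
    by rewrite (bracket_gr _ _ ih) rmorphN scaleNr.
  have [c cE] : exists c : nat, d = - c%:Z by case: d lt => // c _; exists c.+1.
  apply: (@sl2_injE K charK _ _ _ _ M c 1) => //=; last by move: lt; rewrite cE; lia.
  by rewrite (bracket_gr _ _ ih) cE rmorphN scaleNr.
move=> i j nz; rewrite -gtz0_ge1 ltNge; apply/negP => /g0 e0; move/eqP: nz; apply.
by have := congr1 (fun x => cc P x i j) e0; rewrite /= cc_gr eqxx mulr1n cc0 mxE.
Qed.

(** Kostant's argument moves the triple of S to that of S' inside B: the difference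
    of the characteristics is centralized by e' and lies in its image, so it has
    positive degree and can be removed step by step. The product of reflections is
    the torus part of the conjugation by the element theta of the triple, and B
    moves the torus algebra only by positive root vectors; so S and S' have the
    same product. *)
Lemma osum_inj h h' S S' v v' : height2 h -> height2 h' -> orth_roots h S -> orth_roots h' S' ->
  root_family S v -> root_family S' v' ->
  (exists2 b, B b & Ad b (osum S v) = osum S' v') -> S =i S'.
Proof.
move=> hh hh' oS oS' Hv Hv' [b Bb bE].
have ex S0 w h1 : orth_roots h1 S0 -> root_family S0 w -> exists f : 'M[K]_n -> 'M[K]_n,
    forall a, a \in S0 -> [/\ rsp a (w a), rsp (- a) (f a) & sl2_triple (w a) (coroot a) (f a)].
  move=> [_ r0 _] H; have : forall a, exists fa, a \in S0 -> [/\ rsp a (w a), rsp (- a) fa & sl2_triple (w a) (coroot a) fa].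
    move=> a; have [aS|_] := boolP (a \in S0); last by exists 0.
    have [ra _] := r0 a aS; have [rw nw] := H a aS.
    by have [f [rf _ Sf]] := root_sl2 ra rw nw; exists f.
  by move=> H2; have [f Hf] := choice H2; exists f => a aS; exact: Hf.
have [f Hf] := ex S v h oS Hv; have [f' Hf'] := ex S' v' h' oS' Hv'.
set e := osum S v in bE; set e' := osum S' v' in bE.
have tS := osum_triple hh oS Hf; have tS' := osum_triple hh' oS' Hf'.
have ne' := osum_nilp hh' oS' Hf'; have nf' := osum_nilpF hh' oS' Hf'.
have M' := osum_module hh' oS' Hf'.
have iE := eta_integral oS; have iE' := eta_integral oS'; have Le := eta_lie oS; have Le' := eta_lie oS'.
have [he hf ef] := tS; have [he' hf' ef'] := tS'.
pose Q b := B b /\ Ad b e = e'.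
pose c := [set x | [/\ Lie B x, bracket e' x = 0 & fil (eta S') 1 x]].
have BU g : B g -> g \in unitmx := @borel_unit _ hB g.
have [||||||||b' [Bb' b'e] b'eta] := @unip_normalize (eta S') Q c (eta S) iE' _ _ _ _ _ _ _ b.
- by move=> g [/BU].
- by split; [apply: lie0|rewrite bracket0r|apply: fil0].
- move=> s x y [Lx x0 Fx] [Ly y0 Fy]; split; [exact: lie_linear| |exact: fil_linear].
  by rewrite bracketDr bracketZr x0 y0 scaler0 addr0.
- move=> x [Lx x0 Fx]; split; first by apply: (lieB_bracket hB) => //; apply: (lieT_B TB).
    by rewrite jacobi x0 bracket0r addr0 [bracket e' _]bracketC he' bracketNl bracketZl x0 scaler0 oppr0.
  by rewrite -[1]add0r; apply: fil_bracket => //; apply: fil_torus.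
- by move=> x [].
- move=> g [Bg ge]; have ug := BU _ Bg.
  have E : Ad g (eta S) - eta S' = bracket e' (Ad g (osum S f) - osum S' f').
    by rewrite bracketBr -{1}ge -Ad_bracket // ef ef'.
  have E0 : bracket e' (Ad g (eta S) - eta S') = 0.
    rewrite bracketBr -{1}ge -Ad_bracket // [bracket e _]bracketC he [bracket e' _]bracketC he'.
    by rewrite AdN AdZ ge subrr.
  split=> //; first by apply: lie_sub; [apply: (lieB_Ad hB) => //|]; apply: (lieT_B TB).
  by rewrite E; apply: sl2_cent_image iE' tS' ne' nf' _; rewrite -E.
- move=> y g [Ly y0 Fy] [Bg ge]; have ny : nilp y by apply: (@fil_nilp (eta S')).
  split; first by apply: (borelM hB) => //; apply: (borel_expm hB).
  rewrite AdM ?expm_unit //; last exact: BU.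
  by rewrite ge (Ad_exp_fix ny) // bracketC y0 oppr0.
- by [].
have ub' := BU _ Bb'.
have etaE : eta S = eta S'.
  have [y ry yE] := bf_Ad_torus Bb' Le.
  by apply/esym; apply: liet_rspan_eq ry _ => //; rewrite -b'eta yE.
have b'f : Ad b' (osum S f) = osum S' f'.
  apply: subr0_eq; apply: (@sl2_injE K charK _ _ _ _ M' 2 1) => //=.
    rewrite bracketBr hf' -{1}b'eta -Ad_bracket // hf AdN AdZ.
    by rewrite scalerBr !scaleNr.
  by rewrite bracketBr -{1}/e' -{1}b'e -Ad_bracket // ef b'eta ef' subrr.
have ne := osum_nilp hh oS Hf; have nf := osum_nilpF hh oS Hf.
have refl x : Lie T x -> orefl S x = orefl S' x.
  move=> Lx; have [y ry yE] := bf_Ad_torus Bb' Lx.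
  have [z rz zE] := bf_Ad_torus Bb' (orefl_lie oS Lx).
  have thE : Ad b' (theta e (osum S f)) = theta e' (osum S' f').
    by rewrite (Ad_theta_conj ub' ne nf) b'e b'f.
  have E : Ad (theta e' (osum S' f')) (Ad b' x) = Ad b' (Ad (theta e (osum S f)) x).
    have ut := theta_unit charK ne nf.
    by rewrite -thE (Ad_Ad _ ub' ut).
  move: E; rewrite yE AdD (otheta_refl hh' oS' Hf' Lx) (otheta_refl hh oS Hf Lx) zE => E.
  rewrite (liet_diag (orefl_lie oS Lx)) (liet_diag (orefl_lie oS' Lx)); congr dg; apply/rowP => j.
  have := congr1 (fun x => cc P x j j) E; rewrite /= (ccD _ (orefl S' x)) (ccD _ (orefl S x)) (otheta_diag hh' oS' Hf' j ry) (rspan_diag j rz) !addr0.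
  by rewrite !mxE => ->.
have h2 := eta_height2 hh oS Hf.
move=> a; apply/idP/idP; first exact: (orefl_inj hh hh' oS oS' h2 etaE refl).
apply: (orefl_inj hh' hh oS' oS) => //; first by rewrite -etaE.
by move=> x Lx; rewrite refl.
Qed.
End Injectivity.


(** * Degree two elements are conjugate to sums over orthogonal roots *)
Section DegreeTwo.
Implicit Types (x y z h a b g u : 'M[K]_n) (c : K) (S : seq 'M[K]_n).
Local Notation h0 := bf_h0.
Let ih0 : integral h0. Proof. exact: bf_h0_integral. Qed.

Lemma ht_neq0 a : is_root a -> ival a h0 <> 0.
Proof. by move=> ra; apply: (rho_neq0 (bf_sys F)). Qed.

Lemma Ad_expm_mod (W : 'M[K]_n -> Prop) y w : nilp y -> W 0 ->
  (forall c u v, W u -> W v -> W (c *: u + v)) -> (forall u, W u -> W (bracket y u)) ->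
  W (bracket y (bracket y w)) -> W (Ad (expm y) w - (w + bracket y w)).
Proof.
move=> ny W0 WL Wy W2; have [N HN] := ad_nilp ny.
have HN2 : iter N.+2 (bracket y) w = 0 by rewrite !iterS HN !bracket0r.
rewrite (Ad_expm_ad charK ny HN2) 2!big_ord_recl /= !fact0 invr1 !scale1r addrA.
rewrite [_ + _ + _ - _]addrC addrA addNr add0r.
apply: (big_ind W) => // [u v Wu Wv|k _]; first by rewrite -[u]scale1r; apply: WL.
rewrite -[_ *: _]addr0; apply: WL => //=.
by elim: (k : nat) => [|m IH] //=; apply: Wy.
Qed.

Lemma cartan_le2 h a b : height2 h -> is_root a -> is_root b -> ival a h = 2 -> ival b h = 2 -> cartan a b <= 2.
Proof.
move=> hh ra rb ah bh; rewrite leNgt; apply/negP => lt; have [ih _] := hh.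
have rNb := is_rootN rb.
have val : rt (a + 3%:R *: - b) h = - 4.
  by rewrite rtDl rtZl rtNl (ivalE ra ih) (ivalE rb ih) ah bh; ring.
have r3 : is_root (a + 3%:R *: - b).
  apply: root_string => //; first by rewrite cartanNr // opprK.
  move=> E; move: val; rewrite E rt0l => /esym/eqP; rewrite oppr_eq0.
  by rewrite (negPf (natr0 3)).
have := height2_ge hh r3; suff -> : ival (a + 3%:R *: - b) h = - 4 by [].
by apply: intr_eq; rewrite -(ivalE r3 ih) val rmorphN.
Qed.

Section Clear.
Variables (h : 'M[K]_n) (S : seq 'M[K]_n) (v : 'M[K]_n -> 'M[K]_n) (b : 'M[K]_n) (vb : 'M[K]_n).
Hypotheses (hh : height2 h) (oS : orth_roots h S).
Hypothesis rv : forall a, a \in S -> rsp a (v a).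
Definition Qorth S a := ival a h = 2 /\ forall s, s \in S -> cartan a s = 0.
Hypotheses (rb : is_root b) (Qb : Qorth S b) (rvb : rsp b vb) (nvb : vb <> 0).

Let ih : integral h. Proof. by case: hh. Qed.
Let QN (N : nat) a := [/\ Qorth S a, a <> b, ival b h0 <= ival a h0 &
  cartan a b = 0 \/ ival b h0 + N%:Z <= ival a h0].
Let Qz (N : nat) a := [/\ Qorth S a, a <> b, cartan a b <> 0 & ival a h0 = ival b h0 + N%:Z].
Let Qy (N : nat) g := exists a, [/\ is_root a, Qz N a & g = a - b].

Let Qy_val N g : is_root g -> Qy N g -> ival g h0 = N%:Z /\ (0 < N)%N.
Proof.
move=> rg [a [ra [_ _ _ aN] gE]]; have E : ival g h0 = N%:Z.
  apply: intr_eq; rewrite -(ivalE rg ih0) gE rtBl (ivalE ra ih0) (ivalE rb ih0) aN.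
  by rewrite rmorphD /= addrAC subrr add0r.
by split=> //; have := ht_neq0 rg; rewrite E; case: (N).
Qed.

Let pos_cartan N a : is_root a -> Qz N a -> 0 < cartan a b.
Proof.
move=> ra [[ah _] _ /eqP c0 _]; rewrite lt_neqAle eq_sym c0 /=.
by apply: (height2_cartan hh ra rb) => //; case: Qb.
Qed.

Let clear_elt N z : rspan (Qz N) z -> exists y, [/\ rspan (Qy N) y, bracket y (osum S v) = 0 & bracket y vb = z].
Proof.
have [f [rf nf [he hf ef]]] := root_sl2 rb rvb nvb; have [bh bS] := Qb.
apply: (rspan_elim (V := fun z => exists y, [/\ rspan (Qy N) y, bracket y (osum S v) = 0 & bracket y vb = z])).
- by exists 0; rewrite !bracket0l; split=> //; apply: rspan0.
- move=> c z1 z2 [y1 [r1 o1 e1]] [y2 [r2 o2 e2]]; exists (c *: y1 + y2).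
  by rewrite !bracketDl !bracketZl o1 o2 e1 e2 scaler0 addr0; split=> //; apply: rspan_linear.
move=> a x ra Qa rx; have [[ah aS] ab c0 aN] := Qa; have pc := pos_cartan ra Qa.
have rab : is_root (a - b) by apply: root_sub.
have [nz nr] := height2_sum hh ra rb ah bh.
have xv : bracket x vb = 0 by exact: (bracket_nonroot ra rb rx rvb nz nr).
have nc : ((cartan a b)%:~R : K) != 0 by rewrite (intr_eq0K charK); apply/eqP.
exists ((cartan a b)%:~R^-1 *: bracket x f); split.
- apply: (rspan_rsp rab); first by exists a.
  by apply: rspZ; apply: rsp_bracket.
- rewrite bracketZl; apply/eqP; rewrite scaler_eq0; apply/orP; right; apply/eqP.
  rewrite /osum bracket_sumr big_seq big1 // => s sS; have [_ rS cS] := oS; have [rs sh] := rS s sS.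
  have := jacobi x f (v s); have [nz1 nr1] := height2_sum hh ra rs ah sh.
  rewrite (bracket_nonroot ra rs rx (rv sS) nz1 nr1) bracket0r addr0 => <-.
  have sb : s <> b by move=> sb; have := bS s sS; rewrite -sb cartanaa.
  have csb : cartan s b = 0 by apply/eqP; rewrite cartan_eq0 // bS.
  rewrite bracketC (bracket_nonroot (is_rootN rb) rs rf (rv sS)) ?oppr0 ?bracket0l ?oppr0 //.
    by rewrite addrC => /eqP; rewrite subr_eq0 => /eqP.
  by rewrite addrC; apply: (strongly_orth hh rs rb sh bh sb csb).
rewrite bracketZl; have := jacobi x f vb; rewrite xv bracket0r addr0 => <-.
rewrite (bracketC f) ef bracketNr -bracketC; have [_ ->] := rx; last exact: (coroot_lie rb).
by rewrite (cartanE ra rb) scalerA mulVf // scale1r.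
Qed.

Let QyN N g a : is_root g -> is_root a -> Qy N g -> QN N a -> g + a <> 0 /\ (is_root (g + a) -> QN N.+1 (g + a)).
Proof.
move=> rg ra Qg [[ah aS] ab ba Ha]; have [gN N0] := Qy_val rg Qg; have [bh bS] := Qb.
have [d [rd [[dh dS] db dc dN] gE]] := Qg.
have gh : ival g h = 0.
  by apply: intr_eq; rewrite -(ivalE rg ih) gE rtBl (ivalE rd ih) (ivalE rb ih) dh bh subrr.
split=> [ga|rga].
  have aE : a = - g by apply/eqP; rewrite -addr_eq0 addrC ga.
  by move: ah; rewrite aE (ivalN rg ih) gh.
have gah : ival (g + a) h = 2 by rewrite (ivalDl rg ra rga ih) gh ah.
have ga0 : ival (g + a) h0 = N%:Z + ival a h0 by rewrite (ivalDl rg ra rga ih0) gN.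
have gc s : is_root s -> cartan g s = cartan d s - cartan b s.
  move=> rs; have rg' := rg; rewrite gE in rg'.
  by rewrite gE (cartanD rd (is_rootN rb) rg' rs) cartanNl.
split.
- split=> // s sS; have [_ rS _] := oS; have [rs _] := rS s sS.
  by rewrite (cartanD rg ra rga rs) gc // dS // bS // aS.
- by move=> E; move: ga0; rewrite E; lia.
- by rewrite ga0; lia.
have [lt|ge] := ltP (ival b h0) (ival a h0); first by right; rewrite ga0; lia.
left; have cab : cartan a b = 0.
  case: Ha => [//|le]; lia.
have c2 := cartan_le2 hh rd rb dh bh; have := height2_cartan hh rga rb gah bh.
rewrite (cartanD rg ra rga rb) gc // cab (cartanaa rb); lia.
Qed.

Let clear_step N z : rspan (QN N) z -> exists u z', [/\ unip h0 u, rspan (QN N.+1) z' &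
  Ad u (osum S v + vb + z) = osum S v + vb + z'].
Proof.
move=> Hz; have [z1 [z2 [zE H1 H2]]] := rspan_split (fun a => cartan a b <> 0 /\ ival a h0 = ival b h0 + N%:Z) Hz.
have Hz1 : rspan (Qz N) z1 by apply: rspanS H1 => a _ [[Qa ab _ _] [c0 aN]].
have Hz1N : rspan (QN N) z1 by apply: rspanS H1 => a _ [].
have Hz2 : rspan (QN N.+1) z2.
  apply: rspanS H2 => a _ [[Qa ab ba Ha] nS]; split=> //.
  have [c0|/eqP c0] := eqVneq (cartan a b) 0; first by left.
  case: Ha => [//|Ha]; right; have : ival a h0 <> ival b h0 + N%:Z by move=> E; apply: nS.
  lia.
have [|y [ry yS yb]] := @clear_elt N (- z1); first by rewrite -scaleN1r; apply: rspanZ.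
have ny : nil_alg h0 y.
  apply: (rspan_nil_alg ih0); apply: rspanS ry => g rg Qg.
  by have [-> N0] := Qy_val rg Qg.
have nily : nilp y by case: ny => _; apply: fil_nilp.
pose W := rspan (QN N.+1).
have Wy u : rspan (QN N) u -> W (bracket y u).
  by apply: rspan_bracket ry => g a rg ra; apply: QyN.
have NS u : W u -> rspan (QN N) u.
  apply: rspanS => a _ [Qa ab ba Ha]; split=> //; case: Ha => [|Ha]; [by left|right; lia].
have WyW u : W u -> W (bracket y u) by move/NS/Wy.
have W0 : W 0 by apply: rspan0.
have WL c u w : W u -> W w -> W (c *: u + w) by apply: rspan_linear.
have A1 : Ad (expm y) (osum S v) = osum S v by apply: Ad_expm_fix.
have A2 := @Ad_expm_mod W y vb nily W0 WL WyW.
have A3 := @Ad_expm_mod W y z nily W0 WL WyW (WyW _ (Wy _ Hz)).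
set r2 := Ad (expm y) vb - (vb + bracket y vb) in A2.
set r3 := Ad (expm y) z - (z + bracket y z) in A3.
exists (expm y), (r2 + r3 + bracket y z + z2); split; first exact: unip_expm.
  apply: rspanD => //; apply: rspanD; last exact: Wy.
  apply: rspanD => //; apply: A2; rewrite yb -scaleN1r bracketZr; apply: rspanZ; exact: Wy.
rewrite !AdD A1 -(subrK (vb + bracket y vb) (Ad (expm y) vb)) -(subrK (z + bracket y z) (Ad (expm y) z)).
rewrite -/r2 -/r3 yb; move: (bracket y z) => w; rewrite {1}zE; move: (osum S v) => w'.
by apply/matrixP => i j; rewrite !mxE; ring.
Qed.

(** Clearing degree by degree for h0: roots a not orthogonal to b give positive
    roots a - b, by which the component in a is absorbed. *)
Lemma clear_root z : rspan (fun a => [/\ Qorth S a, a <> b & ival b h0 <= ival a h0]) z ->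
  exists u z', [/\ unip h0 u, rspan (fun a => [/\ Qorth S a, a <> b & cartan a b = 0]) z' &
  Ad u (osum S v + vb + z) = osum S v + vb + z'].
Proof.
move=> Hz; have H N : exists u z', [/\ unip h0 u, rspan (QN N) z' & Ad u (osum S v + vb + z) = osum S v + vb + z'].
  elim: N => [|N [u [z' [Uu Hz' E]]]].
    exists 1%:M, z; rewrite Ad1; split=> //; first exact: unip1.
    by apply: rspanS Hz => a _ [Qa ab ba]; split=> //; right; rewrite addr0.
  have [u' [z'' [Uu' Hz'' E']]] := clear_step Hz'; exists (u' *m u), z''; split=> //; first exact: unipM.
  by rewrite AdM ?E // ; [case: Uu' => + _|case: Uu => + _]; apply: Gunit.
have [M HM] := fil_bound h0.
have [N leN] : exists N : nat, M%:Z <= ival b h0 + N%:Z by exists (M + `|ival b h0|)%N; lia.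
have [u [z' [Uu Hz' E]]] := H N; exists u, z'; split=> //.
apply: rspanS Hz' => a ra [Qa ab _ [c0|le]]; first by split.
have [_ _ [x rx nx]] := ra; case: nx; apply: HM; apply: fil_le (fil_rsp ra ih0 rx).
exact: le_trans le.
Qed.

End Clear.

Lemma rspan_single b x : is_root b -> rspan (fun a => a = b) x -> rsp b x.
Proof.
move=> rb; apply: rspan_elim; first exact: rsp0v.
  by move=> c u v; apply: rsp_linear.
by move=> a v _ ->.
Qed.

Lemma rspan_empty Q x : (forall a, is_root a -> ~ Q a) -> rspan Q x -> x = 0.
Proof.
move=> no; apply: (rspan_elim (V := fun x => x = 0)) => // [c u v -> ->|a v ra /(no a ra) //].
by rewrite scaler0 addr0.
Qed.

(** Peeling off the lowest root of the support and clearing the roots not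
    orthogonal to it. *)
Lemma degree2_orth_aux h S v z : height2 h -> orth_roots h S ->
  root_family S v -> rspan (Qorth h S) z ->
  exists S' v' u, [/\ orth_roots h S', root_family S' v',
    unip h0 u & Ad u (osum S v + z) = osum S' v'].
Proof.
move=> hh; move: {2}(count _ _) (leqnn (count (fun a => `[< Qorth h S a >]) root_seq)) => m.
elim: m S v z => [|m IH] S v z le oS Hv Hz.
  have z0 : z = 0.
    apply: rspan_empty Hz => a ra Qa; move: le; rewrite leqn0 => /eqP c0.
    have : has (fun a => `[< Qorth h S a >]) root_seq.
      by apply/hasP; exists a; [apply/mem_root_seq|apply/asboolP].
    by rewrite has_count c0.
  by exists S, v, 1%:M; rewrite z0 addr0 Ad1; split=> //; apply: unip1.
pose L0 := sort (fun a b => ival a h0 <= ival b h0) root_seq.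
have sL0 : sorted (fun a b => ival a h0 <= ival b h0) L0.
  by apply: sort_sorted => a b; apply: le_total.
have HL0 : rspan (fun a => Qorth h S a /\ a \in L0) z.
  by apply: rspanS Hz => a ra Qa; split=> //; rewrite mem_sort; apply/mem_root_seq.
have rL0 a : a \in L0 -> is_root a by rewrite mem_sort => /mem_root_seq.
elim: L0 sL0 HL0 rL0 => [|b L IHL] sL HL rL.
  have z0 : z = 0 by apply: rspan_empty HL => a _ [].
  by exists S, v, 1%:M; rewrite z0 addr0 Ad1; split=> //; apply: unip1.
have [zb [z' [zE Hzb Hz']]] := rspan_split (fun a => a = b) HL.
have rb : is_root b by apply: rL; rewrite mem_head.
have rzb : rsp b zb by apply: rspan_single => //; apply: rspanS Hzb => a _ [].
have [zb0|nzb] := pselect (zb = 0).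
  apply: IHL; first exact: path_sorted sL.
    rewrite zE zb0 add0r; apply: rspanS Hz' => a _ [[Qa aL] ab]; split=> //.
    by move: aL; rewrite inE => /orP[/eqP|].
  by move=> a aL; apply: rL; rewrite inE aL orbT.
have Qb : Qorth h S b.
  apply: contrapT => nQ; apply: nzb; apply: rspan_empty Hzb => a _ [[Qa _] ab].
  by apply: nQ; rewrite -ab.
have [|u [z'' [Uu Hz'' E]]] := @clear_root h S v b zb hh oS (fun a aS => (Hv a aS).1) rb Qb rzb nzb z'.
  apply: rspanS Hz' => a _ [[Qa aL] ab]; split=> //; move: aL; rewrite inE => /orP[/eqP //|aL].
  have tr : transitive (fun a b : 'M[K]_n => ival a h0 <= ival b h0) by move=> ? ? ?; apply: le_trans.
  by have /allP := order_path_min tr sL; apply.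
have nbS : b \notin S by apply/negP => bS; have [_ H] := Qb; have := H b bS; rewrite (cartanaa rb).
pose v1 a := if a == b then zb else v a.
have oS1 : orth_roots h (b :: S).
  have [uS rS cS] := oS; have [bh bS] := Qb; split=> [|a|a d]; first by rewrite /= nbS.
    by rewrite inE => /orP[/eqP ->|/rS].
  rewrite !inE => /orP[/eqP ->|aS] /orP[/eqP ->|dS] //; [by move=> _; apply: bS| |exact: cS].
  by move=> _; apply/eqP; rewrite cartan_eq0 ?bS //; case: (rS a aS).
have Hv1 a : a \in b :: S -> rsp a (v1 a) /\ v1 a <> 0.
  rewrite inE /v1; case: eqP => [->|_] //=; exact: Hv.
have sumE : osum (b :: S) v1 = osum S v + zb.
  rewrite /osum big_cons /v1 eqxx addrC; congr (_ + _); apply: eq_big_seq => a aS.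
  by case: eqP => // ab; move: nbS; rewrite -ab aS.
have Hz1 : rspan (Qorth h (b :: S)) z''.
  apply: rspanS Hz'' => a _ [[ah aS] _ ab]; split=> // s.
  by rewrite inE => /orP[/eqP->|/aS].
have [|S' [v' [u' [oS' Hv' Uu' E']]]] := IH (b :: S) v1 z'' _ oS1 Hv1 Hz1.
  rewrite -ltnS; apply: leq_trans le; apply: (@count_lt _ _ _ b).
  - by move=> a _ /asboolP [ah aS]; apply/asboolP; split=> // s sS; apply: aS; rewrite inE sS orbT.
  - exact/mem_root_seq.
  - exact/asboolP.
  by apply/negP => /asboolP [_ /(_ b (mem_head _ _))]; rewrite (cartanaa rb).
exists S', v', (u' *m u); split=> //; first exact: unipM.
rewrite AdM; [|by case: Uu' => + _; apply: Gunit|by case: Uu => + _; apply: Gunit].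
by rewrite zE addrA E -sumE.
Qed.

Lemma degree2_orth h z : height2 h -> rspan (fun a => ival a h = 2) z ->
  exists S v u, [/\ orth_roots h S, root_family S v,
    unip h0 u & z = Ad u (osum S v)].
Proof.
move=> hh Hz; have [|||S [v [u [oS Hv Uu E]]]] := @degree2_orth_aux h [::] (fun=> 0) z hh.
- by split=> // a; rewrite in_nil.
- by [].
- by apply: rspanS Hz => a _ ah; split=> // s; rewrite in_nil.
exists S, v, (invmx u); split=> //; first exact: unipV.
have uu : u \in unitmx by case: Uu => + _; apply: Gunit.
by rewrite -E /osum big_nil add0r AdK.
Qed.
End DegreeTwo.


(** * Simple reflections *)
Section SimpleReflection.
Implicit Types (x y z h b g u : 'M[K]_n) (c : K) (S : seq 'M[K]_n).
Local Notation h0 := bf_h0.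
Local Notation U := (unip bf_h0).
Let ih0 : integral h0. Proof. exact: bf_h0_integral. Qed.

Lemma Ad_unip_unit u : U u -> u \in unitmx. Proof. by case=> Gu _; apply: Gunit. Qed.

Lemma AdM3 x y t g z : y \in unitmx -> t \in unitmx -> g \in unitmx -> z \in unitmx ->
  Ad (y *m (t *m g) *m z) x = Ad y (Ad t (Ad g (Ad z x))).
Proof. by move=> uy ut ug uz; rewrite !AdM ?unitmx_mul ?uy ?ut. Qed.

Variable Hs : 'M[K]_n -> Prop.
Hypotheses (Hs2 : forall h, Hs h -> height2 h) (Hs_refl : forall h a, Hs h -> is_root a -> Hs (srefl a h)).

(** The U-orbits through the pieces of degree 2; each of them contains a sum of
    orthogonal root vectors. *)
Definition ort_set : set 'M[K]_n :=
  [set x | exists h z u, [/\ Hs h, deg2 h z, U u & x = Ad u z]].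

Lemma ort_set_deg2 h z : Hs h -> deg2 h z -> ort_set z.
Proof. by move=> Hh dz; exists h, z, 1%:M; rewrite Ad1; split=> //; apply: unip1. Qed.

Lemma ort_set_U u x : U u -> ort_set x -> ort_set (Ad u x).
Proof.
move=> Uu [h [z [u' [Hh dz Uu' ->]]]]; exists h, z, (u *m u'); split=> //; first exact: unipM.
by rewrite AdM //; apply: Ad_unip_unit.
Qed.

Lemma ort_set_T t x : T t -> ort_set x -> ort_set (Ad t x).
Proof.
move=> Tt [h [z [u [Hh dz Uu ->]]]]; have ut := Tunit Tt; have uu := Ad_unip_unit Uu.
have [[Lh _] _] := Hs2 Hh; rewrite -(Ad_Ad _ ut uu); apply: ort_set_U.
  by apply: unip_conj => //; [apply: frame_TG|apply: Ad_fix_comm => //; apply: AdT_fix => //; case: ih0].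
by apply: (ort_set_deg2 Hh); rewrite -(AdT_fix Tt Lh); apply: deg2_Ad => //; apply: frame_TG.
Qed.

Section Simple.
Variables (a e f : 'M[K]_n).
Hypotheses (sa : simple pos a) (re : rsp a e) (ne : e <> 0) (rf : rsp (- a) f) (sl2 : sl2_triple e (coroot a) f).
Let ra : is_root a. Proof. by have [[+ _ _] _] := PS; apply; case: sa. Qed.
Let rNa : is_root (- a). Proof. exact: is_rootN. Qed.
Let ee := root_nilpE ra re.
Let ff := root_nilpF ra rf.
Local Notation nn := (theta e f).
Let Gn : G nn. Proof. exact: (theta_root_G ra re rf). Qed.
Let un : nn \in unitmx. Proof. exact: (Gunit Gn). Qed.
Let h1 := h0 + srefl a h0.
Let ih1 : integral h1. Proof. by apply: integralD => //; apply: srefl_integral. Qed.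
Let Lh1 : Lie T h1. Proof. by case: ih1. Qed.
Local Notation V := (unip h1).

Let ah1 : rt a h1 = 0.
Proof. by rewrite rtDr -{2}(srefl_invol a ra) srefl_rt // srefl_self // rtNl addrN. Qed.

Let Adn_t x : Lie T x -> Ad nn x = srefl a x.
Proof. by move=> Lx; rewrite (theta_root_refl ra re rf sl2 Lx) (sreflE _ ra). Qed.

Let nn_lie := theta_root_lie ra re rf sl2.
Let nn_lieV := theta_root_lieV ra re rf sl2.

Let fixE c : Ad (expm (c *: e)) h1 = h1.
Proof.
apply: (Ad_exp_fix (nilpZ c ee)); rewrite bracketZl bracketC; have [_ ->] := re; last by [].
by rewrite ah1 scale0r oppr0 scaler0.
Qed.
Let fixF c : Ad (expm (c *: f)) h1 = h1.
Proof.
apply: (Ad_exp_fix (nilpZ c ff)); rewrite bracketZl bracketC; have [_ ->] := rf; last by [].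
by rewrite rtNl ah1 oppr0 scale0r oppr0 scaler0.
Qed.
Let fixn : Ad nn h1 = h1.
Proof. by rewrite (theta_root_refl ra re rf sl2 Lh1) ah1 scale0r subr0. Qed.

Let GE c : G (expm (c *: e)).
Proof. by apply: expmG; [apply: lieZ; case: re|apply: nilpZ]. Qed.
Let GF c : G (expm (c *: f)).
Proof. by apply: expmG; [apply: lieZ; case: rf|apply: nilpZ]. Qed.

(** V is the unipotent radical of the minimal parabolic subgroup of a. *)
Lemma radical_conj g r : G g -> Ad g h1 = h1 -> V r -> V (Ad g r).
Proof. by move=> Gg gh; apply: unip_conj => //; apply: Ad_fix_comm => //; apply: Gunit. Qed.

Lemma radical_U r : V r -> U r.
Proof.
move=> /unip_log [y Hy ->]; apply: unip_expm; apply: (rspan_nil_alg ih0).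
apply: rspanS (nil_alg_rspan ih1 Hy) => b rb b1; apply/(bf_posP rb).
have [_ tot] := PS; have [//|nb] := tot b rb; have rNb := is_rootN rb.
have [ba|nba] := eqVneq (- b) a.
  have : ival b h1 = 0 by apply: intr_eq; rewrite -(ivalE rb ih1) -[b]opprK ba rtNl ah1 oppr0.
  by move=> E; rewrite E in b1.
have := simple_pos_rho PS sa nb (elimN eqP nba).
by rewrite -/bf_h0 -/h1 (ivalN rb ih1); lia.
Qed.

Lemma expE_U c : U (expm (c *: e)).
Proof.
apply: unip_expm; apply: (rspan_nil_alg ih0); apply: (rspan_rsp ra); last exact: rspZ.
by apply/(bf_posP ra); case: sa.
Qed.

(** The quotient of U by the radical V is the root group of a. *)
Lemma unip_factor u : U u -> exists r c, V r /\ u = r *m expm (c *: e).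
Proof.
move=> /unip_log [y Hy ->]; have ny : nilp y by case: Hy => _; apply: fil_nilp.
have [y0 [y1 [yE H0 H1]]] := rspan_split (fun b => b = a) (nil_alg_rspan ih0 Hy).
have r0 : rsp a y0 by apply: rspan_single => //; apply: rspanS H0 => b _ [].
have [c cE] := rsp_dim1 ra re ne r0.
exists (expm y *m expm (- (c *: e))), c; split; last first.
  have := expmNK charK (nilpN (nilpZ c ee)); rewrite opprK => E.
  by rewrite -mulmxA E mulmx1.
have F1 : fil h1 1 y1.
  apply: rspan_fil H1 => // b rb [b0 nb]; have pb : pos b by apply/(bf_posP rb).
  by have := simple_pos_rho PS sa pb nb; rewrite -/bf_h0 -/h1; lia.
have F0 : fil h1 0 (c *: e).
  apply: filZ; have <- : ival a h1 = 0 by apply: intr_eq; rewrite -(ivalE ra ih1) ah1.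
  exact: fil_rsp.
apply: unip_comm_expm => //; [exact: nilpZ| | |by case: Hy|by apply: lieZ; case: re].
  by rewrite yE cE; apply: filD => //; apply: fil_le F1.
by rewrite yE cE addrAC subrr add0r.
Qed.

(** The Bruhat decomposition in the rank one group. *)
Lemma bruhatF c : c != 0 -> exists2 t, T t &
  expm (c *: f) = expm (c^-1 *: e) *m (t *m nn) *m expm (c^-1 *: e).
Proof.
move=> nc; have nc' : - c^-1 != 0 by rewrite oppr_eq0 invr_eq0.
have [t Tt tE] := theta_scale ra re rf sl2 nc'.
exists t => //; rewrite -tE; have := @expm_theta K charK n (- c^-1 *: e) ((- c^-1)^-1 *: f) (nilpZ _ ee) (nilpZ _ ff).
by rewrite invrN invrK !scaleNr !opprK.
Qed.

Let ue c : expm (c *: e) \in unitmx. Proof. exact: (Gunit (GE c)). Qed.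
Let uf c : expm (c *: f) \in unitmx. Proof. exact: (Gunit (GF c)). Qed.

(** If the degree of a is nonnegative then expm(e) preserves g(2); otherwise
    expm(f) fixes g(2) pointwise, and the Bruhat decomposition applies. *)
Lemma ort_set_n x : ort_set x -> ort_set (Ad nn x).
Proof.
move=> [h [z [u [Hh dz Uu ->]]]]; have hh := Hs2 Hh; have [ih _] := hh; have [Lh _] := ih.
have [r [c [Vr ->]]] := unip_factor Uu; have ur := Ad_unip_unit (radical_U Vr).
rewrite AdM // -(Ad_Ad _ un ur); apply: ort_set_U; first by apply: radical_U; apply: radical_conj.
have [ge|lt] := leP 0 (ival a h).
  apply: (ort_set_deg2 (Hs_refl Hh ra)); rewrite -Adn_t //; apply: deg2_Ad => //.
  apply: (deg2_expm hh) => //; first exact: nilpZ.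
  by apply: (rspan_rsp ra ge); apply: rspZ.
have fz d : Ad (expm (d *: f)) z = z.
  apply: (Ad_exp_fix (nilpZ d ff)); rewrite bracketZl (deg2_bracket0 hh rNa rf) ?scaler0 //.
  by rewrite (ivalN ra ih); lia.
have [c0|nc] := eqVneq c 0.
  rewrite c0 scale0r expm0 Ad1; apply: (ort_set_deg2 (Hs_refl Hh ra)); rewrite -Adn_t //.
  exact: deg2_Ad.
have [t Tt tE] := bruhatF (invr_neq0 nc); have ut := Tunit Tt.
have := fz c^-1; rewrite tE invrK AdM3 // => E.
have -> : Ad nn (Ad (expm (c *: e)) z) = Ad (invmx t) (Ad (expm (- c *: e)) z).
  by rewrite -{2}E scaleNr -(invmx_exp (nilpZ c ee)) AdK // AdK.
apply: ort_set_T; first exact: TV.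
by apply: ort_set_U; [exact: expE_U|exact: ort_set_deg2 dz].
Qed.

Section MinimalParabolic.
Variable Y : set 'M[K]_n.
Hypotheses (cY : zclosed Y) (YT : forall t x, T t -> Y x -> Y (Ad t x)).
Hypothesis YU : forall u x, U u -> Y x -> Y (Ad u x).

(** The saturation of Y under the minimal parabolic subgroup of a. *)
Definition par_sat := [set x | (exists c, Y (Ad (expm (c *: f)) x)) \/ Y (Ad nn x)].

Let YTE t x : T t -> Y (Ad t x) <-> Y x.
Proof.
move=> Tt; split; last exact: YT.
by move=> /(YT (TV Tt)); rewrite AdK // Tunit.
Qed.

Let YUE u x : U u -> Y (Ad u x) <-> Y x.
Proof.
move=> Uu; split; last exact: YU.
by move=> /(YU (unipV Uu)); rewrite AdK // (Ad_unip_unit Uu).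
Qed.

Let bruhatY c x : c != 0 -> Y (Ad (expm (c *: f)) x) <-> Y (Ad nn (Ad (expm (c^-1 *: e)) x)).
Proof.
move=> nc; have [t Tt ->] := bruhatF nc; have ut := Tunit Tt.
have Ue := expE_U c^-1; rewrite AdM3 // YUE //; exact: YTE.
Qed.

Lemma par_satP x : par_sat x <-> Y x \/ exists c, Y (Ad nn (Ad (expm (c *: e)) x)).
Proof.
split=> [[[c Yc]|Yn]|[Yx|[c Yc]]].
- have [c0|nc] := eqVneq c 0; first by left; rewrite c0 scale0r expm0 Ad1 in Yc.
  by right; exists c^-1; apply/bruhatY.
- by right; exists 0; rewrite scale0r expm0 Ad1.
- by left; exists 0; rewrite scale0r expm0 Ad1.
have [c0|nc] := eqVneq c 0; first by right; rewrite c0 scale0r expm0 Ad1 in Yc.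
by left; exists c^-1; apply/bruhatY; rewrite ?invr_eq0 ?invrK.
Qed.

Lemma par_sat_closed : zclosed par_sat.
Proof.
pose C x := ecurve f *m pc x *m ecurve (- f).
pose C' x := pc nn *m (ecurve e *m pc x *m ecurve (- e)) *m pc (invmx nn).
have pc_cst (A : 'M[{poly K}]_n) : cfam (fun _ : 'M[K]_n => A) by move=> i j; apply: pfam_cst.
have pc_id : cfam (fun x : 'M[K]_n => pc x).
  move=> i j; have := pfam_polyC (@polyfun_entry K n n i j).
  by congr pfam; apply: funext => x; rewrite mxE.
have CE x c : ceval (C x) c = Ad (expm (c *: f)) x.
  rewrite !cevalM ceval_pc !ecurve_eval //; last exact: nilpN.
  by rewrite /Ad (invmx_exp (nilpZ c ff)) scalerN.
have C'E x c : ceval (C' x) c = Ad nn (Ad (expm (c *: e)) x).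
  rewrite !cevalM !ceval_pc !ecurve_eval //; last exact: nilpN.
  by rewrite /Ad (invmx_exp (nilpZ c ee)) scalerN.
have := @projective_line_closed _ _ _ _ _ C C' Y _ _ cY.
have -> : [set x | (exists c, Y (ceval (C x) c)) \/ Y (ceval (C' x) 0)] = par_sat.
  apply: funext => x; rewrite /= C'E scale0r expm0 Ad1 /par_sat /=.
  by under eq_exists do rewrite CE.
apply; [by do 2?apply: cfam_mul|by do 4?apply: cfam_mul|].
by move=> x c nc; rewrite CE C'E => /bruhatY; apply.
Qed.

Lemma par_sat_sub : Y `<=` par_sat.
Proof. by move=> x Yx; apply/par_satP; left. Qed.

Lemma par_sat_F c x : Y x -> par_sat (Ad (expm (c *: f)) x).
Proof. by move=> Yx; left; exists (- c); rewrite scaleNr -(invmx_exp (nilpZ c ff)) AdK. Qed.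

Let TY t x : T t -> Y (Ad nn (Ad t x)) <-> Y (Ad nn x).
Proof.
move=> Tt; have ut := Tunit Tt.
by rewrite -(Ad_Ad x un ut) YTE //; apply: torus_Ad.
Qed.

Lemma par_sat_T t x : T t -> par_sat x -> par_sat (Ad t x).
Proof.
move=> Tt; have ut := Tunit Tt; rewrite !par_satP => -[Yx|[c Yc]]; first by left; apply: YT.
right; have [k kE] : exists k, e = k *: Ad t e.
  by apply: (rsp_dim1 ra) => //; [apply: rsp_AdT|move=> /(congr1 (Ad (invmx t))); rewrite AdK // raddf0].
exists (c / k); have nk : k != 0 by apply: contra_not_neq ne => k0; rewrite kE k0 scale0r.
have -> : (c / k) *: e = Ad t (c *: e) by rewrite {1}kE scalerA divfK // linearZ.
by rewrite -(Ad_expm ut (nilpZ c ee)) (Ad_Ad x ut (ue c)) TY.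
Qed.

Let VY r x : V r -> Y (Ad nn (Ad r x)) <-> Y (Ad nn x).
Proof.
move=> Vr; have ur : r \in unitmx by apply: Ad_unip_unit (radical_U Vr).
by rewrite -(Ad_Ad x un ur) YUE //; apply: radical_U; apply: radical_conj.
Qed.

Lemma par_sat_U u x : U u -> par_sat x -> par_sat (Ad u x).
Proof.
move=> Uu; rewrite !par_satP => -[Yx|[c Yc]]; first by left; apply: YU.
have [r [d [Vr uE]]] := unip_factor Uu; have ur : r \in unitmx by apply: Ad_unip_unit (radical_U Vr).
right; exists (c - d); rewrite uE AdM ?ue // -(Ad_Ad _ (ue _) ur) VY; last by apply: radical_conj.
have cE : (c - d) *: e *m (d *: e) = d *: e *m ((c - d) *: e).
  by rewrite -!scalemxAl -!scalemxAr !scalerA mulrC.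
rewrite -(AdM x (ue (c - d)) (ue d)) -(expmD charK cE (nilpZ _ ee) (nilpZ _ ee)).
by rewrite -scalerDl subrK.
Qed.

Lemma par_sat_ort : Y `<=` ort_set -> par_sat `<=` ort_set.
Proof.
move=> sub x /par_satP [/sub //|[c /sub oc]].
have [t Tt tE] : exists2 t, T t & invmx nn = t *m nn.
  have n1 : (-1 : K) != 0 by rewrite oppr_eq0 oner_neq0.
  have [t Tt tE] := theta_scale ra re rf sl2 n1; exists t => //; rewrite -tE.
  have [uE uF] : expm e \in unitmx /\ expm (- f) \in unitmx by split; apply: expm_unit => //; apply: nilpN.
  rewrite invrN invr1 !scaleN1r /theta !invmx_mul ?unitmx_mul ?uE ?uF //.
  by rewrite !(invmx_exp) ?mulmxA //; apply: nilpN.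
suff : ort_set (Ad (expm (c *: e)) x).
  by move=> /(ort_set_U (expE_U (- c))); rewrite scaleNr -(invmx_exp (nilpZ c ee)) AdK.
rewrite -(AdK un (Ad (expm (c *: e)) x)) tE AdM // ?(Tunit Tt) //.
by apply: ort_set_T => //; apply: ort_set_n.
Qed.

End MinimalParabolic.

End Simple.
End SimpleReflection.


(** * Stability of the parametrized set *)
Section Maximal.
Implicit Types (x y u k a b g t h : 'M[K]_n) (c : K) (S : seq 'M[K]_n) (v : 'M[K]_n -> 'M[K]_n).
Local Notation U := (unip bf_h0).

(** The coroots of orthogonal roots give one-parameter groups of T scaling the
    root vectors independently. *)
Lemma orth_scale h S v v' : orth_roots h S -> root_family S v -> root_family S v' ->
  exists2 t, T t & Ad t (osum S v) = osum S v'.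
Proof.
move=> [uS rS cS] rv rv'.
suff H (S' : seq 'M[K]_n) : {subset S' <= S} -> uniq S' ->
    exists2 t, T t & forall a, a \in S -> Ad t (v a) = if a \in S' then v' a else v a.
  have [t Tt tE] := H S (fun a aS => aS) uS; exists t => //.
  by rewrite Ad_sum; apply: eq_big_seq => a aS; rewrite tE ?aS.
elim: S' => [|b S' IH] sub; first by exists 1%:M => [|a _]; [case: frame_aT => -[]|rewrite Ad1].
move=> /andP[bS' uS']; have bS : b \in S by apply: sub; rewrite inE eqxx.
have [|t Tt tE] := IH _ uS'; first by move=> a aS'; apply: sub; rewrite inE aS' orbT.
have [rb _] := rS b bS; have [rvb nvb] := rv b bS; have [rvb' nvb'] := rv' b bS.
have [d dE] := rsp_dim1 rb rvb nvb rvb'.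
have nd : d != 0 by apply/eqP => d0; apply: nvb'; rewrite dE d0 scale0r.
have [z zE] : exists z : K, z ^+ 2 = d.
  have [z] := @solve_monicpoly K 2 (fun i => if i == 0%N then d else 0) isT.
  by rewrite !big_ord_recl big_ord0 /= mul0r !addr0 expr0 mulr1 => zE; exists z.
have nz : z != 0 by apply: contraNneq nd => z0; rewrite -zE z0 expr0n.
have [s [Ts sE _]] := integral_torus (integral_coroot rb) nz.
have [us ut] := (Tunit Ts, Tunit Tt).
exists (s *m t); first by case: frame_aT => -[_ _ TM _] _; apply: TM.
move=> a aS; rewrite AdM // tE // inE; have [ra _] := rS a aS.
have [[rva _] [rva' _]] := (rv a aS, rv' a aS).
have [->|ab] := eqVneq a b.
  rewrite (negPf bS') /= (sE b _ 2) // ?rt_coroot //.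
  by rewrite dE -zE -exprnP.
have a0 : rt a (coroot b) = 0%:~R by rewrite (cartanE ra rb) cS //; apply/eqP.
by case: ifP => _ /=; rewrite (sE a _ 0) // expr0z scale1r.
Qed.

Variable Hs : 'M[K]_n -> Prop.
Hypotheses (Hs2 : forall h, Hs h -> height2 h) (Hs_refl : forall h a, Hs h -> is_root a -> Hs (srefl a h)).
Local Notation A := (ort_set Hs).

Definition stable_closed (Y : set 'M[K]_n) := [/\ zclosed Y, forall t x, T t -> Y x -> Y (Ad t x),
  forall u x, U u -> Y x -> Y (Ad u x) & Y `<=` A].

Let rs := root_seq.

Lemma root_vectors_exist : exists v, forall a, is_root a -> rsp a (v a) /\ v a <> 0.
Proof.
have [v vE] := @choice _ _ (fun a x => is_root a -> rsp a x /\ x <> 0) (fun a =>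
  match pselect (is_root a) with
  | left (And3 _ _ (ex_intro2 x rx nx)) => ex_intro _ x (fun _ => conj rx nx)
  | right nr => ex_intro _ 0 (fun ra => False_ind _ (nr ra)) end).
by exists v.
Qed.

(** A stable closed subset of A is determined by the finitely many sets of
    orthogonal roots that it meets, so that there is a largest one. *)
Lemma stable_closed_maximal Y : stable_closed Y -> exists Y', [/\ stable_closed Y', Y `<=` Y' &
  forall Z, stable_closed Z -> Y' `<=` Z -> Z `<=` Y'].
Proof.
have [v rv] := root_vectors_exist.
pose ty (Z : set 'M[K]_n) := finset (fun m : (size rs).-tuple bool =>
  `[< exists h, [/\ Hs h, orth_roots h (mask m rs) & Z (osum (mask m rs) v)] >]).
have tyP Z Z' : stable_closed Z -> stable_closed Z' -> {subset ty Z <= ty Z'} -> Z `<=` Z'.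
  move=> [_ ZT ZU ZA] [_ ZT' ZU' _] sub x Zx.
  have [h [z [u1 [Hh dz Uu1 xE1]]]] := ZA _ Zx; have hh := Hs2 Hh.
  have [S [w [u2 [oS rw Uu2 zE]]]] := degree2_orth hh (deg2_rspan hh dz); have [uS rS cS] := oS.
  have Uu := unipM Uu1 Uu2; have xE : x = Ad (u1 *m u2) (osum S w).
    by rewrite AdM ?(Ad_unip_unit Uu1) ?(Ad_unip_unit Uu2) // -zE.
  move: Uu xE; set u := _ *m _ => Uu xE.
  pose m := map_tuple (mem S) (in_tuple rs).
  have mE : mask m rs = [seq a <- rs | a \in S] by rewrite -filter_mask.
  have mS : perm_eq (mask m rs) S.
    rewrite mE; apply: uniq_perm => [|//|a]; first by rewrite filter_uniq // undup_uniq.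
    by rewrite mem_filter; case: (boolP (a \in S)) => //= aS; apply/mem_root_seq; case: (rS a aS).
  have vS : root_family S v by move=> a aS; apply: rv; case: (rS a aS).
  have om : osum (mask m rs) v = osum S v by rewrite /osum (perm_big _ mS).
  have orm : orth_roots h (mask m rs).
    split=> [|a|a b]; rewrite ?(perm_uniq mS) // ?(perm_mem mS); [exact: rS|exact: cS].
  have [uu UV] := (Ad_unip_unit Uu, unipV Uu).
  have Zo : Z (osum S w) by rewrite -(AdK uu (osum S w)) -xE; apply: ZU.
  have [t Tt tE] := orth_scale oS rw vS; have [s Ts sE] := orth_scale oS vS rw.
  have : m \in ty Z by rewrite inE; apply/asboolP; exists h; rewrite om -tE; split=> //; apply: ZT.
  move=> /sub; rewrite inE => /asboolP [h' [_ _]]; rewrite om => Zv.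
  by rewrite xE; apply: ZU' => //; rewrite -sE; apply: ZT'.
have [k] := ubnP #|~: ty Y|; elim: k Y => // k IH Y lt scY.
have [max|] := pselect (forall Z, stable_closed Z -> Y `<=` Z -> Z `<=` Y); first by exists Y; split.
move=> /existsNP [Z] /not_implyP [scZ] /not_implyP [YZ nZY].
have tyYZ : ty Y \subset ty Z.
  apply/fintype.subsetP => m; rewrite !finset.inE => /asboolP Hm; apply/asboolP; move: Hm => [h [Hh om Ym]].
  by exists h; split=> //; apply: YZ.
have : (#|~: ty Z| < k)%N.
  rewrite -ltnS; apply: leq_trans lt; rewrite ltnS; apply: proper_card; rewrite properC properE tyYZ.
  by apply/negP => /fintype.subsetP sub; apply: nZY; apply: tyP.
case/IH => // Y' [scY' ZY' max]; exists Y'; split=> // x Yx; exact/ZY'/YZ.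
Qed.

(** A largest stable closed set is stable under the minimal parabolic
    subgroups, hence under G, since the Lie algebra of its stabilizer contains
    the torus and the root vectors of simple roots and of their opposites. *)
Section Stabilizer.
Variable Y : set 'M[K]_n.
Hypotheses (scY : stable_closed Y) (maxY : forall Z, stable_closed Z -> Y `<=` Z -> Z `<=` Y).
Let cY : zclosed Y. Proof. by case: scY. Qed.

Lemma max_stable_simple a f c x : simple (bf_pos F) a -> rsp (- a) f -> Y x -> Y (Ad (expm (c *: f)) x).
Proof.
move=> sa rf Yx; have [_ YT YU YA] := scY; have [CA _] := bf_sys F.
have ra : is_root a by case: CA => H _ _; apply: H; case: sa.
have [_ _ [e re ne]] := ra; have [f' [rf' nf' sl2]] := root_sl2 ra re ne.
have [d ->] := rsp_dim1 (is_rootN ra) rf' nf' rf; rewrite scalerA.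
apply: (maxY (Z := par_sat e f' Y)).
- split; first exact: (par_sat_closed sa re rf' sl2 cY YT YU).
  + by move=> t y; apply: (par_sat_T sa re ne rf' sl2 YT YU).
  + by move=> u y; apply: (par_sat_U sa re ne rf' sl2 YT YU).
  + exact: (par_sat_ort Hs2 Hs_refl sa re ne rf' sl2 YT YU).
- exact: (par_sat_sub sa re rf' sl2 YT YU).
- exact: (par_sat_F e sa rf').
Qed.

Definition stabilizer := [set g | [/\ G g, forall x, Y x -> Y (Ad g x) & forall x, Y x -> Y (Ad (invmx g) x)]].

Lemma stabilizer_group : subgroup_GL stabilizer.
Proof.
have [Gu G1 GM GiV] := frame_aG.1.
split=> [g [/Gu]//||g g' [Gg gY giY] [Gg' gY' giY']|g [Gg gY giY]].
- by split=> // x; rewrite ?invmx1 Ad1.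
- have [ug ug'] := (Gu _ Gg, Gu _ Gg'); split=> [|x Yx|x Yx]; first exact: GM.
    by rewrite AdM //; apply: gY; apply: gY'.
  by rewrite invmx_mul // AdM ?unitmx_inv //; apply: giY'; apply: giY.
- by split=> //; [apply: GiV|rewrite invmxK].
Qed.

Lemma alg_stabilizer g x : alg_closure stabilizer g -> Y x -> Y (Ad g x).
Proof.
move=> [clg ug] Yx; rewrite -(zclosedE cY) => p Ip.
have := @regular_zclosure K charK n stabilizer _ (polyfun_conj p x) _ _ g clg ug.
rewrite row_mxKl row_mxKr; apply; first by case: stabilizer_group.
by move=> g' [_ gY _]; rewrite row_mxKl row_mxKr; apply: Ip; apply: gY.
Qed.

Lemma lie_stabilizer x : Lie G x -> Lie (alg_closure stabilizer) x.
Proof.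
have aH := alg_closure_group charK stabilizer_group; have mH := subgroup_monoid aH.1.
have [_ YT YU _] := scY; set H := alg_closure stabilizer in aH mH *.
have subH : stabilizer `<=` H by apply: sub_alg_closure; case: stabilizer_group.
have expH a y : is_root a -> rsp a y -> (forall c x, Y x -> Y (Ad (expm (c *: y)) x)) -> Lie H y.
  move=> ra ry yY; have ny := rsp_nilp ra ry.
  apply: (lie_of_expm charK aH ny) => c; apply: subH; split=> [|z|z]; last by rewrite (invmx_exp (nilpZ c ny)) -scaleNr; apply: yY.
    by apply: expmG; [apply: lieZ; case: ry|apply: nilpZ].
  exact: yY.
  have posH a y : is_root a -> bf_pos F a -> rsp a y -> Lie H y.
  move=> ra pa ry; apply: (expH a) => // c z; apply: YU; apply: unip_expm.
  split; first by apply: lieZ; case: ry.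
  apply: filZ; apply: (@fil_le _ _ (ival a bf_h0)); last exact: (fil_rsp ra bf_h0_integral ry).
  by have := (bf_posP ra).1 pa; lia.
have [CA tot] := bf_sys F; have Sr a : bf_pos F a -> is_root a by case: CA => S _ _; apply: S.
have negH a : bf_pos F a -> forall y, rsp (- a) y -> Lie H y.
  move: a; apply: (pos_ind (bf_sys F)) => [a sa y ry|b d pb pd pbd IHb IHd y ry].
    apply: (expH (- a)) => //; first by apply: is_rootN; apply: Sr; case: sa.
    by move=> c z; apply: (max_stable_simple _ sa).
  have [rb rd] := (is_rootN (Sr _ pb), is_rootN (Sr _ pd)).
  have rbd : is_root (- b + - d) by rewrite -opprD; apply: is_rootN; apply: Sr.
  have [_ _ [xb rxb nb]] := rb; have [_ _ [xd rxd nd]] := rd.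
  rewrite opprD in ry.
  have [c ->] := rsp_dim1 rbd (rsp_bracket rxb rxd) (root_bracket_neq0 rb rd rbd rxb nb rxd nd) ry.
  by apply: lieZ; apply: lie_bracket => //; [apply: IHb|apply: IHd].
apply: lieG_ind.
- exact: lie0.
- by move=> c y z; apply: lie_linear.
- move=> y; apply: lie_mono => t Tt; apply: subH; split=> [|z|z]; first exact: frame_TG.
    exact: YT.
  by apply: YT; apply: TV.
- move=> a y ra ry; case: (tot a ra) => pa; first exact: (posH a).
  by apply: (negH _ pa); rewrite opprK.
Qed.

Lemma max_stable_orbit e : Lie G e -> nilp e -> Y e -> orbit_Ad G e `<=` Y.
Proof.
have aH := alg_closure_group charK stabilizer_group.
pose N := [set x | Lie G x /\ nilp x].
have NZ (a : K) x : N x -> N (a *: x) by move=> [Lx nx]; split; [apply: lieZ|apply: nilpZ].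
have NA g x : G g -> N x -> N (Ad g x).
  by move=> Gg [Lx nx]; split; [apply: lieG_Ad|apply: nilp_conj => //; apply: Gunit].
have Nn : N `<=` @nilp K n by move=> x [].
have NL : N `<=` Lie G by move=> x [].
move=> Le ne Ye _ [g Gg <-].
case: (@almost_simple_exp_group K charK n N Nn NZ G (tf_G R) NL NA) => E.
  have e0 : e = 0.
    apply: (expm_trivial charK ne) => t; have : [set 1%:M] (expm (t *: e)); last by [].
    have [|Nu _ _ _] := @exp_group_subgroup K charK n N Nn; first exact: NZ.
    rewrite -E; apply: sub_alg_closure => //; apply: exp_group_expm.
    exact: NZ.
  by rewrite e0 linear0 -e0.
apply: alg_stabilizer => //.
suff sub : alg_closure (exp_group N) `<=` alg_closure stabilizer by apply: sub; rewrite E.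
apply: alg_closure_min => //; by apply: (exp_group_sub charK) => // x [Lx _]; apply: lie_stabilizer.
Qed.

End Stabilizer.

Lemma deg2_U h u x : height2 h -> (forall b, bf_pos F b -> 0 <= ival b h) ->
  U u -> deg2 h x -> deg2 h (Ad u x).
Proof.
move=> hh dom /unip_log [y Hy ->]; apply: (deg2_expm hh); first by case: Hy => _; apply: fil_nilp.
apply: rspanS (nil_alg_rspan bf_h0_integral Hy) => b rb b0; apply: dom.
exact/(bf_posP rb).
Qed.

(** The part of degree 2 is closed and stable; a largest stable closed set
    containing it is G-stable, hence contains the closure of the orbit. *)
Lemma orbit_closure_ort h e f : Lie T h -> Lie G e -> Lie G f ->
  sl2_triple e h f -> (forall b, bf_pos F b -> 0 <= ival b h) -> Hs h -> zclosure (orbit_Ad G e) `<=` A.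
Proof.
move=> Lh Le Lf sl2 dom Hh; have hh := Hs2 Hh.
have [|Y' [scY' sub max]] := @stable_closed_maximal (deg2 h).
  split; first exact: deg2_closed.
  - by move=> t x Tt; rewrite -{2}(AdT_fix Tt Lh); apply: deg2_Ad; apply: frame_TG.
  - by move=> u x; apply: (deg2_U hh dom).
  - by move=> x; apply: ort_set_deg2.
have [cY _ _ YA] := scY'.
apply: subset_trans YA; apply: zclosure_min => //.
apply: (max_stable_orbit scY' max) => //; first by have [] := char_nilp Lh sl2.
by apply: sub; split => //; case: sl2.
Qed.
End Maximal.


(** * The parametrization of B-orbits *)
Section Parametrization.
Local Notation roots := (Defs.roots G T).
Variables (ip : chr K n -> chr K n -> rat) (ev : chr K n -> 'M[K]_n) (e h : 'M[K]_n).
Hypotheses (hip : weyl_inner_product G T ip) (hev : root_vectors G T ev).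
Hypotheses (he : height_le2_nilpotents G e) (hh : dominant_characteristic G B T e h).
Implicit Types (a b : chr K n) (x y w g t al be : 'M[K]_n) (s : seq 'M[K]_n) (S : set (chr K n)).

Let Lh : Lie T h. Proof. by case: hh. Qed.

(** Data conjugate to the given characteristic. *)
Definition char_data h' := exists e' f, [/\ orbit_Ad G e e', Lie G e', Lie G f,
  sl2_triple e' h' f & forall x, Lie G x -> iter 3 (bracket e') x = 0].

Lemma char_data_Ad g h' : G g -> char_data h' -> char_data (Ad g h').
Proof.
move=> Gg [e' [f [[g' Gg' e'E] Le Lf [he' hf ef] e3]]]; have [ug ug'] := (Gunit Gg, Gunit Gg').
exists (Ad g e'), (Ad g f); split; try exact: lieG_Ad.
- exists (g *m g'); last by rewrite AdM // e'E.
  by case: frame_mG => _; apply.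
- by split; rewrite -Ad_bracket // ?he' ?hf ?ef ?linearN ?linearZ.
move=> x Lx; rewrite -(AdVK ug x) /= -!Ad_bracket // -/(iter 3 (bracket e') _) e3 ?linear0 //.
by apply: lieG_Ad => //; apply: GV.
Qed.

Lemma char_data_h : char_data h.
Proof.
have [[Le [k ek]] [m m2 [_ mmax]]] := he; have [_ _ [e' [f [[g Gg e'E] Lf sl2]]]] := hh.
have ug := Gunit Gg; have [Gg' ug'] := (GV Gg, unitmx_inv g).
exists e', f; split=> //; first by exists g.
  by rewrite -e'E; apply: lieG_Ad.
move=> x Lx; rewrite -e'E -(AdVK ug x) /= -!Ad_bracket // -/(iter 3 (bracket e) _).
suff -> : iter 3 (bracket e) (Ad (invmx g) x) = 0 by rewrite linear0.
apply: contrapT => n0; have /mmax : ad_power_neq0 G e 3.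
  by exists (Ad (invmx g) x) => //; apply: lieG_Ad.
by move=> /leq_trans /(_ m2).
Qed.

Definition char_orbit h' := exists2 w, normalizer G T w & h' = Ad w h.

Lemma char_orbit_lie h' : char_orbit h' -> Lie T h'.
Proof. by move=> [w Nw ->]; apply: (normalizer_lie Nw). Qed.

Lemma char_orbit_data h' : char_orbit h' -> char_data h'.
Proof. by move=> [w [Gw _] ->]; apply: char_data_Ad char_data_h. Qed.

Lemma char_orbit_height2 h' : char_orbit h' -> height2 h'.
Proof.
move=> Hh; have [e' [f [_ Le Lf sl2 e3]]] := char_orbit_data Hh.
exact: (char_height2 (char_orbit_lie Hh) sl2 e3).
Qed.

Lemma char_orbit_refl h' al : char_orbit h' -> is_root al -> char_orbit (srefl al h').
Proof.
move=> Hh ral; have Lh' := char_orbit_lie Hh; have [w Nw wE] := Hh.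
have [_ _ [x rx nx]] := ral; have [f [rf nf sl2]] := root_sl2 ral rx nx.
have Nn : normalizer G T (theta x f).
  apply: norm_torus; first exact: (theta_root_G ral).
    exact: (theta_root_lie ral rx rf sl2).
  exact: (theta_root_lieV ral rx rf sl2).
exists (theta x f *m w); first exact: normalizerM.
have [Gn _] := Nn; have [Gw _] := Nw.
rewrite AdM ?(Gunit Gn) ?(Gunit Gw) // -wE (theta_root_refl ral rx rf sl2 Lh').
by rewrite (sreflE _ ral).
Qed.

Lemma char_orbit_h : char_orbit h.
Proof.
exists 1%:M; last by rewrite Ad1.
split; first by case: frame_mG.
by apply/seteqP; split=> [_ [t Tt <-]|t Tt]; [rewrite Ad1|exists t; rewrite ?Ad1].
Qed.

(** Simple matrix roots come from simple roots of B, as differentials are additive. *)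
Lemma char_dominant al : bf_pos F al -> 0 <= ival al h.
Proof.
have ih : integral h by have [] := char_orbit_height2 char_orbit_h.
have [CA _] := bf_sys F; have Pr be : bf_pos F be -> is_root be by case: CA => H _ _; apply: H.
have posB be : bf_pos F be -> positive_roots G B T (cr be).
  move=> pb; have rb := Pr _ pb; have [rc cE] := crP rb; have [_ _ _ cE'] := mrP rc.
  split=> // x /cE'; rewrite cE; have [_ H] := (bf_broot F rb).2 pb.
  exact: H.
have Bpos a : positive_roots G B T a -> bf_pos F (mr a).
  move=> [ra sub]; have [_ rm _ aE] := mrP ra; apply/(bf_broot F rm); split=> // x rx.
  by apply: sub; apply/aE.
apply: (pos_ind (bf_sys F) (Q := fun al => 0 <= ival al h)) => [be [pb dec]|be de pb pd pbd IHb IHd]; last first.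
  by rewrite (ivalDl (Pr _ pb) (Pr _ pd) (Pr _ pbd) ih) addr_ge0.
have rb := Pr _ pb; have [rc cE] := crP rb; have [_ _ cd _] := mrP rc.
have [|q q0] := (let: And3 _ dom _ := hh in dom) (cr be).
  split=> [|b c pb' pc E]; first exact: posB.
  apply: (dec _ _ (Bpos _ pb') (Bpos _ pc)).
  have [[rb' _] [rc' _]] := (pb', pc); have [[cb _ _] [cc _ _]] := (rb', rc').
  have [Lb _ bE _] := mrP rb'; have [Lc _ cE' _] := mrP rc'.
  have [_ add] := chr_addP cb cc; have [Lbe _ _] := rb.
  apply: subr0_eq; apply: liet_nondeg.
    by rewrite -scaleN1r addrC; apply: lie_linear => //; apply: lieD.
  by move=> k Lk; rewrite rtBl rtDl bE // cE' // -add // -E -cd // cE subrr.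
rewrite -cd // cE (ivalE rb ih) => E.
have dq : (denq q)%:~R != 0 :> K by rewrite -(rmorph0 intr) (inj_eq (intr_injK charK)) denq_neq0.
have : (ival be h * denq q)%:~R = (numq q)%:~R :> K by rewrite intrM E /ratr divfK.
move=> /intr_eq E'; rewrite -(pmulr_lge0 _ (denq_gt0 q)) E' numq_ge0.
exact: q0.
Qed.

(** ** Orthogonal subsets *)

Definition chs s : set (chr K n) := [set a | roots a /\ mr a \in s].
Let evm al := ev (cr al).

Lemma evm_family h' s : orth_roots h' s -> root_family s evm.
Proof.
move=> [_ rS _] al /rS [ral _]; have [rc cE] := crP ral; have [rv nv] := hev rc.
by have [_ _ _ cE'] := mrP rc; split=> //; have := (cE' _).1 rv; rewrite cE.
Qed.

Lemma chs_sum h' s : orth_roots h' s -> root_vector_sum ev (chs s) = osum s evm.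
Proof.
move=> [us rS _]; rewrite /root_vector_sum /osum.
have -> : chs s = [set` [seq cr al | al <- s]].
  apply/seteqP; split=> a /=.
    by move=> [ra as_]; apply/mapP; exists (mr a); rewrite ?crK.
  by move=> /mapP [al als ->]; have [ral _] := rS _ als; have [rc cE] := crP ral; split=> //; rewrite cE.
rewrite -fsbig_seq ?big_map // map_inj_in_uniq // => al be /rS [ra _] /rS [rb _] E.
by have [_ <-] := crP ra; have [_ <-] := crP rb; rewrite E.
Qed.

Lemma rt_chr_diff a : roots a -> rt (mr a) h = chr_diff T a h.
Proof. by move=> ra; have [_ _ E _] := mrP ra; rewrite E. Qed.

Lemma PsiE a : roots a -> chr_diff T a h = 2 <-> ival (mr a) h = 2.
Proof.
move=> ra; have [_ rm _ _] := mrP ra; have [ih _] := char_orbit_height2 char_orbit_h.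
rewrite -rt_chr_diff // (ivalE rm ih); split=> [E|->//].
by apply: intr_eq; rewrite E.
Qed.

Lemma ip_orth a b : roots a -> roots b -> ival (mr a) h = 2 -> ival (mr b) h = 2 ->
  ip a b = 0 <-> cartan (mr a) (mr b) = 0.
Proof.
move=> ra rb ah bh; have [[_ rma _ _] [_ rmb _ _]] := (mrP ra, mrP rb).
have h2 := char_orbit_height2 char_orbit_h; have [_ _ ip0 _] := hip; have [cb ntb _] := rb.
have [k kE] : exists k : nat, cartan (mr a) (mr b) = k.
  by have := height2_cartan h2 rma rmb ah bh; case: cartan => // k _; exists k.
have := ip_cartan hip ra rb kE; rewrite kE; split=> [ab|k0].
  have := ip0 b cb ntb; move: H; rewrite ab mulr0 => /esym/eqP; rewrite mulf_eq0 => /orP[|/eqP ->].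
    by rewrite pnatr_eq0 => /eqP ->.
  by rewrite ltxx.
by move: H; rewrite (_ : k = 0%N) ?mul0r; [move=> /eqP; rewrite mulf_eq0 /= => /eqP|case: k0].
Qed.

Lemma OrtX_chs S : OrtX G T ip h S -> exists h' s, [/\ char_orbit h', orth_roots h' s & S = chs s].
Proof.
move=> [w [S' [Nw [sub orth] SE]]]; have [Gw _] := Nw; have uw := Gunit Gw.
have S'P a : S' a -> [/\ roots a, is_root (mr a) & ival (mr a) h = 2].
  by move=> /sub [ra ah]; have [_ rm _ _] := mrP ra; split=> //; apply/PsiE.
exists (Ad w h), [seq Ad w al | al <- root_seq & `[< S' (cr al) >]].
have mem al : is_root al -> S' (cr al) -> Ad w al \in [seq Ad w al | al <- root_seq & `[< S' (cr al) >]].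
  move=> ral Sa; apply/mapP; exists al => //; rewrite mem_filter; apply/andP; split; first exact/asboolP.
  exact/mem_root_seq.
have memP be : be \in [seq Ad w al | al <- root_seq & `[< S' (cr al) >]] ->
    exists al, [/\ is_root al, S' (cr al), ival al h = 2 & be = Ad w al].
  move=> /mapP [al]; rewrite mem_filter => /andP[/asboolP Sa /mem_root_seq ral] ->; exists al; split=> //.
  by have [_ _] := S'P _ Sa; have [_ ->] := crP ral.
split; first by exists w.
- split.
  + rewrite map_inj_uniq ?filter_uniq ?undup_uniq // => x y E.
    by rewrite -(AdK uw x) E AdK.
  + move=> _ /memP [al [ral _ alh ->]]; split; first exact: (normalizer_root Nw).
    by rewrite /ival rt_Ad.
  + move=> _ _ /memP [al [ral Sa ah ->]] /memP [be [rbe Sb bh ->]] nab.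
    rewrite (normalizer_cartan Nw); have [ra aE] := crP ral; have [rb bE] := crP rbe.
    rewrite -{1}aE -{1}bE; apply/ip_orth; rewrite ?aE ?bE //.
    by apply: orth => // E; apply: nab; rewrite -aE -bE E.
- rewrite SE; apply/seteqP; split=> [_ [a Sa <-]|b [rb /memP [al [ral Sa _ bE]]]].
  + have [ra rm _] := S'P _ Sa; have [rc cE] := crP (normalizer_root Nw rm).
    by rewrite (weyl_actE Nw ra); split=> //; rewrite cE; apply: mem => //; rewrite crK.
  + by exists (cr al) => //; have [rc cE] := crP ral; rewrite (weyl_actE Nw rc) cE -bE crK.
Qed.

Lemma chs_OrtX h' s : char_orbit h' -> orth_roots h' s -> OrtX G T ip h (chs s).
Proof.
move=> [w Nw ->] [us rS cS]; have [Gw _] := Nw; have uw := Gunit Gw.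
have NV := normalizerV Nw.
exists w, [set a | roots a /\ Ad w (mr a) \in s]; split=> //.
- split=> [a [ra /rS [_ ah]]|a b [ra as_] [rb bs] ab].
    by split=> //; apply/PsiE => //; rewrite -ah /ival rt_Ad.
  have [[_ ah] [_ bh]] := (rS _ as_, rS _ bs).
  rewrite /ival rt_Ad // in ah; rewrite /ival rt_Ad // in bh.
  apply/(ip_orth ra rb ah bh); rewrite -(normalizer_cartan Nw); apply: cS => // E; apply: ab.
  by apply: (mr_inj ra rb); rewrite -(AdK uw (mr a)) E AdK.
apply/seteqP; split=> [b [rb bs]|_ [a [ra as_] <-]].
  have [_ rm _ _] := mrP rb; have [rc cE] := crP (normalizer_root NV rm).
  exists (cr (Ad (invmx w) (mr b))); first by split=> //; rewrite cE AdVK.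
  by rewrite (weyl_actE Nw rc) cE AdVK // crK.
have [_ rm _ _] := mrP ra; have [rc cE] := crP (normalizer_root Nw rm).
by rewrite (weyl_actE Nw ra); split=> //; rewrite cE.
Qed.

(** ** Bijectivity *)

Lemma orbit_eq x y : orbit_Ad B x = orbit_Ad B y -> exists2 b, B b & Ad b x = y.
Proof.
move=> E; have : orbit_Ad B y y by exists 1%:M; [case: (borel_mon (bf_borel F))|rewrite Ad1].
by rewrite -E => -[b Bb bE]; exists b.
Qed.

Lemma orbit_AdB g x : B g -> orbit_Ad B (Ad g x) = orbit_Ad B x.
Proof.
have hB := bf_borel F; move=> Bb; have ub := borel_unit hB Bb.
apply/seteqP; split=> [_ [c Bc <-]|_ [c Bc <-]].
  by exists (c *m g); [apply: (borelM hB)|rewrite AdM // (borel_unit hB Bc)].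
exists (c *m invmx g); first by apply: (borelM hB) => //; apply: (borelV hB).
by rewrite AdM ?unitmx_inv ?(borel_unit hB Bc) // AdK.
Qed.

(** The three parts are deg2_dense, osum_inj and orbit_closure_ort; T rescales the
    root vectors to the chosen ones. *)
Theorem orbit_parametrization : set_bij (OrtX G T ip h) (orbits_on B (zclosure (orbit_Ad G e)))
  (fun S => orbit_Ad B (root_vector_sum ev S)).
Proof.
have orbE e' : orbit_Ad G e e' -> orbit_Ad G e' = orbit_Ad G e.
  move=> [g Gg <-]; have ug := Gunit Gg; have [_ GM] := frame_mG.
  apply/seteqP; split=> [_ [k Gk <-]|_ [k Gk <-]]; have uk := Gunit Gk.
    by exists (k *m g); [apply: GM|rewrite AdM].
  exists (k *m invmx g); first by apply: GM => //; apply: GV.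
  by rewrite AdM ?unitmx_inv // AdK.
split.
- move=> S /OrtX_chs [h' [s [Hh os ->]]]; rewrite /= (chs_sum os); exists (osum s evm) => //.
  have [e' [f [eo Le Lf sl2 e3]]] := char_orbit_data Hh; rewrite -(orbE _ eo).
  have Lh' := char_orbit_lie Hh; have [ih' _] := char_orbit_height2 Hh.
  apply: (deg2_dense Lh' Le Lf sl2); have ef := evm_family os; have [_ rS _] := os.
  rewrite /osum big_seq; elim/big_ind: _ => [|x y dx dy|al als].
  + exact: deg2_0.
  + by rewrite -[x]scale1r; apply: deg2_linear.
  have [rv _] := ef al als; have [ral alh] := rS al als; split; first by case: rv.
  by case: rv => _ -> //; rewrite (ivalE ral ih') alh.
- move=> S S' /set_mem /OrtX_chs [h1 [s [H1 o1 ->]]] /set_mem /OrtX_chs [h2 [s' [H2 o2 ->]]].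
  rewrite (chs_sum o1) (chs_sum o2) => /orbit_eq bE.
  have E := osum_inj (char_orbit_height2 H1) (char_orbit_height2 H2) o1 o2 (evm_family o1) (evm_family o2) bE.
  by apply: funext => a; rewrite /chs /= E.
- move=> _ [x Xx <-]; have [e' [f [eo Le Lf sl2 e3]]] := char_data_h; rewrite -(orbE _ eo) in Xx.
  have := orbit_closure_ort char_orbit_height2 char_orbit_refl Lh Le Lf sl2 char_dominant char_orbit_h.
  move=> /(_ x Xx) [h' [z [u [Hh dz Uu ->]]]]; have h2 := char_orbit_height2 Hh.
  have [s [v [u' [os rv Uu' ->]]]] := degree2_orth h2 (deg2_rspan h2 dz).
  have [t Tt tE] := orth_scale os (evm_family os) rv.
  have [[Bu Bu'] Bt] := ((bf_unip Uu, bf_unip Uu'), bf_TB F Tt).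
  exists (chs s); first exact: (chs_OrtX Hh os).
  by rewrite (chs_sum os) -tE !orbit_AdB.
Qed.
End Parametrization.


End BorelFrame.


End Frame.

Theorem proposition3p6 (K : closedFieldType) (n : nat) (G B T : set 'M[K]_n)
    (ip : chr K n -> chr K n -> rat) (ev : chr K n -> 'M[K]_n) (e h : 'M[K]_n)
    (charK : [pchar K] =i pred0)
    (hG : almost_simple G)
    (hB : borel_subgroup G B)
    (hT : maximal_torus G T)
    (hTB : T `<=` B)
    (hip : weyl_inner_product G T ip)
    (hev : root_vectors G T ev)
    (he : height_le2_nilpotents G e)
    (hh : dominant_characteristic G B T e h) :
  let X := zclosure (orbit_Ad G e) in
  set_bij (OrtX G T ip h) (orbits_on B X)
    (fun S => orbit_Ad B (root_vector_sum ev S)).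
Proof.
have [R _] := torus_frame_exists charK hG hT.
have [F _] := borel_frame_exists R hB hTB.
exact: (orbit_parametrization R F hip hev he hh).
Qed.
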